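(* Let $a,b,s$ be positive integers, $h:=a+b+s$, and consider the tenable urn with replacement matrix $\begin{pmatrix} -a & a+s \\ b+s & -b \end{pmatrix}$ initialized with $a_0=a$ black balls and $b_0=0$ white balls (so $t_0=a$). Let $\psi$ be the corresponding function, defined implicitly near $0$ by $\psi(I(u))=u^{a_0}/\delta(u)^{t_0}$. Then: (i) $\psi$ is analytic for $z$ in the (interior of the) fundamental polygon. (ii) $\psi$ is analytic in $|z|<\rho$, where $$\rho=I(1)=\int_0^1\frac{t^{a-1}}{(1-t^h)^{(a+b)/h}}\,dt=\frac1h B\Bigl(\frac ah,\frac sh\Bigr)=\frac1h\,\frac{\Gamma(a/h)\Gamma(s/h)}{\Gamma((a+s)/h)}.$$ (iii) On $|z|=\rho$, the function $\psi$ is singular at $\rho$ and at the points $\rho\omega^j$, where $\omega=\exp(2i\pi\frac ah)$ is an $(h/a)$th root of unity, and is regular at the other points. (iv) The singular expansion of $\psi$ as $z\to\rho$ is of the form $$\psi(z)=s^{-t_0/s}(\rho-z)^{-t_0/s}\,\mathcal{A}\bigl((\rho-z)^{h/s}\bigr),$$ with $\mathcal{A}$ analytic at $0$, $\mathcal{A}(0)=1$, $\mathcal{A}'(0)\ne0$ (principal determinations of the powers being taken as $z\to\rho^-$). This expansion extends to a sector of opening angle larger than $\pi$ at $\rho$. (v) At the points $z=\rho\omega^j$, the singular expansion is determined from the expansion at $z=\rho$ by the fact that $\psi(z)z^{-a_0/a}$ is invariant under the mapping $z\mapsto\omega z$.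
   Context: Urn process: at each time step a ball is drawn uniformly at random from an urn of black and white balls, observed and put back; if black, $a$ black balls are removed and $a+s$ white balls are added; if white, $b+s$ black balls are added and $b$ white balls are removed. Tenability (with $a_0=a$, $b_0=0$) means: $a$ divides $b+s$ and $b$ divides $a+s$ (and $a\mid a_0$, $b\mid b_0$, which hold automatically here). Notation: $\delta(u):=(1-u^h)^{1/h}$ with $\delta(0)=1$, and $I(u):=\int_0^u t^{a-1}\delta(t)^{-(a+b)}\,dt$. $B(\cdot,\cdot)$ is the Euler Beta function. Elementary kite: let $S_0=\{Re^{i\theta}: 0<R<\infty,\ 0<\theta<2\pi/h\}$. The integrand of $I$ is continued analytically from near $0$ to $S_0$, and $I$ maps $S_0$ onto the interior of a quadrilateral $\mathcal{K}$ (the elementary kite) with vertices $0$, $I(1)$, $I(\infty)$ (limit of $I(u)$ as $u\to\infty$ in $S_0$) and $I(e^{2i\pi/h})$. The fundamental polygon is the (closure of the) union of the $h/a$ regularly rotated copies $\omega^j\mathcal{K}$, $0\le j<h/a$, of the elementary kite about the origin, $\omega=e^{2i\pi a/h}$. *)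

(* Defs.v *)
(* Stdlib reals together with Coquelicot's limits, integrals and complex numbers. *)
From Stdlib Require Import Reals Arith.
From Coquelicot Require Import Coquelicot.

Open Scope R_scope.

(** * Complex numbers: polar form, principal powers, topology *)

Definition Cexpi (theta : R) : C := (cos theta, sin theta).

(* Principal argument, in (-PI, PI]; the value at 0 is irrelevant. *)
Definition Carg (z : C) : R :=
  if Rle_dec 0 (Im z) then acos (Re z / Cmod z) else - acos (Re z / Cmod z).

(* Principal power z ^ alpha = exp (alpha Log z) for a real exponent. The branch
   0 ^ alpha = 0 is only a convention: Stdlib's Rpower would give 1 there. *)
Definition Cpowr (z : C) (alpha : R) : C :=
  if Req_EM_T (Cmod z) 0 then RtoC 0
  else Cmult (RtoC (Rpower (Cmod z) alpha)) (Cexpi (alpha * Carg z)).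

Definition near (z : C) (P : C -> Prop) : Prop :=
  exists eps : R, 0 < eps /\ forall w : C, Cmod (w - z)%C < eps -> P w.

Definition Cinterior (D : C -> Prop) (z : C) : Prop := near z D.

Definition Cclosure (D : C -> Prop) (z : C) : Prop :=
  forall eps : R, 0 < eps -> exists w : C, D w /\ Cmod (w - z)%C < eps.

Definition Cdisc (r : R) (z : C) : Prop := Cmod z < r.

(** * Analytic functions *)

Definition analytic_at (f : C -> C) (z : C) : Prop :=
  exists c : nat -> C,
    near z (fun w => is_pseries (K := C_AbsRing) (V := C_NormedModule)
                       c (w - z)%C (f w)).

Definition analytic_on (f : C -> C) (D : C -> Prop) : Prop :=
  forall z : C, D z -> analytic_at f z.

(* [f], considered on the domain [D], continues analytically to the (boundary)
   point [z]. *)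
Definition regular_at (f : C -> C) (D : C -> Prop) (z : C) : Prop :=
  exists g : C -> C, analytic_at g z /\ near z (fun w => D w -> g w = f w).

Definition singular_at (f : C -> C) (D : C -> Prop) (z : C) : Prop :=
  ~ regular_at f D z.

(** * Euler integrals, for positive arguments *)

Definition Gamma (x : R) : R :=
  RInt_gen (fun t => Rpower t (x - 1) * exp (- t))
    (at_right 0) (Rbar_locally p_infty).

Definition Beta (x y : R) : R :=
  RInt_gen (fun t => Rpower t (x - 1) * Rpower (1 - t) (y - 1))
    (at_right 0) (at_left 1).

(** * The urn [[-a, a+s], [b+s, -b]] *)

(* Started from a0 black and b0 white balls, no draw ever asks for the removal of
   balls that are not present. *)
Definition tenable (a b s a0 b0 : nat) : Prop :=
  Nat.divide a (b + s) /\ Nat.divide b (a + s) /\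
  Nat.divide a a0 /\ Nat.divide b b0.

(* The principal determination equals 1 at 0 and is analytic both in |u| < 1 and
   in the sector S0 below, where u ^ h is never real nonnegative; the two domains
   overlap, so it is the required continuation of (1 - u ^ h) ^ (1 / h). *)
Definition delta (h : nat) (u : C) : C :=
  Cpowr (RtoC 1 - u ^ h)%C (1 / INR h).

(* Integral from 0 to u along the segment t = x u, 0 <= x < 1; it is improper at
   the endpoint x = 1, so that it also makes sense at u = 1. *)
Definition I_int (a b s : nat) (u : C) : C :=
  RInt_gen (V := C_R_CompleteNormedModule)
    (fun x : R =>
       let t := (RtoC x * u)%C in
       (u * (t ^ (a - 1) / delta (a + b + s) t ^ (a + b)))%C)
    (at_point 0) (at_left 1).

(* [psi] is only constrained near 0, where I maps neighbourhoods of 0 onto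
   neighbourhoods of 0. *)
Definition implicit_psi (a b s a0 t0 : nat) (psi : C -> C) : Prop :=
  near (RtoC 0) (fun u =>
    psi (I_int a b s u) = (u ^ a0 / delta (a + b + s) u ^ t0)%C).

(** * Elementary kite and fundamental polygon *)

Definition S0 (h : nat) (z : C) : Prop :=
  exists r theta : R,
    0 < r /\ 0 < theta < 2 * PI / INR h /\ z = (RtoC r * Cexpi theta)%C.

Definition kite_interior (a b s : nat) (z : C) : Prop :=
  exists u : C, S0 (a + b + s) u /\ z = I_int a b s u.

Definition kite (a b s : nat) : C -> Prop := Cclosure (kite_interior a b s).

Definition omega (a b s : nat) : C :=
  Cexpi (2 * PI * INR a / INR (a + b + s)).

Definition polygon (a b s : nat) : C -> Prop :=
  Cclosure (fun z => exists (j : nat) (w : C),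
    (j < (a + b + s) / a)%nat /\ kite a b s w /\ z = (omega a b s ^ j * w)%C).

(** * The dominant singularity *)

Definition rho (a b s : nat) : R :=
  RInt_gen (fun t : R => t ^ (a - 1) /
              Rpower (1 - t ^ (a + b + s)) (INR (a + b) / INR (a + b + s)))
    (at_point 0) (at_left 1).

(* Open sector of radius r and opening angle phi at the real point p, bisected by
   the half-line going from p to -oo. *)
Definition sector (p r phi : R) (z : C) : Prop :=
  0 < Cmod (z - RtoC p)%C < r /\ Rabs (Carg (RtoC p - z)%C) < phi / 2.

Definition rotated (w : C) (D : C -> Prop) (z : C) : Prop :=
  exists z' : C, D z' /\ z = (w * z')%C.

Definition singular_form (h s t0 : nat) (p : R) (A : C -> C) (z : C) : C :=
  (Cpowr (RtoC (INR s)) (- (INR t0 / INR s))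
   * Cpowr (RtoC p - z) (- (INR t0 / INR s))
   * A (Cpowr (RtoC p - z) (INR h / INR s)))%C.

(* Main.v *)
Require Import Defs.
From Stdlib Require Import Reals Arith Lra Lia ClassicalEpsilon.
From Coquelicot Require Import Coquelicot.
Open Scope R_scope.

(** Put [p = h / a] and [q = h / b], which are integers by tenability, and let
    [X] and [Y] be the right-hand sides [u^a / delta^a] and [1 / delta^b] of the
    implicit equation, seen as functions of [z = I(u)]. The chain rule gives the
    autonomous polynomial system
      [X' = a Y^(q-1)], [Y' = b X^(p-1)], [X(0) = 0], [Y(0) = 1],
    with the first integral [Y^q - X^p = 1], and [psi] is [X]. The theorem is thus
    about the continuation of one solution of this system. Solutions are compared
    along segments by the Gronwall argument of [path_unique], and every
    continuation considered here lives on a domain that is star-shaped with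
    respect to 0. All of them agree where they meet, and [continuation] is their
    union. A solution of the system is analytic, because it is the sum of the
    local power series with the same initial value ([solves_analytic]).

    The disc. For real [u] in [0, 1) the solution is explicit, with nonnegative
    Taylor coefficients and blow-up time [rho = I(1)]. It dominates the moduli of
    the partial sums of the series of any solution with smaller initial data
    ([sx_sy_CVin]). Hence the series of [X] and [Y] converge in [|z| < rho], and
    [X] is unbounded near [rho] ([rhoh_singular]). The system is invariant under
    [(z, X, Y) -> (omega z, omega X, Y)], which gives the [h / a] singular points
    [rho omega^j] and the relation between the expansions there.

    Beyond the disc. Exchanging the two colours exchanges [X] and [Y], and the
    substitution [t -> 1/t] in the integral shows that
    [I(u) + e^{i PI (a+b)/h} I'(1/u)] is constant on the sector of [u], where [I']
    is the integral of the exchanged urn ([apex_sum_eq]). The constant is the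
    vertex [I(oo)] of the kite, here called the apex. Therefore the solution for
    the exchanged urn, moved to a disc around the apex, solves the original
    system. It agrees with [X] on the bisector of the kite, and continues [X]
    ([apex_region_reachable]). The triangle with vertices 0, [rho] and the apex
    has acute or right angles [PI / p] at 0 and [PI / q] at the apex, and its
    altitude from [rho] lies on the common chord of the two discs. The monotonicity of [I] in the angle and the same
    facts for the exchanged urn put the image of the sector in the kite spanned by
    this triangle and its mirror image ([kite_image]). Up to its outer sides the
    kite is covered by the two discs ([kite_covered]). This gives the interior of
    the fundamental polygon ([interior_reachable]), and also every point of the
    circle [|z| = rho] except the [rho omega^j] ([circle_reachable]).

    The expansion at [rho]. With [zeta = rho - z] and [w = zeta^(h/s)], the form
    [X = (s zeta)^(-a/s) A(w)], [Y = (s zeta)^(-b/s) D(w)] reduces the system to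
    [h w A' = a (A - D^(q-1))], [h w D' = b (D - A^(p-1))]. This is of Fuchsian
    type, with a one-parameter family of convergent series solutions starting with
    1 ([fuchs_approx_bound], [coef_rec]). The parameter is the constant [K] in
    [D^q - A^p = K w] ([fuchs_first_integral]), and the first integral of the
    system requires [K = s^(h/s)]. The resulting solution is then real on the axis
    and meets the real curve up to a translation in [z]. Both blow up at the end
    of the same interval, so that the translation is trivial ([branch_pole]).

    The value of [rho]. The formula with the Beta function is the substitution
    [t = v^h]. The one with the Gamma function comes from computing the integral
    of [m^(a-1) n^(s-1) exp(- m^h - n^h)] over the quadrant in two ways; only its
    derivative with respect to the slope of a triangle is needed
    ([Egam_product]). *)

(** * Complex numbers in polar form *)

Lemma C_eq (z w : C) : Re z = Re w -> Im z = Im w -> z = w.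
Proof. destruct z, w; simpl; intros; subst; reflexivity. Qed.

Lemma RtoC_neq0 (x : R) : x <> 0 -> RtoC x <> RtoC 0.
Proof. intros H E; apply H; inversion E; reflexivity. Qed.

Lemma Cmod_sqr (z : C) : Cmod z ^ 2 = Re z ^ 2 + Im z ^ 2.
Proof. apply Cmod2_alt. Qed.

Lemma im_le_Cmod (z : C) : Rabs (Im z) <= Cmod z.
Proof.
  apply Rle_trans with (2 := Rmax_Cmod z); apply Rmax_r.
Qed.

Lemma Cmod_le_Re_Im (z : C) : Cmod z <= Rabs (Re z) + Rabs (Im z).
Proof.
  replace z with (RtoC (Re z) + Ci * RtoC (Im z))%C at 1.
  - apply Rle_trans with (1 := Cmod_triangle _ _).
    rewrite Cmod_mult, Cmod_Ci, !Cmod_R; lra.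
  - apply C_eq; simpl; ring.
Qed.

Lemma Cmod_minus_sym (z w : C) : Cmod (z - w) = Cmod (w - z).
Proof. rewrite <- Cmod_opp; f_equal; ring. Qed.

Lemma Cmod_triangle_minus (z w : C) : Cmod z - Cmod w <= Cmod (z - w).
Proof.
  assert (H := Cmod_triangle (z - w) w).
  replace (z - w + w)%C with z in H by ring; lra.
Qed.

Lemma Cmod_RtoC_pos (x : R) : 0 <= x -> Cmod (RtoC x) = x.
Proof. intros; rewrite Cmod_R; apply Rabs_pos_eq; auto. Qed.

Lemma Cexpi_0 : Cexpi 0 = RtoC 1.
Proof. unfold Cexpi; rewrite cos_0, sin_0; reflexivity. Qed.

Lemma Cexpi_PI : Cexpi PI = RtoC (-1).
Proof. unfold Cexpi; rewrite cos_PI, sin_PI; reflexivity. Qed.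

Lemma Cexpi_plus (x y : R) : Cexpi (x + y) = (Cexpi x * Cexpi y)%C.
Proof.
  apply C_eq; unfold Cexpi; simpl; rewrite ?cos_plus, ?sin_plus; ring.
Qed.

Lemma Cmod_Cexpi (x : R) : Cmod (Cexpi x) = 1.
Proof.
  unfold Cmod, Cexpi; simpl.
  replace (_ + _) with 1; [apply sqrt_1|].
  generalize (sin2_cos2 x); unfold Rsqr; lra.
Qed.

Lemma Cexpi_neq0 (x : R) : Cexpi x <> RtoC 0.
Proof.
  intros E; generalize (Cmod_Cexpi x); rewrite E, Cmod_0; lra.
Qed.

Lemma Cexpi_opp (x : R) : Cexpi (- x) = (/ Cexpi x)%C.
Proof.
  assert (H : (Cexpi (- x) * Cexpi x)%C = RtoC 1).
  { rewrite <- Cexpi_plus.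
    replace (- x + x) with 0 by ring; apply Cexpi_0. }
  replace (Cexpi (- x)) with (Cexpi (- x) * Cexpi x * / Cexpi x)%C
    by (field; apply Cexpi_neq0).
  rewrite H; ring.
Qed.

Lemma Cexpi_minus (x y : R) : Cexpi (x - y) = (Cexpi x / Cexpi y)%C.
Proof. unfold Rminus; rewrite Cexpi_plus, Cexpi_opp; reflexivity. Qed.

Lemma Cexpi_conj (x : R) : Cconj (Cexpi x) = Cexpi (- x).
Proof.
  apply C_eq; unfold Cexpi; simpl; rewrite ?cos_neg, ?sin_neg; reflexivity.
Qed.

Lemma Cexpi_pow (x : R) (n : nat) : (Cexpi x ^ n)%C = Cexpi (INR n * x).
Proof.
  induction n as [|n IH].
  - simpl; rewrite Rmult_0_l, Cexpi_0; reflexivity.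
  - rewrite S_INR, Cpow_S, IH, <- Cexpi_plus; f_equal; ring.
Qed.

Lemma Cexpi_2PI_nat (n : nat) : Cexpi (2 * PI * INR n) = RtoC 1.
Proof.
  replace (2 * PI * INR n) with (INR n * (2 * PI)) by ring.
  rewrite <- Cexpi_pow.
  replace (Cexpi (2 * PI)) with (RtoC 1); [apply Cpow_1_l|].
  unfold Cexpi; rewrite cos_2PI, sin_2PI; reflexivity.
Qed.

Lemma Carg_bound (z : C) : - PI <= Carg z <= PI.
Proof.
  unfold Carg.
  generalize (acos_bound (Re z / Cmod z)); destruct (Rle_dec 0 (Im z)); lra.
Qed.

Lemma Re_div_Cmod_bound (z : C) : z <> RtoC 0 -> -1 <= Re z / Cmod z <= 1.
Proof.
  intros Hz; apply Cmod_gt_0 in Hz.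
  generalize (re_le_Cmod z); intros H; apply Rabs_le_between in H.
  split; apply Rmult_le_reg_r with (Cmod z); auto; unfold Rdiv;
    rewrite Rmult_assoc, Rinv_l; lra.
Qed.

Lemma cos_Carg (z : C) : z <> RtoC 0 -> cos (Carg z) = Re z / Cmod z.
Proof.
  intros Hz; generalize (Re_div_Cmod_bound z Hz); intros Hb.
  unfold Carg; destruct (Rle_dec 0 (Im z)); rewrite ?cos_neg;
    apply cos_acos; auto.
Qed.

Lemma sin_Carg (z : C) : z <> RtoC 0 -> sin (Carg z) = Im z / Cmod z.
Proof.
  intros Hz; generalize (Re_div_Cmod_bound z Hz); intros Hb.
  assert (Hm := Hz); apply Cmod_gt_0 in Hm.
  assert (E : sin (acos (Re z / Cmod z)) = Rabs (Im z) / Cmod z).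
  { rewrite sin_acos by auto.
    replace (1 - Rsqr (Re z / Cmod z)) with (Rsqr (Im z / Cmod z)).
    - rewrite sqrt_Rsqr_abs; unfold Rdiv; rewrite Rabs_mult.
      rewrite (Rabs_pos_eq (/ Cmod z)); auto.
      left; apply Rinv_0_lt_compat; auto.
    - generalize (Cmod_sqr z); unfold Rsqr; intros E.
      replace 1 with (Cmod z ^ 2 / Cmod z ^ 2) by (field; lra).
      rewrite E at 1; field; lra. }
  unfold Carg; destruct (Rle_dec 0 (Im z)).
  - rewrite E, Rabs_pos_eq; auto.
  - rewrite sin_neg, E, Rabs_left by lra; field; lra.
Qed.

Lemma polar_form (z : C) : z <> RtoC 0 -> z = (RtoC (Cmod z) * Cexpi (Carg z))%C.
Proof.
  intros Hz; assert (Hm := Hz); apply Cmod_gt_0 in Hm.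
  apply C_eq; simpl; rewrite cos_Carg, sin_Carg by auto; field; lra.
Qed.

Lemma Cmod_polar (r th : R) : 0 <= r -> Cmod (RtoC r * Cexpi th) = r.
Proof.
  intros Hr; rewrite Cmod_mult, Cmod_Cexpi, Cmod_RtoC_pos by auto; ring.
Qed.

Lemma Carg_polar (r th : R) : 0 < r -> - PI < th <= PI ->
  Carg (RtoC r * Cexpi th) = th.
Proof.
  intros Hr Hth; unfold Carg.
  rewrite Cmod_polar by lra.
  replace (Re (RtoC r * Cexpi th) / r) with (cos th) by (simpl; field; lra).
  replace (Im (RtoC r * Cexpi th)) with (r * sin th) by (simpl; ring).
  destruct (Rle_lt_dec 0 th).
  - assert (0 <= sin th) by (apply sin_ge_0; lra).
    destruct (Rle_dec 0 (r * sin th)) as [_|N].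
    + apply acos_cos; lra.
    + exfalso; apply N; apply Rmult_le_pos; lra.
  - assert (sin th < 0) by (apply sin_lt_0_var; lra).
    destruct (Rle_dec 0 (r * sin th)) as [N|_].
    + exfalso; assert (0 < r * - sin th) by (apply Rmult_lt_0_compat; lra); lra.
    + replace (cos th) with (cos (- th)) by apply cos_neg.
      rewrite acos_cos; lra.
Qed.

(** ** Principal powers *)

Lemma Cpowr_nz (z : C) (al : R) : z <> RtoC 0 ->
  Cpowr z al = (RtoC (Rpower (Cmod z) al) * Cexpi (al * Carg z))%C.
Proof.
  intros Hz; unfold Cpowr; destruct (Req_EM_T (Cmod z) 0) as [E|_]; auto.
  exfalso; apply Hz, Cmod_eq_0; auto.
Qed.

Lemma Cpowr_polar (r th al : R) : 0 < r -> - PI < th <= PI ->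
  Cpowr (RtoC r * Cexpi th) al = (RtoC (Rpower r al) * Cexpi (al * th))%C.
Proof.
  intros Hr Hth; rewrite Cpowr_nz.
  - rewrite Cmod_polar, Carg_polar by lra; reflexivity.
  - apply Cmod_gt_0; rewrite Cmod_polar; lra.
Qed.

Lemma Cpowr_RtoC (x al : R) : 0 < x -> Cpowr (RtoC x) al = RtoC (Rpower x al).
Proof.
  intros Hx.
  replace (RtoC x) with (RtoC x * Cexpi 0)%C by (rewrite Cexpi_0; ring).
  rewrite Cpowr_polar by (generalize PI_RGT_0; lra).
  rewrite Rmult_0_r, Cexpi_0; ring.
Qed.

Lemma Cmod_Cpowr (z : C) (al : R) : z <> RtoC 0 -> Cmod (Cpowr z al) = Rpower (Cmod z) al.
Proof.
  intros Hz; rewrite Cpowr_nz, Cmod_polar; auto.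
  left; apply exp_pos.
Qed.

Lemma Cpowr_neq0 (z : C) (al : R) : z <> RtoC 0 -> Cpowr z al <> RtoC 0.
Proof.
  intros Hz; apply Cmod_gt_0; rewrite Cmod_Cpowr by auto; apply exp_pos.
Qed.

Lemma Cpowr_plus (z : C) (al be : R) : z <> RtoC 0 ->
  Cpowr z (al + be) = (Cpowr z al * Cpowr z be)%C.
Proof.
  intros Hz; rewrite !Cpowr_nz by auto.
  rewrite Rpower_plus, Rmult_plus_distr_r, Cexpi_plus, RtoC_mult; ring.
Qed.

Lemma Cpowr_0 (z : C) : z <> RtoC 0 -> Cpowr z 0 = RtoC 1.
Proof.
  intros Hz; rewrite Cpowr_nz by auto.
  rewrite Rmult_0_l, Cexpi_0, Rpower_O; [ring|].
  apply Cmod_gt_0; auto.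
Qed.

Lemma Cpowr_1 (z : C) : z <> RtoC 0 -> Cpowr z 1 = z.
Proof.
  intros Hz; rewrite Cpowr_nz by auto.
  rewrite Rmult_1_l, Rpower_1 by (apply Cmod_gt_0; auto).
  symmetry; apply polar_form; auto.
Qed.

Lemma Cpowr_pow (z : C) (al : R) (n : nat) : z <> RtoC 0 ->
  (Cpowr z al ^ n)%C = Cpowr z (INR n * al).
Proof.
  intros Hz; induction n as [|n IH].
  - simpl; rewrite Rmult_0_l, Cpowr_0; auto.
  - rewrite S_INR, Rmult_plus_distr_r, Rmult_1_l, Cpowr_plus, Cpow_S, IH by auto.
    ring.
Qed.

Lemma Cpowr_root_pow (z : C) (n : nat) : (0 < n)%nat -> z <> RtoC 0 ->
  (Cpowr z (1 / INR n) ^ n)%C = z.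
Proof.
  intros Hn Hz; rewrite Cpowr_pow by auto.
  replace (INR n * (1 / INR n)) with 1; [apply Cpowr_1; auto|].
  field; apply not_0_INR; lia.
Qed.

Lemma Cpowr_opp (z : C) (al : R) : z <> RtoC 0 -> Cpowr z (- al) = (/ Cpowr z al)%C.
Proof.
  intros Hz.
  assert (H : (Cpowr z (- al) * Cpowr z al)%C = RtoC 1).
  { rewrite <- Cpowr_plus by auto.
    replace (- al + al) with 0 by ring; apply Cpowr_0; auto. }
  replace (Cpowr z (- al)) with (Cpowr z (- al) * Cpowr z al * / Cpowr z al)%C
    by (field; apply Cpowr_neq0; auto).
  rewrite H; ring.
Qed.

(** The plane slit along the nonpositive reals. *)
Definition slit (z : C) : Prop := 0 < Cmod z + Re z.

Lemma slit_neq0 (z : C) : slit z -> z <> RtoC 0.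
Proof. unfold slit; intros H E; rewrite E, Cmod_0 in H; simpl in H; lra. Qed.

Lemma slit_iff (z : C) : slit z <-> ~ (Im z = 0 /\ Re z <= 0).
Proof.
  unfold slit; generalize (Cmod_sqr z) (Cmod_ge_0 z) (re_le_Cmod z); intros E H0 H1.
  apply Rabs_le_between in H1.
  split.
  - intros H [Hi Hr]; rewrite Hi in E.
    assert ((Cmod z - Re z) * (Cmod z + Re z) = 0) by (ring_simplify; lra).
    assert (0 < Cmod z - Re z) by nra.
    apply Rmult_integral in H2; lra.
  - intros N; destruct (Rle_lt_or_eq_dec 0 (Cmod z + Re z)) as [|E0]; auto; [lra|].
    exfalso; apply N; assert (Cmod z = - Re z) by lra.
    rewrite H in E; split; [|lra]. nra.
Qed.

(** A single formula for the argument on the whole slit plane: twice the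
    inscribed angle seen from the opposite point of the circle. *)
Lemma Carg_atan (z : C) : slit z -> Carg z = 2 * atan (Im z / (Cmod z + Re z)).
Proof.
  intros Hs; assert (Hz := slit_neq0 z Hs).
  assert (Hm := Hz); apply Cmod_gt_0 in Hm; unfold slit in Hs.
  set (th := atan (Im z / (Cmod z + Re z))).
  assert (Hth : - PI / 2 < th < PI / 2) by (unfold th; generalize (atan_bound (Im z / (Cmod z + Re z))); lra).
  assert (Hc : 0 < cos th) by (apply cos_gt_0; lra).
  assert (Ht : sin th = Im z / (Cmod z + Re z) * cos th).
  { replace (Im z / (Cmod z + Re z)) with (tan th) by (unfold th; apply tan_atan).
    unfold tan; field; lra. }
  assert (E := Cmod_sqr z).
  assert (Hc2 : cos th ^ 2 = (Cmod z + Re z) / (2 * Cmod z)).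
  { generalize (sin2_cos2 th); unfold Rsqr; rewrite Ht; intros E1.
    assert (E2 : cos th ^ 2 * (2 * Cmod z * (Cmod z + Re z)) = (Cmod z + Re z) ^ 2).
    { replace (2 * Cmod z * (Cmod z + Re z)) with
        (Im z ^ 2 + (Cmod z + Re z) ^ 2) by (ring_simplify; lra).
      rewrite <- (Rmult_1_l ((Cmod z + Re z) ^ 2)) at 2; rewrite <- E1; field; lra. }
    apply Rmult_eq_reg_r with (2 * Cmod z * (Cmod z + Re z)).
    - rewrite E2; field; lra.
    - apply Rmult_integral_contrapositive; split; lra. }
  rewrite <- (Carg_polar (Cmod z) (2 * th)) by lra.
  f_equal; rewrite (polar_form z) at 1 by auto.
  f_equal; unfold Cexpi; rewrite cos_Carg, sin_Carg by auto.
  apply C_eq; simpl.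
  - rewrite cos_2a_cos.
    replace (2 * cos th * cos th) with (2 * cos th ^ 2) by ring; rewrite Hc2.
    field; lra.
  - rewrite sin_2a, Ht.
    replace (2 * (Im z / (Cmod z + Re z) * cos th) * cos th)
      with (2 * (Im z / (Cmod z + Re z)) * cos th ^ 2) by ring; rewrite Hc2.
    field; lra.
Qed.

Lemma Re_pos_slit (z : C) : 0 < Re z -> slit z.
Proof. intros H; unfold slit; generalize (Cmod_ge_0 z); lra. Qed.

Lemma Carg_conj (z : C) : slit z -> Carg (Cconj z) = - Carg z.
Proof.
  intros Hs; rewrite !Carg_atan; auto.
  - rewrite Cmod_conj.
    change (Re (Cconj z)) with (Re z); change (Im (Cconj z)) with (- Im z).
    unfold Rdiv; rewrite Ropp_mult_distr_l_reverse, atan_opp; ring.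
  - unfold slit; rewrite Cmod_conj; auto.
Qed.

Lemma Cpowr_conj (z : C) (al : R) : slit z -> Cpowr (Cconj z) al = Cconj (Cpowr z al).
Proof.
  intros Hs; assert (Hz := slit_neq0 z Hs).
  rewrite !Cpowr_nz; auto.
  - rewrite Cmod_conj, Carg_conj, Cmult_conj, Cexpi_conj by auto.
    f_equal; [apply C_eq; simpl; ring|f_equal; ring].
  - apply Cmod_gt_0; rewrite Cmod_conj; apply Cmod_gt_0; auto.
Qed.

(** * Derivatives along paths and complex derivatives *)

(** The derivative of a complex path is taken componentwise, so that the real mean
    value theorem applies to each component. *)
Definition Pder (f : R -> C) (t : R) (d : C) : Prop :=
  is_derive (fun x => Re (f x)) t (Re d) /\ is_derive (fun x => Im (f x)) t (Im d).

Lemma Pder_eq (f : R -> C) (t : R) (d e : C) : Pder f t d -> d = e -> Pder f t e.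
Proof. intros H E; rewrite <- E; exact H. Qed.

Lemma Pder_ext_loc (f g : R -> C) (t : R) (d : C) (eps : R) : 0 < eps ->
  (forall x, Rabs (x - t) < eps -> f x = g x) -> Pder f t d -> Pder g t d.
Proof.
  intros He H [H1 H2]; split.
  - apply is_derive_ext_loc with (2 := H1).
    exists (mkposreal eps He); intros x Hx; rewrite H; auto.
  - apply is_derive_ext_loc with (2 := H2).
    exists (mkposreal eps He); intros x Hx; rewrite H; auto.
Qed.

Lemma Pder_ext (f g : R -> C) (t : R) (d : C) :
  (forall x, f x = g x) -> Pder f t d -> Pder g t d.
Proof. intros H; apply (Pder_ext_loc f g t d 1); auto; lra. Qed.

Lemma Pder_const (c : C) (t : R) : Pder (fun _ => c) t (RtoC 0).
Proof. split; simpl; apply is_derive_Reals, derivable_pt_lim_const. Qed.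

Lemma Pder_RtoC (f : R -> R) (t d : R) : is_derive f t d -> Pder (fun x => RtoC (f x)) t (RtoC d).
Proof. intros H; split; simpl; auto; apply is_derive_Reals, derivable_pt_lim_const. Qed.

Lemma Pder_id (t : R) : Pder RtoC t (RtoC 1).
Proof. apply (Pder_RtoC (fun x => x)); apply is_derive_Reals, derivable_pt_lim_id. Qed.

Lemma Pder_plus (f g : R -> C) (t : R) (d e : C) :
  Pder f t d -> Pder g t e -> Pder (fun x => f x + g x)%C t (d + e)%C.
Proof.
  intros [H1 H2] [H3 H4]; split; simpl.
  - apply (is_derive_plus (fun x => Re (f x)) (fun x => Re (g x))); auto.
  - apply (is_derive_plus (fun x => Im (f x)) (fun x => Im (g x))); auto.
Qed.

Lemma Pder_opp (f : R -> C) (t : R) (d : C) :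
  Pder f t d -> Pder (fun x => - f x)%C t (- d)%C.
Proof.
  intros [H1 H2]; split; simpl.
  - apply (is_derive_opp (fun x => Re (f x))); auto.
  - apply (is_derive_opp (fun x => Im (f x))); auto.
Qed.

Lemma Pder_minus (f g : R -> C) (t : R) (d e : C) :
  Pder f t d -> Pder g t e -> Pder (fun x => f x - g x)%C t (d - e)%C.
Proof. intros H1 H2; apply Pder_plus; auto; apply Pder_opp; auto. Qed.

Lemma is_derive_Rmult (f g : R -> R) (t df dg : R) :
  is_derive f t df -> is_derive g t dg ->
  is_derive (fun x => f x * g x) t (df * g t + f t * dg).
Proof.
  intros H1 H2; apply is_derive_Reals; apply is_derive_Reals in H1; apply is_derive_Reals in H2.
  exact (derivable_pt_lim_mult _ _ _ _ _ H1 H2).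
Qed.

Lemma is_derive_Rplus (f g : R -> R) (t df dg : R) :
  is_derive f t df -> is_derive g t dg ->
  is_derive (fun x => f x + g x) t (df + dg).
Proof. apply (is_derive_plus f g). Qed.

Lemma is_derive_Rminus (f g : R -> R) (t df dg : R) :
  is_derive f t df -> is_derive g t dg ->
  is_derive (fun x => f x - g x) t (df - dg).
Proof. apply (is_derive_minus f g). Qed.

Lemma is_derive_Rcomp (f g : R -> R) (t df dg : R) :
  is_derive f (g t) df -> is_derive g t dg ->
  is_derive (fun x => f (g x)) t (df * dg).
Proof.
  intros H1 H2; rewrite Rmult_comm; apply (is_derive_comp f g); auto.
Qed.

Lemma is_derive_eq (f : R -> R) (t d e : R) : is_derive f t d -> d = e -> is_derive f t e.
Proof. intros H E; rewrite <- E; auto. Qed.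

Lemma Pder_mult (f g : R -> C) (t : R) (d e : C) :
  Pder f t d -> Pder g t e -> Pder (fun x => f x * g x)%C t (d * g t + f t * e)%C.
Proof.
  intros [H1 H2] [H3 H4]; split; simpl.
  - apply is_derive_eq with (1 := is_derive_Rminus _ _ _ _ _
      (is_derive_Rmult _ _ _ _ _ H1 H3) (is_derive_Rmult _ _ _ _ _ H2 H4)).
    unfold Re, Im; ring.
  - apply is_derive_eq with (1 := is_derive_Rplus _ _ _ _ _
      (is_derive_Rmult _ _ _ _ _ H1 H4) (is_derive_Rmult _ _ _ _ _ H2 H3)).
    unfold Re, Im; ring.
Qed.

Lemma Pder_scal (c : C) (f : R -> C) (t : R) (d : C) :
  Pder f t d -> Pder (fun x => c * f x)%C t (c * d)%C.
Proof.
  intros H; apply Pder_eq with (1 := Pder_mult _ _ _ _ _ (Pder_const c t) H); ring.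
Qed.

Lemma Pder_pow (f : R -> C) (t : R) (d : C) (n : nat) :
  Pder f t d -> Pder (fun x => f x ^ n)%C t (RtoC (INR n) * f t ^ (n - 1) * d)%C.
Proof.
  intros H; induction n as [|n IH].
  - apply Pder_eq with (1 := Pder_const (RtoC 1) t); simpl; ring.
  - apply Pder_eq with (1 := Pder_mult _ _ _ _ _ H IH).
    rewrite S_INR, RtoC_plus; destruct n as [|n]; simpl; [ring|].
    replace (n - 0)%nat with n by lia; ring.
Qed.

Lemma Pder_affine (z v : C) (t : R) : Pder (fun x => z + RtoC x * v)%C t v.
Proof.
  apply Pder_eq with (1 := Pder_plus _ _ _ _ _ (Pder_const z t)
    (Pder_mult _ _ _ _ _ (Pder_id t) (Pder_const v t))); ring.
Qed.

Lemma Pder_comp (f : R -> C) (g : R -> R) (t dg : R) (d : C) :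
  Pder f (g t) d -> is_derive g t dg -> Pder (fun x => f (g x)) t (RtoC dg * d)%C.
Proof.
  intros [H1 H2] H3; split; simpl.
  - apply is_derive_eq with (1 := is_derive_Rcomp (fun x => Re (f x)) g _ _ _ H1 H3).
    unfold Re, Im; ring.
  - apply is_derive_eq with (1 := is_derive_Rcomp (fun x => Im (f x)) g _ _ _ H2 H3).
    unfold Re, Im; ring.
Qed.

Lemma Pder_continuous_Re (f : R -> C) (t : R) (d : C) : Pder f t d -> continuous (fun x => Re (f x)) t.
Proof. intros [H _]; apply (ex_derive_continuous (fun x => Re (f x))); eexists; exact H. Qed.

Lemma Pder_continuous_Im (f : R -> C) (t : R) (d : C) : Pder f t d -> continuous (fun x => Im (f x)) t.
Proof. intros [_ H]; apply (ex_derive_continuous (fun x => Im (f x))); eexists; exact H. Qed.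

Lemma Pder_Cexpi (f : R -> R) (t d : R) : is_derive f t d ->
  Pder (fun x => Cexpi (f x)) t (Ci * RtoC d * Cexpi (f t))%C.
Proof.
  intros H; split; simpl.
  - apply is_derive_eq with (1 := is_derive_Rcomp cos f t _ _ (is_derive_cos (f t)) H); ring.
  - apply is_derive_eq with (1 := is_derive_Rcomp sin f t _ _ (is_derive_sin (f t)) H); ring.
Qed.

(** *** First-order expansions *)

Lemma is_derive_expand (f : R -> R) (t d : R) : is_derive f t d <->
  (forall eps, 0 < eps -> exists del, 0 < del /\
     forall k, Rabs k < del -> Rabs (f (t + k) - f t - k * d) <= eps * Rabs k).
Proof.
  split.
  - intros H eps He; apply is_derive_Reals in H.
    destruct (H eps He) as [del Hd]; exists del; split; [apply cond_pos|].
    intros k Hk; destruct (Req_dec k 0) as [->|Hk0].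
    + replace (f (t + 0) - f t - 0 * d) with 0 by (rewrite Rplus_0_r; ring).
      rewrite Rabs_R0; lra.
    + specialize (Hd k Hk0 Hk).
      replace (f (t + k) - f t - k * d) with (((f (t + k) - f t) / k - d) * k) by (field; auto).
      rewrite Rabs_mult; apply Rmult_le_compat_r; [apply Rabs_pos|lra].
  - intros H; apply is_derive_Reals; intros eps He.
    destruct (H (eps / 2)) as [del [Hd Hk]]; [lra|].
    exists (mkposreal del Hd); intros k Hk0 Hkd; simpl in Hkd.
    specialize (Hk k Hkd).
    replace ((f (t + k) - f t) / k - d) with ((f (t + k) - f t - k * d) / k) by (field; auto).
    unfold Rdiv; rewrite Rabs_mult, Rabs_inv.
    assert (0 < Rabs k) by (apply Rabs_pos_lt; auto).
    apply Rmult_lt_reg_r with (Rabs k); auto.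
    rewrite Rmult_assoc, Rinv_l by lra; nra.
Qed.

Lemma Pder_expand (f : R -> C) (t : R) (d : C) : Pder f t d <->
  (forall eps, 0 < eps -> exists del, 0 < del /\
     forall k, Rabs k < del -> Cmod (f (t + k)%R - f t - RtoC k * d) <= eps * Rabs k).
Proof.
  unfold Pder; rewrite !is_derive_expand; split.
  - intros [H1 H2] eps He.
    destruct (H1 (eps / 2)) as [d1 [Hd1 K1]]; [lra|].
    destruct (H2 (eps / 2)) as [d2 [Hd2 K2]]; [lra|].
    exists (Rmin d1 d2); split; [apply Rmin_pos; auto|].
    intros k Hk.
    assert (A1 := K1 k (Rlt_le_trans _ _ _ Hk (Rmin_l _ _))).
    assert (A2 := K2 k (Rlt_le_trans _ _ _ Hk (Rmin_r _ _))).
    apply Rle_trans with (1 := Cmod_le_Re_Im _).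
    match goal with |- Rabs ?x + Rabs ?y <= _ =>
      replace x with (Re (f (t + k)) - Re (f t) - k * Re d) by (simpl; unfold Re, Im; ring);
      replace y with (Im (f (t + k)) - Im (f t) - k * Im d) by (simpl; unfold Re, Im; ring)
    end; lra.
  - intros H; split; intros eps He; destruct (H eps He) as [del [Hd K]];
      exists del; split; auto; intros k Hk; apply Rle_trans with (2 := K k Hk).
    + apply Rle_trans with (2 := re_le_Cmod _); right; f_equal; simpl; unfold Re, Im; ring.
    + apply Rle_trans with (2 := im_le_Cmod _); right; f_equal; simpl; unfold Re, Im; ring.
Qed.

Definition Cder (f : C -> C) (z d : C) : Prop :=
  forall eps, 0 < eps -> exists del, 0 < del /\
    forall w, Cmod w < del -> Cmod (f (z + w)%C - f z - w * d)%C <= eps * Cmod w.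

(** Differentiability in each real direction, with a derivative linear in the
    direction; this is all that uniqueness along segments needs. *)
Definition Gder (f : C -> C) (z d : C) : Prop :=
  forall v : C, Pder (fun t => f (z + RtoC t * v)%C) 0 (v * d)%C.

Lemma Cder_Pder (f : C -> C) (g : R -> C) (t : R) (d e : C) :
  Pder g t e -> Cder f (g t) d -> Pder (fun x => f (g x)) t (e * d)%C.
Proof.
  intros Hg Hf; apply Pder_expand; intros eps He; rewrite Pder_expand in Hg.
  set (M := 1 + Cmod e + Cmod d).
  assert (HM : 0 < M) by (unfold M; generalize (Cmod_ge_0 e) (Cmod_ge_0 d); lra).
  destruct (Hf (eps / (2 * M))) as [d1 [Hd1 K1]];
    [apply Rdiv_lt_0_compat; lra|].
  destruct (Hg (Rmin 1 (eps / (2 * M)))) as [d2 [Hd2 K2]];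
    [apply Rmin_pos; [lra|apply Rdiv_lt_0_compat; lra]|].
  exists (Rmin d2 (d1 / M)); split;
    [apply Rmin_pos; auto; apply Rdiv_lt_0_compat; auto|].
  intros k Hk; specialize (K2 k (Rlt_le_trans _ _ _ Hk (Rmin_l _ _))).
  assert (Hk2 := Rlt_le_trans _ _ _ Hk (Rmin_r _ _)).
  set (w := (g (t + k)%R - g t)%C) in *.
  assert (Ak := Rabs_pos k).
  assert (Hw1 : Cmod (w - RtoC k * e) <= 1 * Rabs k).
  { apply Rle_trans with (1 := K2), Rmult_le_compat_r; auto; apply Rmin_l. }
  assert (Hw2 : Cmod (w - RtoC k * e) <= eps / (2 * M) * Rabs k).
  { apply Rle_trans with (1 := K2), Rmult_le_compat_r; auto; apply Rmin_r. }
  assert (Hw : Cmod w <= M * Rabs k).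
  { assert (T := Cmod_triangle_minus w (RtoC k * e)).
    rewrite Cmod_mult, Cmod_R in T; unfold M.
    generalize (Cmod_ge_0 d); nra. }
  assert (Hwd : Cmod w < d1).
  { apply Rle_lt_trans with (1 := Hw).
    apply Rmult_lt_reg_l with (/ M); [apply Rinv_0_lt_compat; auto|].
    rewrite <- Rmult_assoc, Rinv_l by lra; unfold Rdiv in Hk2; lra. }
  specialize (K1 w Hwd).
  replace (g t + w)%C with (g (t + k)%R) in K1 by (unfold w; ring).
  replace (f (g (t + k)%R) - f (g t) - RtoC k * (e * d))%C
    with ((f (g (t + k)%R) - f (g t) - w * d) + (w - RtoC k * e) * d)%C by ring.
  apply Rle_trans with (1 := Cmod_triangle _ _); rewrite Cmod_mult.
  assert (Hd0 := Cmod_ge_0 d).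
  assert (E1 : eps / (2 * M) * Cmod w <= eps / 2 * Rabs k).
  { apply Rle_trans with (eps / (2 * M) * (M * Rabs k)).
    - apply Rmult_le_compat_l; auto; left; apply Rdiv_lt_0_compat; lra.
    - right; field; lra. }
  assert (E2 : Cmod (w - RtoC k * e) * Cmod d <= eps / 2 * Rabs k).
  { apply Rle_trans with (eps / (2 * M) * Rabs k * M).
    - apply Rmult_le_compat; auto; [apply Cmod_ge_0|].
      unfold M; generalize (Cmod_ge_0 e); lra.
    - right; field; lra. }
  lra.
Qed.

Lemma Cder_Gder (f : C -> C) (z d : C) : Cder f z d -> Gder f z d.
Proof.
  intros H v; apply (Cder_Pder f (fun t => z + RtoC t * v)%C).
  - apply Pder_affine.
  - replace (z + RtoC 0 * v)%C with z by ring; auto.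
Qed.

Lemma Gder_affine (f : C -> C) (z0 v d : C) (t : R) :
  Gder f (z0 + RtoC t * v) d -> Pder (fun x => f (z0 + RtoC x * v)%C) t (v * d)%C.
Proof.
  intros H; specialize (H v).
  apply Pder_ext with (fun x => f (z0 + RtoC t * v + RtoC (x - t) * v)%C).
  - intros x; f_equal; rewrite RtoC_minus; ring.
  - apply Pder_eq with (RtoC 1 * (v * d))%C; [|ring].
    apply (Pder_comp (fun y => f (z0 + RtoC t * v + RtoC y * v)%C) (fun x => x - t)).
    + replace (t - t) with 0 by ring; auto.
    + auto_derive; auto; ring.
Qed.

(** ** Powers and moduli along a path *)

Lemma is_derive_Cmod (g : R -> C) (t : R) (e : C) : Pder g t e -> g t <> RtoC 0 ->
  is_derive (fun x => Cmod (g x)) t ((Re (g t) * Re e + Im (g t) * Im e) / Cmod (g t)).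
Proof.
  intros [H1 H2] Hz; apply Cmod_gt_0 in Hz.
  assert (E := Cmod_sqr (g t)).
  assert (Hs : is_derive (fun x => Re (g x) * Re (g x) + Im (g x) * Im (g x)) t
     (2 * (Re (g t) * Re e + Im (g t) * Im e))).
  { apply is_derive_eq with (1 := is_derive_Rplus _ _ _ _ _
      (is_derive_Rmult _ _ _ _ _ H1 H1) (is_derive_Rmult _ _ _ _ _ H2 H2)); ring. }
  apply is_derive_ext with (fun x => sqrt (Re (g x) * Re (g x) + Im (g x) * Im (g x))).
  - intros x; unfold Cmod, Re, Im; f_equal; simpl; ring.
  - assert (Es : sqrt (Re (g t) * Re (g t) + Im (g t) * Im (g t)) = Cmod (g t)).
    { unfold Cmod, Re, Im; f_equal; simpl; ring. }
    assert (Hp : 0 < Re (g t) * Re (g t) + Im (g t) * Im (g t)) by nra.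
    apply is_derive_eq with (1 := is_derive_Rcomp sqrt _ _ _ _
      (proj2 (is_derive_Reals _ _ _) (derivable_pt_lim_sqrt _ Hp)) Hs).
    rewrite Es; field; lra.
Qed.

Lemma is_derive_Carg (g : R -> C) (t : R) (e : C) : Pder g t e -> slit (g t) ->
  is_derive (fun x => Carg (g x)) t
    ((Re (g t) * Im e - Im (g t) * Re e) / Cmod (g t) ^ 2).
Proof.
  intros H Hs; assert (Hz := slit_neq0 _ Hs).
  assert (Hm := is_derive_Cmod g t e H Hz).
  destruct H as [H1 H2]; unfold slit in Hs.
  assert (Hz' := Hz); apply Cmod_gt_0 in Hz'.
  assert (E := Cmod_sqr (g t)).
  assert (Hsum := is_derive_Rplus _ _ _ _ _ Hm H1).
  assert (Hloc : locally t (fun x => 0 < Cmod (g x) + Re (g x))).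
  { assert (Hc : continuous (fun x => Cmod (g x) + Re (g x)) t).
    { apply (ex_derive_continuous (fun x => Cmod (g x) + Re (g x))); eexists; exact Hsum. }
    apply Hc; apply open_gt; auto. }
  apply is_derive_ext_loc with (fun x => 2 * atan (Im (g x) * / (Cmod (g x) + Re (g x)))).
  - destruct Hloc as [eps He]; exists eps; intros x Hx.
    symmetry; apply Carg_atan; unfold slit; auto.
  - assert (Hinv := is_derive_inv _ _ _ Hsum (Rgt_not_eq _ _ Hs)).
    assert (Hq := is_derive_Rmult _ _ _ _ _ H2 Hinv).
    assert (Hat := is_derive_Rcomp atan _ t _ _
       (proj2 (is_derive_Reals _ _ _) (derivable_pt_lim_atan _)) Hq).
    apply is_derive_eq with (1 := is_derive_Rmult _ _ _ _ _
       (proj2 (is_derive_Reals _ _ _) (derivable_pt_lim_const 2 t)) Hat).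
    unfold Rsqr; set (x := Re (g t)) in *; set (y := Im (g t)) in *; set (m := Cmod (g t)) in *.
    assert (D : (m + x) ^ 2 + y ^ 2 = 2 * m * (m + x)) by (ring_simplify; lra).
    assert (Hmx : 0 < 2 * m * (m + x)) by (apply Rmult_lt_0_compat; lra).
    unfold fct_cte. rewrite Rmult_0_l, Rplus_0_l.
    replace (/ (1 + (y * / (m + x)) ^ 2)) with ((m + x) ^ 2 / (2 * m * (m + x))).
    2:{ rewrite <- D; field; split; [nra|lra]. }
    assert (Y2 : y ^ 2 = (m - x) * (m + x)) by (ring_simplify; lra).
    apply Rmult_eq_reg_r with (m ^ 2); [|apply pow_nonzero; lra].
    transitivity (x * Im e - y * Re e); [|field; lra].
    transitivity (m * Im e - y * ((x * Re e + y * Im e) / m + Re e) * m / (m + x)).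
    { field; split; lra. }
    apply Rmult_eq_reg_r with (m + x); [|lra].
    transitivity (m * Im e * (m + x) - y * Re e * (m + x) - y ^ 2 * Im e).
    { field; split; lra. }
    rewrite Y2; ring.
Qed.

Lemma Pder_Cpowr (g : R -> C) (t : R) (e : C) (al : R) : Pder g t e -> slit (g t) ->
  Pder (fun x => Cpowr (g x) al) t (RtoC al * Cpowr (g t) al / g t * e)%C.
Proof.
  intros H Hs; assert (Hz := slit_neq0 _ Hs).
  assert (Hz' := Hz); apply Cmod_gt_0 in Hz'.
  assert (Hm := is_derive_Cmod g t e H Hz).
  assert (Ha := is_derive_Carg g t e H Hs).
  assert (Hloc : exists eps, 0 < eps /\ forall x, Rabs (x - t) < eps -> g x <> RtoC 0).
  { assert (Hc : continuous (fun x => Cmod (g x)) t).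
    { apply (ex_derive_continuous (fun x => Cmod (g x))); eexists; exact Hm. }
    destruct (Hc (fun y => 0 < y)) as [eps He]; [apply open_gt; auto|].
    exists eps; split; [apply cond_pos|]; intros x Hx; apply Cmod_gt_0, He, Hx. }
  destruct Hloc as [eps [He Hnz]].
  apply Pder_ext_loc with (f := fun x => (RtoC (Rpower (Cmod (g x)) al) * Cexpi (al * Carg (g x)))%C)
    (eps := eps); auto.
  { intros x Hx; symmetry; apply Cpowr_nz; auto. }
  assert (D1 := is_derive_Rcomp (fun x => Rpower x al) _ t _ _
    (proj2 (is_derive_Reals _ _ _) (derivable_pt_lim_power _ al Hz')) Hm).
  assert (D2 : is_derive (fun x => al * Carg (g x)) t
     (al * ((Re (g t) * Im e - Im (g t) * Re e) / Cmod (g t) ^ 2))).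
  { apply is_derive_eq with (1 := is_derive_Rmult _ _ _ _ _
       (proj2 (is_derive_Reals _ _ _) (derivable_pt_lim_const al t)) Ha).
    unfold fct_cte; ring. }
  apply Pder_eq with (1 := Pder_mult _ _ _ _ _ (Pder_RtoC _ _ _ D1) (Pder_Cexpi _ _ _ D2)).
  rewrite (Cpowr_nz (g t)) by auto.
  replace (Rpower (Cmod (g t)) (al - 1)) with (Rpower (Cmod (g t)) al / Cmod (g t)).
  2:{ unfold Rminus; rewrite Rpower_plus, Rpower_Ropp, Rpower_1; auto. }
  set (P := Rpower (Cmod (g t)) al); set (W := Cexpi (al * Carg (g t))).
  assert (E := Cmod_sqr (g t)).
  (* logarithmic derivative: e / g = m'/m + i theta' *)
  assert (L : (e / g t)%C = (RtoC ((Re (g t) * Re e + Im (g t) * Im e) / Cmod (g t) ^ 2)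
     + Ci * RtoC ((Re (g t) * Im e - Im (g t) * Re e) / Cmod (g t) ^ 2))%C).
  { transitivity (e * Cconj (g t) / RtoC (Cmod (g t) ^ 2))%C.
    - replace (RtoC (Cmod (g t) ^ 2)) with (g t * Cconj (g t))%C.
      + field; split; auto.
        apply Cmod_gt_0; rewrite Cmod_conj; auto.
      + rewrite E; apply C_eq; simpl; unfold Re, Im; ring.
    - unfold Cdiv; rewrite <- RtoC_inv by (apply pow_nonzero; lra).
      apply C_eq; simpl; unfold Re, Im; field; lra. }
  replace (RtoC al * (RtoC P * W) / g t * e)%C with (RtoC al * RtoC P * W * (e / g t))%C
    by (field; auto).
  rewrite L.
  set (u := Re (g t) * Re e + Im (g t) * Im e).
  set (v := Re (g t) * Im e - Im (g t) * Re e).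
  replace (al * (P / Cmod (g t)) * (u / Cmod (g t)))%R with (al * P * (u / Cmod (g t) ^ 2))%R
    by (field; lra).
  rewrite !RtoC_mult; ring.
Qed.

(** * Mean values and uniqueness for the differential system *)

Lemma is_derive_continuity_pt (f : R -> R) (t d : R) : is_derive f t d -> continuity_pt f t.
Proof.
  intros H; apply derivable_continuous_pt.
  exists d; apply is_derive_Reals; exact H.
Qed.

Lemma is_derive_incr (f df : R -> R) (a b : R) : a <= b ->
  (forall t, a <= t <= b -> is_derive f t (df t)) ->
  (forall t, a <= t <= b -> 0 <= df t) -> f a <= f b.
Proof.
  intros Hab Hd Hp.
  destruct (MVT_gen f a b df) as [c [Hc E]]; rewrite ?Rmin_left, ?Rmax_right in * by lra.
  - intros x Hx; apply Hd; lra.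
  - intros x Hx; eapply is_derive_continuity_pt, Hd; lra.
  - assert (0 <= df c * (b - a)) by (apply Rmult_le_pos; [apply Hp; auto|lra]); lra.
Qed.

Lemma is_derive_incr_strict (f df : R -> R) (a b : R) : a < b ->
  (forall t, a <= t <= b -> is_derive f t (df t)) ->
  (forall t, a <= t <= b -> 0 <= df t) ->
  (forall t, a < t < b -> 0 < df t) -> f a < f b.
Proof.
  intros Hab Hd Hp Hs.
  set (c := (2 * a + b) / 3); set (d := (a + 2 * b) / 3).
  assert (H1 : f a <= f c) by (apply is_derive_incr with df; unfold c; intros; try apply Hd; try apply Hp; lra).
  assert (H2 : f d <= f b) by (apply is_derive_incr with df; unfold d; intros; try apply Hd; try apply Hp; lra).
  destruct (MVT_gen f c d df) as [x [Hx E]];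
    rewrite ?Rmin_left, ?Rmax_right in * by (unfold c, d; lra).
  - intros x Hx; apply Hd; unfold c, d in *; lra.
  - intros x Hx; eapply is_derive_continuity_pt, Hd; unfold c, d in *; lra.
  - assert (0 < df x * (d - c)) by (apply Rmult_lt_0_compat; [apply Hs|]; unfold c, d in *; lra); lra.
Qed.

Lemma is_derive_const_eq (f : R -> R) (a b : R) : a <= b ->
  (forall t, a <= t <= b -> is_derive f t 0) -> f b = f a.
Proof.
  intros Hab Hd.
  destruct (MVT_gen f a b (fun _ => 0)) as [c [Hc E]]; rewrite ?Rmin_left, ?Rmax_right in * by lra.
  - intros x Hx; apply Hd; lra.
  - intros x Hx; eapply is_derive_continuity_pt, Hd; lra.
  - lra.
Qed.

Lemma Pder_const_eq (f : R -> C) (a b : R) : a <= b ->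
  (forall t, a <= t <= b -> Pder f t (RtoC 0)) -> f b = f a.
Proof.
  intros Hab Hd; apply C_eq.
  - apply (is_derive_const_eq (fun t => Re (f t))); auto; intros t Ht; apply (Hd t Ht).
  - apply (is_derive_const_eq (fun t => Im (f t))); auto; intros t Ht; apply (Hd t Ht).
Qed.

Lemma Re_mult_conj_le (w d : C) : Re w * Re d + Im w * Im d <= Cmod w * Cmod d.
Proof.
  replace (Re w * Re d + Im w * Im d) with (Re (Cconj w * d)%C)
    by (simpl; unfold Re, Im; ring).
  apply Rle_trans with (1 := Rle_abs _), Rle_trans with (1 := re_le_Cmod _).
  rewrite Cmod_mult, Cmod_conj; lra.
Qed.

(** Projection on the direction of [f b - f a] reduces this to a monotone real
    function. *)
Lemma path_increment_le (f d : R -> C) (g dg : R -> R) (a b : R) : a <= b ->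
  (forall t, a <= t <= b -> Pder f t (d t)) ->
  (forall t, a <= t <= b -> is_derive g t (dg t)) ->
  (forall t, a <= t <= b -> Cmod (d t) <= dg t) ->
  Cmod (f b - f a) <= g b - g a.
Proof.
  intros Hab Hf Hg Hle.
  set (w := (f b - f a)%C).
  destruct (Req_dec (Cmod w) 0) as [E|E].
  { rewrite E; assert (g a <= g b); [|lra].
    apply is_derive_incr with dg; auto.
    intros t Ht; apply Rle_trans with (2 := Hle t Ht), Cmod_ge_0. }
  assert (Hw : 0 < Cmod w) by (generalize (Cmod_ge_0 w); lra).
  assert (H : Cmod w * g a - (Re w * Re (f a) + Im w * Im (f a))
           <= Cmod w * g b - (Re w * Re (f b) + Im w * Im (f b))).
  { apply (is_derive_incr (fun t => Cmod w * g t - (Re w * Re (f t) + Im w * Im (f t)))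
      (fun t => Cmod w * dg t - (Re w * Re (d t) + Im w * Im (d t)))); auto.
    - intros t Ht; destruct (Hf t Ht) as [F1 F2]; specialize (Hg t Ht).
      apply is_derive_Rminus; [apply is_derive_scal; auto|].
      apply is_derive_Rplus; apply is_derive_scal; auto.
    - intros t Ht; generalize (Re_mult_conj_le w (d t)) (Hle t Ht); nra. }
  assert (E2 : Cmod w ^ 2 = Re w * Re (f b) + Im w * Im (f b) - (Re w * Re (f a) + Im w * Im (f a))).
  { rewrite Cmod_sqr; unfold w; simpl; unfold Re, Im; ring. }
  apply Rmult_le_reg_l with (Cmod w); auto; nra.
Qed.

Lemma path_mean_value (f d : R -> C) (M a b : R) : a <= b ->
  (forall t, a <= t <= b -> Pder f t (d t)) ->
  (forall t, a <= t <= b -> Cmod (d t) <= M) ->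
  Cmod (f b - f a) <= M * (b - a).
Proof.
  intros Hab Hf HM.
  replace (M * (b - a)) with (M * b - M * a) by ring.
  apply (path_increment_le f d (fun t => M * t) (fun _ => M)); auto.
  intros t _; auto_derive; auto; ring.
Qed.

Lemma Cmod_pow_minus_le (x y : C) (n : nat) (B : R) : 1 <= B ->
  Cmod x <= B -> Cmod y <= B ->
  Cmod (x ^ n - y ^ n) <= INR n * B ^ n * Cmod (x - y).
Proof.
  intros HB Hx Hy; induction n as [|n IH].
  - simpl; replace (RtoC 1 - RtoC 1)%C with (RtoC 0) by ring; rewrite Cmod_0; lra.
  - rewrite S_INR.
    replace (x ^ S n - y ^ S n)%C with (x * (x ^ n - y ^ n) + (x - y) * y ^ n)%C
      by (simpl; ring).
    apply Rle_trans with (1 := Cmod_triangle _ _); rewrite !Cmod_mult, Cmod_pow.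
    assert (P : 0 <= B ^ n) by (apply pow_le; lra).
    assert (Q : Cmod y ^ n <= B ^ n) by (apply pow_incr; split; [apply Cmod_ge_0|auto]).
    assert (D := Cmod_ge_0 (x - y)).
    assert (A1 : Cmod x * Cmod (x ^ n - y ^ n) <= B * (INR n * B ^ n * Cmod (x - y))).
    { apply Rmult_le_compat; auto; apply Cmod_ge_0. }
    assert (A2 : Cmod (x - y) * Cmod y ^ n <= Cmod (x - y) * (B * B ^ n)).
    { apply Rmult_le_compat_l; auto; nra. }
    simpl; nra.
Qed.

Lemma path_bounded (f d : R -> C) (a b : R) : a <= b ->
  (forall t, a <= t <= b -> Pder f t (d t)) ->
  exists M, forall t, a <= t <= b -> Cmod (f t) <= M.
Proof.
  intros Hab Hf.
  destruct (continuity_ab_maj (fun t => Rabs (Re (f t)) + Rabs (Im (f t))) a b Hab) as [c [Hc _]].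
  - intros t Ht; destruct (Hf t Ht) as [H1 H2].
    apply continuity_pt_plus; apply (continuity_pt_comp _ Rabs);
      try apply Rcontinuity_abs; eapply is_derive_continuity_pt; eassumption.
  - exists (Rabs (Re (f c)) + Rabs (Im (f c))); intros t Ht.
    apply Rle_trans with (1 := Cmod_le_Re_Im _), (Hc t Ht).
Qed.

Section System.

(** The polynomial system [f' = ca g^m], [g' = cb f^n]. *)
Variables (ca cb : R) (m n : nat).

(** The squared distance [D] of the two solutions satisfies [D' <= K D], because
    powers are Lipschitz on bounded sets. *)
Lemma path_unique (c x1 y1 x2 y2 : R -> C) (M : R) :
  (forall t, 0 <= t <= 1 -> Cmod (c t) <= M) ->
  (forall t, 0 <= t <= 1 -> Pder x1 t (c t * (RtoC ca * y1 t ^ m))%C) ->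
  (forall t, 0 <= t <= 1 -> Pder y1 t (c t * (RtoC cb * x1 t ^ n))%C) ->
  (forall t, 0 <= t <= 1 -> Pder x2 t (c t * (RtoC ca * y2 t ^ m))%C) ->
  (forall t, 0 <= t <= 1 -> Pder y2 t (c t * (RtoC cb * x2 t ^ n))%C) ->
  x1 0 = x2 0 -> y1 0 = y2 0 ->
  forall t, 0 <= t <= 1 -> x1 t = x2 t /\ y1 t = y2 t.
Proof.
  intros HM X1 Y1 X2 Y2 Ex Ey.
  destruct (path_bounded x1 _ 0 1 Rle_0_1 X1) as [B1 H1].
  destruct (path_bounded y1 _ 0 1 Rle_0_1 Y1) as [B2 H2].
  destruct (path_bounded x2 _ 0 1 Rle_0_1 X2) as [B3 H3].
  destruct (path_bounded y2 _ 0 1 Rle_0_1 Y2) as [B4 H4].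
  set (B := 1 + Rabs B1 + Rabs B2 + Rabs B3 + Rabs B4).
  assert (HB : 1 <= B /\ B1 <= B /\ B2 <= B /\ B3 <= B /\ B4 <= B).
  { unfold B; generalize (Rle_abs B1) (Rle_abs B2) (Rle_abs B3) (Rle_abs B4)
      (Rabs_pos B1) (Rabs_pos B2) (Rabs_pos B3) (Rabs_pos B4); intuition lra. }
  destruct HB as [HB [HB1 [HB2 [HB3 HB4]]]].
  assert (M0 : 0 <= M) by (apply Rle_trans with (2 := HM 0 ltac:(lra)), Cmod_ge_0).
  set (K := (Rabs ca * (INR m * B ^ m) + Rabs cb * (INR n * B ^ n)) * M).
  set (dx := fun t => (x1 t - x2 t)%C); set (dy := fun t => (y1 t - y2 t)%C).
  set (dx' := fun t => (c t * (RtoC ca * y1 t ^ m) - c t * (RtoC ca * y2 t ^ m))%C).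
  set (dy' := fun t => (c t * (RtoC cb * x1 t ^ n) - c t * (RtoC cb * x2 t ^ n))%C).
  set (D := fun t => (Re (dx t) * Re (dx t) + Im (dx t) * Im (dx t))
                   + (Re (dy t) * Re (dy t) + Im (dy t) * Im (dy t))).
  set (D' := fun t => (Re (dx' t) * Re (dx t) + Re (dx t) * Re (dx' t)
                     + (Im (dx' t) * Im (dx t) + Im (dx t) * Im (dx' t)))
                    + (Re (dy' t) * Re (dy t) + Re (dy t) * Re (dy' t)
                     + (Im (dy' t) * Im (dy t) + Im (dy t) * Im (dy' t)))).
  assert (DD : forall t, 0 <= t <= 1 -> is_derive D t (D' t)).
  { intros t Ht.
    destruct (Pder_minus _ _ _ _ _ (X1 t Ht) (X2 t Ht)) as [R1 I1].
    destruct (Pder_minus _ _ _ _ _ (Y1 t Ht) (Y2 t Ht)) as [R2 I2].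
    exact (is_derive_Rplus _ _ _ _ _
      (is_derive_Rplus _ _ _ _ _ (is_derive_Rmult _ _ _ _ _ R1 R1) (is_derive_Rmult _ _ _ _ _ I1 I1))
      (is_derive_Rplus _ _ _ _ _ (is_derive_Rmult _ _ _ _ _ R2 R2) (is_derive_Rmult _ _ _ _ _ I2 I2))). }
  assert (ED : forall t, D t = Cmod (dx t) ^ 2 + Cmod (dy t) ^ 2).
  { intros t; rewrite !Cmod_sqr; unfold D; ring. }
  assert (Bd : forall t, 0 <= t <= 1 -> D' t <= K * D t).
  { intros t Ht.
    assert (A1 : Cmod (dx' t) <= M * (Rabs ca * (INR m * B ^ m)) * Cmod (dy t)).
    { unfold dx'; replace (c t * (RtoC ca * y1 t ^ m) - c t * (RtoC ca * y2 t ^ m))%C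
        with (c t * (RtoC ca * (y1 t ^ m - y2 t ^ m)))%C by ring.
      rewrite !Cmod_mult, Cmod_R, !Rmult_assoc.
      apply Rmult_le_compat; auto; try apply Cmod_ge_0.
      - apply Rmult_le_pos; [apply Rabs_pos|apply Cmod_ge_0].
      - apply Rmult_le_compat_l; [apply Rabs_pos|].
        rewrite <- Rmult_assoc; apply Cmod_pow_minus_le; auto.
        + apply Rle_trans with (2 := HB2); auto.
        + apply Rle_trans with (2 := HB4); auto. }
    assert (A2 : Cmod (dy' t) <= M * (Rabs cb * (INR n * B ^ n)) * Cmod (dx t)).
    { unfold dy'; replace (c t * (RtoC cb * x1 t ^ n) - c t * (RtoC cb * x2 t ^ n))%C
        with (c t * (RtoC cb * (x1 t ^ n - x2 t ^ n)))%C by ring.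
      rewrite !Cmod_mult, Cmod_R, !Rmult_assoc.
      apply Rmult_le_compat; auto; try apply Cmod_ge_0.
      - apply Rmult_le_pos; [apply Rabs_pos|apply Cmod_ge_0].
      - apply Rmult_le_compat_l; [apply Rabs_pos|].
        rewrite <- Rmult_assoc; apply Cmod_pow_minus_le; auto.
        + apply Rle_trans with (2 := HB1); auto.
        + apply Rle_trans with (2 := HB3); auto. }
    assert (E1 := Re_mult_conj_le (dx t) (dx' t)); assert (E2 := Re_mult_conj_le (dy t) (dy' t)).
    rewrite ED; unfold D'.
    set (k1 := M * (Rabs ca * (INR m * B ^ m))) in *.
    set (k2 := M * (Rabs cb * (INR n * B ^ n))) in *.
    assert (K1 : 0 <= k1).
    { unfold k1; repeat apply Rmult_le_pos; auto using Rabs_pos, pos_INR.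
      apply pow_le; lra. }
    assert (K2 : 0 <= k2).
    { unfold k2; repeat apply Rmult_le_pos; auto using Rabs_pos, pos_INR.
      apply pow_le; lra. }
    replace K with (k1 + k2) by (unfold K, k1, k2; ring).
    assert (P1 := Cmod_ge_0 (dx t)); assert (P2 := Cmod_ge_0 (dy t)).
    assert (F1 : Cmod (dx t) * Cmod (dx' t) <= Cmod (dx t) * (k1 * Cmod (dy t)))
      by (apply Rmult_le_compat_l; auto).
    assert (F2 : Cmod (dy t) * Cmod (dy' t) <= Cmod (dy t) * (k2 * Cmod (dx t)))
      by (apply Rmult_le_compat_l; auto).
    assert (F3 : 2 * (Cmod (dx t) * Cmod (dy t)) <= Cmod (dx t) ^ 2 + Cmod (dy t) ^ 2)
      by (generalize (pow2_ge_0 (Cmod (dx t) - Cmod (dy t))); intros; nra).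
    assert (F4 := Rmult_le_compat_l (k1 + k2) _ _ ltac:(lra) F3).
    lra. }
  intros t Ht.
  assert (D0 : D 0 = 0) by (unfold D, dx, dy; rewrite Ex, Ey; simpl; ring).
  assert (G : exp (- K * t) * D t <= 0).
  { assert (H : - (exp (- K * 0) * D 0) <= - (exp (- K * t) * D t)).
    { apply (is_derive_incr (fun t => - (exp (- K * t) * D t))
        (fun t => - ((- K * exp (- K * t)) * D t + exp (- K * t) * D' t))); [lra| |].
      - intros u Hu; apply (is_derive_opp (fun t => exp (- K * t) * D t)).
        apply (is_derive_Rmult (fun t => exp (- K * t)) D); [|apply DD; lra].
        auto_derive; auto; ring.
      - intros u Hu; specialize (Bd u ltac:(lra)); generalize (exp_pos (- K * u)); nra. }
    rewrite D0 in H; lra. }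
  assert (D1 : D t <= 0) by (generalize (exp_pos (- K * t)); nra).
  rewrite ED in D1.
  assert (Z1 : Cmod (dx t) = 0) by (generalize (Cmod_ge_0 (dx t)); nra).
  assert (Z2 : Cmod (dy t) = 0) by (generalize (Cmod_ge_0 (dy t)); nra).
  apply Cmod_eq_0 in Z1; apply Cmod_eq_0 in Z2; unfold dx, dy in *; split.
  - replace (x1 t) with (x1 t - x2 t + x2 t)%C by ring; rewrite Z1; ring.
  - replace (y1 t) with (y1 t - y2 t + y2 t)%C by ring; rewrite Z2; ring.
Qed.

Definition solves (f g : C -> C) (z : C) : Prop :=
  Gder f z (RtoC ca * g z ^ m)%C /\ Gder g z (RtoC cb * f z ^ n)%C.

Lemma segment_unique (f1 g1 f2 g2 : C -> C) (z0 z1 : C) :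
  (forall t, 0 <= t <= 1 -> solves f1 g1 (z0 + RtoC t * (z1 - z0))%C) ->
  (forall t, 0 <= t <= 1 -> solves f2 g2 (z0 + RtoC t * (z1 - z0))%C) ->
  f1 z0 = f2 z0 -> g1 z0 = g2 z0 -> f1 z1 = f2 z1 /\ g1 z1 = g2 z1.
Proof.
  intros H1 H2 Ef Eg.
  assert (P0 : (z0 + RtoC 0 * (z1 - z0))%C = z0) by ring.
  assert (P1 : (z0 + RtoC 1 * (z1 - z0))%C = z1) by ring.
  generalize (path_unique (fun _ => (z1 - z0)%C)
    (fun t => f1 (z0 + RtoC t * (z1 - z0))%C) (fun t => g1 (z0 + RtoC t * (z1 - z0))%C)
    (fun t => f2 (z0 + RtoC t * (z1 - z0))%C) (fun t => g2 (z0 + RtoC t * (z1 - z0))%C)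
    (Cmod (z1 - z0))); rewrite P0.
  intros U; destruct (U) with (t := 1) as [A B]; auto; try lra.
  - intros; apply Rle_refl.
  - intros t Ht; apply Gder_affine, H1; auto.
  - intros t Ht; apply Gder_affine, H1; auto.
  - intros t Ht; apply Gder_affine, H2; auto.
  - intros t Ht; apply Gder_affine, H2; auto.
  - rewrite P1 in A, B; auto.
Qed.

Definition Csolves (f g : C -> C) (z : C) : Prop :=
  Cder f z (RtoC ca * g z ^ m)%C /\ Cder g z (RtoC cb * f z ^ n)%C.

Lemma Csolves_solves (f g : C -> C) (z : C) : Csolves f g z -> solves f g z.
Proof. intros [H1 H2]; split; apply Cder_Gder; auto. Qed.

Lemma curve_unique (f g : C -> C) (gam c x y : R -> C) (M : R) :
  (forall t, 0 <= t <= 1 -> Csolves f g (gam t)) ->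
  (forall t, 0 <= t <= 1 -> Pder gam t (c t)) ->
  (forall t, 0 <= t <= 1 -> Cmod (c t) <= M) ->
  (forall t, 0 <= t <= 1 -> Pder x t (c t * (RtoC ca * y t ^ m))%C) ->
  (forall t, 0 <= t <= 1 -> Pder y t (c t * (RtoC cb * x t ^ n))%C) ->
  f (gam 0) = x 0 -> g (gam 0) = y 0 ->
  forall t, 0 <= t <= 1 -> f (gam t) = x t /\ g (gam t) = y t.
Proof.
  intros HS Hg HM Hx Hy Ex Ey.
  apply (path_unique c (fun t => f (gam t)) (fun t => g (gam t)) x y M); auto.
  - intros t Ht; apply Cder_Pder; [auto|apply (HS t Ht)].
  - intros t Ht; apply Cder_Pder; [auto|apply (HS t Ht)].
Qed.

End System.

(** * Complex power series *)

Lemma ex_series_bounded (a : nat -> R) (M : R) : (forall k, 0 <= a k) ->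
  (forall N, sum_f_R0 a N <= M) -> ex_series a.
Proof.
  intros Ha HM.
  destruct (ex_finite_lim_seq_incr (sum_n a) M) as [l Hl].
  - intros k; rewrite sum_Sn; unfold plus; simpl; specialize (Ha (S k)); lra.
  - intros k; rewrite sum_n_Reals; auto.
  - exists l; exact Hl.
Qed.

Lemma ex_series_nonneg_le (a b : nat -> R) : (forall k, 0 <= a k <= b k) -> ex_series b -> ex_series a.
Proof.
  intros H Hb; apply (ex_series_le (V := R_CompleteNormedModule) a b); auto.
  intros k; unfold norm; simpl; unfold abs; simpl.
  rewrite Rabs_pos_eq; apply H.
Qed.

Lemma is_series_zero : is_series (fun _ : nat => 0) 0.
Proof.
  apply filterlim_ext with (fun _ : nat => 0).
  - intros n; rewrite sum_n_const; ring.
  - apply filterlim_const.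
Qed.

Lemma ex_series_ext_R (a b : nat -> R) : (forall k, a k = b k) -> ex_series a -> ex_series b.
Proof. intros H; apply ex_series_ext; auto. Qed.

Lemma ex_series_scal_R (c : R) (a : nat -> R) : ex_series a -> ex_series (fun k => c * a k).
Proof. exact (ex_series_scal c a). Qed.

Lemma sum_le_Series (a : nat -> R) (N : nat) : (forall k, 0 <= a k) -> ex_series a ->
  sum_f_R0 a N <= Series a.
Proof.
  intros Ha He; apply Series_correct in He.
  apply is_lim_seq_incr_compare with (u := sum_f_R0 a).
  - apply is_lim_seq_ext with (sum_n a); [intros k; apply sum_n_Reals|exact He].
  - intros k; simpl; specialize (Ha (S k)); lra.
Qed.

Lemma is_series_Rscal (c : R) (a : nat -> R) (l : R) : is_series a l ->
  is_series (fun k => c * a k) (c * l).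
Proof. exact (is_series_scal c a l). Qed.

Lemma is_series_Rplus (a b : nat -> R) (la lb : R) : is_series a la -> is_series b lb ->
  is_series (fun k => a k + b k) (la + lb).
Proof. exact (is_series_plus a b la lb). Qed.

Lemma is_series_Rminus (a b : nat -> R) (la lb : R) : is_series a la -> is_series b lb ->
  is_series (fun k => a k - b k) (la - lb).
Proof. exact (is_series_minus a b la lb). Qed.

Definition Cis_series (u : nat -> C) (l : C) : Prop :=
  is_series (fun k => Re (u k)) (Re l) /\ is_series (fun k => Im (u k)) (Im l).

Definition CSeries (u : nat -> C) : C :=
  (Series (fun k => Re (u k)), Series (fun k => Im (u k))).

Lemma CSeries_ext (u v : nat -> C) : (forall k, u k = v k) -> CSeries u = CSeries v.
Proof. intros H; apply C_eq; apply Series_ext; intros k; rewrite H; reflexivity. Qed.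

Definition Csum (u : nat -> C) (n : nat) : C :=
  (sum_f_R0 (fun k => Re (u k)) n, sum_f_R0 (fun k => Im (u k)) n).

Lemma Csum_S (u : nat -> C) (n : nat) : Csum u (S n) = (Csum u n + u (S n))%C.
Proof. reflexivity. Qed.

Lemma Cmod_Csum_le (u : nat -> C) (n : nat) : Cmod (Csum u n) <= sum_f_R0 (fun k => Cmod (u k)) n.
Proof.
  induction n as [|n IH].
  - simpl; right; f_equal; apply C_eq; reflexivity.
  - rewrite Csum_S; simpl; apply Rle_trans with (1 := Cmod_triangle _ _); lra.
Qed.

Lemma Csum_ext (u v : nat -> C) (n : nat) : (forall k, (k <= n)%nat -> u k = v k) -> Csum u n = Csum v n.
Proof. intros H; unfold Csum; f_equal; apply sum_eq; intros i Hi; rewrite H; auto. Qed.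

Definition Cabs_series (u : nat -> C) : Prop := ex_series (fun k => Cmod (u k)).

Lemma Cabs_series_Re (u : nat -> C) : Cabs_series u -> ex_series (fun k => Rabs (Re (u k))).
Proof. apply ex_series_nonneg_le; intros k; split; [apply Rabs_pos|apply re_le_Cmod]. Qed.

Lemma Cabs_series_Im (u : nat -> C) : Cabs_series u -> ex_series (fun k => Rabs (Im (u k))).
Proof. apply ex_series_nonneg_le; intros k; split; [apply Rabs_pos|apply im_le_Cmod]. Qed.

Lemma CSeries_correct (u : nat -> C) : Cabs_series u -> Cis_series u (CSeries u).
Proof.
  intros H; split; apply Series_correct, ex_series_Rabs;
    [apply Cabs_series_Re|apply Cabs_series_Im]; auto.
Qed.

Lemma Cis_series_unique (u : nat -> C) (l : C) : Cis_series u l -> CSeries u = l.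
Proof. intros [H1 H2]; apply C_eq; simpl; apply is_series_unique; auto. Qed.

Lemma Cis_series_ext (u v : nat -> C) (l : C) : (forall k, u k = v k) -> Cis_series u l -> Cis_series v l.
Proof.
  intros E [H1 H2]; split; [apply is_series_ext with (2 := H1)|apply is_series_ext with (2 := H2)];
    intros k; rewrite E; reflexivity.
Qed.

Lemma Cis_series_plus (u v : nat -> C) (l l' : C) : Cis_series u l -> Cis_series v l' ->
  Cis_series (fun k => u k + v k)%C (l + l')%C.
Proof.
  intros [H1 H2] [H3 H4]; split; simpl.
  - apply (is_series_Rplus (fun k => Re (u k)) (fun k => Re (v k))); auto.
  - apply (is_series_Rplus (fun k => Im (u k)) (fun k => Im (v k))); auto.
Qed.

Lemma Cis_series_scal (c : C) (u : nat -> C) (l : C) : Cis_series u l ->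
  Cis_series (fun k => c * u k)%C (c * l)%C.
Proof.
  intros [H1 H2]; split; simpl.
  - apply (is_series_Rminus (fun k => fst c * Re (u k)) (fun k => snd c * Im (u k)));
      apply is_series_Rscal; auto.
  - apply (is_series_Rplus (fun k => fst c * Im (u k)) (fun k => snd c * Re (u k)));
      apply is_series_Rscal; auto.
Qed.

Lemma Cis_series_minus (u v : nat -> C) (l l' : C) : Cis_series u l -> Cis_series v l' ->
  Cis_series (fun k => u k - v k)%C (l - l')%C.
Proof.
  intros H1 H2; apply Cis_series_ext with (fun k => u k + RtoC (-1) * v k)%C.
  - intros k; ring.
  - replace (l - l')%C with (l + RtoC (-1) * l')%C by ring.
    apply Cis_series_plus, Cis_series_scal; auto.
Qed.

Lemma Cis_series_incr_1 (u : nat -> C) (l : C) :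
  Cis_series (fun k => u (S k)) l -> Cis_series u (u 0%nat + l)%C.
Proof.
  intros [H1 H2]; split; [apply (is_series_decr_1 (fun k => Re (u k)))|
    apply (is_series_decr_1 (fun k => Im (u k)))]; simpl; unfold plus, opp; simpl.
  - replace (fst (u 0%nat) + fst l + - Re (u 0%nat)) with (Re l) by (unfold Re; ring); auto.
  - replace (snd (u 0%nat) + snd l + - Im (u 0%nat)) with (Im l) by (unfold Im; ring); auto.
Qed.

Lemma is_series_le_R (a b : nat -> R) (la lb : R) : (forall k, a k <= b k) ->
  is_series a la -> is_series b lb -> la <= lb.
Proof.
  intros H Ha Hb.
  assert (L : Rbar_le la lb); [|exact L].
  apply is_lim_seq_le with (u := sum_n a) (v := sum_n b); auto.
  intros n; apply sum_n_m_le; auto.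
Qed.

Lemma Cmod_series_le (u : nat -> C) (l : C) (b : nat -> R) : Cis_series u l ->
  (forall k, Cmod (u k) <= b k) -> ex_series b -> Cmod l <= Series b.
Proof.
  intros [H1 H2] Hb He; apply Series_correct in He.
  destruct (Req_dec (Cmod l) 0) as [E|E].
  { rewrite E; apply is_series_le_R with (2 := is_series_zero) (3 := He).
    intros k; apply Rle_trans with (2 := Hb k), Cmod_ge_0. }
  assert (Hl : 0 < Cmod l) by (generalize (Cmod_ge_0 l); lra).
  assert (H : Re l * Re l + Im l * Im l <= Cmod l * Series b).
  { apply is_series_le_R with (a := fun k => Re l * Re (u k) + Im l * Im (u k))
      (b := fun k => Cmod l * b k).
    - intros k; apply Rle_trans with (1 := Re_mult_conj_le l (u k)).
      apply Rmult_le_compat_l; auto; lra.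
    - apply is_series_Rplus; apply is_series_Rscal; auto.
    - apply is_series_Rscal; auto. }
  assert (E2 := Cmod_sqr l).
  apply Rmult_le_reg_l with (Cmod l); auto; nra.
Qed.

(** ** Cauchy products *)

Definition conv (u v : nat -> C) (k : nat) : C := Csum (fun i => u i * v (k - i)%nat)%C k.

Fixpoint conv_pow (u : nat -> C) (m : nat) : nat -> C :=
  match m with
  | O => fun k => match k with O => RtoC 1 | _ => RtoC 0 end
  | S m' => conv u (conv_pow u m')
  end.

Lemma conv_ext (u u' v v' : nat -> C) (k : nat) :
  (forall i, (i <= k)%nat -> u i = u' i) -> (forall i, (i <= k)%nat -> v i = v' i) ->
  conv u v k = conv u' v' k.
Proof. intros H1 H2; apply Csum_ext; intros i Hi; rewrite H1, H2; auto; lia. Qed.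

Lemma conv_pow_ext (u u' : nat -> C) (m k : nat) :
  (forall i, (i <= k)%nat -> u i = u' i) -> conv_pow u m k = conv_pow u' m k.
Proof.
  revert k; induction m as [|m IH]; intros k H; simpl; auto.
  apply conv_ext; auto; intros i Hi; apply IH; intros j Hj; apply H; lia.
Qed.

Lemma Csum_scal (c : C) (u : nat -> C) (n : nat) : Csum (fun k => c * u k)%C n = (c * Csum u n)%C.
Proof.
  induction n as [|n IH].
  - apply C_eq; reflexivity.
  - rewrite !Csum_S, IH; ring.
Qed.

Lemma conv_geom (u v : nat -> C) (z : C) (k : nat) :
  conv (fun i => u i * z ^ i)%C (fun i => v i * z ^ i)%C k = (conv u v k * z ^ k)%C.
Proof.
  unfold conv; rewrite Cmult_comm, <- Csum_scal; apply Csum_ext; intros i Hi.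
  replace (z ^ k)%C with (z ^ i * z ^ (k - i))%C by (rewrite <- Cpow_add_r; f_equal; lia).
  ring.
Qed.

Lemma sum_f_R0_triangle (p r : nat -> R) (N : nat) :
  (forall k, 0 <= p k) -> (forall k, 0 <= r k) ->
  sum_f_R0 (fun k => sum_f_R0 (fun i => p i * r (k - i)%nat) k) N
    <= sum_f_R0 p N * sum_f_R0 r N.
Proof.
  intros Hp Hr.
  assert (Hmon : forall i j, (i <= j)%nat -> sum_f_R0 r i <= sum_f_R0 r j).
  { intros i j Hij; induction Hij as [|j Hij IH]; [lra|].
    simpl; specialize (Hr (S j)); lra. }
  assert (E : sum_f_R0 (fun k => sum_f_R0 (fun i => p i * r (k - i)%nat) k) N
     = sum_f_R0 (fun i => p i * sum_f_R0 r (N - i)) N).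
  { induction N as [|N IH].
    - simpl; ring.
    - simpl sum_f_R0 at 1; rewrite IH.
      simpl sum_f_R0 at 4.
      assert (S1 : sum_f_R0 (fun i => p i * sum_f_R0 r (S N - i)) N
        = sum_f_R0 (fun i => p i * sum_f_R0 r (N - i)) N + sum_f_R0 (fun i => p i * r (S N - i)%nat) N).
      { rewrite <- sum_plus; apply sum_eq; intros i Hi.
        replace (S N - i)%nat with (S (N - i)) by lia; simpl; ring. }
      simpl in S1 |- *; rewrite S1, Nat.sub_diag; simpl; ring. }
  rewrite E, Rmult_comm, scal_sum; apply sum_Rle; intros i Hi.
  apply Rmult_le_compat_l; auto; apply Hmon; lia.
Qed.

Lemma sum_Cmod_conv_le (u v : nat -> C) (N : nat) :
  sum_f_R0 (fun k => Cmod (conv u v k)) N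
    <= sum_f_R0 (fun k => Cmod (u k)) N * sum_f_R0 (fun k => Cmod (v k)) N.
Proof.
  eapply Rle_trans; [|apply sum_f_R0_triangle; intros; apply Cmod_ge_0].
  apply sum_Rle; intros k Hk; unfold conv.
  eapply Rle_trans; [apply Cmod_Csum_le|].
  apply sum_Rle; intros i Hi; rewrite Cmod_mult; lra.
Qed.

Lemma sum_Cmod_ge_0 (u : nat -> C) (N : nat) : 0 <= sum_f_R0 (fun k => Cmod (u k)) N.
Proof. apply cond_pos_sum; intros; apply Cmod_ge_0. Qed.

Lemma sum_Cmod_conv_pow_le (u : nat -> C) (m N : nat) :
  sum_f_R0 (fun k => Cmod (conv_pow u m k)) N <= sum_f_R0 (fun k => Cmod (u k)) N ^ m.
Proof.
  induction m as [|m IH].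
  - simpl pow; induction N as [|N IHN]; simpl in *; rewrite ?Cmod_1, ?Cmod_0; lra.
  - simpl; eapply Rle_trans; [apply sum_Cmod_conv_le|].
    apply Rmult_le_compat_l; auto; apply sum_Cmod_ge_0.
Qed.

Lemma Cabs_series_conv (u v : nat -> C) : Cabs_series u -> Cabs_series v -> Cabs_series (conv u v).
Proof.
  intros Hu Hv; apply ex_series_bounded with
    (Series (fun k => Cmod (u k)) * Series (fun k => Cmod (v k))).
  - intros; apply Cmod_ge_0.
  - intros N; eapply Rle_trans; [apply sum_Cmod_conv_le|].
    apply Rmult_le_compat; auto using sum_Cmod_ge_0; apply sum_le_Series; auto;
      intros; apply Cmod_ge_0.
Qed.

Lemma Cis_series_conv (u v : nat -> C) (lu lv : C) : Cabs_series u -> Cabs_series v ->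
  Cis_series u lu -> Cis_series v lv -> Cis_series (conv u v) (lu * lv)%C.
Proof.
  intros Hu Hv [U1 U2] [V1 V2].
  assert (A1 := Cabs_series_Re u Hu); assert (A2 := Cabs_series_Im u Hu).
  assert (B1 := Cabs_series_Re v Hv); assert (B2 := Cabs_series_Im v Hv).
  assert (C1 := is_series_mult _ _ _ _ U1 V1 A1 B1).
  assert (C2 := is_series_mult _ _ _ _ U2 V2 A2 B2).
  assert (C3 := is_series_mult _ _ _ _ U1 V2 A1 B2).
  assert (C4 := is_series_mult _ _ _ _ U2 V1 A2 B1).
  split.
  - eapply is_series_ext; [|exact (is_series_Rminus _ _ _ _ C1 C2)].
    intros k; simpl; rewrite <- minus_sum; apply sum_eq.
    intros; unfold Re, Im; simpl; ring.
  - eapply is_series_ext; [|exact (is_series_Rplus _ _ _ _ C3 C4)].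
    intros k; simpl; rewrite <- sum_plus; apply sum_eq.
    intros; unfold Re, Im; simpl; ring.
Qed.

(** ** Power series and their derivatives *)

(** Absolute convergence in the open disc of radius [R0]. *)
Definition CVin (c : nat -> C) (R0 : R) : Prop :=
  forall r, 0 <= r < R0 -> ex_series (fun k => Cmod (c k) * r ^ k).

Definition PS (c : nat -> C) (z : C) : C := CSeries (fun k => c k * z ^ k)%C.

Lemma CVin_abs (c : nat -> C) (R0 : R) (z : C) : CVin c R0 -> Cmod z < R0 ->
  Cabs_series (fun k => c k * z ^ k)%C.
Proof.
  intros H Hz; apply ex_series_ext_R with (2 := H (Cmod z) (conj (Cmod_ge_0 z) Hz)).
  intros k; rewrite Cmod_mult, Cmod_pow; reflexivity.
Qed.

Lemma PS_correct (c : nat -> C) (R0 : R) (z : C) : CVin c R0 -> Cmod z < R0 ->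
  Cis_series (fun k => c k * z ^ k)%C (PS c z).
Proof. intros H Hz; apply CSeries_correct, (CVin_abs c R0); auto. Qed.

Lemma PS_0 (c : nat -> C) : PS c (RtoC 0) = c 0%nat.
Proof.
  apply Cis_series_unique.
  replace (c 0%nat) with (c 0%nat * RtoC 0 ^ 0 + RtoC 0 * RtoC 0)%C by (simpl; ring).
  apply (Cis_series_incr_1 (fun k => c k * RtoC 0 ^ k)%C).
  replace (RtoC 0 * RtoC 0)%C with (RtoC 0) by ring.
  split; (eapply is_series_ext; [|exact is_series_zero]);
    intros k; unfold Re, Im; simpl; ring.
Qed.

Lemma CVin_conv (u v : nat -> C) (R0 : R) : CVin u R0 -> CVin v R0 -> CVin (conv u v) R0.
Proof.
  intros Hu Hv r Hr.
  assert (Mr : Cmod (RtoC r) < R0) by (rewrite Cmod_RtoC_pos; lra).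
  assert (A := Cabs_series_conv _ _ (CVin_abs u R0 _ Hu Mr) (CVin_abs v R0 _ Hv Mr)).
  apply ex_series_ext_R with (2 := A); intros k.
  rewrite conv_geom, Cmod_mult, Cmod_pow, Cmod_RtoC_pos; lra.
Qed.

Lemma PS_conv (u v : nat -> C) (R0 : R) (z : C) : CVin u R0 -> CVin v R0 -> Cmod z < R0 ->
  PS (conv u v) z = (PS u z * PS v z)%C.
Proof.
  intros Hu Hv Hz; apply Cis_series_unique.
  apply Cis_series_ext with (conv (fun i => u i * z ^ i)%C (fun i => v i * z ^ i)%C).
  - intros k; apply conv_geom.
  - apply Cis_series_conv; try apply CSeries_correct; eapply CVin_abs; eauto.
Qed.

Lemma CVin_conv_pow (u : nat -> C) (R0 : R) (m : nat) : CVin u R0 -> CVin (conv_pow u m) R0.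
Proof.
  intros Hu; induction m as [|m IH]; [|apply CVin_conv; auto].
  intros r Hr; apply ex_series_bounded with 1.
  - intros k; apply Rmult_le_pos; [apply Cmod_ge_0|apply pow_le; lra].
  - intros N; induction N as [|N IHN]; simpl in *; rewrite ?Cmod_1, ?Cmod_0; lra.
Qed.

Lemma PS_conv_pow (u : nat -> C) (R0 : R) (m : nat) (z : C) : CVin u R0 -> Cmod z < R0 ->
  PS (conv_pow u m) z = (PS u z ^ m)%C.
Proof.
  intros Hu Hz; induction m as [|m IH].
  - transitivity (PS (conv_pow u 0) (RtoC 0)); [|rewrite PS_0; reflexivity].
    apply CSeries_ext; intros [|k]; [reflexivity|].
    simpl conv_pow; rewrite !Cmult_0_l; reflexivity.
  - simpl conv_pow; rewrite (PS_conv _ _ R0), IH; auto using CVin_conv_pow.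
Qed.

Lemma CVin_index (c : nat -> C) (R0 : R) : CVin c R0 -> CVin (fun k => RtoC (INR k) * c k)%C R0.
Proof.
  intros H r Hr.
  set (r1 := (r + R0) / 2).
  assert (Hr1 : 0 <= r1 < R0) by (unfold r1; lra).
  set (x := (r1 - r) / R0).
  assert (Hx : 0 < x) by (unfold x; apply Rdiv_lt_0_compat; unfold r1; lra).
  (* Bernoulli: k x <= (1+x)^k, and r (1+x) <= r1 *)
  assert (Hrx : r * (1 + x) <= r1).
  { assert (r * x <= R0 * x) by (apply Rmult_le_compat_r; lra).
    replace (R0 * x) with (r1 - r) in H0 by (unfold x; field; lra); lra. }
  apply ex_series_nonneg_le with (fun k => / x * (Cmod (c k) * r1 ^ k));
    [|apply ex_series_scal_R, H; auto].
  intros k; rewrite Cmod_mult, Cmod_RtoC_pos by apply pos_INR.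
  assert (Hk := pos_INR k); assert (Hc := Cmod_ge_0 (c k)); assert (Hrk : 0 <= r ^ k) by (apply pow_le; lra).
  split; [repeat apply Rmult_le_pos; auto|].
  assert (B := poly k x Hx).
  assert (P : r ^ k * (1 + x) ^ k <= r1 ^ k).
  { rewrite <- Rpow_mult_distr; apply pow_incr; split; auto; apply Rmult_le_pos; lra. }
  apply Rmult_le_reg_l with x; auto.
  replace (x * (/ x * (Cmod (c k) * r1 ^ k))) with (Cmod (c k) * r1 ^ k) by (field; lra).
  replace (x * (INR k * Cmod (c k) * r ^ k)) with (Cmod (c k) * (r ^ k * (INR k * x))) by ring.
  apply Rmult_le_compat_l; auto; apply Rle_trans with (2 := P).
  apply Rmult_le_compat_l; auto; lra.
Qed.

Lemma Cpow_expand_le (z w : C) (r : R) (k : nat) : Cmod z <= r -> Cmod (z + w) <= r ->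
  Cmod ((z + w) ^ k - z ^ k - w * (RtoC (INR k) * z ^ (k - 1))) * r ^ 2
    <= INR k * INR k * Cmod w ^ 2 * r ^ k.
Proof.
  intros Hz Hzw; assert (Hr : 0 <= r) by (apply Rle_trans with (2 := Hz), Cmod_ge_0).
  induction k as [|k IH].
  - simpl; replace (RtoC 1 - RtoC 1 - w * (RtoC 0 * RtoC 1))%C with (RtoC 0) by ring.
    rewrite Cmod_0; lra.
  - set (E := ((z + w) ^ k - z ^ k - w * (RtoC (INR k) * z ^ (k - 1)))%C) in *.
    replace ((z + w) ^ S k - z ^ S k - w * (RtoC (INR (S k)) * z ^ (S k - 1)))%C
      with ((z + w) * E + w * w * (RtoC (INR k) * z ^ (k - 1)))%C.
    2:{ unfold E; rewrite S_INR, RtoC_plus; destruct k as [|k]; simpl; [ring|].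
        replace (k - 0)%nat with k by lia; ring. }
    apply Rle_trans with ((Cmod (z + w) * Cmod E + Cmod w ^ 2 * (INR k * Cmod z ^ (k - 1))) * r ^ 2).
    { apply Rmult_le_compat_r; [apply pow_le; auto|].
      apply Rle_trans with (1 := Cmod_triangle _ _).
      rewrite !Cmod_mult, Cmod_pow, (Cmod_RtoC_pos (INR k)) by apply pos_INR; right; ring. }
    rewrite Rmult_plus_distr_r.
    assert (Hk := pos_INR k); assert (Hw := pow2_ge_0 (Cmod w)).
    assert (Hrk : 0 <= r ^ k) by (apply pow_le; auto).
    assert (A1 : Cmod (z + w) * Cmod E * r ^ 2 <= r * (INR k * INR k * Cmod w ^ 2 * r ^ k)).
    { rewrite Rmult_assoc; apply Rmult_le_compat; auto using Cmod_ge_0.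
      apply Rmult_le_pos; [apply Cmod_ge_0|apply pow_le; auto]. }
    assert (A2 : INR k * Cmod z ^ (k - 1) * r ^ 2 <= INR k * (r * r ^ k)).
    { destruct k as [|k]; [simpl; lra|].
      rewrite Rmult_assoc; apply Rmult_le_compat_l; auto.
      replace (r * r ^ S k) with (r ^ k * r ^ 2) by (simpl; ring).
      replace (S k - 1)%nat with k by lia.
      apply Rmult_le_compat_r; [apply pow_le; auto|].
      apply pow_incr; split; auto; apply Cmod_ge_0. }
    rewrite S_INR; simpl (r ^ S k).
    assert (Hrr : 0 <= r * r ^ k) by (apply Rmult_le_pos; auto).
    assert (A3 := Rmult_le_compat_l _ _ _ Hw A2).
    assert (A4 : 0 <= Cmod w ^ 2 * (r * r ^ k)) by (apply Rmult_le_pos; auto).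
    nra.
Qed.

Lemma CVin_le (c : nat -> C) (R0 R1 : R) : R1 <= R0 -> CVin c R0 -> CVin c R1.
Proof. intros Hle H r Hr; apply H; lra. Qed.

Lemma CVin_succ (c : nat -> C) (R0 : R) : CVin c R0 -> CVin (fun k => c (S k)) R0.
Proof.
  intros H r Hr; set (r1 := (r + R0) / 2).
  assert (Hr1 : 0 < r1 < R0 /\ r <= r1) by (unfold r1; lra).
  assert (A := H r1 ltac:(lra)).
  apply (ex_series_incr_1 (fun k => Cmod (c k) * r1 ^ k)) in A.
  apply ex_series_nonneg_le with (fun k => / r1 * (Cmod (c (S k)) * r1 ^ S k));
    [|apply ex_series_scal_R; exact A].
  intros k; assert (Hc := Cmod_ge_0 (c (S k))).
  assert (0 <= r ^ k <= r1 ^ k) by (split; [apply pow_le|apply pow_incr]; lra).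
  split; [apply Rmult_le_pos; lra|].
  replace (/ r1 * (Cmod (c (S k)) * r1 ^ S k)) with (Cmod (c (S k)) * r1 ^ k)
    by (simpl; field; lra).
  apply Rmult_le_compat_l; lra.
Qed.

Definition dseq (c : nat -> C) (k : nat) : C := (RtoC (INR (S k)) * c (S k))%C.

Lemma CVin_dseq (c : nat -> C) (R0 : R) : CVin c R0 -> CVin (dseq c) R0.
Proof. intros H; apply (CVin_succ (fun k => RtoC (INR k) * c k)%C), CVin_index, H. Qed.

(** The remainder of the monomial of degree [k] is at most [k^2 |w|^2 r^(k-2)], and
    the factors [k^2] do not change the radius of convergence. *)
Lemma PS_Cder (c : nat -> C) (R0 : R) (z : C) : CVin c R0 -> Cmod z < R0 ->
  Cder (PS c) z (PS (dseq c) z).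
Proof.
  intros H Hz; assert (Hz0 := Cmod_ge_0 z).
  set (r := (Cmod z + R0) / 2).
  assert (Hr : Cmod z < r < R0 /\ 0 < r) by (unfold r; lra).
  set (b := fun k => INR k * INR k * Cmod (c k) * r ^ k).
  assert (Hb : ex_series b).
  { assert (A := CVin_index _ _ (CVin_index _ _ H) r ltac:(lra)).
    apply ex_series_ext_R with (2 := A); intros k.
    rewrite !Cmod_mult, !(Cmod_RtoC_pos (INR k)) by apply pos_INR; unfold b; ring. }
  set (M := Series b / r ^ 2).
  assert (Hr2 : 0 < r ^ 2) by (apply pow_lt; lra).
  assert (Hb0 : forall k, 0 <= b k).
  { intros k; unfold b; repeat apply Rmult_le_pos; auto using pos_INR, Cmod_ge_0; apply pow_le; lra. }
  assert (HM : 0 <= M).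
  { unfold M; apply Rmult_le_pos; [|left; apply Rinv_0_lt_compat; auto].
    apply Rle_trans with (2 := sum_le_Series b 0 Hb0 Hb); simpl; auto. }
  intros eps He.
  exists (Rmin (r - Cmod z) (eps / (M + 1))); split.
  { apply Rmin_pos; [lra|apply Rdiv_lt_0_compat; lra]. }
  intros w Hw.
  assert (Hw1 := Rlt_le_trans _ _ _ Hw (Rmin_l _ _)).
  assert (Hw2 := Rlt_le_trans _ _ _ Hw (Rmin_r _ _)).
  assert (Hzw : Cmod (z + w) <= r) by (apply Rle_trans with (1 := Cmod_triangle _ _); lra).
  assert (S1 := PS_correct c R0 (z + w)%C H ltac:(lra)).
  assert (S2 := PS_correct c R0 z H Hz).
  assert (S3 : Cis_series (fun k => RtoC (INR k) * c k * z ^ (k - 1))%C (PS (dseq c) z)).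
  { replace (PS (dseq c) z) with (RtoC (INR 0) * c 0%nat * z ^ (0 - 1) + PS (dseq c) z)%C
      by (simpl; ring).
    apply (Cis_series_incr_1 (fun k => RtoC (INR k) * c k * z ^ (k - 1))%C).
    apply Cis_series_ext with (2 := PS_correct (dseq c) R0 z (CVin_dseq c R0 H) Hz).
    intros k; unfold dseq; replace (S k - 1)%nat with k by lia; reflexivity. }
  assert (S4 := Cis_series_minus _ _ _ _ (Cis_series_minus _ _ _ _ S1 S2) (Cis_series_scal w _ _ S3)).
  apply Rle_trans with (Series (fun k => Cmod w ^ 2 / r ^ 2 * b k)).
  - apply Cmod_series_le with (1 := S4); [|apply ex_series_scal_R; auto].
    intros k.
    replace (c k * (z + w) ^ k - c k * z ^ k - w * (RtoC (INR k) * c k * z ^ (k - 1)))%C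
      with (c k * ((z + w) ^ k - z ^ k - w * (RtoC (INR k) * z ^ (k - 1))))%C by ring.
    rewrite Cmod_mult.
    assert (E := Cpow_expand_le z w r k ltac:(lra) Hzw).
    apply Rmult_le_reg_r with (r ^ 2); auto.
    replace (Cmod w ^ 2 / r ^ 2 * b k * r ^ 2) with (Cmod (c k) * (INR k * INR k * Cmod w ^ 2 * r ^ k))
      by (unfold b; field; lra).
    rewrite Rmult_assoc; apply Rmult_le_compat_l; auto; apply Cmod_ge_0.
  - rewrite Series_scal_l.
    replace (Cmod w ^ 2 / r ^ 2 * Series b) with (M * Cmod w * Cmod w) by (unfold M; field; lra).
    apply Rmult_le_compat_r; [apply Cmod_ge_0|].
    assert (Hw0 := Cmod_ge_0 w).
    apply Rle_trans with ((M + 1) * (eps / (M + 1))); [|right; field; lra].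
    apply Rmult_le_compat; lra.
Qed.

Lemma fst_sum_n (u : nat -> C_NormedModule) (n : nat) :
  fst (sum_n u n) = sum_n (fun k => fst (u k)) n.
Proof.
  induction n as [|n IH]; [rewrite !sum_O; reflexivity|].
  rewrite !sum_Sn, <- IH; reflexivity.
Qed.

Lemma snd_sum_n (u : nat -> C_NormedModule) (n : nat) :
  snd (sum_n u n) = sum_n (fun k => snd (u k)) n.
Proof.
  induction n as [|n IH]; [rewrite !sum_O; reflexivity|].
  rewrite !sum_Sn, <- IH; reflexivity.
Qed.

Lemma pow_n_Cpow (w : C) (k : nat) : pow_n (K := C_Ring) w k = (w ^ k)%C.
Proof.
  induction k as [|k IH]; [reflexivity|].
  simpl; rewrite IH; reflexivity.
Qed.

Lemma is_pseries_iff (c : nat -> C) (w l : C) :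
  is_pseries (K := C_AbsRing) (V := C_NormedModule) c w l
  <-> Cis_series (fun k => c k * w ^ k)%C l.
Proof.
  assert (E : forall k, scal (pow_n (K := C_AbsRing) w k) (c k : C_NormedModule) = (c k * w ^ k)%C).
  { intros k; transitivity (pow_n (K := C_Ring) w k * c k)%C; [reflexivity|].
    rewrite pow_n_Cpow; apply Cmult_comm. }
  unfold is_pseries, is_series; split.
  - intros H; split.
    + apply filterlim_ext with (fun n => fst (sum_n (fun k =>
        scal (pow_n (K := C_AbsRing) w k) (c k : C_NormedModule)) n)).
      { intros n; rewrite fst_sum_n; apply sum_n_ext; intros k; rewrite E; reflexivity. }
      apply filterlim_locally; intros eps.
      destruct (proj1 (filterlim_locally _ _) H eps) as [N HN].
      exists N; intros n Hn; apply (HN n Hn).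
    + apply filterlim_ext with (fun n => snd (sum_n (fun k =>
        scal (pow_n (K := C_AbsRing) w k) (c k : C_NormedModule)) n)).
      { intros n; rewrite snd_sum_n; apply sum_n_ext; intros k; rewrite E; reflexivity. }
      apply filterlim_locally; intros eps.
      destruct (proj1 (filterlim_locally _ _) H eps) as [N HN].
      exists N; intros n Hn; apply (HN n Hn).
  - intros [H1 H2]; apply filterlim_locally; intros eps.
    destruct (proj1 (filterlim_locally _ _) H1 eps) as [N1 HN1].
    destruct (proj1 (filterlim_locally _ _) H2 eps) as [N2 HN2].
    exists (max N1 N2); intros n Hn.
    specialize (HN1 n ltac:(lia)); specialize (HN2 n ltac:(lia)).
    split.
    + rewrite fst_sum_n.
      rewrite (sum_n_ext _ (fun k => Re (c k * w ^ k)%C)); auto.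
      intros k; rewrite E; reflexivity.
    + rewrite snd_sum_n.
      rewrite (sum_n_ext _ (fun k => Im (c k * w ^ k)%C)); auto.
      intros k; rewrite E; reflexivity.
Qed.

Lemma analytic_at_PS (f : C -> C) (z0 : C) (c : nat -> C) (R0 : R) : 0 < R0 -> CVin c R0 ->
  (forall w, Cmod (w - z0) < R0 -> f w = PS c (w - z0)%C) -> analytic_at f z0.
Proof.
  intros HR Hc Hf; exists c, R0; split; auto.
  intros w Hw; apply is_pseries_iff; rewrite Hf by auto.
  apply PS_correct with R0; auto.
Qed.

Lemma analytic_at_bounded (g : C -> C) (z : C) : analytic_at g z ->
  exists M eps, 0 < eps /\ forall w, Cmod (w - z) < eps -> Cmod (g w) <= M.
Proof.
  intros [c [eps [He H]]]; set (r := eps / 2).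
  assert (Hr : 0 < r < eps) by (unfold r; lra).
  assert (E1 : (z + RtoC r - z)%C = RtoC r) by ring.
  assert (H1 := H (z + RtoC r)%C); rewrite E1, Cmod_RtoC_pos in H1 by lra.
  specialize (H1 (proj2 Hr)); apply is_pseries_iff in H1; destruct H1 as [A B].
  assert (BD : forall a l, is_series a l -> exists M, forall k : nat, Rabs (a k) <= M).
  { intros a l Hs; assert (L : ex_series a) by (exists l; exact Hs).
    apply ex_series_lim_0 in L.
    destruct (filterlim_bounded a) as [M HM]; [exists 0; exact L|].
    exists M; exact HM. }
  destruct (BD _ _ A) as [M1 HM1]; destruct (BD _ _ B) as [M2 HM2].
  exists (Series (fun k => (M1 + M2) * (/ 2) ^ k)), (r / 2); split; [lra|].
  intros w Hw; assert (Hw' : Cmod (w - z) < eps) by lra.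
  specialize (H w Hw'); apply is_pseries_iff in H.
  apply Cmod_series_le with (1 := H).
  - intros k.
    assert (T : Cmod (c k) * r ^ k <= M1 + M2).
    { rewrite <- (Cmod_RtoC_pos r) at 1 by lra; rewrite <- Cmod_pow, <- Cmod_mult.
      apply Rle_trans with (1 := Cmod_le_Re_Im _), Rplus_le_compat; auto. }
    rewrite Cmod_mult, Cmod_pow.
    apply Rle_trans with (Cmod (c k) * (r * / 2) ^ k).
    + apply Rmult_le_compat_l; [apply Cmod_ge_0|].
      apply pow_incr; split; [apply Cmod_ge_0|lra].
    + rewrite Rpow_mult_distr, <- Rmult_assoc.
      apply Rmult_le_compat_r; auto; apply pow_le; lra.
  - apply ex_series_scal_R, ex_series_geom; rewrite Rabs_pos_eq; lra.
Qed.

(** * Power series solutions and their real majorants *)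

Lemma PS_scal (k : C) (c : nat -> C) (R0 : R) (z : C) : CVin c R0 -> Cmod z < R0 ->
  PS (fun i => k * c i)%C z = (k * PS c z)%C.
Proof.
  intros H Hz; apply Cis_series_unique.
  apply Cis_series_ext with (2 := Cis_series_scal k _ _ (PS_correct c R0 z H Hz)).
  intros i; ring.
Qed.

Lemma PS_ext (c d : nat -> C) (z : C) : (forall k, c k = d k) -> PS c z = PS d z.
Proof. intros H; apply CSeries_ext; intros k; rewrite H; reflexivity. Qed.

Lemma is_derive_cst (c t : R) : is_derive (fun _ => c) t 0.
Proof. apply is_derive_Reals, (derivable_pt_lim_const c). Qed.

Lemma is_derive_monomial (c t : R) (k : nat) :
  is_derive (fun x => c * x ^ S k) t (INR (S k) * c * t ^ k).
Proof.
  apply is_derive_eq with (c * (INR (S k) * t ^ k)); [|ring].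
  apply is_derive_scal, is_derive_Reals, derivable_pt_lim_pow.
Qed.

Lemma is_derive_poly (c : nat -> R) (N : nat) (t : R) :
  is_derive (fun x => sum_f_R0 (fun k => c k * x ^ k) (S N)) t
    (sum_f_R0 (fun k => INR (S k) * c (S k) * t ^ k) N).
Proof.
  induction N as [|N IH].
  - apply is_derive_eq with (0 + INR 1 * c 1%nat * t ^ 0); [|apply Rplus_0_l].
    apply (is_derive_Rplus (fun x => c 0%nat * x ^ 0) (fun x => c 1%nat * x ^ 1));
      [|apply is_derive_monomial].
    apply (is_derive_cst (c 0%nat * 1)).
  - apply (is_derive_Rplus (fun x => sum_f_R0 (fun k => c k * x ^ k) (S N))
      (fun x => c (S (S N)) * x ^ S (S N))); [exact IH|apply is_derive_monomial].
Qed.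

Section LocalSolution.

Variables (ca cb : R) (m n : nat).

Section Coefficients.

Variables x0 y0 : C.

(** The [N]-th iterate has the right coefficients up to index [N]. *)
Fixpoint picard (N : nat) : (nat -> C) * (nat -> C) :=
  match N with
  | O => (fun _ => x0, fun _ => y0)
  | S N' =>
      (fun k => match k with
                | O => x0
                | S j => RtoC (ca / INR (S j)) * conv_pow (snd (picard N')) m j
                end,
       fun k => match k with
                | O => y0
                | S j => RtoC (cb / INR (S j)) * conv_pow (fst (picard N')) n j
                end)%C
  end.

Definition sx (k : nat) : C := fst (picard k) k.
Definition sy (k : nat) : C := snd (picard k) k.

Lemma picard_stable (N k : nat) : (k <= N)%nat ->
  fst (picard (S N)) k = fst (picard N) k /\ snd (picard (S N)) k = snd (picard N) k.
Proof.
  revert k; induction N as [|N IH]; intros k Hk.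
  - replace k with 0%nat by lia; auto.
  - destruct k as [|j]; [auto|].
    split; simpl; f_equal; apply conv_pow_ext; intros i Hi; apply (IH i); lia.
Qed.

Lemma picard_coeff (N k : nat) : (k <= N)%nat ->
  fst (picard N) k = sx k /\ snd (picard N) k = sy k.
Proof.
  intros H; induction H as [|N H IH]; [split; reflexivity|].
  destruct (picard_stable N k H) as [E1 E2]; rewrite E1, E2; auto.
Qed.

Lemma sx_S (j : nat) : dseq sx j = (RtoC ca * conv_pow sy m j)%C.
Proof.
  unfold dseq; unfold sx at 1; cbn [picard fst].
  rewrite (conv_pow_ext _ sy).
  - rewrite Cmult_assoc, <- RtoC_mult.
    replace (INR (S j) * (ca / INR (S j)))%R with ca; [reflexivity|].
    field; apply not_0_INR; lia.
  - intros i Hi; apply picard_coeff; auto.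
Qed.

Lemma sy_S (j : nat) : dseq sy j = (RtoC cb * conv_pow sx n j)%C.
Proof.
  unfold dseq; unfold sy at 1; cbn [picard snd].
  rewrite (conv_pow_ext _ sx).
  - rewrite Cmult_assoc, <- RtoC_mult.
    replace (INR (S j) * (cb / INR (S j)))%R with cb; [reflexivity|].
    field; apply not_0_INR; lia.
  - intros i Hi; apply picard_coeff; auto.
Qed.

Lemma PS_Csolves (R0 : R) (z : C) : CVin sx R0 -> CVin sy R0 -> Cmod z < R0 ->
  Csolves ca cb m n (PS sx) (PS sy) z.
Proof.
  intros Hx Hy Hz; split.
  - replace (RtoC ca * PS sy z ^ m)%C with (PS (dseq sx) z); [apply PS_Cder with R0; auto|].
    rewrite (PS_ext _ _ z sx_S), (PS_scal _ _ R0), (PS_conv_pow _ R0); auto.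
    apply CVin_conv_pow; auto.
  - replace (RtoC cb * PS sx z ^ n)%C with (PS (dseq sy) z); [apply PS_Cder with R0; auto|].
    rewrite (PS_ext _ _ z sy_S), (PS_scal _ _ R0), (PS_conv_pow _ R0); auto.
    apply CVin_conv_pow; auto.
Qed.

End Coefficients.

(** A real solution of the system, with its independent variable [J] given as a
    function of a parameter in [0, 1). *)
Definition real_curve (J dJ X Y : R -> R) : Prop :=
  forall t, 0 <= t < 1 ->
    0 <= dJ t /\ 0 <= X t /\ 0 <= Y t /\
    is_derive J t (dJ t) /\
    is_derive X t (ca * Y t ^ m * dJ t) /\ is_derive Y t (cb * X t ^ n * dJ t).

Lemma sum_conv_pow_weight (y : nat -> C) (k N : nat) (tau : R) : 0 <= tau ->
  sum_f_R0 (fun j => Cmod (conv_pow y k j) * tau ^ j) N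
    <= sum_f_R0 (fun j => Cmod (y j) * tau ^ j) N ^ k.
Proof.
  intros Ht.
  assert (E : forall j, conv_pow (fun i => y i * RtoC tau ^ i)%C k j = (conv_pow y k j * RtoC tau ^ j)%C).
  { induction k as [|k IH]; intros j.
    - destruct j; simpl; ring.
    - simpl; rewrite <- conv_geom; apply conv_ext; auto. }
  assert (W : forall (u : nat -> C) j, Cmod (u j * RtoC tau ^ j) = Cmod (u j) * tau ^ j).
  { intros u j; rewrite Cmod_mult, Cmod_pow, Cmod_RtoC_pos; auto. }
  assert (H := sum_Cmod_conv_pow_le (fun i => y i * RtoC tau ^ i)%C k N).
  rewrite (sum_eq _ (fun j => Cmod (conv_pow y k j) * tau ^ j)) in H
    by (intros i _; rewrite E, W; auto).
  rewrite (sum_eq (fun j => Cmod (y j * RtoC tau ^ j)) (fun j => Cmod (y j) * tau ^ j)) in H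
    by (intros i _; rewrite W; auto).
  exact H.
Qed.

Lemma partial_sum_step (c : nat -> R) (u : nat -> C) (k N : nat) (J dJ X Y : R -> R) (al t0 t : R) :
  0 <= al -> t0 <= t ->
  (forall i, INR (S i) * c (S i) = al * Cmod (conv_pow u k i)) ->
  c 0%nat <= X t0 ->
  (forall v, t0 <= v <= t -> 0 <= dJ v /\ J t0 <= J v /\
     is_derive J v (dJ v) /\ is_derive X v (al * Y v ^ k * dJ v) /\
     sum_f_R0 (fun j => Cmod (u j) * (J v - J t0) ^ j) N <= Y v) ->
  sum_f_R0 (fun j => c j * (J t - J t0) ^ j) (S N) <= X t.
Proof.
  intros Hal Htt Hc H0 HY.
  set (p := fun x => sum_f_R0 (fun j => c j * x ^ j) (S N)).
  set (p' := fun x => sum_f_R0 (fun j => INR (S j) * c (S j) * x ^ j) N).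
  assert (B : X t0 - p (J t0 - J t0) <= X t - p (J t - J t0)).
  { apply (is_derive_incr (fun v => X v - p (J v - J t0))
      (fun v => al * Y v ^ k * dJ v - p' (J v - J t0) * dJ v)); auto.
    - intros v Hv; destruct (HY v Hv) as [_ [_ [D1 [D2 _]]]].
      apply is_derive_Rminus; auto.
      apply (is_derive_Rcomp p (fun v => J v - J t0)); [apply is_derive_poly|].
      apply is_derive_eq with (dJ v - 0); [|ring].
      apply is_derive_Rminus; auto; apply is_derive_cst.
    - intros v Hv; destruct (HY v Hv) as [D0 [D1 [_ [_ D2]]]].
      assert (E : p' (J v - J t0) = al * sum_f_R0 (fun j => Cmod (conv_pow u k j) * (J v - J t0) ^ j) N).
      { unfold p'; rewrite scal_sum; apply sum_eq; intros i _; rewrite Hc; ring. }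
      assert (L := sum_conv_pow_weight u k N (J v - J t0) ltac:(lra)).
      assert (L2 : sum_f_R0 (fun j => Cmod (u j) * (J v - J t0) ^ j) N ^ k <= Y v ^ k).
      { apply pow_incr; split; auto; apply cond_pos_sum; intros i.
        apply Rmult_le_pos; [apply Cmod_ge_0|apply pow_le; lra]. }
      rewrite E.
      assert (al * sum_f_R0 (fun j => Cmod (conv_pow u k j) * (J v - J t0) ^ j) N <= al * Y v ^ k)
        by (apply Rmult_le_compat_l; auto; lra).
      assert (0 <= (al * Y v ^ k - al * sum_f_R0 (fun j => Cmod (conv_pow u k j) * (J v - J t0) ^ j) N) * dJ v)
        by (apply Rmult_le_pos; lra).
      lra. }
  assert (E0 : p (J t0 - J t0) = c 0%nat).
  { unfold p; rewrite Rminus_diag_eq by reflexivity; clear.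
    induction (S N) as [|M IH]; simpl; [ring|rewrite IH; ring]. }
  rewrite E0 in B; unfold p in B; lra.
Qed.

Hypotheses (ca_pos : 0 <= ca) (cb_pos : 0 <= cb).

(** Partial sums with the moduli of the coefficients stay below the real
    solution: by induction on the number of terms, because the derivative of one
    partial sum is at most the vector field evaluated at the previous ones. *)
Lemma partial_sums_le (x0 y0 : C) (J dJ X Y : R -> R) (t0 : R) :
  real_curve J dJ X Y -> 0 <= t0 -> Cmod x0 <= X t0 -> Cmod y0 <= Y t0 ->
  forall N t, t0 <= t < 1 ->
    sum_f_R0 (fun k => Cmod (sx x0 y0 k) * (J t - J t0) ^ k) N <= X t /\
    sum_f_R0 (fun k => Cmod (sy x0 y0 k) * (J t - J t0) ^ k) N <= Y t.
Proof.
  intros HC Ht0 Hx Hy.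
  assert (HJ : forall t, t0 <= t < 1 -> J t0 <= J t).
  { intros t Ht; apply is_derive_incr with dJ; try lra; intros v Hv;
      destruct (HC v ltac:(lra)) as [? [? [? [? ?]]]]; auto. }
  assert (Mc : forall (c : nat -> C) be i z, 0 <= be -> dseq c i = (RtoC be * z)%C ->
     INR (S i) * Cmod (c (S i)) = be * Cmod z).
  { intros c be i z Hb E; unfold dseq in E; apply (f_equal Cmod) in E.
    rewrite !Cmod_mult, !Cmod_RtoC_pos in E by auto using pos_INR; exact E. }
  intros N; induction N as [|N IH]; intros t Ht.
  - simpl; rewrite !Rmult_1_r; split.
    + apply Rle_trans with (1 := Hx), (is_derive_incr X (fun v => ca * Y v ^ m * dJ v)); [lra| |];
        intros v Hv; destruct (HC v ltac:(lra)) as [? [? [? [? [? ?]]]]]; auto.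
      repeat apply Rmult_le_pos; auto; apply pow_le; auto.
    + apply Rle_trans with (1 := Hy), (is_derive_incr Y (fun v => cb * X v ^ n * dJ v)); [lra| |];
        intros v Hv; destruct (HC v ltac:(lra)) as [? [? [? [? [? ?]]]]]; auto.
      repeat apply Rmult_le_pos; auto; apply pow_le; auto.
  - split.
    + apply (partial_sum_step (fun k => Cmod (sx x0 y0 k)) (sy x0 y0) m N J dJ X Y ca); auto; try lra.
      * intros i; apply Mc; auto; apply sx_S.
      * intros v Hv; destruct (HC v ltac:(lra)) as [? [? [? [? [? ?]]]]].
        refine (conj _ (conj _ (conj _ (conj _ _)))); auto; [apply HJ|apply IH]; lra.
    + apply (partial_sum_step (fun k => Cmod (sy x0 y0 k)) (sx x0 y0) n N J dJ Y X cb); auto; try lra.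
      * intros i; apply Mc; auto; apply sy_S.
      * intros v Hv; destruct (HC v ltac:(lra)) as [? [? [? [? [? ?]]]]].
        refine (conj _ (conj _ (conj _ (conj _ _)))); auto; [apply HJ|apply IH]; lra.
Qed.

(** The radius of convergence is at least the time for which the majorant still
    exists. *)
Lemma sx_sy_CVin (x0 y0 : C) (J dJ X Y : R -> R) (t0 R1 : R) :
  real_curve J dJ X Y -> 0 <= t0 -> Cmod x0 <= X t0 -> Cmod y0 <= Y t0 ->
  (forall r, 0 <= r < R1 -> exists t, t0 <= t < 1 /\ r <= J t - J t0) ->
  CVin (sx x0 y0) R1 /\ CVin (sy x0 y0) R1.
Proof.
  intros HC Ht0 Hx Hy HR.
  assert (B := partial_sums_le x0 y0 J dJ X Y t0 HC Ht0 Hx Hy).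
  assert (G : forall (c : nat -> C) r s M, 0 <= r <= s ->
    (forall N, sum_f_R0 (fun k => Cmod (c k) * s ^ k) N <= M) ->
    ex_series (fun k => Cmod (c k) * r ^ k)).
  { intros c r s M Hr HM; apply ex_series_bounded with M.
    - intros k; apply Rmult_le_pos; [apply Cmod_ge_0|apply pow_le; lra].
    - intros N; apply Rle_trans with (2 := HM N), sum_Rle; intros k _.
      apply Rmult_le_compat_l; [apply Cmod_ge_0|apply pow_incr; lra]. }
  split; intros r Hr; destruct (HR r Hr) as [t [Ht Hrt]].
  - apply (G _ r (J t - J t0) (X t)); [lra|]; intros N; apply B; auto.
  - apply (G _ r (J t - J t0) (Y t)); [lra|]; intros N; apply B; auto.
Qed.

End LocalSolution.

(** * The integrand and the explicit solution along rays *)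

Definition CInt (f : R -> C) (x y : R) : C :=
  (RInt (fun t => Re (f t)) x y, RInt (fun t => Im (f t)) x y).

Definition Ccont (f : R -> C) (t : R) : Prop :=
  continuous (fun x => Re (f x)) t /\ continuous (fun x => Im (f x)) t.

Lemma Pder_Ccont (f : R -> C) (t : R) (d : C) : Pder f t d -> Ccont f t.
Proof. intros H; split; [eapply Pder_continuous_Re|eapply Pder_continuous_Im]; exact H. Qed.

Lemma ex_RInt_cont (f : R -> R) (x y : R) : x <= y ->
  (forall t, x <= t <= y -> continuous f t) -> ex_RInt f x y.
Proof.
  intros Hxy Hc; apply (ex_RInt_continuous (V := R_CompleteNormedModule)).
  intros t; rewrite Rmin_left, Rmax_right by auto; apply Hc.
Qed.

Lemma CInt_point (f : R -> C) (x : R) : CInt f x x = RtoC 0.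
Proof. apply C_eq; apply (RInt_point (V := R_CompleteNormedModule)). Qed.

Lemma is_derive_RInt_open (f : R -> R) (x0 lo hi t : R) : lo < x0 < hi -> lo < t < hi ->
  (forall v, lo < v < hi -> continuous f v) ->
  is_derive (fun x => RInt f x0 x) t (f t).
Proof.
  intros H0 Ht Hc; apply (is_derive_RInt f (fun x => RInt f x0 x) x0 t).
  - exists (mkposreal (Rmin (t - lo) (hi - t)) ltac:(apply Rmin_pos; lra)).
    intros y Hy; apply (RInt_correct (V := R_CompleteNormedModule)).
    apply (ex_RInt_continuous (V := R_CompleteNormedModule)).
    intros z Hz; apply Hc.
    assert (Hy' : Rabs (y - t) < Rmin (t - lo) (hi - t)) by exact Hy.
    assert (A := Rlt_le_trans _ _ _ Hy' (Rmin_l _ _)).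
    assert (B := Rlt_le_trans _ _ _ Hy' (Rmin_r _ _)).
    apply Rabs_def2 in A; apply Rabs_def2 in B.
    destruct Hz as [Hz1 Hz2]; split.
    + apply Rlt_le_trans with (2 := Hz1); apply Rmin_glb_lt; lra.
    + apply Rle_lt_trans with (1 := Hz2); apply Rmax_lub_lt; lra.
  - apply Hc; auto.
Qed.

Lemma CInt_Pder (f : R -> C) (x0 lo hi t : R) : lo < x0 < hi -> lo < t < hi ->
  (forall v, lo < v < hi -> Ccont f v) -> Pder (fun x => CInt f x0 x) t (f t).
Proof.
  intros H0 Ht Hc; split.
  - apply (is_derive_RInt_open (fun x => Re (f x)) x0 lo hi); auto; intros v Hv; apply (Hc v Hv).
  - apply (is_derive_RInt_open (fun x => Im (f x)) x0 lo hi); auto; intros v Hv; apply (Hc v Hv).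
Qed.

(** ** The algebra of the root [delta] *)

(** The divisibility conditions of a tenable urn: [h] is the common value of
    [a p] and [b q]. Exchanging the two colours gives again such data. *)
Class urn (a b h p q : nat) : Prop := {
  urn_a : (0 < a)%nat;
  urn_b : (0 < b)%nat;
  urn_ab : (a + b < h)%nat;
  urn_p : h = (a * p)%nat;
  urn_q : h = (b * q)%nat }.

#[global] Instance urn_swap (a b h p q : nat) (U : urn a b h p q) : urn b a h q p | 10.
Proof. destruct U; split; auto; lia. Qed.

(** The points where the principal determination of [delta] is analytic. *)
Definition regular (h : nat) (u : C) : Prop := slit (RtoC 1 - u ^ h)%C.

(** [xi] is the right-hand side of the implicit equation, and [eta] its companion:
    both solve the autonomous system when the integral is the variable. *)
Definition xi (a h : nat) (u : C) : C := (u ^ a / delta h u ^ a)%C.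
Definition eta (b h : nat) (u : C) : C := (/ delta h u ^ b)%C.

Definition integrand (a b h : nat) (u : C) : C :=
  (u ^ (a - 1) / delta h u ^ (a + b))%C.

Definition dintegrand (a b h : nat) (u : C) : C :=
  (RtoC (INR (a - 1)) * u ^ (a - 1 - 1) / delta h u ^ (a + b)
   + u ^ (a - 1) * (RtoC (INR (a + b)) * u ^ (h - 1) / (delta h u ^ h * delta h u ^ (a + b))))%C.

Definition ray_integrand (a b h : nat) (u : C) (x : R) : C :=
  (u * integrand a b h (RtoC x * u))%C.

(** The integral of the integrand from 0 to [x u]. *)
Definition ray_int (a b h : nat) (u : C) (x : R) : C := CInt (ray_integrand a b h u) 0 x.

Section Integrand.

Context {a b h p q : nat} {U : urn a b h p q}.

Let Ha : (0 < a)%nat. Proof. apply U. Qed.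
Let Hb : (0 < b)%nat. Proof. apply U. Qed.
Let Hab : (a + b < h)%nat. Proof. apply U. Qed.

Local Notation regular := (regular h).
Local Notation xi := (xi a h).
Local Notation eta := (eta b h).
Local Notation integrand := (integrand a b h).
Local Notation dintegrand := (dintegrand a b h).
Local Notation ray_integrand := (ray_integrand a b h).
Local Notation ray_int := (ray_int a b h).

Lemma INR_h_pos : 0 < INR h.
Proof. apply lt_0_INR; lia. Qed.

Lemma one_minus_neq0 (u : C) : regular u -> (RtoC 1 - u ^ h)%C <> RtoC 0.
Proof. apply slit_neq0. Qed.

Lemma delta_neq0 (u : C) : regular u -> delta h u <> RtoC 0.
Proof. intros H; apply Cpowr_neq0, one_minus_neq0; auto. Qed.

Lemma delta_pow (u : C) : regular u -> (delta h u ^ h)%C = (RtoC 1 - u ^ h)%C.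
Proof. intros H; apply Cpowr_root_pow; [lia|apply one_minus_neq0; auto]. Qed.

Lemma Pder_delta (g : R -> C) (t : R) (e : C) : Pder g t e -> regular (g t) ->
  Pder (fun x => delta h (g x)) t
    (- (g t ^ (h - 1) * delta h (g t) / delta h (g t) ^ h) * e)%C.
Proof.
  intros Hg Hr.
  assert (D1 := Pder_minus _ _ _ _ _ (Pder_const (RtoC 1) t) (Pder_pow g t e h Hg)).
  apply Pder_eq with (1 := Pder_Cpowr _ t _ (1 / INR h) D1 Hr).
  fold (delta h (g t)); rewrite <- delta_pow by auto.
  assert (Hh := INR_h_pos).
  replace (RtoC (1 / INR h)) with (/ RtoC (INR h))%C.
  2:{ unfold Rdiv; rewrite Rmult_1_l, RtoC_inv; auto; lra. }
  field; split.
  - apply Cpow_nz, delta_neq0; auto.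
  - apply RtoC_neq0; lra.
Qed.

Lemma Pder_Cinv (f : R -> C) (t : R) (d : C) : Pder f t d -> f t <> RtoC 0 ->
  Pder (fun x => / f x)%C t (- d / (f t * f t))%C.
Proof.
  intros [H1 H2] Hz.
  assert (Hm : 0 < Re (f t) ^ 2 + Im (f t) ^ 2).
  { rewrite <- Cmod_sqr; apply pow_lt, Cmod_gt_0; auto. }
  assert (Hs : is_derive (fun x => Re (f x) ^ 2 + Im (f x) ^ 2) t
    (2 * Re (f t) * Re d + 2 * Im (f t) * Im d)).
  { apply is_derive_ext with (fun x => Re (f x) * Re (f x) + Im (f x) * Im (f x)).
    - intros x; unfold pow; rewrite !Rmult_1_r; reflexivity.
    - apply is_derive_eq with (1 := is_derive_Rplus _ _ _ _ _
        (is_derive_Rmult _ _ _ _ _ H1 H1) (is_derive_Rmult _ _ _ _ _ H2 H2)); ring. }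
  assert (Hi := is_derive_inv _ _ _ Hs (Rgt_not_eq _ _ Hm)).
  split.
  - apply is_derive_ext with (fun x => Re (f x) * / (Re (f x) ^ 2 + Im (f x) ^ 2)).
    + intros x; reflexivity.
    + apply is_derive_eq with (1 := is_derive_Rmult _ _ _ _ _ H1 Hi).
      simpl; unfold Re, Im in *; field; nra.
  - apply is_derive_ext with (fun x => - Im (f x) * / (Re (f x) ^ 2 + Im (f x) ^ 2)).
    + intros x; reflexivity.
    + apply is_derive_eq with (1 := is_derive_Rmult _ _ _ _ _ (is_derive_opp _ _ _ H2) Hi).
      simpl; unfold Re, Im, opp in *; simpl; field; nra.
Qed.

Lemma Cpow_pred (z : C) (k : nat) : (0 < k)%nat -> (z * z ^ (k - 1))%C = (z ^ k)%C.
Proof. intros Hk; rewrite <- Cpow_S; f_equal; lia. Qed.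

Lemma Pder_inv_delta_pow (g : R -> C) (t : R) (e : C) (k : nat) : Pder g t e -> regular (g t) ->
  Pder (fun x => / delta h (g x) ^ k)%C t
    (RtoC (INR k) * g t ^ (h - 1) / (delta h (g t) ^ h * delta h (g t) ^ k) * e)%C.
Proof.
  intros Hg Hr; assert (Hd := delta_neq0 _ Hr).
  apply Pder_eq with (1 := Pder_Cinv _ _ _ (Pder_pow _ _ _ k (Pder_delta g t e Hg Hr)) (Cpow_nz _ k Hd)).
  destruct k as [|k].
  - simpl; field; apply Cpow_nz; auto.
  - rewrite <- (Cpow_pred (delta h (g t)) (S k)) by lia.
    field; repeat split; auto; apply Cpow_nz; auto.
Qed.

Lemma Pder_eta (g : R -> C) (t : R) (e : C) : Pder g t e -> regular (g t) ->
  Pder (fun x => eta (g x)) t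
    (RtoC (INR b) * g t ^ (h - 1) / (delta h (g t) ^ h * delta h (g t) ^ b) * e)%C.
Proof. apply Pder_inv_delta_pow. Qed.

Lemma Pder_xi (g : R -> C) (t : R) (e : C) : Pder g t e -> regular (g t) ->
  Pder (fun x => xi (g x)) t
    (RtoC (INR a) * g t ^ (a - 1) / (delta h (g t) ^ h * delta h (g t) ^ a) * e)%C.
Proof.
  intros Hg Hr; assert (Hd := delta_neq0 _ Hr).
  apply Pder_eq with (1 := Pder_mult _ _ _ _ _ (Pder_pow g t e a Hg) (Pder_inv_delta_pow g t e a Hg Hr)).
  rewrite <- (Cpow_pred (g t) a) by auto.
  assert (E : (RtoC 1 = delta h (g t) ^ h + g t * g t ^ (h - 1))%C).
  { rewrite delta_pow, Cpow_pred by (auto; lia); ring. }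
  transitivity (RtoC (INR a) * g t ^ (a - 1) * (delta h (g t) ^ h + g t * g t ^ (h - 1))
    / (delta h (g t) ^ h * delta h (g t) ^ a) * e)%C.
  - field; split; apply Cpow_nz; auto.
  - rewrite <- E; field; split; apply Cpow_nz; auto.
Qed.

Lemma Pder_integrand (g : R -> C) (t : R) (e : C) : Pder g t e -> regular (g t) ->
  Pder (fun x => integrand (g x)) t (dintegrand (g t) * e)%C.
Proof.
  intros Hg Hr; assert (Hd := delta_neq0 _ Hr).
  apply Pder_eq with (1 := Pder_mult _ _ _ _ _ (Pder_pow g t e (a - 1) Hg)
    (Pder_inv_delta_pow g t e (a + b) Hg Hr)).
  unfold dintegrand; field; split; apply Cpow_nz; auto.
Qed.

Lemma regular_ray (u : C) (x : R) : regular u -> 0 <= x <= 1 -> regular (RtoC x * u).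
Proof.
  unfold regular; intros H Hx; apply slit_iff; apply slit_iff in H; intros [H1 H2]; apply H.
  rewrite Cpow_mult_l, <- RtoC_pow in H1, H2; simpl in H1, H2; unfold Re, Im in *; simpl in *.
  assert (Hk : 0 <= x ^ h <= 1) by (split; [apply pow_le|rewrite <- (pow1 h); apply pow_incr]; lra).
  set (k := x ^ h) in *; set (v := snd (u ^ h)%C) in *; set (w := fst (u ^ h)%C) in *.
  assert (0 < k) by (destruct (Req_dec k 0) as [E|E]; [rewrite E in *|]; lra).
  assert (Ev : k * v = 0) by lra; assert (Ew : 1 <= k * w) by lra.
  apply Rmult_integral in Ev; destruct (Rle_lt_dec w 0) as [L|L]; [nra|].
  assert (0 <= (1 - k) * w) by (apply Rmult_le_pos; lra).
  split; lra.
Qed.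

Lemma regular_unit (u : C) : Cmod u < 1 -> regular u.
Proof.
  intros H; apply Re_pos_slit; simpl.
  assert (P : Cmod (u ^ h) < 1).
  { rewrite Cmod_pow; apply pow_lt_1_compat; [split; [apply Cmod_ge_0|auto]|lia]. }
  generalize (re_le_Cmod (u ^ h)); intros R; apply Rabs_le_between in R; unfold Re in *; lra.
Qed.

Lemma regular_open_ray (u : C) (x : R) : regular (RtoC x * u) ->
  exists eps, 0 < eps /\ forall y, Rabs (y - x) < eps -> regular (RtoC y * u).
Proof.
  intros H.
  assert (D : Pder (fun y => (RtoC 1 - (RtoC y * u) ^ h)%C) x
    (RtoC 0 - RtoC (INR h) * (RtoC x * u) ^ (h - 1) * u)%C).
  { apply Pder_minus; [apply Pder_const|apply Pder_pow].
    apply Pder_eq with (1 := Pder_mult _ _ _ _ _ (Pder_id x) (Pder_const u x)); ring. }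
  assert (Dm := is_derive_Cmod _ _ _ D (slit_neq0 _ H)).
  assert (Ds := is_derive_Rplus _ _ _ _ _ Dm (proj1 D)).
  assert (Hc : continuous (fun y => Cmod (RtoC 1 - (RtoC y * u) ^ h) + Re (RtoC 1 - (RtoC y * u) ^ h)%C) x).
  { apply (ex_derive_continuous (fun y => Cmod (RtoC 1 - (RtoC y * u) ^ h) + Re (RtoC 1 - (RtoC y * u) ^ h)%C)).
    eexists; exact Ds. }
  destruct (Hc (fun y => 0 < y)) as [eps He]; [apply open_gt; exact H|].
  exists eps; split; [apply cond_pos|]; intros y Hy; apply He, Hy.
Qed.

Lemma regular_ray_ext (u : C) : regular u ->
  exists eps, 0 < eps /\ forall y, - eps < y < 1 + eps -> regular (RtoC y * u).
Proof.
  intros H.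
  destruct (regular_open_ray u 1) as [e1 [He1 K1]]; [rewrite Cmult_1_l; auto|].
  destruct (regular_open_ray u 0) as [e2 [He2 K2]].
  { apply regular_unit; rewrite Cmult_0_l, Cmod_0; lra. }
  exists (Rmin e1 e2); split; [apply Rmin_pos; auto|]; intros y Hy.
  assert (A := Rmin_l e1 e2); assert (B := Rmin_r e1 e2).
  destruct (Rle_lt_dec y 0); [apply K2, Rabs_def1; lra|].
  destruct (Rle_lt_dec y 1); [apply regular_ray; auto; lra|apply K1, Rabs_def1; lra].
Qed.

Lemma Pder_ray (u : C) (x : R) : Pder (fun y => RtoC y * u)%C x u.
Proof. apply Pder_eq with (1 := Pder_mult _ _ _ _ _ (Pder_id x) (Pder_const u x)); ring. Qed.

Lemma ray_integrand_cont (u : C) (x : R) : regular (RtoC x * u) -> Ccont (ray_integrand u) x.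
Proof.
  intros H; eapply Pder_Ccont; apply Pder_scal, (Pder_integrand (fun y => RtoC y * u)%C).
  - apply Pder_ray.
  - exact H.
Qed.

Lemma ray_int_0 (u : C) : ray_int u 0 = RtoC 0.
Proof. apply CInt_point. Qed.

Lemma Pder_ray_int (u : C) (r x : R) : 0 < r -> regular (RtoC r * u) -> 0 <= x <= r ->
  Pder (ray_int u) x (ray_integrand u x).
Proof.
  intros Hr H Hx.
  destruct (regular_ray_ext _ H) as [eps [He K]].
  apply CInt_Pder with (- (r * eps)) (r * (1 + eps)); try nra.
  intros v Hv; apply ray_integrand_cont.
  replace (RtoC v * u)%C with (RtoC (v / r) * (RtoC r * u))%C.
  - apply K; split; apply Rmult_lt_reg_l with r; try lra; unfold Rdiv;
      rewrite (Rmult_comm v), <- Rmult_assoc, Rinv_r; nra.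
  - rewrite Cmult_assoc, <- RtoC_mult; do 2 f_equal; field; lra.
Qed.

Lemma Pder_ray_int_unit (u : C) (x : R) : regular u -> 0 <= x <= 1 ->
  Pder (ray_int u) x (ray_integrand u x).
Proof. intros H; apply Pder_ray_int with (r := 1); [lra|rewrite Cmult_1_l; auto]. Qed.

Lemma ray_int_scale (u : C) (r : R) : 0 < r -> regular (RtoC r * u) ->
  ray_int (RtoC r * u) 1 = ray_int u r.
Proof.
  intros Hr H.
  assert (E : (ray_int (RtoC r * u) 1 - ray_int u (r * 1))%C
            = (ray_int (RtoC r * u) 0 - ray_int u (r * 0))%C).
  { apply (Pder_const_eq (fun x => ray_int (RtoC r * u) x - ray_int u (r * x)%R)%C 0 1); [lra|].
    intros x Hx.
    apply Pder_eq with (ray_integrand (RtoC r * u) x - RtoC r * ray_integrand u (r * x))%C.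
    - apply Pder_minus.
      + apply Pder_ray_int_unit; auto.
      + apply (Pder_comp (ray_int u) (fun x => r * x)).
        * apply Pder_ray_int with r; auto; nra.
        * auto_derive; auto; ring.
    - unfold ray_integrand; rewrite RtoC_mult.
      replace (RtoC x * (RtoC r * u))%C with (RtoC r * RtoC x * u)%C by ring; ring. }
  rewrite Rmult_0_r, !ray_int_0, Rmult_1_r in E.
  replace (ray_int (RtoC r * u) 1) with (ray_int (RtoC r * u) 1 - ray_int u r + ray_int u r)%C by ring.
  rewrite E; ring.
Qed.

End Integrand.

(** * The real solution and its blow-up time [rho] *)

Lemma is_RInt_gen_filterlim {V : NormedModule R_AbsRing} (Fa Fb : (R -> Prop) -> Prop)
  {FFa : Filter Fa} {FFb : Filter Fb} (f : R -> V) (G : R * R -> V) (l : V) :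
  filter_prod Fa Fb (fun ab => is_RInt f (fst ab) (snd ab) (G ab)) ->
  filterlim G (filter_prod Fa Fb) (locally l) ->
  is_RInt_gen f Fa Fb l.
Proof.
  intros H HG P HP; specialize (HG P HP).
  unfold filtermapi; apply (filter_imp (fun ab => is_RInt f (fst ab) (snd ab) (G ab) /\ P (G ab))).
  - intros ab [H1 H2]; exists (G ab); split; [exact H1|exact H2].
  - apply filter_and; [exact H|exact HG].
Qed.

Lemma is_RInt_gen_at_left {V : NormedModule R_AbsRing} (f : R -> V) (G : R -> V) (x0 x1 : R) (l : V) :
  x0 < x1 -> (forall x, x0 <= x < x1 -> is_RInt f x0 x (G x)) ->
  filterlim G (at_left x1) (locally l) ->
  is_RInt_gen f (at_point x0) (at_left x1) l.
Proof.
  intros Hx H HG; refine (is_RInt_gen_filterlim _ _ f (fun ab => G (snd ab)) l _ _).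
  - apply Filter_prod with (fun x => x = x0) (fun x => x0 <= x < x1).
    + reflexivity.
    + exists (mkposreal (x1 - x0) ltac:(lra)); intros y Hy1 Hy2.
      assert (Hy : Rabs (y - x1) < x1 - x0) by exact Hy1.
      apply Rabs_def2 in Hy; lra.
    + intros x y -> Hy; apply H; auto.
  - apply filterlim_comp with (G := at_left x1); auto.
    apply filterlim_snd.
Qed.

Lemma increasing_left_limit (G : R -> R) (x0 x1 M : R) : x0 < x1 ->
  (forall x y, x0 <= x -> x <= y -> y < x1 -> G x <= G y) ->
  (forall x, x0 <= x < x1 -> G x <= M) ->
  exists L, filterlim G (at_left x1) (locally L) /\
    (forall x, x0 <= x < x1 -> G x <= L) /\
    (forall v, v < L -> exists x, x0 <= x < x1 /\ v < G x).
Proof.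
  intros Hx Hm HM.
  destruct (completeness (fun v => exists x, x0 <= x < x1 /\ v = G x)) as [L [HL1 HL2]].
  - exists M; intros v [x [H1 ->]]; auto.
  - exists (G x0), x0; split; auto; lra.
  - assert (A : forall x, x0 <= x < x1 -> G x <= L) by (intros x H; apply HL1; exists x; auto).
    assert (B : forall v, v < L -> exists x, x0 <= x < x1 /\ v < G x).
    { intros v Hv; apply Classical_Prop.NNPP; intros N.
      assert (L <= v); [|lra].
      apply HL2; intros y [x [H1 ->]].
      destruct (Rle_lt_dec (G x) v); auto; exfalso; apply N; exists x; auto. }
    exists L; split; [|auto].
    apply filterlim_locally; intros eps.
    destruct (B (L - eps)) as [x [H1 H2]]; [generalize (cond_pos eps); lra|].
    exists (mkposreal (x1 - x) ltac:(lra)); intros y Hy1 Hy2.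
    assert (Hy : Rabs (y - x1) < x1 - x) by exact Hy1.
    apply Rabs_def2 in Hy.
    assert (G x <= G y) by (apply Hm; lra).
    assert (G y <= L) by (apply A; lra).
    unfold ball; simpl; unfold AbsRing_ball, abs, minus, plus, opp; simpl.
    apply Rabs_def1; generalize (cond_pos eps); lra.
Qed.

(** [dr], [Fr], [Xr], [Yr] and [Jr] are the restrictions of [delta], the integrand,
    [xi], [eta] and the integral to the interval [0, 1). *)
Definition dr (h : nat) (t : R) : R := Rpower (1 - t ^ h) (1 / INR h).
Definition Fr (a b h : nat) (t : R) : R := t ^ (a - 1) / dr h t ^ (a + b).
Definition Xr (a h : nat) (t : R) : R := t ^ a / dr h t ^ a.
Definition Yr (b h : nat) (t : R) : R := / dr h t ^ b.
Definition Jr (a b h : nat) (t : R) : R := RInt (Fr a b h) 0 t.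
Definition kappa (a b h : nat) : R := INR (a + b) / INR h.

(** The radius, with [h] as a parameter so that the colours can be exchanged. *)
Definition rhoh (a b h : nat) : R :=
  RInt_gen (fun t : R => t ^ (a - 1) / Rpower (1 - t ^ h) (INR (a + b) / INR h))
    (at_point 0) (at_left 1).

(** Inverse of [dr]. *)
Definition tpar (h : nat) (d : R) : R := Rpower (1 - d ^ h) (1 / INR h).

Section RealCurve.

Context {a b h p q : nat} {U : urn a b h p q}.

Let Ha : (0 < a)%nat. Proof. apply U. Qed.
Let Hb : (0 < b)%nat. Proof. apply U. Qed.
Let Hab : (a + b < h)%nat. Proof. apply U. Qed.
Let Hp : h = (a * p)%nat. Proof. apply U. Qed.
Let Hq : h = (b * q)%nat. Proof. apply U. Qed.

Local Notation dr := (dr h).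
Local Notation Fr := (Fr a b h).
Local Notation Xr := (Xr a h).
Local Notation Yr := (Yr b h).
Local Notation Jr := (Jr a b h).
Local Notation kappa := (kappa a b h).
Local Notation rhoh := (rhoh a b h).
Local Notation tpar := (tpar h).

Lemma p_ge_2 : (2 <= p)%nat.
Proof. destruct p as [|[|k]]; lia. Qed.

Lemma q_ge_2 : (2 <= q)%nat.
Proof. destruct q as [|[|k]]; lia. Qed.

Lemma Pder_xi_system (g : R -> C) (t : R) (e : C) : Pder g t e -> regular h (g t) ->
  Pder (fun x => xi a h (g x)) t
    (e * integrand a b h (g t) * (RtoC (INR a) * eta b h (g t) ^ (q - 1)))%C.
Proof.
  intros Hg Hr; assert (Hd := delta_neq0 _ Hr).
  apply Pder_eq with (1 := Pder_xi g t e Hg Hr).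
  unfold integrand, eta.
  assert (E : (delta h (g t) ^ h = delta h (g t) ^ b * (delta h (g t) ^ b) ^ (q - 1))%C).
  { rewrite <- Cpow_mult_r, <- Cpow_add_r; f_equal; generalize q_ge_2; nia. }
  rewrite E, Cpow_inv, Cpow_add_r by (apply Cpow_nz; auto).
  field; repeat split; try apply Cpow_nz; auto; apply Cpow_nz; auto.
Qed.

Lemma Pder_eta_system (g : R -> C) (t : R) (e : C) : Pder g t e -> regular h (g t) ->
  Pder (fun x => eta b h (g x)) t
    (e * integrand a b h (g t) * (RtoC (INR b) * xi a h (g t) ^ (p - 1)))%C.
Proof.
  intros Hg Hr; assert (Hd := delta_neq0 _ Hr).
  apply Pder_eq with (1 := Pder_eta g t e Hg Hr).
  unfold integrand, xi.
  assert (E : (delta h (g t) ^ h = delta h (g t) ^ a * (delta h (g t) ^ a) ^ (p - 1))%C).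
  { rewrite <- Cpow_mult_r, <- Cpow_add_r; f_equal; generalize p_ge_2; nia. }
  assert (E2 : (g t ^ (h - 1) = g t ^ (a - 1) * (g t ^ a) ^ (p - 1))%C).
  { rewrite <- Cpow_mult_r, <- Cpow_add_r; f_equal; generalize p_ge_2; nia. }
  unfold Cdiv at 3; rewrite Cpow_mult_l, Cpow_inv by (apply Cpow_nz; auto).
  rewrite E, E2, Cpow_add_r.
  field; repeat split; try apply Cpow_nz; auto; apply Cpow_nz; auto.
Qed.

Lemma dr_pos (t : R) : 0 < dr t.
Proof. apply exp_pos. Qed.

Lemma one_minus_pow_pos (t : R) : -1 < t < 1 -> 0 < 1 - t ^ h.
Proof.
  intros H; assert (Rabs (t ^ h) < 1).
  { rewrite <- RPow_abs; apply pow_lt_1_compat; [|lia].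
    split; [apply Rabs_pos|apply Rabs_def1; lra]. }
  apply Rabs_def2 in H0; lra.
Qed.

Lemma delta_RtoC (t : R) : t ^ h < 1 -> delta h (RtoC t) = RtoC (dr t).
Proof.
  intros H; unfold delta, dr; rewrite <- RtoC_pow, <- RtoC_minus; apply Cpowr_RtoC; lra.
Qed.

Lemma integrand_RtoC (t : R) : t ^ h < 1 -> integrand a b h (RtoC t) = RtoC (Fr t).
Proof.
  intros H; unfold integrand, Fr; rewrite delta_RtoC, <- !RtoC_pow, <- RtoC_div; auto.
  apply pow_nonzero, Rgt_not_eq, dr_pos.
Qed.

Lemma xi_RtoC (t : R) : t ^ h < 1 -> xi a h (RtoC t) = RtoC (Xr t).
Proof.
  intros H; unfold xi, Xr; rewrite delta_RtoC, <- !RtoC_pow, <- RtoC_div; auto.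
  apply pow_nonzero, Rgt_not_eq, dr_pos.
Qed.

Lemma eta_RtoC (t : R) : t ^ h < 1 -> eta b h (RtoC t) = RtoC (Yr t).
Proof.
  intros H; unfold eta, Yr; rewrite delta_RtoC, <- !RtoC_pow, <- RtoC_inv; auto.
  apply pow_nonzero, Rgt_not_eq, dr_pos.
Qed.

Lemma pow_h_lt_1 (t : R) : -1 < t < 1 -> t ^ h < 1.
Proof. intros H; generalize (one_minus_pow_pos t H); lra. Qed.

Lemma regular_RtoC (t : R) : -1 < t < 1 -> regular h (RtoC t).
Proof.
  intros H; apply regular_unit; rewrite Cmod_R; apply Rabs_def1; lra.
Qed.

Lemma is_derive_of_Pder (f : C -> C) (g : R -> R) (t : R) (d : C) (e : R) : -1 < t < 1 ->
  (forall x, -1 < x < 1 -> f (RtoC x) = RtoC (g x)) ->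
  Pder (fun x => f (RtoC x)) t d -> d = RtoC e -> is_derive g t e.
Proof.
  intros Ht Hf [H _] E; rewrite E in H; simpl in H.
  apply is_derive_ext_loc with (2 := H).
  exists (mkposreal (Rmin (t + 1) (1 - t)) ltac:(apply Rmin_pos; lra)).
  intros x Hx; assert (Hx' : Rabs (x - t) < Rmin (t + 1) (1 - t)) by exact Hx.
  assert (A := Rlt_le_trans _ _ _ Hx' (Rmin_l _ _)); assert (B := Rlt_le_trans _ _ _ Hx' (Rmin_r _ _)).
  apply Rabs_def2 in A; apply Rabs_def2 in B; rewrite Hf by lra; reflexivity.
Qed.

Lemma Fr_continuous (t : R) : -1 < t < 1 -> continuous Fr t.
Proof.
  intros Ht; apply (ex_derive_continuous Fr).
  exists (Re (dintegrand a b h (RtoC t) * RtoC 1)%C).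
  assert (D := Pder_integrand RtoC t (RtoC 1) (Pder_id t) (regular_RtoC t Ht)).
  destruct D as [D _]; apply is_derive_ext_loc with (2 := D).
  exists (mkposreal (Rmin (t + 1) (1 - t)) ltac:(apply Rmin_pos; lra)).
  intros x Hx; assert (Hx' : Rabs (x - t) < Rmin (t + 1) (1 - t)) by exact Hx.
  assert (A := Rlt_le_trans _ _ _ Hx' (Rmin_l _ _)); assert (B := Rlt_le_trans _ _ _ Hx' (Rmin_r _ _)).
  apply Rabs_def2 in A; apply Rabs_def2 in B.
  rewrite integrand_RtoC; [reflexivity|apply pow_h_lt_1; lra].
Qed.

Lemma is_derive_Jr (t : R) : -1 < t < 1 -> is_derive Jr t (Fr t).
Proof.
  intros Ht; apply (is_derive_RInt_open Fr 0 (-1) 1); [lra|lra|apply Fr_continuous].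
Qed.

Lemma Fr_nonneg (t : R) : 0 <= t -> 0 <= Fr t.
Proof.
  intros Ht; apply Rmult_le_pos; [apply pow_le; auto|].
  left; apply Rinv_0_lt_compat, pow_lt, dr_pos.
Qed.

Lemma Fr_pos (t : R) : 0 < t -> 0 < Fr t.
Proof.
  intros Ht; apply Rmult_lt_0_compat; [apply pow_lt; auto|].
  apply Rinv_0_lt_compat, pow_lt, dr_pos.
Qed.

Lemma real_curve_Jr : real_curve (INR a) (INR b) (q - 1) (p - 1) Jr Fr Xr Yr.
Proof.
  intros t Ht; assert (Ht' : -1 < t < 1) by lra.
  assert (P1 : 0 <= Xr t).
  { apply Rmult_le_pos; [apply pow_le; lra|].
    left; apply Rinv_0_lt_compat, pow_lt, dr_pos. }
  assert (P2 : 0 <= Yr t) by (left; apply Rinv_0_lt_compat, pow_lt, dr_pos).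
  refine (conj _ (conj P1 (conj P2 (conj _ (conj _ _))))).
  - apply Fr_nonneg; lra.
  - apply is_derive_Jr; auto.
  - eapply (is_derive_of_Pder (xi a h) Xr t _ _ Ht').
    + intros x Hx; apply xi_RtoC, pow_h_lt_1; auto.
    + apply (Pder_xi_system RtoC t (RtoC 1)); [apply Pder_id|apply regular_RtoC; auto].
    + rewrite integrand_RtoC, eta_RtoC, <- RtoC_pow, <- !RtoC_mult by (apply pow_h_lt_1; auto).
      f_equal; ring.
  - eapply (is_derive_of_Pder (eta b h) Yr t _ _ Ht').
    + intros x Hx; apply eta_RtoC, pow_h_lt_1; auto.
    + apply (Pder_eta_system RtoC t (RtoC 1)); [apply Pder_id|apply regular_RtoC; auto].
    + rewrite integrand_RtoC, xi_RtoC, <- RtoC_pow, <- !RtoC_mult by (apply pow_h_lt_1; auto).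
      f_equal; ring.
Qed.

Lemma Jr_0 : Jr 0 = 0.
Proof. apply (RInt_point (V := R_CompleteNormedModule)). Qed.

Lemma Xr_0 : Xr 0 = 0.
Proof. unfold Xr; rewrite pow_ne_zero by lia; unfold Rdiv; ring. Qed.

Lemma dr_0 : dr 0 = 1.
Proof.
  unfold dr; rewrite pow_ne_zero, Rminus_0_r by lia.
  unfold Rpower; rewrite ln_1, Rmult_0_r, exp_0; reflexivity.
Qed.

Lemma Yr_0 : Yr 0 = 1.
Proof. unfold Yr; rewrite dr_0, pow1; field. Qed.

Lemma Jr_incr (x y : R) : 0 <= x -> x <= y -> y < 1 -> Jr x <= Jr y.
Proof.
  intros H1 H2 H3; apply is_derive_incr with Fr; auto; intros t Ht;
    [apply is_derive_Jr|apply Fr_nonneg]; lra.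
Qed.

Lemma Jr_incr_strict (x y : R) : 0 <= x -> x < y -> y < 1 -> Jr x < Jr y.
Proof.
  intros H1 H2 H3; apply is_derive_incr_strict with Fr; auto; intros t Ht;
    [apply is_derive_Jr|apply Fr_nonneg|apply Fr_pos]; lra.
Qed.

Lemma kappa_bounds : 0 < kappa < 1.
Proof.
  assert (0 < INR h) by (apply lt_0_INR; lia).
  assert (0 < INR (a + b)) by (apply lt_0_INR; lia).
  assert (INR (a + b) < INR h) by (apply lt_INR; lia).
  unfold kappa; split; [apply Rdiv_lt_0_compat; auto|].
  apply Rmult_lt_reg_r with (INR h); auto; unfold Rdiv; rewrite Rmult_assoc, Rinv_l; lra.
Qed.

Lemma Rpower_nat_pow (x y : R) (k : nat) : Rpower x y ^ k = Rpower x (INR k * y).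
Proof.
  rewrite <- Rpower_pow by apply exp_pos; rewrite Rpower_mult; f_equal; ring.
Qed.

Lemma dr_pow_ab (t : R) : dr t ^ (a + b) = Rpower (1 - t ^ h) kappa.
Proof.
  unfold dr, kappa; rewrite Rpower_nat_pow; f_equal; field.
  apply not_0_INR; lia.
Qed.

(** [1 - x^h >= 1 - x], and [(1 - x)^(- kappa)] is integrable because [kappa < 1]. *)
Lemma Jr_bounded (t : R) : 0 <= t < 1 -> Jr t <= / (1 - kappa).
Proof.
  intros Ht; assert (K := kappa_bounds).
  set (G := fun x => - Rpower (1 - x) (1 - kappa) / (1 - kappa)).
  assert (H : G 0 - Jr 0 <= G t - Jr t).
  { apply (is_derive_incr (fun x => G x - Jr x) (fun x => Rpower (1 - x) (- kappa) - Fr x)); [lra| |].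
    - intros x Hx; apply is_derive_Rminus; [|apply is_derive_Jr; lra].
      unfold G, Rpower; auto_derive; [lra|].
      replace (- kappa) with ((1 - kappa) - 1) by ring.
      replace (((1 - kappa) - 1) * ln (1 - x)) with ((1 - kappa) * ln (1 - x) + - ln (1 - x)) by ring.
      rewrite exp_plus, exp_Ropp, exp_ln by lra; unfold Rminus; field; lra.
    - intros x Hx; unfold Fr; rewrite dr_pow_ab.
      assert (Q : Rpower (1 - x) kappa <= Rpower (1 - x ^ h) kappa).
      { apply Rle_Rpower_l; [lra|].
        assert (x ^ h <= x).
        { replace h with (S (h - 1)) by lia; simpl.
          assert (0 <= x ^ (h - 1) <= 1) by (split; [apply pow_le|rewrite <- (pow1 (h - 1)); apply pow_incr]; lra).
          nra. }
        lra. }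
      rewrite Rpower_Ropp.
      assert (0 < Rpower (1 - x) kappa) by apply exp_pos.
      assert (/ Rpower (1 - x ^ h) kappa <= / Rpower (1 - x) kappa) by (apply Rinv_le_contravar; auto).
      assert (0 <= x ^ (a - 1) <= 1) by (split; [apply pow_le|rewrite <- (pow1 (a - 1)); apply pow_incr]; lra).
      assert (0 < / Rpower (1 - x ^ h) kappa) by (apply Rinv_0_lt_compat, exp_pos).
      unfold Rdiv; nra. }
  rewrite Jr_0 in H; unfold G in H.
  rewrite Rminus_0_r in H.
  assert (E : Rpower (1 - 0) (1 - kappa) = 1).
  { rewrite Rminus_0_r; unfold Rpower; rewrite ln_1, Rmult_0_r, exp_0; reflexivity. }
  rewrite E in H.
  assert (0 < Rpower (1 - t) (1 - kappa) / (1 - kappa)) by (apply Rdiv_lt_0_compat; [apply exp_pos|lra]).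
  unfold Rdiv in *; lra.
Qed.

Lemma is_RInt_Fr (x : R) : 0 <= x < 1 -> is_RInt Fr 0 x (Jr x).
Proof.
  intros Hx; apply (RInt_correct (V := R_CompleteNormedModule)), ex_RInt_cont; [lra|].
  intros t Ht; apply Fr_continuous; lra.
Qed.

Lemma rhoh_spec : filterlim Jr (at_left 1) (locally rhoh) /\
  (forall x, 0 <= x < 1 -> Jr x < rhoh) /\
  (forall v, v < rhoh -> exists x, 0 <= x < 1 /\ v < Jr x).
Proof.
  destruct (increasing_left_limit Jr 0 1 (/ (1 - kappa)) Rlt_0_1 Jr_incr Jr_bounded) as [L [H1 [H2 H3]]].
  assert (E : rhoh = L).
  { apply (is_RInt_gen_unique (V := R_CompleteNormedModule) (Fa := at_point 0) (Fb := at_left 1) _ L).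
    apply is_RInt_gen_at_left with Jr; auto; [lra|].
    intros x Hx; apply is_RInt_ext with Fr; [|apply is_RInt_Fr; auto].
    intros t _; unfold Fr; rewrite dr_pow_ab; reflexivity. }
  rewrite E; repeat split; auto.
  intros x Hx; apply Rlt_le_trans with (Jr ((x + 1) / 2)); [apply Jr_incr_strict|apply H2]; lra.
Qed.

Lemma Jr_lt_rhoh (x : R) : 0 <= x < 1 -> Jr x < rhoh.
Proof. apply rhoh_spec. Qed.

Lemma rhoh_pos : 0 < rhoh.
Proof. rewrite <- Jr_0; apply Jr_lt_rhoh; lra. Qed.

Lemma Rpower_root_pow (x : R) : 0 < x -> Rpower x (1 / INR h) ^ h = x.
Proof.
  intros Hx; rewrite Rpower_nat_pow.
  replace (INR h * (1 / INR h)) with 1; [apply Rpower_1; auto|].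
  field; apply not_0_INR; lia.
Qed.

Lemma Rpower_pow_root (x : R) : 0 < x -> Rpower (x ^ h) (1 / INR h) = x.
Proof.
  intros Hx; rewrite <- (Rpower_pow h x Hx), Rpower_mult.
  replace (INR h * (1 / INR h)) with 1; [apply Rpower_1; auto|].
  field; apply not_0_INR; lia.
Qed.

Lemma dr_tpar (d : R) : 0 < d < 1 -> 0 < tpar d < 1 /\ dr (tpar d) = d.
Proof.
  intros Hd.
  assert (P : 0 < 1 - d ^ h) by (apply one_minus_pow_pos; lra).
  assert (Q : 0 < d ^ h) by (apply pow_lt; lra).
  assert (E : tpar d ^ h = 1 - d ^ h) by (apply Rpower_root_pow; auto).
  assert (T : 0 < tpar d) by apply exp_pos.
  repeat split; auto.
  - destruct (Rle_lt_dec 1 (tpar d)) as [N|]; auto.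
    exfalso; assert (1 <= tpar d ^ h) by (apply pow_R1_Rle; auto); lra.
  - unfold dr; rewrite E; replace (1 - (1 - d ^ h)) with (d ^ h) by ring.
    apply Rpower_pow_root; lra.
Qed.

Lemma dr_pow_h (t : R) : -1 < t < 1 -> dr t ^ h = 1 - t ^ h.
Proof. intros Ht; apply Rpower_root_pow, one_minus_pow_pos; auto. Qed.

Lemma pow_div (x y : R) (k : nat) : (x / y) ^ k = x ^ k / y ^ k.
Proof. unfold Rdiv; rewrite Rpow_mult_distr, pow_inv; reflexivity. Qed.

Lemma Yr_pow_q (t : R) : -1 < t < 1 -> Yr t ^ q = 1 + Xr t ^ p.
Proof.
  intros Ht; unfold Yr, Xr; rewrite pow_div, pow_inv, <- !pow_mult.
  replace (b * q)%nat with h by auto; replace (a * p)%nat with h by auto.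
  rewrite dr_pow_h by auto; field; generalize (one_minus_pow_pos t Ht); lra.
Qed.

Lemma real_curve_unbounded (M : R) : exists t, 0 <= t < 1 /\ M <= Xr t /\ M <= Yr t.
Proof.
  set (N := 1 + Rabs M); assert (HN : 1 <= N /\ M <= N).
  { unfold N; generalize (Rle_abs M) (Rabs_pos M); lra. }
  set (d := / (2 * N)).
  assert (Hd : 0 < d <= 1 / 2).
  { unfold d; split; [apply Rinv_0_lt_compat; lra|].
    replace (1 / 2) with (/ 2) by lra; apply Rinv_le_contravar; lra. }
  destruct (dr_tpar d) as [Ht E]; [lra|].
  assert (Ht2 : / 2 <= tpar d).
  { destruct (Rle_lt_dec (/ 2) (tpar d)) as [|L]; auto; exfalso.
    assert (F : tpar d ^ h = 1 - d ^ h) by (apply Rpower_root_pow, one_minus_pow_pos; lra).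
    assert (G : forall x, 0 <= x <= 1 -> x ^ h <= x).
    { intros x Hx; replace h with (S (h - 1)) by lia; simpl.
      assert (0 <= x ^ (h - 1) <= 1)
        by (split; [apply pow_le|rewrite <- (pow1 (h - 1)); apply pow_incr]; lra); nra. }
    assert (G1 := G (tpar d) ltac:(lra)); assert (G2 := G d ltac:(lra)); lra. }
  exists (tpar d); split; [lra|].
  assert (G : forall x k, 1 <= x -> (0 < k)%nat -> x <= x ^ k).
  { intros x k Hx Hk; replace k with (S (k - 1)) by lia; simpl.
    assert (1 <= x ^ (k - 1)) by (apply pow_R1_Rle; auto); nra. }
  unfold Xr, Yr; rewrite E.
  rewrite <- pow_div, <- pow_inv.
  assert (I : / d = 2 * N) by (unfold d; apply Rinv_inv).
  unfold Rdiv; rewrite I.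
  split.
  - apply Rle_trans with (tpar d * (2 * N)); [nra|apply G; auto; nra].
  - apply Rle_trans with (2 * N); [lra|apply G; auto; lra].
Qed.

End RealCurve.

(** * The solution in the disc of radius [rho] *)

Lemma Cder_translate (f : C -> C) (z0 z d : C) : Cder f (z - z0) d -> Cder (fun w => f (w - z0)%C) z d.
Proof.
  intros H eps He; destruct (H eps He) as [del [Hd K]]; exists del; split; auto.
  intros w Hw; replace (z + w - z0)%C with (z - z0 + w)%C by ring; auto.
Qed.

Lemma segment_in_ball (z0 z1 : C) (t : R) : 0 <= t <= 1 ->
  Cmod (z0 + RtoC t * (z1 - z0) - z0) <= Cmod (z1 - z0).
Proof.
  intros Ht; replace (z0 + RtoC t * (z1 - z0) - z0)%C with (RtoC t * (z1 - z0))%C by ring.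
  rewrite Cmod_mult, Cmod_RtoC_pos by lra; generalize (Cmod_ge_0 (z1 - z0)); nra.
Qed.

Lemma segment_in_disc (z0 z1 c : C) (r t : R) : 0 <= t <= 1 ->
  Cmod (z0 - c) < r -> Cmod (z1 - c) < r -> Cmod (z0 + RtoC t * (z1 - z0) - c) < r.
Proof.
  intros Ht H0 H1.
  replace (z0 + RtoC t * (z1 - z0) - c)%C
    with (RtoC (1 - t) * (z0 - c) + RtoC t * (z1 - c))%C by (rewrite RtoC_minus; ring).
  apply Rle_lt_trans with (1 := Cmod_triangle _ _).
  rewrite !Cmod_mult, !Cmod_RtoC_pos by lra.
  destruct (Rle_lt_dec t (1 / 2)) as [L|L].
  - assert (0 < (1 - t) * (r - Cmod (z0 - c))) by (apply Rmult_lt_0_compat; lra).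
    assert (0 <= t * (r - Cmod (z1 - c))) by (apply Rmult_le_pos; lra); lra.
  - assert (0 <= (1 - t) * (r - Cmod (z0 - c))) by (apply Rmult_le_pos; lra).
    assert (0 < t * (r - Cmod (z1 - c))) by (apply Rmult_lt_0_compat; lra); lra.
Qed.

Definition X0 (a b p q : nat) : C -> C :=
  PS (sx (INR a) (INR b) (q - 1) (p - 1) (RtoC 0) (RtoC 1)).
Definition Y0 (a b p q : nat) : C -> C :=
  PS (sy (INR a) (INR b) (q - 1) (p - 1) (RtoC 0) (RtoC 1)).

Section Disc.

Context {a b h p q : nat} {U : urn a b h p q}.

Let Ha : (0 < a)%nat. Proof. apply U. Qed.
Let Hb : (0 < b)%nat. Proof. apply U. Qed.
Let Hab : (a + b < h)%nat. Proof. apply U. Qed.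
Let Hp : h = (a * p)%nat. Proof. apply U. Qed.
Let Hq : h = (b * q)%nat. Proof. apply U. Qed.

Local Notation rhoh := (rhoh a b h).
Local Notation Jr := (Jr a b h).
Local Notation Xr := (Xr a h).
Local Notation Yr := (Yr b h).
Local Notation Fr := (Fr a b h).
Local Notation sys := (solves (INR a) (INR b) (q - 1) (p - 1)).
Local Notation Csys := (Csolves (INR a) (INR b) (q - 1) (p - 1)).
Local Notation sX := (sx (INR a) (INR b) (q - 1) (p - 1)).
Local Notation sY := (sy (INR a) (INR b) (q - 1) (p - 1)).

Local Notation X0 := (X0 a b p q).
Local Notation Y0 := (Y0 a b p q).

(** The real curve dominates the series, and it lives up to the time [rho]. *)
Lemma basic_CVin : CVin (sX (RtoC 0) (RtoC 1)) rhoh /\ CVin (sY (RtoC 0) (RtoC 1)) rhoh.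
Proof.
  apply sx_sy_CVin with Jr Fr Xr Yr 0; auto using pos_INR.
  - apply real_curve_Jr; auto.
  - lra.
  - rewrite Cmod_0, Xr_0 by auto; lra.
  - rewrite Cmod_1, Yr_0 by lia; lra.
  - intros r Hr; destruct (rhoh_spec) as [_ [_ H]].
    destruct (H r ltac:(lra)) as [t [Ht1 Ht2]]; exists t; split; auto.
    rewrite Jr_0; lra.
Qed.

Lemma basic_Csolves (z : C) : Cmod z < rhoh -> Csys X0 Y0 z.
Proof. apply PS_Csolves; apply basic_CVin. Qed.

Lemma X0_0 : X0 (RtoC 0) = RtoC 0.
Proof. apply PS_0. Qed.

Lemma Y0_0 : Y0 (RtoC 0) = RtoC 1.
Proof. apply PS_0. Qed.

(** Any initial data are dominated by the real solution at a late enough time,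
    hence every initial value problem has an analytic solution. *)
Lemma local_CVin (x0 y0 : C) : exists R1, 0 < R1 /\
  CVin (sX x0 y0) R1 /\ CVin (sY x0 y0) R1.
Proof.
  destruct (real_curve_unbounded (Cmod x0 + Cmod y0)) as [t0 [Ht [H1 H2]]].
  exists (rhoh - Jr t0); split.
  - generalize (Jr_lt_rhoh t0 Ht); lra.
  - apply sx_sy_CVin with Jr Fr Xr Yr t0; auto using pos_INR; try lra.
    + apply real_curve_Jr; auto.
    + generalize (Cmod_ge_0 y0); lra.
    + generalize (Cmod_ge_0 x0); lra.
    + intros r Hr; destruct (rhoh_spec) as [_ [_ H]].
      destruct (H (Jr t0 + r) ltac:(lra)) as [t [Ht1 Ht2]].
      exists t; split; [split; [|lra]|lra].
      destruct (Rle_lt_dec t0 t) as [|L]; auto; exfalso.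
      assert (Jr t <= Jr t0) by (apply Jr_incr; auto; lra); lra.
Qed.

(** Uniqueness along segments identifies a solution with the sum of the local series
    that has the same value at [z]. *)
Lemma solves_local_series (f g : C -> C) (z : C) : near z (sys f g) ->
  exists R1 c d, 0 < R1 /\ CVin c R1 /\ CVin d R1 /\
    forall w, Cmod (w - z) < R1 -> f w = PS c (w - z)%C /\ g w = PS d (w - z)%C.
Proof.
  intros [eps [He H]].
  destruct (local_CVin (f z) (g z)) as [R1 [HR [C1 C2]]].
  assert (M1 := Rmin_l R1 eps); assert (M2 := Rmin_r R1 eps).
  assert (M0 : 0 < Rmin R1 eps) by (apply Rmin_pos; auto).
  exists (Rmin R1 eps), (sX (f z) (g z)), (sY (f z) (g z)).
  refine (conj M0 (conj (CVin_le _ _ _ M1 C1) (conj (CVin_le _ _ _ M1 C2) _))).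
  intros w Hw.
  apply (segment_unique (INR a) (INR b) (q - 1) (p - 1) f g
    (fun w => PS (sX (f z) (g z)) (w - z)%C) (fun w => PS (sY (f z) (g z)) (w - z)%C) z w).
  - intros t Ht; apply H.
    apply Rle_lt_trans with (1 := segment_in_ball z w t Ht); lra.
  - intros t Ht; apply Csolves_solves.
    destruct (PS_Csolves (INR a) (INR b) (q - 1) (p - 1) (f z) (g z) R1
      (z + RtoC t * (w - z) - z)%C) as [D1 D2]; auto.
    { apply Rle_lt_trans with (1 := segment_in_ball z w t Ht); lra. }
    split; [apply (Cder_translate (PS _)); exact D1|apply (Cder_translate (PS _)); exact D2].
  - replace (z - z)%C with (RtoC 0) by ring; rewrite PS_0; reflexivity.
  - replace (z - z)%C with (RtoC 0) by ring; rewrite PS_0; reflexivity.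
Qed.

Lemma solves_analytic (f g : C -> C) (z : C) : near z (sys f g) -> analytic_at f z.
Proof.
  intros H; destruct (solves_local_series f g z H) as [R1 [c [d [HR [Hc [_ E]]]]]].
  apply analytic_at_PS with c R1; auto; intros w Hw; apply E; auto.
Qed.

(** ** The solution along the images of rays *)

Lemma Cmod_1_minus_pow_ge (u : C) : 1 - Cmod u ^ h <= Cmod (RtoC 1 - u ^ h).
Proof. rewrite <- Cmod_pow, <- Cmod_1 at 1; apply Cmod_triangle_minus. Qed.

Lemma Cmod_integrand (u : C) : regular h u ->
  Cmod (integrand a b h u) = Cmod u ^ (a - 1) / Rpower (Cmod (RtoC 1 - u ^ h)) (kappa a b h).
Proof.
  intros H; assert (Hd := delta_neq0 u H).
  unfold integrand; rewrite Cmod_div by (apply Cpow_nz; auto).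
  rewrite !Cmod_pow; f_equal; f_equal.
  unfold delta; rewrite Cmod_Cpowr by (apply one_minus_neq0; auto).
  rewrite Rpower_nat_pow; unfold kappa; f_equal.
  field; apply not_0_INR; lia.
Qed.

Lemma Cmod_integrand_le (u : C) (v : R) : regular h u -> 0 < v -> v <= Cmod (RtoC 1 - u ^ h) ->
  Cmod (integrand a b h u) <= Cmod u ^ (a - 1) / Rpower v (kappa a b h).
Proof.
  intros H Hv Hle; rewrite Cmod_integrand by auto.
  apply Rmult_le_compat_l; [apply pow_le, Cmod_ge_0|].
  apply Rinv_le_contravar; [apply exp_pos|].
  apply Rle_Rpower_l; [generalize (kappa_bounds)|]; lra.
Qed.

Lemma Cmod_integrand_le_Fr (u : C) : Cmod u < 1 -> Cmod (integrand a b h u) <= Fr (Cmod u).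
Proof.
  intros H; assert (Hu := Cmod_ge_0 u).
  unfold Fr; rewrite (dr_pow_ab) by auto.
  apply Cmod_integrand_le; [apply regular_unit; auto| |apply Cmod_1_minus_pow_ge].
  apply (one_minus_pow_pos); auto; lra.
Qed.

(** The modulus of the integrand is largest on the positive reals. *)
Lemma ray_int_le (u : C) (x y : R) : Cmod u <= 1 -> 0 <= x <= y -> y * Cmod u < 1 -> 
  (forall v, 0 <= v <= y -> regular h (RtoC v * u)) ->
  (0 < y) ->
  Cmod (ray_int a b h u y - ray_int a b h u x) <= Jr (y * Cmod u) - Jr (x * Cmod u).
Proof.
  intros Hu Hxy Hy Hr Hy0.
  assert (U0 := Cmod_ge_0 u).
  apply (path_increment_le (ray_int a b h u) (ray_integrand a b h u)
     (fun v => Jr (v * Cmod u)) (fun v => Fr (v * Cmod u) * Cmod u)); [lra| | |].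
  - intros t Ht; apply (Pder_ray_int) with y; auto; [apply Hr|]; lra.
  - intros t Ht; apply (is_derive_Rcomp Jr (fun v => v * Cmod u)).
    + apply is_derive_Jr; auto; nra.
    + auto_derive; auto; ring.
  - intros t Ht; unfold ray_integrand; rewrite Cmod_mult, Rmult_comm.
    apply Rmult_le_compat_r; auto.
    replace (t * Cmod u) with (Cmod (RtoC t * u)) by (rewrite Cmod_mult, Cmod_RtoC_pos; lra).
    apply Cmod_integrand_le_Fr; rewrite Cmod_mult, Cmod_RtoC_pos by lra; nra.
Qed.

Lemma xi_0 : xi a h (RtoC 0) = RtoC 0.
Proof.
  unfold xi; replace (RtoC 0 ^ a)%C with (RtoC 0); [unfold Cdiv; ring|].
  rewrite <- RtoC_pow, pow_ne_zero by lia; reflexivity.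
Qed.

Lemma eta_0 : eta b h (RtoC 0) = RtoC 1.
Proof.
  rewrite eta_RtoC; auto.
  - rewrite Yr_0 by lia; reflexivity.
  - rewrite pow_ne_zero by lia; lra.
Qed.

(** The pair [(xi, eta)] solves the system along the image of the ray, by the chain
    rule; uniqueness along this curve identifies it with the disc solution. *)
Lemma basic_on_ray (u : C) : regular h u ->
  (forall x, 0 <= x <= 1 -> Cmod (ray_int a b h u x) < rhoh) ->
  X0 (ray_int a b h u 1) = xi a h u /\ Y0 (ray_int a b h u 1) = eta b h u.
Proof.
  intros Hr Hd.
  assert (HP : forall x, 0 <= x <= 1 -> Pder (ray_int a b h u) x (ray_integrand a b h u x))
    by (intros x Hx; apply Pder_ray_int_unit; auto).
  destruct (path_bounded (ray_integrand a b h u)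
     (fun x => u * (dintegrand a b h (RtoC x * u) * u))%C 0 1) as [M HM]; [lra| |].
  { intros x Hx; apply Pder_scal, (Pder_integrand (fun y => RtoC y * u)%C);
      [apply Pder_ray|apply regular_ray; auto]. }
  destruct (curve_unique (INR a) (INR b) (q - 1) (p - 1) X0 Y0 (ray_int a b h u)
    (ray_integrand a b h u) (fun x => xi a h (RtoC x * u)%C) (fun x => eta b h (RtoC x * u)%C) M)
    with (t := 1) as [E1 E2]; auto; try lra.
  - intros x Hx; apply basic_Csolves; auto.
  - intros x Hx; apply (Pder_xi_system (fun y => RtoC y * u)%C);
      [apply Pder_ray|apply regular_ray; auto].
  - intros x Hx; apply (Pder_eta_system (fun y => RtoC y * u)%C);
      [apply Pder_ray|apply regular_ray; auto].
  - rewrite ray_int_0, X0_0, Cmult_0_l, xi_0; reflexivity.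
  - rewrite ray_int_0, Y0_0, Cmult_0_l, eta_0; reflexivity.
  - rewrite Cmult_1_l in E1, E2; auto.
Qed.

Lemma basic_in_unit_disc (u : C) : Cmod u < 1 ->
  Cmod (ray_int a b h u 1) < rhoh /\
  X0 (ray_int a b h u 1) = xi a h u /\ Y0 (ray_int a b h u 1) = eta b h u.
Proof.
  intros Hu; assert (U0 := Cmod_ge_0 u).
  assert (Hr : regular h u) by (apply regular_unit; auto).
  assert (B : forall x, 0 <= x <= 1 -> Cmod (ray_int a b h u x) < rhoh).
  { intros x Hx; destruct (Req_dec x 0) as [->|Hx0].
    - rewrite ray_int_0, Cmod_0; apply rhoh_pos; auto.
    - assert (G := ray_int_le u 0 x ltac:(lra) ltac:(lra) ltac:(nra)).
      rewrite ray_int_0, Rmult_0_l, Jr_0 in G.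
      replace (ray_int a b h u x - RtoC 0)%C with (ray_int a b h u x) in G by ring.
      rewrite Rminus_0_r in G; apply Rle_lt_trans with (Jr (x * Cmod u)).
      + apply G; [|lra]; intros v Hv; apply regular_ray; auto; lra.
      + apply Jr_lt_rhoh; auto; nra. }
  split; [apply B; lra|apply basic_on_ray; auto].
Qed.

Lemma ray_int_real (t : R) : 0 <= t < 1 -> ray_int a b h (RtoC 1) t = RtoC (Jr t).
Proof.
  intros Ht; apply C_eq.
  - apply (RInt_ext (V := R_CompleteNormedModule)); intros x Hx.
    rewrite Rmin_left, Rmax_right in Hx by lra; cbv beta.
    unfold ray_integrand; rewrite Cmult_1_l, Cmult_1_r.
    rewrite integrand_RtoC; auto; apply (pow_h_lt_1); auto; lra.
  - transitivity (RInt (fun _ => 0) 0 t).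
    + apply (RInt_ext (V := R_CompleteNormedModule)); intros x Hx.
      rewrite Rmin_left, Rmax_right in Hx by lra; cbv beta.
      unfold ray_integrand; rewrite Cmult_1_l, Cmult_1_r.
      rewrite integrand_RtoC; auto; apply (pow_h_lt_1); auto; lra.
    + rewrite RInt_const; apply Rmult_0_r.
Qed.

Lemma basic_real (t : R) : 0 <= t < 1 ->
  X0 (RtoC (Jr t)) = RtoC (Xr t) /\ Y0 (RtoC (Jr t)) = RtoC (Yr t).
Proof.
  intros Ht.
  assert (P : t ^ h < 1) by (apply (pow_h_lt_1); auto; lra).
  destruct (Req_dec t 0) as [->|Ht0].
  - rewrite Jr_0, X0_0, Y0_0, Xr_0, Yr_0 by lia; auto.
  - destruct (basic_in_unit_disc (RtoC t)) as [_ [E1 E2]].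
    + rewrite Cmod_RtoC_pos; lra.
    + assert (E : ray_int a b h (RtoC t) 1 = RtoC (Jr t)).
      { replace (RtoC t) with (RtoC t * RtoC 1)%C by ring.
        rewrite ray_int_scale; auto; [apply ray_int_real; auto|lra|].
        rewrite Cmult_1_r; apply (regular_RtoC); auto; lra. }
      rewrite E in E1, E2; rewrite E1, E2, xi_RtoC, eta_RtoC; auto.
Qed.

End Disc.

(** * Differentiating the ray integrals in the angle *)

Definition C2cont (f : R -> R -> C) (x y : R) : Prop :=
  continuity_2d_pt (fun u v => Re (f u v)) x y /\ continuity_2d_pt (fun u v => Im (f u v)) x y.

Lemma C2cont_ext_loc (f g : R -> R -> C) (x y : R) :
  locally_2d (fun u v => f u v = g u v) x y -> C2cont f x y -> C2cont g x y.
Proof.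
  intros [d Hd] [F1 F2]; split.
  - apply continuity_2d_pt_ext_loc with (2 := F1); exists d; intros u v Hu Hv; rewrite (Hd u v Hu Hv); reflexivity.
  - apply continuity_2d_pt_ext_loc with (2 := F2); exists d; intros u v Hu Hv; rewrite (Hd u v Hu Hv); reflexivity.
Qed.

Lemma C2cont_const (c : C) (x y : R) : C2cont (fun _ _ => c) x y.
Proof. split; apply continuity_2d_pt_const. Qed.

Lemma C2cont_plus (f g : R -> R -> C) (x y : R) : C2cont f x y -> C2cont g x y ->
  C2cont (fun u v => f u v + g u v)%C x y.
Proof.
  intros [F1 F2] [G1 G2]; split.
  - apply (continuity_2d_pt_plus (fun u v => Re (f u v)) (fun u v => Re (g u v))); auto.
  - apply (continuity_2d_pt_plus (fun u v => Im (f u v)) (fun u v => Im (g u v))); auto.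
Qed.

Lemma C2cont_mult (f g : R -> R -> C) (x y : R) : C2cont f x y -> C2cont g x y ->
  C2cont (fun u v => f u v * g u v)%C x y.
Proof.
  intros [F1 F2] [G1 G2]; split.
  - apply (continuity_2d_pt_minus (fun u v => Re (f u v) * Re (g u v))
      (fun u v => Im (f u v) * Im (g u v))); apply continuity_2d_pt_mult; auto.
  - apply (continuity_2d_pt_plus (fun u v => Re (f u v) * Im (g u v))
      (fun u v => Im (f u v) * Re (g u v))); apply continuity_2d_pt_mult; auto.
Qed.

Lemma C2cont_pow (f : R -> R -> C) (x y : R) (k : nat) : C2cont f x y ->
  C2cont (fun u v => f u v ^ k)%C x y.
Proof.
  intros H; induction k as [|k IH]; [apply (C2cont_const (RtoC 1))|].
  apply (C2cont_mult f (fun u v => f u v ^ k)%C); auto.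
Qed.

Lemma C2cont_real (f : R -> R -> R) (x y : R) : continuity_2d_pt f x y ->
  C2cont (fun u v => RtoC (f u v)) x y.
Proof. intros H; split; [exact H|apply (continuity_2d_pt_const x y 0)]. Qed.

Lemma C2cont_Cmod (f : R -> R -> C) (x y : R) : C2cont f x y ->
  continuity_2d_pt (fun u v => Cmod (f u v)) x y.
Proof.
  intros [F1 F2].
  apply (continuity_1d_2d_pt_comp sqrt (fun u v => fst (f u v) ^ 2 + snd (f u v) ^ 2)).
  - apply continuity_pt_sqrt; nra.
  - apply continuity_2d_pt_plus; [refine (continuity_2d_pt_ext _ _ _ _ _ (continuity_2d_pt_mult _ _ _ _ F1 F1))
      |refine (continuity_2d_pt_ext _ _ _ _ _ (continuity_2d_pt_mult _ _ _ _ F2 F2))];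
      intros u v; unfold Re, Im; ring.
Qed.

Lemma continuity_2d_pos (f : R -> R -> R) (x y : R) : continuity_2d_pt f x y -> 0 < f x y ->
  locally_2d (fun u v => 0 < f u v) x y.
Proof.
  intros Hc Hp; destruct (Hc (mkposreal _ Hp)) as [d Hd]; exists d; intros u v Hu Hv.
  specialize (Hd u v Hu Hv); simpl in Hd; apply Rabs_def2 in Hd; lra.
Qed.

Lemma C2cont_slit (f : R -> R -> C) (x y : R) : C2cont f x y -> slit (f x y) ->
  locally_2d (fun u v => slit (f u v)) x y.
Proof.
  intros H Hs; apply (continuity_2d_pos (fun u v => Cmod (f u v) + Re (f u v))); auto.
  apply continuity_2d_pt_plus; [apply C2cont_Cmod; auto|apply H].
Qed.

Lemma C2cont_Cpowr (f : R -> R -> C) (x y al : R) : C2cont f x y -> slit (f x y) ->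
  C2cont (fun u v => Cpowr (f u v) al) x y.
Proof.
  intros H Hs.
  assert (Hz := slit_neq0 _ Hs); assert (Hm := Hz); apply Cmod_gt_0 in Hm.
  assert (CM := C2cont_Cmod f x y H).
  assert (CA : continuity_2d_pt (fun u v => al * (2 * atan (Im (f u v) * / (Cmod (f u v) + Re (f u v))))) x y).
  { apply continuity_2d_pt_mult; [apply continuity_2d_pt_const|].
    apply continuity_2d_pt_mult; [apply continuity_2d_pt_const|].
    apply (continuity_1d_2d_pt_comp atan).
    - apply derivable_continuous_pt, derivable_pt_atan.
    - apply continuity_2d_pt_mult; [apply H|].
      apply continuity_2d_pt_inv; [apply continuity_2d_pt_plus; [auto|apply H]|].
      unfold slit in Hs; lra. }
  assert (CP : continuity_2d_pt (fun u v => Rpower (Cmod (f u v)) al) x y).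
  { apply (continuity_1d_2d_pt_comp (fun t => Rpower t al) (fun u v => Cmod (f u v))); auto.
    apply derivable_continuous_pt; exists (al * Rpower (Cmod (f x y)) (al - 1)).
    apply derivable_pt_lim_power; auto. }
  destruct (C2cont_slit f x y H Hs) as [d Hd].
  assert (E : forall u v, Rabs (u - x) < d -> Rabs (v - y) < d ->
    (RtoC (Rpower (Cmod (f u v)) al) *
       Cexpi (al * (2 * atan (Im (f u v) * / (Cmod (f u v) + Re (f u v))))))%C = Cpowr (f u v) al).
  { intros u v Hu Hv; specialize (Hd u v Hu Hv).
    rewrite Cpowr_nz, Carg_atan by (auto using slit_neq0); reflexivity. }
  assert (C0 : C2cont (fun u v => RtoC (Rpower (Cmod (f u v)) al) *
       Cexpi (al * (2 * atan (Im (f u v) * / (Cmod (f u v) + Re (f u v))))))%C x y).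
  { apply C2cont_mult; [apply C2cont_real; auto|].
    split; simpl.
    - apply (continuity_1d_2d_pt_comp cos); [apply continuity_cos|auto].
    - apply (continuity_1d_2d_pt_comp sin); [apply continuity_sin|auto]. }
  apply C2cont_ext_loc with (2 := C0); exists d; exact E.
Qed.

Lemma C2cont_Cinv (f : R -> R -> C) (x y : R) : C2cont f x y -> f x y <> RtoC 0 ->
  C2cont (fun u v => / f u v)%C x y.
Proof.
  intros [F1 F2] Hz.
  assert (Hm : 0 < Re (f x y) ^ 2 + Im (f x y) ^ 2).
  { rewrite <- Cmod_sqr; apply pow_lt, Cmod_gt_0; auto. }
  assert (CI : continuity_2d_pt (fun u v => / (Re (f u v) ^ 2 + Im (f u v) ^ 2)) x y).
  { apply continuity_2d_pt_inv; [|lra].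
    apply continuity_2d_pt_ext with (fun u v => Re (f u v) * Re (f u v) + Im (f u v) * Im (f u v)).
    - intros u v; ring.
    - apply continuity_2d_pt_plus; apply continuity_2d_pt_mult; auto. }
  split.
  - apply (continuity_2d_pt_mult (fun u v => Re (f u v)) (fun u v => / (Re (f u v) ^ 2 + Im (f u v) ^ 2))); auto.
  - apply (continuity_2d_pt_mult (fun u v => - Im (f u v)) (fun u v => / (Re (f u v) ^ 2 + Im (f u v) ^ 2))); auto.
    apply continuity_2d_pt_opp; auto.
Qed.

Lemma Pder_CInt_param (f df : R -> R -> C) (th eps : R) : 0 < eps ->
  (forall y x, Rabs (y - th) < eps -> 0 <= x <= 1 ->
     Pder (fun z => f z x) y (df y x) /\ Ccont (f y) x) ->
  (forall x, 0 <= x <= 1 ->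
     locally_2d (fun y x' => Pder (fun z => f z x') y (df y x')) th x /\ C2cont df th x) ->
  Pder (fun y => CInt (f y) 0 1) th (CInt (df th) 0 1).
Proof.
  intros He H1 H2.
  assert (G : forall g dg : R -> R -> R,
    (forall y x, Rabs (y - th) < eps -> 0 <= x <= 1 ->
       is_derive (fun z => g z x) y (dg y x) /\ continuous (g y) x) ->
    (forall x, 0 <= x <= 1 ->
       locally_2d (fun y x' => is_derive (fun z => g z x') y (dg y x')) th x /\
       continuity_2d_pt dg th x) ->
    is_derive (fun y => RInt (g y) 0 1) th (RInt (dg th) 0 1)).
  { intros g dg K1 K2.
    assert (T0 : Rabs (th - th) < eps) by (rewrite Rminus_diag_eq, Rabs_R0; auto).
    rewrite (RInt_ext (dg th) (fun t => Derive (fun u => g u t) th)).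
    2:{ intros x Hx; rewrite Rmin_left, Rmax_right in Hx by lra.
        symmetry; apply is_derive_unique, K1; auto; lra. }
    apply is_derive_RInt_param; rewrite ?Rmin_left, ?Rmax_right by lra.
    - exists (mkposreal eps He); intros y Hy t Ht; rewrite ?Rmin_left, ?Rmax_right in Ht by lra.
      eexists; apply K1; auto.
    - intros t Ht; rewrite ?Rmin_left, ?Rmax_right in Ht by lra.
      destruct (K2 t Ht) as [[d Hd] Hc].
      apply continuity_2d_pt_ext_loc with (2 := Hc).
      exists d; intros u v Hu Hv; symmetry; apply is_derive_unique, Hd; auto.
    - exists (mkposreal eps He); intros y Hy; apply ex_RInt_cont; [lra|].
      intros t Ht; apply K1; auto. }
  split.
  - apply (G (fun y x => Re (f y x)) (fun y x => Re (df y x))).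
    + intros y x Hy Hx; destruct (H1 y x Hy Hx) as [[A _] [B _]]; auto.
    + intros x Hx; destruct (H2 x Hx) as [[d Hd] [C _]]; split; auto.
      exists d; intros u v Hu Hv; apply (Hd u v Hu Hv).
  - apply (G (fun y x => Im (f y x)) (fun y x => Im (df y x))).
    + intros y x Hy Hx; destruct (H1 y x Hy Hx) as [[_ A] [_ B]]; auto.
    + intros x Hx; destruct (H2 x Hx) as [[d Hd] [_ C]]; split; auto.
      exists d; intros u v Hu Hv; apply (Hd u v Hu Hv).
Qed.

Lemma CInt_FTC (G g : R -> C) : (forall x, 0 <= x <= 1 -> Pder G x (g x) /\ Ccont g x) ->
  CInt g 0 1 = (G 1 - G 0)%C.
Proof.
  intros H; apply C_eq; simpl.
  - apply is_RInt_unique, (is_RInt_derive (fun x => Re (G x)) (fun x => Re (g x)));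
      rewrite ?Rmin_left, ?Rmax_right by lra; intros x Hx; apply (H x Hx).
  - apply is_RInt_unique, (is_RInt_derive (fun x => Im (G x)) (fun x => Im (g x)));
      rewrite ?Rmin_left, ?Rmax_right by lra; intros x Hx; apply (H x Hx).
Qed.

Lemma C2cont_Ccont (f : R -> R -> C) (x y : R) : C2cont f x y -> Ccont (f x) y.
Proof.
  assert (G : forall g : R -> R -> R, continuity_2d_pt g x y -> continuous (g x) y).
  { intros g Hg; apply filterlim_locally; intros eps.
    destruct (Hg eps) as [d Hd]; exists d; intros v Hv.
    apply (Hd x v); auto; rewrite Rminus_diag_eq, Rabs_R0; auto; apply cond_pos. }
  intros [H1 H2]; split; [apply (G (fun u v => Re (f u v)))|apply (G (fun u v => Im (f u v)))]; auto.
Qed.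

Section Angle.

Context {a b h p q : nat} {U : urn a b h p q}.

Let Ha : (0 < a)%nat. Proof. apply U. Qed.
Let Hb : (0 < b)%nat. Proof. apply U. Qed.
Let Hab : (a + b < h)%nat. Proof. apply U. Qed.

Local Notation regular := (regular h).
Local Notation integrand := (integrand a b h).
Local Notation dintegrand := (dintegrand a b h).
Local Notation ray_integrand := (ray_integrand a b h).
Local Notation ray_int := (ray_int a b h).

Lemma C2cont_one_minus (g : R -> R -> C) (x y : R) : C2cont g x y ->
  C2cont (fun u v => RtoC 1 - g u v ^ h)%C x y.
Proof.
  intros H; apply (C2cont_plus (fun _ _ => RtoC 1) (fun u v => - g u v ^ h)%C);
    [apply C2cont_const|].
  assert (K := C2cont_mult _ _ _ _ (C2cont_const (RtoC (-1)) x y) (C2cont_pow g x y h H)).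
  apply C2cont_ext_loc with (2 := K); exists (mkposreal 1 Rlt_0_1); intros; ring.
Qed.

Lemma C2cont_inv_delta_pow (g : R -> R -> C) (x y : R) (k : nat) : C2cont g x y ->
  regular (g x y) -> C2cont (fun u v => / delta h (g u v) ^ k)%C x y.
Proof.
  intros H Hr; apply (C2cont_Cinv (fun u v => delta h (g u v) ^ k)%C).
  - apply C2cont_pow, C2cont_Cpowr; auto; apply C2cont_one_minus; auto.
  - apply Cpow_nz, delta_neq0; auto.
Qed.

Lemma C2cont_integrand (g : R -> R -> C) (x y : R) : C2cont g x y -> regular (g x y) ->
  C2cont (fun u v => integrand (g u v)) x y.
Proof.
  intros H Hr; apply C2cont_mult; [apply C2cont_pow|apply C2cont_inv_delta_pow]; auto.
Qed.

Lemma C2cont_dintegrand (g : R -> R -> C) (x y : R) : C2cont g x y -> regular (g x y) ->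
  C2cont (fun u v => dintegrand (g u v)) x y.
Proof.
  intros H Hr.
  assert (Hd := delta_neq0 _ Hr).
  assert (CD : C2cont (fun u v => delta h (g u v)) x y)
    by (apply C2cont_Cpowr; auto; apply C2cont_one_minus; auto).
  unfold dintegrand.
  repeat first [apply C2cont_plus | apply C2cont_mult | apply C2cont_const
    | apply C2cont_pow; assumption | apply C2cont_inv_delta_pow; assumption].
  apply C2cont_Cinv.
  - apply C2cont_mult; apply C2cont_pow; assumption.
  - apply Cmult_neq_0; apply Cpow_nz; auto.
Qed.

(** The integral over [0, u] of the integrand is a primitive of it also
    transversally to the rays; along a circle centred at 0 the speed of [u] is
    [i u]. *)
Lemma Pder_ray_int_angle (r th : R) : regular (RtoC r * Cexpi th) ->
  Pder (fun y => ray_int (RtoC r * Cexpi y) 1) th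
    (Ci * (RtoC r * Cexpi th) * integrand (RtoC r * Cexpi th))%C.
Proof.
  intros Hr.
  set (u := fun y => (RtoC r * Cexpi y)%C).
  assert (Du : forall y, Pder u y (Ci * u y)%C).
  { intros y; apply Pder_eq with (1 := Pder_scal (RtoC r) _ _ _
      (Pder_Cexpi (fun x => x) y 1 (is_derive_id y))); unfold u; ring. }
  set (df := fun y x => (Ci * u y * integrand (RtoC x * u y)
     + u y * (dintegrand (RtoC x * u y) * (RtoC x * (Ci * u y))))%C).
  assert (Dxu : forall x y, Pder (fun z => RtoC x * u z)%C y (RtoC x * (Ci * u y))%C)
    by (intros x y; apply Pder_scal, Du).
  assert (Df : forall x y, regular (RtoC x * u y) ->
     Pder (fun z => ray_integrand (u z) x) y (df y x)).
  { intros x y H; apply (Pder_mult u (fun z => integrand (RtoC x * u z)%C)); [apply Du|].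
    apply (Pder_integrand (fun z => RtoC x * u z)%C); auto. }
  assert (Cu : forall x y, C2cont (fun y _ => u y) y x).
  { intros x y; apply C2cont_mult; [apply C2cont_const|]; split; simpl.
    - apply (continuity_1d_2d_pt_comp cos (fun u _ => u)); [apply continuity_cos|apply continuity_2d_pt_id1].
    - apply (continuity_1d_2d_pt_comp sin (fun u _ => u)); [apply continuity_sin|apply continuity_2d_pt_id1]. }
  assert (Cx : forall x y, C2cont (fun _ x => RtoC x) y x)
    by (intros x y; apply C2cont_real, continuity_2d_pt_id2).
  assert (Cxu : forall x y, C2cont (fun y x => RtoC x * u y)%C y x).
  { intros x y; apply (C2cont_mult (fun _ x => RtoC x) (fun y _ => u y)); auto. }
  assert (Hreg : exists eps, 0 < eps /\ forall y, Rabs (y - th) < eps -> regular (u y)).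
  { destruct (C2cont_slit (fun y _ => RtoC 1 - u y ^ h)%C th 0) as [d Hd]; auto.
    - apply C2cont_one_minus, Cu.
    - exists d; split; [apply cond_pos|]; intros y Hy; apply (Hd y 0); auto.
      rewrite Rminus_diag_eq, Rabs_R0; auto; apply cond_pos. }
  destruct Hreg as [eps [He Hreg]].
  assert (Hth : regular (u th)) by exact Hr.
  assert (Cdf : forall x, 0 <= x <= 1 -> C2cont df th x).
  { intros x Hx; assert (Hrx := regular_ray _ x Hth Hx); unfold df.
    apply C2cont_plus.
    - apply C2cont_mult; [apply (C2cont_mult (fun _ _ => Ci) (fun y _ => u y)); auto using C2cont_const|].
      apply (C2cont_integrand (fun y x => RtoC x * u y)%C); auto.
    - apply (C2cont_mult (fun y _ => u y)); auto.
      apply C2cont_mult; [apply (C2cont_dintegrand (fun y x => RtoC x * u y)%C); auto|].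
      apply (C2cont_mult (fun _ x => RtoC x)); auto.
      apply (C2cont_mult (fun _ _ => Ci) (fun y _ => u y)); auto using C2cont_const. }
  apply Pder_eq with (CInt (df th) 0 1).
  - apply (Pder_CInt_param (fun y => ray_integrand (u y)) df th eps He).
    + intros y x Hy Hx; assert (Hrx := regular_ray _ x (Hreg y Hy) Hx); split; auto.
      apply ray_integrand_cont; auto.
    + intros x Hx; assert (Hrx := regular_ray _ x Hth Hx); split; auto.
      destruct (C2cont_slit (fun y x => RtoC 1 - (RtoC x * u y) ^ h)%C th x) as [d Hd]; auto.
      * apply (C2cont_one_minus (fun y x => RtoC x * u y)%C); auto.
      * exists d; intros y v Hy Hv; apply Df, (Hd y v Hy Hv).
  - rewrite (CInt_FTC (fun x => RtoC x * (Ci * u th * integrand (RtoC x * u th)))%C).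
    + fold (u th); rewrite !Cmult_1_l; ring.
    + intros x Hx; assert (Hrx := regular_ray _ x Hth Hx); split.
      * apply Pder_eq with (1 := Pder_mult _ _ _ _ _ (Pder_id x)
          (Pder_scal (Ci * u th)%C _ _ _ (Pder_integrand (fun y => RtoC y * u th)%C x (u th)
             (Pder_ray (u th) x) Hrx))).
        unfold df; ring.
      * apply C2cont_Ccont, Cdf; auto.
Qed.

End Angle.

(** * The apex of the kite *)

Lemma cos_lt_1 (x : R) : 0 < x < 2 * PI -> cos x < 1.
Proof.
  intros Hx; replace x with (2 * (x / 2)) by field.
  rewrite cos_2a_sin; assert (0 < sin (x / 2)) by (apply sin_gt_0; lra); nra.
Qed.

Lemma Carg_nonneg (z : C) : 0 <= Im z -> 0 <= Carg z.
Proof.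
  intros H; unfold Carg; destruct (Rle_dec 0 (Im z)) as [_|N]; [|lra].
  apply acos_bound.
Qed.

Lemma Carg_nonpos (z : C) : Im z < 0 -> Carg z <= 0.
Proof.
  intros H; unfold Carg; destruct (Rle_dec 0 (Im z)) as [N|_]; [lra|].
  generalize (acos_bound (Re z / Cmod z)); lra.
Qed.

(** [1 - R e^{i be}] is a combination of 1 and [- e^{i be}] with nonnegative
    coefficients. *)
Lemma Carg_one_minus (R0 be : R) : 0 <= R0 -> 0 < be <= PI ->
  be - PI <= Carg (RtoC 1 - RtoC R0 * Cexpi be) <= 0.
Proof.
  intros HR Hbe; set (W := (RtoC 1 - RtoC R0 * Cexpi be)%C).
  assert (EI : Im W = - (R0 * sin be)) by (unfold W; simpl; ring).
  assert (ER : Re W = 1 - R0 * cos be) by (unfold W; simpl; ring).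
  destruct (Req_dec (R0 * sin be) 0) as [E0|E0].
  - assert (P : 0 < Re W).
    { rewrite ER; apply Rmult_integral in E0; destruct E0 as [->|E0]; [lra|].
      assert (be = PI).
      { destruct (Req_dec be PI) as [|N]; auto; exfalso.
        assert (0 < sin be) by (apply sin_gt_0; lra); lra. }
      subst be; rewrite cos_PI; lra. }
    assert (EW : W = (RtoC (Re W) * Cexpi 0)%C).
    { rewrite Cexpi_0; apply C_eq.
      - unfold Re; simpl; ring.
      - rewrite EI, E0; simpl; ring. }
    rewrite EW, Carg_polar by (generalize PI_RGT_0; lra); lra.
  - assert (Hs : 0 <= sin be) by (apply sin_ge_0; lra).
    assert (P : 0 < R0 * sin be) by nra.
    assert (Hbe' : be < PI).
    { destruct (Req_dec be PI) as [->|]; [|lra]. rewrite sin_PI in P; lra. }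
    assert (H0 : Carg W <= 0) by (apply Carg_nonpos; lra).
    split; auto.
    destruct (Rle_lt_dec (be - PI) (Carg W)) as [|L]; auto; exfalso.
    assert (HW : W <> RtoC 0) by (intros E; rewrite E in EI; simpl in EI; lra).
    assert (Hm := proj1 (Cmod_gt_0 W) HW).
    assert (B := Carg_bound W).
    (* the imaginary part of W e^{i (PI - be)} is sin be *)
    assert (E : Cmod W * sin (Carg W + (PI - be)) = sin be).
    { rewrite sin_plus, (sin_Carg W), (cos_Carg W) by auto.
      replace (Cmod W * (Im W / Cmod W * cos (PI - be) + Re W / Cmod W * sin (PI - be)))
        with (Im W * cos (PI - be) + Re W * sin (PI - be)) by (field; lra).
      rewrite EI, ER, sin_PI_x.
      replace (cos (PI - be)) with (- cos be) by (rewrite cos_minus, cos_PI, sin_PI; ring).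
      ring. }
    assert (0 < sin be) by nra.
    assert (sin (Carg W + (PI - be)) <= 0) by (apply Ropp_le_cancel; rewrite Ropp_0, <- sin_neg; apply sin_ge_0; lra).
    nra.
Qed.

Lemma left_limit_le (f : R -> R) (x1 d x0 M : R) : is_derive f x1 d -> x0 < x1 ->
  (forall x, x0 <= x < x1 -> f x <= M) -> f x1 <= M.
Proof.
  intros Hd Hx HM; destruct (Rle_lt_dec (f x1) M) as [|L]; auto; exfalso.
  destruct (proj1 (is_derive_expand f x1 d) Hd 1 Rlt_0_1) as [del [Hdel K]].
  set (S := 1 + Rabs d).
  assert (HS : 0 < S) by (unfold S; generalize (Rabs_pos d); lra).
  set (e := Rmin (del / 2) (Rmin (x1 - x0) ((f x1 - M) / (2 * S)))).
  assert (Hq : 0 < (f x1 - M) / (2 * S)) by (apply Rdiv_lt_0_compat; lra).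
  assert (He : 0 < e /\ e <= del / 2 /\ e <= x1 - x0 /\ e <= (f x1 - M) / (2 * S)).
  { unfold e; repeat split.
    - apply Rmin_pos; [lra|apply Rmin_pos; lra].
    - apply Rmin_l.
    - eapply Rle_trans; [apply Rmin_r|apply Rmin_l].
    - eapply Rle_trans; [apply Rmin_r|apply Rmin_r]. }
  destruct He as [E0 [E1 [E2 E3]]].
  assert (Ae : Rabs (- e) = e) by (rewrite Rabs_Ropp, Rabs_pos_eq; lra).
  specialize (K (- e) ltac:(rewrite Ae; lra)); rewrite Ae in K.
  specialize (HM (x1 + - e) ltac:(lra)).
  apply Rabs_le_between in K.
  assert (e * S <= (f x1 - M) / 2).
  { apply Rle_trans with ((f x1 - M) / (2 * S) * S); [apply Rmult_le_compat_r; lra|right; field; lra]. }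
  assert (- Rabs d <= d <= Rabs d) by (apply Rabs_le_between; lra).
  unfold S in H; nra.
Qed.

Definition in_angle (h : nat) (th : R) : Prop := 0 < INR h * th < 2 * PI.

(** This sum depends neither on [r] nor on [th]: the substitution [t -> 1/t] turns
    the remaining part of the integral, from [u] to infinity, into the integral of
    the exchanged urn. *)
Definition apex_sum (a b h : nat) (r th : R) : C :=
  (ray_int a b h (RtoC r * Cexpi th) 1
   + Cexpi (PI * kappa a b h) * ray_int b a h (RtoC (/ r) * Cexpi (- th)) 1)%C.

Definition mid_angle (h : nat) : R := PI / INR h.

(** The vertex [I(oo)] of the kite. *)
Definition apex (a b h : nat) : C := apex_sum a b h 1 (mid_angle h).

Section Apex.

Context {a b h p q : nat} {U : urn a b h p q}.

Let Ha : (0 < a)%nat. Proof. apply U. Qed.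
Let Hb : (0 < b)%nat. Proof. apply U. Qed.
Let Hab : (a + b < h)%nat. Proof. apply U. Qed.
Let Hp : h = (a * p)%nat. Proof. apply U. Qed.
Let Hq : h = (b * q)%nat. Proof. apply U. Qed.

Local Notation regular := (regular h).
Local Notation kappa := (kappa a b h).
Local Notation rhoh := (rhoh a b h).
Local Notation Jr := (Jr a b h).
Local Notation in_angle := (in_angle h).
Local Notation mid_angle := (mid_angle h).
Local Notation apex_sum := (apex_sum a b h).
Local Notation apex := (apex a b h).
Local Notation beta0 := (PI / INR p).
Local Notation gamma0 := (PI / INR q).

Lemma INR_h_gt0 : 0 < INR h.
Proof. apply lt_0_INR; lia. Qed.

Lemma polar_pow (r th : R) (k : nat) :
  ((RtoC r * Cexpi th) ^ k)%C = (RtoC (r ^ k) * Cexpi (INR k * th))%C.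
Proof. rewrite Cpow_mult_l, Cexpi_pow, <- RtoC_pow; reflexivity. Qed.

Lemma regular_polar (r th : R) : 0 <= r -> cos (INR h * th) <> 1 -> regular (RtoC r * Cexpi th).
Proof.
  intros Hr Hc; apply slit_iff; rewrite polar_pow; simpl; intros [E1 E2].
  assert (P : 0 <= r ^ h) by (apply pow_le; auto).
  set (k := r ^ h) in *; set (x := INR h * th) in *.
  assert (S := sin2_cos2 x); unfold Rsqr in S.
  destruct (Req_dec (sin x) 0) as [E|E].
  - assert ((cos x - 1) * (cos x + 1) = 0) by (ring_simplify; rewrite E in S; lra).
    apply Rmult_integral in H; destruct H; [lra|].
    assert (cos x = -1) by lra; rewrite H0 in E2; nra.
  - assert (k * sin x = 0) by lra; apply Rmult_integral in H; destruct H; [|lra].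
    rewrite H in E2; lra.
Qed.

Lemma regular_angle (r th : R) : 0 <= r -> in_angle th -> regular (RtoC r * Cexpi th).
Proof. intros Hr H; apply regular_polar; auto; apply Rlt_not_eq, cos_lt_1, H. Qed.

Lemma regular_angle_opp (r th : R) : 0 <= r -> in_angle th -> regular (RtoC r * Cexpi (- th)).
Proof.
  intros Hr H; apply regular_polar; auto.
  rewrite <- Ropp_mult_distr_r, cos_neg; apply Rlt_not_eq, cos_lt_1, H.
Qed.

Lemma integrand_polar (r th : R) : regular (RtoC r * Cexpi th) ->
  (Cexpi th * integrand a b h (RtoC r * Cexpi th))%C =
  (RtoC (r ^ (a - 1) * Rpower (Cmod (RtoC 1 - (RtoC r * Cexpi th) ^ h)) (- kappa))
   * Cexpi (INR a * th - kappa * Carg (RtoC 1 - (RtoC r * Cexpi th) ^ h)))%C.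
Proof.
  intros Hr; assert (Hz := one_minus_neq0 _ Hr).
  unfold integrand, delta; rewrite Cpowr_pow by auto.
  replace (INR (a + b) * (1 / INR h)) with kappa
    by (unfold kappa; field; generalize INR_h_gt0; lra).
  unfold Cdiv; rewrite <- Cpowr_opp, Cpowr_nz, polar_pow by auto.
  set (W := (RtoC 1 - (RtoC r * Cexpi th) ^ h)%C).
  replace (INR a * th - kappa * Carg W) with (th + INR (a - 1) * th + - kappa * Carg W)
    by (rewrite minus_INR by lia; simpl; ring).
  rewrite RtoC_mult, !Cexpi_plus; ring.
Qed.

(** ** Exchanging the colours: the change of variable [t -> 1/t] *)

Lemma delta_inv (r th : R) : 0 < r -> in_angle th ->
  (RtoC r * Cexpi th * delta h (RtoC (/ r) * Cexpi (- th)))%C =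
  (Cexpi (PI / INR h) * delta h (RtoC r * Cexpi th))%C.
Proof.
  intros Hr Hth; assert (Hh := INR_h_gt0).
  assert (Reg := regular_angle r th ltac:(lra) Hth).
  assert (HW := one_minus_neq0 _ Reg).
  unfold delta.
  set (W := (RtoC 1 - (RtoC r * Cexpi th) ^ h)%C) in *.
  assert (Hm := proj1 (Cmod_gt_0 W) HW).
  set (A := Carg W).
  assert (E : (RtoC 1 - (RtoC (/ r) * Cexpi (- th)) ^ h)%C
     = (RtoC (/ r ^ h * Cmod W) * Cexpi (A + PI - INR h * th))%C).
  { rewrite polar_pow, pow_inv, RtoC_mult, Cexpi_minus, Cexpi_plus, Cexpi_PI.
    replace (INR h * - th) with (- (INR h * th)) by ring; rewrite Cexpi_opp.
    assert (EW := polar_form W HW); fold A in EW.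
    transitivity (RtoC (/ r ^ h) * (RtoC (Cmod W) * Cexpi A) * RtoC (-1) / Cexpi (INR h * th))%C.
    - rewrite <- EW; unfold W; rewrite polar_pow, RtoC_inv by (apply pow_nonzero; lra).
      field; split; first [apply Cexpi_neq0|apply RtoC_neq0, pow_nonzero; lra].
    - field; apply Cexpi_neq0. }
  rewrite E, Cpowr_polar.
  - rewrite Cpowr_nz by auto; fold A.
    rewrite <- Rpower_mult_distr by (auto; apply Rinv_0_lt_compat, pow_lt; auto).
    replace (Rpower (/ r ^ h) (1 / INR h)) with (/ r).
    2:{ rewrite <- pow_inv; symmetry; apply Rpower_pow_root, Rinv_0_lt_compat; auto. }
    replace (1 / INR h * (A + PI - INR h * th)) with (1 / INR h * A + PI / INR h - th) by (field; lra).
    rewrite Cexpi_minus, Cexpi_plus, RtoC_mult, RtoC_inv by lra.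
    field; split; first [apply Cexpi_neq0|apply RtoC_neq0; lra].
  - apply Rmult_lt_0_compat; auto; apply Rinv_0_lt_compat, pow_lt; auto.
  - assert (B := Carg_bound W); fold A in B; unfold in_angle in Hth.
    assert (EI : Im W = - (r ^ h * sin (INR h * th))) by (unfold W; rewrite polar_pow; simpl; ring).
    assert (Pr : 0 < r ^ h) by (apply pow_lt; auto).
    destruct (Rlt_le_dec (INR h * th) PI) as [L|L].
    + assert (0 < sin (INR h * th)) by (apply sin_gt_0; lra).
      assert (A <= 0) by (apply Carg_nonpos; nra); lra.
    + assert (sin (INR h * th) <= 0) by (apply sin_le_0; lra).
      assert (0 <= A) by (apply Carg_nonneg; nra); lra.
Qed.

Lemma delta_neq0_angle (r th : R) : 0 <= r -> in_angle th -> delta h (RtoC r * Cexpi th) <> RtoC 0.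
Proof. intros; apply delta_neq0, regular_angle; auto. Qed.

Lemma polar_neq0 (r th : R) : 0 < r -> (RtoC r * Cexpi th)%C <> RtoC 0.
Proof. intros; apply Cmult_neq_0; [apply RtoC_neq0; lra|apply Cexpi_neq0]. Qed.

Lemma polar_inv (r th : R) : 0 < r -> (RtoC (/ r) * Cexpi (- th))%C = (/ (RtoC r * Cexpi th))%C.
Proof.
  intros; rewrite Cexpi_opp, RtoC_inv by lra; field; split; first [apply Cexpi_neq0|apply RtoC_neq0; lra].
Qed.

(** On the sector, [u delta (1/u) = e^{i PI/h} delta u]; the powers of this relation
    give the constant direction. *)
Lemma integrand_inv (r th : R) : 0 < r -> in_angle th ->
  let u := (RtoC r * Cexpi th)%C in
  (u * integrand a b h u)%C =
  (Cexpi (PI * kappa) * (/ u * integrand b a h (RtoC (/ r) * Cexpi (- th))))%C.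
Proof.
  intros Hr Hth u.
  assert (Hu : u <> RtoC 0) by (apply polar_neq0; auto).
  assert (Hd := delta_neq0_angle r th ltac:(lra) Hth); fold u in Hd.
  assert (D := delta_inv r th Hr Hth); fold u in D.
  set (d' := delta h (RtoC (/ r) * Cexpi (- th))) in *.
  assert (D' : d' = (Cexpi (PI / INR h) * delta h u / u)%C).
  { rewrite <- D; field; auto. }
  unfold integrand; fold d'; rewrite D', polar_inv by auto; fold u.
  unfold Cdiv; rewrite !Cpow_mult_l, !Cpow_inv, Cexpi_pow by auto.
  replace (INR (b + a) * (PI / INR h)) with (PI * kappa).
  2:{ unfold kappa; rewrite (Nat.add_comm b a); field; generalize INR_h_gt0; lra. }
  rewrite (Nat.add_comm b a).
  replace (u ^ (a + b))%C with (u ^ (a - 1) * u * (u ^ (b - 1) * u))%C.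
  2:{ rewrite Cpow_add_r, <- (Cpow_pred u a), <- (Cpow_pred u b) by auto; ring. }
  field; repeat split; auto; try apply Cpow_nz; auto; apply Cexpi_neq0.
Qed.

Lemma apex_sum_radial (r1 r2 th : R) : 0 < r1 <= r2 -> in_angle th ->
  apex_sum r2 th = apex_sum r1 th.
Proof.
  intros Hr Hth; unfold apex_sum.
  assert (E1 : forall r, 0 < r -> ray_int a b h (RtoC r * Cexpi th) 1 = ray_int a b h (Cexpi th) r)
    by (intros r Hr0; apply ray_int_scale; auto; apply regular_angle; auto; lra).
  assert (E2 : forall r, 0 < r -> ray_int b a h (RtoC (/ r) * Cexpi (- th)) 1 = ray_int b a h (Cexpi (- th)) (/ r)).
  { intros r Hr0; assert (0 < / r) by (apply Rinv_0_lt_compat; auto).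
    apply ray_int_scale; auto; apply regular_angle_opp; auto; lra. }
  rewrite !E1, !E2 by lra.
  apply (Pder_const_eq (fun r => ray_int a b h (Cexpi th) r
    + Cexpi (PI * kappa) * ray_int b a h (Cexpi (- th)) (/ r))%C r1 r2); [lra|].
  intros r Hr'; assert (0 < / r) by (apply Rinv_0_lt_compat; lra).
  assert (D1 : Pder (ray_int a b h (Cexpi th)) r (ray_integrand a b h (Cexpi th) r)).
  { apply Pder_ray_int with r; try lra; apply regular_angle; auto; lra. }
  assert (D2 : Pder (ray_int b a h (Cexpi (- th))) (/ r) (ray_integrand b a h (Cexpi (- th)) (/ r))).
  { apply Pder_ray_int with (/ r); try lra; apply regular_angle_opp; auto; lra. }
  assert (D3 : is_derive (fun r => / r) r (- / r ^ 2)) by (auto_derive; [lra|field; lra]).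
  apply Pder_eq with (1 := Pder_plus _ _ _ _ _ D1 (Pder_scal (Cexpi (PI * kappa)) _ _ _ (Pder_comp _ _ _ _ _ D2 D3))).
  assert (I := integrand_inv r th ltac:(lra) Hth); cbv zeta in I.
  unfold ray_integrand.
  assert (Hr0 : RtoC r <> RtoC 0) by (apply RtoC_neq0; lra).
  assert (He := Cexpi_neq0 th).
  replace (Cexpi th * integrand a b h (RtoC r * Cexpi th))%C
    with (RtoC r * Cexpi th * integrand a b h (RtoC r * Cexpi th) / RtoC r)%C by (field; auto).
  rewrite I, Cexpi_opp, RtoC_opp, !RtoC_inv, RtoC_pow by (try apply pow_nonzero; lra).
  field; auto.
Qed.

Lemma apex_sum_angle (th1 th2 : R) : th1 <= th2 -> in_angle th1 -> in_angle th2 ->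
  apex_sum 1 th2 = apex_sum 1 th1.
Proof.
  intros Hle H1 H2; apply (Pder_const_eq (apex_sum 1)); auto.
  intros th Hth.
  assert (Hi : in_angle th) by (unfold in_angle in *; generalize INR_h_gt0; nra).
  assert (D1 := Pder_ray_int_angle 1 th (regular_angle 1 th ltac:(lra) Hi)).
  assert (D2 : Pder (fun y => ray_int b a h (RtoC (/ 1) * Cexpi (- y)) 1) th
    (RtoC (-1) * (Ci * (RtoC (/ 1) * Cexpi (- th)) * integrand b a h (RtoC (/ 1) * Cexpi (- th))))%C).
  { apply (Pder_comp (fun y => ray_int b a h (RtoC (/ 1) * Cexpi y) 1) Ropp).
    - apply Pder_ray_int_angle, regular_angle_opp; auto; lra.
    - auto_derive; auto; ring. }
  apply Pder_eq with (1 := Pder_plus _ _ _ _ _ D1 (Pder_scal (Cexpi (PI * kappa)) _ _ _ D2)).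
  assert (I := integrand_inv 1 th ltac:(lra) Hi); cbv zeta in I.
  rewrite <- Cmult_assoc, I, (polar_inv 1 th) by lra.
  ring.
Qed.

Lemma mid_angle_in : in_angle mid_angle.
Proof.
  unfold in_angle, mid_angle.
  replace (INR h * (PI / INR h)) with PI by (field; generalize INR_h_gt0; lra).
  generalize PI_RGT_0; lra.
Qed.

Lemma INR_h_p : INR h = INR a * INR p.
Proof. rewrite Hp at 1; apply mult_INR. Qed.

Lemma INR_h_q : INR h = INR b * INR q.
Proof. rewrite Hq at 1; apply mult_INR. Qed.

Lemma INR_pos_params : 1 <= INR a /\ 1 <= INR b /\ 2 <= INR p /\ 2 <= INR q.
Proof.
  assert (2 <= p)%nat by apply p_ge_2; assert (2 <= q)%nat by apply q_ge_2.
  refine (conj _ (conj _ (conj _ _)));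
    [apply (le_INR 1)|apply (le_INR 1)|apply (le_INR 2)|apply (le_INR 2)]; lia.
Qed.

Lemma beta0_a : INR a * mid_angle = beta0.
Proof.
  unfold mid_angle; rewrite INR_h_p; field; generalize INR_pos_params; lra.
Qed.

Lemma gamma0_b : INR b * mid_angle = gamma0.
Proof.
  unfold mid_angle; rewrite INR_h_q; field; generalize INR_pos_params; lra.
Qed.

Lemma kappa_angles : PI * kappa = beta0 + gamma0.
Proof.
  rewrite <- beta0_a, <- gamma0_b; unfold kappa, mid_angle; rewrite plus_INR.
  field; generalize INR_h_gt0; lra.
Qed.

Lemma beta0_bounds : 0 < beta0 <= PI / 2.
Proof.
  generalize PI_RGT_0 INR_pos_params; intros HPI [_ [_ [Hp2 _]]]; split.
  - apply Rdiv_lt_0_compat; lra.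
  - apply Rmult_le_compat_l; [lra|apply Rinv_le_contravar; lra].
Qed.

Lemma apex_sum_eq (r th : R) : 0 < r -> in_angle th -> apex_sum r th = apex.
Proof.
  intros Hr Hth; transitivity (apex_sum 1 th).
  - destruct (Rle_lt_dec 1 r); [apply apex_sum_radial|symmetry; apply apex_sum_radial]; auto; lra.
  - unfold apex; destruct (Rle_lt_dec mid_angle th);
      [apply apex_sum_angle|symmetry; apply apex_sum_angle]; auto using mid_angle_in; lra.
Qed.

(** On the bisecting ray [1 - u^h] is positive, so that the integrand has a constant
    direction. *)
Lemma ray_int_mid (s0 : R) : s0 = 1 \/ s0 = -1 -> exists l : R -> R,
  forall x, 0 <= x <= 1 ->
    ray_int a b h (Cexpi (s0 * mid_angle)) x = (RtoC (l x) * Cexpi (s0 * beta0))%C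
    /\ 0 <= l x < rhoh /\ (0 < x -> 0 < l x).
Proof.
  intros Hs; set (u := Cexpi (s0 * mid_angle)).
  assert (Hh := INR_h_gt0).
  assert (Eh : forall x, ((RtoC x * u) ^ h)%C = RtoC (- x ^ h)).
  { intros x; unfold u; rewrite polar_pow.
    replace (INR h * (s0 * mid_angle)) with (s0 * PI) by (unfold mid_angle; field; lra).
    replace (Cexpi (s0 * PI)) with (RtoC (-1)).
    - rewrite <- RtoC_mult; f_equal; ring.
    - destruct Hs as [->| ->]; [rewrite Rmult_1_l|replace (-1 * PI) with (- PI) by ring; rewrite Cexpi_opp];
        rewrite Cexpi_PI; auto.
      rewrite <- RtoC_inv by lra; f_equal; field. }
  set (w := fun x : R => x ^ (a - 1) * Rpower (1 + x ^ h) (- kappa)).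
  assert (Hreg : forall x, 0 <= x -> regular (RtoC x * u)).
  { intros x Hx; apply Re_pos_slit; rewrite Eh; simpl.
    assert (0 <= x ^ h) by (apply pow_le; auto); lra. }
  assert (Hw : forall x, 0 <= x -> ray_integrand a b h u x = (RtoC (w x) * Cexpi (s0 * beta0))%C).
  { intros x Hx; unfold ray_integrand, u.
    rewrite integrand_polar by (apply Hreg; auto).
    fold u; rewrite Eh.
    assert (P : 0 <= x ^ h) by (apply pow_le; auto).
    replace (RtoC 1 - RtoC (- x ^ h))%C with (RtoC (1 + x ^ h) * Cexpi 0)%C
      by (rewrite Cexpi_0, RtoC_opp, RtoC_plus; ring).
    rewrite Cmod_polar, Carg_polar by (generalize PI_RGT_0; lra).
    unfold w; do 2 f_equal; rewrite <- beta0_a; ring. }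
  set (l := fun x => Re (Cexpi (- (s0 * beta0)) * ray_int a b h u x)%C).
  assert (Dl : forall x, 0 <= x <= 1 -> Pder (fun x => Cexpi (- (s0 * beta0)) * ray_int a b h u x)%C x (RtoC (w x))).
  { intros x Hx; apply Pder_eq with (Cexpi (- (s0 * beta0)) * ray_integrand a b h u x)%C.
    - apply Pder_scal, Pder_ray_int_unit; auto.
      replace u with (RtoC 1 * u)%C by ring; apply Hreg; lra.
    - rewrite Hw, Cexpi_opp by lra; field; apply Cexpi_neq0. }
  assert (Hw0 : forall x, 0 <= x -> 0 <= w x)
    by (intros x Hx; apply Rmult_le_pos; [apply pow_le; auto|left; apply exp_pos]).
  assert (Hw1 : forall x, 0 < x -> 0 < w x)
    by (intros x Hx; apply Rmult_lt_0_compat; [apply pow_lt; auto|apply exp_pos]).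
  assert (l0 : l 0 = 0) by (unfold l; rewrite ray_int_0, Cmult_0_r; reflexivity).
  assert (lmono : forall x y, 0 <= x -> x < y -> y <= 1 -> l x < l y).
  { intros x y H1 H2 H3; apply is_derive_incr_strict with w; auto; intros t Ht;
      [apply (Dl t); lra|apply Hw0; lra|apply Hw1; lra]. }
  (* the modulus of the integrand is smaller than on the positive reals *)
  assert (wF : forall t, 0 <= t < 1 -> w t <= Fr a b h t /\ (0 < t -> w t < Fr a b h t)).
  { intros t Ht; unfold Fr, w; rewrite dr_pow_ab, Rpower_Ropp.
    assert (Pt2 := one_minus_pow_pos t ltac:(lra)).
    assert (K := kappa_bounds (U := U)).
    split.
    - apply Rmult_le_compat_l; [apply pow_le; lra|].
      apply Rinv_le_contravar; [apply exp_pos|apply Rle_Rpower_l; [lra|]].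
      assert (0 <= t ^ h) by (apply pow_le; lra); lra.
    - intros Ht0; apply Rmult_lt_compat_l; [apply pow_lt; lra|].
      apply Rinv_lt_contravar; [apply Rmult_lt_0_compat; apply exp_pos|].
      apply Rlt_Rpower_l; [lra|]; assert (0 < t ^ h) by (apply pow_lt; lra); lra. }
  assert (gap : forall x y, 0 <= x -> x < y -> y < 1 -> Jr x - l x < Jr y - l y).
  { intros x y H1 H2 H3.
    apply (is_derive_incr_strict (fun x => Jr x - l x) (fun x => Fr a b h x - w x)); auto.
    - intros t Ht; apply is_derive_Rminus; [apply is_derive_Jr; lra|apply (Dl t); lra].
    - intros t Ht; generalize (proj1 (wF t ltac:(lra))); lra.
    - intros t Ht; generalize (proj2 (wF t ltac:(lra)) ltac:(lra)); lra. }
  assert (g0 := gap 0 (1 / 2) ltac:(lra) ltac:(lra) ltac:(lra)); rewrite l0, Jr_0 in g0.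
  set (c := Jr (1 / 2) - l (1 / 2)) in *.
  assert (l1 : l 1 <= rhoh - c).
  { apply (left_limit_le l 1 (w 1) (1 / 2) (rhoh - c)); [apply (Dl 1); lra|lra|].
    intros x Hx; assert (Jx := Jr_lt_rhoh x ltac:(lra)).
    destruct (Req_dec x (1 / 2)) as [->|Hx2]; [unfold c; lra|].
    generalize (gap (1 / 2) x ltac:(lra) ltac:(lra) ltac:(lra)); unfold c; lra. }
  exists l; intros x Hx; split; [|split; [split|]].
  - assert (E : (Cexpi (- (s0 * beta0)) * ray_int a b h u x)%C = RtoC (l x)).
    { apply C_eq; [reflexivity|].
      transitivity (Im (Cexpi (- (s0 * beta0)) * ray_int a b h u 0)%C).
      - apply (is_derive_const_eq (fun x => Im (Cexpi (- (s0 * beta0)) * ray_int a b h u x)%C) 0 x); [lra|].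
        intros t Ht; apply (Dl t); lra.
      - rewrite ray_int_0, Cmult_0_r; reflexivity. }
    rewrite <- E, Cexpi_opp; field; apply Cexpi_neq0.
  - destruct (Req_dec x 0) as [->|]; [lra|]; rewrite <- l0; left; apply lmono; lra.
  - apply Rle_lt_trans with (l 1); [|lra].
    destruct (Req_dec x 1) as [->|]; [lra|]; left; apply lmono; lra.
  - intros H; rewrite <- l0; apply lmono; lra.
Qed.

End Apex.

(** * The shape of the kite *)

Lemma left_limit_Cmod_le (f : R -> C) (d c : C) (x0 x1 M : R) : 0 <= M -> Pder f x1 d -> x0 < x1 ->
  (forall x, x0 <= x < x1 -> Cmod (f x - c) <= M) -> Cmod (f x1 - c) <= M.
Proof.
  intros HM [D1 D2] Hx H; set (w := (f x1 - c)%C).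
  destruct (Req_dec (Cmod w) 0) as [E|E]; [rewrite E; auto|].
  assert (Hw : 0 < Cmod w) by (generalize (Cmod_ge_0 w); lra).
  assert (K : Re w * (Re (f x1) - Re c) + Im w * (Im (f x1) - Im c) <= Cmod w * M).
  { apply (left_limit_le (fun x => Re w * (Re (f x) - Re c) + Im w * (Im (f x) - Im c)) x1
      (Re w * (Re d - 0) + Im w * (Im d - 0)) x0); auto.
    - apply is_derive_Rplus; apply is_derive_scal, is_derive_Rminus; auto using is_derive_cst.
    - intros x Hx'; specialize (H x Hx').
      apply Rle_trans with (1 := Re_mult_conj_le w (f x - c)%C), Rmult_le_compat_l; lra. }
  assert (E2 : Cmod w * Cmod w = Re w * (Re (f x1) - Re c) + Im w * (Im (f x1) - Im c)).
  { replace (Cmod w * Cmod w) with (Cmod w ^ 2) by ring; rewrite Cmod_sqr.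
    unfold w; simpl; unfold Re, Im; ring. }
  apply Rmult_le_reg_l with (Cmod w); auto; lra.
Qed.

Section Shape.

Context {a b h p q : nat} {U : urn a b h p q}.

Let Ha : (0 < a)%nat. Proof. apply U. Qed.
Let Hb : (0 < b)%nat. Proof. apply U. Qed.
Let Hab : (a + b < h)%nat. Proof. apply U. Qed.

Local Notation regular := (regular h).
Local Notation rhoh := (rhoh a b h).
Local Notation Jr := (Jr a b h).

(** The integral along a ray close to the positive reals is close to [rho]: the
    part near the endpoint is small uniformly in the angle because the modulus
    of the integrand is largest on the positive reals. *)
Lemma ray_int_near_rho (eps : R) : 0 < eps -> exists eta, 0 < eta /\
  forall th, Rabs th < eta -> regular (Cexpi th) ->
    Cmod (ray_int a b h (Cexpi th) 1 - RtoC rhoh) <= eps.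
Proof.
  intros He; destruct rhoh_spec as [_ [HJ HR]].
  destruct (HR (rhoh - eps / 3)) as [r0 [Hr0 Hr0']]; [lra|].
  set (r := (r0 + 1) / 2); assert (Hr : 0 < r < 1 /\ r0 <= r) by (unfold r; lra).
  assert (HJr : rhoh - eps / 3 < Jr r) by (apply Rlt_le_trans with (1 := Hr0'), Jr_incr; lra).
  assert (Hreg : forall th, regular (RtoC r * Cexpi th)).
  { intros th; apply regular_unit; rewrite Cmod_polar; lra. }
  assert (Hsc : forall th, ray_int a b h (RtoC r * Cexpi th) 1 = ray_int a b h (Cexpi th) r)
    by (intros th; apply ray_int_scale; auto; lra).
  assert (D := Pder_ray_int_angle r 0 (Hreg 0)).
  set (d := (Ci * (RtoC r * Cexpi 0) * integrand a b h (RtoC r * Cexpi 0))%C) in D.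
  destruct (proj1 (Pder_expand _ _ _) D 1 Rlt_0_1) as [del [Hdel K]].
  assert (Hd0 := Cmod_ge_0 d).
  exists (Rmin del (eps / 3 / (1 + Cmod d))); split.
  { apply Rmin_pos; auto; repeat apply Rdiv_lt_0_compat; lra. }
  intros th Hth Rth.
  assert (Hth1 := Rlt_le_trans _ _ _ Hth (Rmin_l _ _)).
  assert (Hth2 := Rlt_le_trans _ _ _ Hth (Rmin_r _ _)).
  specialize (K th Hth1); rewrite Rplus_0_l, !Hsc, Cexpi_0, ray_int_real in K by lra.
  assert (K1 : Cmod (ray_int a b h (Cexpi th) r - RtoC (Jr r)) <= eps / 3).
  { replace (ray_int a b h (Cexpi th) r - RtoC (Jr r))%C
      with ((ray_int a b h (Cexpi th) r - RtoC (Jr r) - RtoC th * d) + RtoC th * d)%C by ring.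
    apply Rle_trans with (1 := Cmod_triangle _ _); rewrite Cmod_mult, Cmod_R.
    assert (Rabs th * (1 + Cmod d) <= eps / 3); [|lra].
    apply Rle_trans with (eps / 3 / (1 + Cmod d) * (1 + Cmod d)); [|right; field; lra].
    apply Rmult_le_compat_r; lra. }
  assert (K2 : Cmod (ray_int a b h (Cexpi th) 1 - ray_int a b h (Cexpi th) r) <= eps / 3).
  { apply (left_limit_Cmod_le (ray_int a b h (Cexpi th)) (ray_integrand a b h (Cexpi th) 1) _ r); try lra.
    - apply Pder_ray_int_unit; auto; lra.
    - intros x Hx.
      assert (L := ray_int_le (a := a) (b := b) (h := h) (Cexpi th) r x); rewrite Cmod_Cexpi, !Rmult_1_r in L.
      apply Rle_trans with (Jr x - Jr r); [|generalize (HJ x ltac:(lra)); lra].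
      apply L; try lra; intros v Hv; apply regular_ray; auto; lra. }
  assert (K3 : Cmod (RtoC (Jr r) - RtoC rhoh) <= eps / 3).
  { rewrite <- RtoC_minus, Cmod_R, Rabs_left1; [|generalize (HJ r ltac:(lra))]; lra. }
  replace (ray_int a b h (Cexpi th) 1 - RtoC rhoh)%C with
    ((ray_int a b h (Cexpi th) 1 - ray_int a b h (Cexpi th) r)
     + ((ray_int a b h (Cexpi th) r - RtoC (Jr r)) + (RtoC (Jr r) - RtoC rhoh)))%C by ring.
  apply Rle_trans with (1 := Cmod_triangle _ _).
  assert (T := Cmod_triangle (ray_int a b h (Cexpi th) r - RtoC (Jr r)) (RtoC (Jr r) - RtoC rhoh)).
  lra.
Qed.

End Shape.

Section Shape2.

Context {a b h p q : nat} {U : urn a b h p q}.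

Let Ha : (0 < a)%nat. Proof. apply U. Qed.
Let Hb : (0 < b)%nat. Proof. apply U. Qed.
Let Hab : (a + b < h)%nat. Proof. apply U. Qed.

Local Notation regular := (regular h).
Local Notation kappa := (kappa a b h).
Local Notation in_angle := (in_angle h).
Local Notation mid_angle := (mid_angle h).
Local Notation apex := (apex a b h).
Local Notation beta0 := (PI / INR p).
Local Notation gamma0 := (PI / INR q).

(** Let [u] tend to 1 along the unit circle. *)
Lemma apex_rho : apex = (RtoC (rhoh a b h) + Cexpi (PI * kappa) * RtoC (rhoh b a h))%C.
Proof.
  assert (Z : forall z : C, (forall eps, 0 < eps -> Cmod z <= eps) -> z = RtoC 0).
  { intros z Hz; apply Cmod_eq_0; destruct (Req_dec (Cmod z) 0) as [|N]; auto.
    generalize (Cmod_ge_0 z) (Hz (Cmod z / 2)); lra. }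
  assert (E : (apex - (RtoC (rhoh a b h) + Cexpi (PI * kappa) * RtoC (rhoh b a h)))%C = RtoC 0).
  { apply Z; intros eps He.
    destruct (ray_int_near_rho (U := U) (eps / 2)) as [e1 [He1 K1]]; [lra|].
    destruct (ray_int_near_rho (U := urn_swap a b h p q U) (eps / 2)) as [e2 [He2 K2]]; [lra|].
    assert (Hh := INR_h_gt0 (U := U)); assert (HPI := PI_RGT_0).
    set (th := Rmin (PI / INR h) (Rmin (e1 / 2) (e2 / 2))).
    assert (Hth0 : 0 < th) by (repeat apply Rmin_pos; try lra; apply Rdiv_lt_0_compat; lra).
    assert (Hth1 : th <= PI / INR h) by apply Rmin_l.
    assert (Hth2 : th <= e1 / 2) by (eapply Rle_trans; [apply Rmin_r|apply Rmin_l]).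
    assert (Hth3 : th <= e2 / 2) by (eapply Rle_trans; [apply Rmin_r|apply Rmin_r]).
    assert (Hi : in_angle th).
    { split; [apply Rmult_lt_0_compat; auto|].
      apply Rle_lt_trans with (INR h * (PI / INR h)); [apply Rmult_le_compat_l; lra|].
      replace (INR h * (PI / INR h)) with PI by (field; lra); lra. }
    rewrite <- (apex_sum_eq 1 th) by (auto; lra).
    unfold apex_sum; rewrite Rinv_1, !Cmult_1_l.
    specialize (K1 th ltac:(rewrite Rabs_pos_eq; lra)).
    specialize (K2 (- th) ltac:(rewrite Rabs_Ropp, Rabs_pos_eq; lra)).
    assert (R1 := regular_angle 1 th Rle_0_1 Hi); assert (R2 := regular_angle_opp 1 th Rle_0_1 Hi).
    rewrite Cmult_1_l in R1, R2; specialize (K1 R1); specialize (K2 R2).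
    replace (ray_int a b h (Cexpi th) 1 + Cexpi (PI * kappa) * ray_int b a h (Cexpi (- th)) 1
      - (RtoC (rhoh a b h) + Cexpi (PI * kappa) * RtoC (rhoh b a h)))%C
      with ((ray_int a b h (Cexpi th) 1 - RtoC (rhoh a b h))
        + Cexpi (PI * kappa) * (ray_int b a h (Cexpi (- th)) 1 - RtoC (rhoh b a h)))%C by ring.
    apply Rle_trans with (1 := Cmod_triangle _ _); rewrite Cmod_mult, Cmod_Cexpi; lra. }
  replace apex with (apex - (RtoC (rhoh a b h) + Cexpi (PI * kappa) * RtoC (rhoh b a h))
    + (RtoC (rhoh a b h) + Cexpi (PI * kappa) * RtoC (rhoh b a h)))%C by ring.
  rewrite E; ring.
Qed.

(** On the bisecting ray, at [|u| = 1], both terms of the sum have the direction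
    [e^{i beta0}]. *)
Lemma apex_polar : exists L, 0 < L /\ apex = (RtoC L * Cexpi beta0)%C.
Proof.
  destruct (ray_int_mid (U := U) 1) as [l1 K1]; [auto|].
  destruct (ray_int_mid (U := urn_swap a b h p q U) (-1)) as [l2 K2]; [auto|].
  destruct (K1 1) as [E1 [_ P1]]; [lra|]; destruct (K2 1) as [E2 [_ P2]]; [lra|].
  exists (l1 1 + l2 1); split; [specialize (P1 Rlt_0_1); specialize (P2 Rlt_0_1); lra|].
  unfold apex, apex_sum; rewrite Rinv_1, !Cmult_1_l.
  replace (1 * mid_angle) with mid_angle in E1 by ring.
  replace (-1 * mid_angle) with (- mid_angle) in E2 by ring.
  rewrite E1, E2, Rmult_1_l, kappa_angles, Cexpi_plus, RtoC_plus.
  replace (-1 * gamma0) with (- gamma0) by ring; rewrite Cexpi_opp.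
  field; apply Cexpi_neq0.
Qed.

(** Directions along the integration path stay in the upper half-plane. *)
Lemma Im_ray_int_nonneg (r th : R) : 0 < r -> 0 < INR h * th <= PI ->
  0 <= Im (ray_int a b h (RtoC r * Cexpi th) 1).
Proof.
  intros Hr Hth; set (u := (RtoC r * Cexpi th)%C).
  assert (Hi : in_angle th) by (unfold in_angle; generalize PI_RGT_0; lra).
  assert (Hreg : regular u) by (apply regular_angle; auto; lra).
  replace 0 with (Im (ray_int a b h u 0)) by (rewrite ray_int_0; reflexivity).
  apply (is_derive_incr (fun x => Im (ray_int a b h u x)) (fun x => Im (ray_integrand a b h u x))); [lra| |].
  - intros t Ht; apply (Pder_ray_int_unit u t); auto.
  - intros t Ht; unfold ray_integrand, u.
    replace (RtoC t * (RtoC r * Cexpi th))%C with (RtoC (t * r) * Cexpi th)%C by (rewrite RtoC_mult; ring).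
    assert (Htr : 0 <= t * r) by (apply Rmult_le_pos; lra).
    rewrite <- Cmult_assoc, integrand_polar by (apply regular_angle; auto).
    set (A := Carg _).
    assert (HA : INR h * th - PI <= A <= 0).
    { unfold A; rewrite polar_pow; apply Carg_one_minus; auto; apply pow_le; auto. }
    set (w := (t * r) ^ (a - 1) * _).
    assert (Hw : 0 <= w) by (apply Rmult_le_pos; [apply pow_le; auto|left; apply exp_pos]).
    replace (Im (RtoC r * (RtoC w * Cexpi (INR a * th - kappa * A)))%C)
      with (r * w * sin (INR a * th - kappa * A)) by (simpl; ring).
    apply Rmult_le_pos; [apply Rmult_le_pos; [lra|exact Hw]|].
    assert (K := kappa_bounds (U := U)); assert (Hh := INR_h_gt0 (U := U)).
    assert (Hp := INR_pos_params (U := U)); destruct Hp as [A1 [B1 _]].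
    assert (Hth0 : 0 < th) by (apply Rmult_lt_reg_l with (INR h); lra).
    assert (Ek : kappa * INR h = INR a + INR b) by (unfold kappa; rewrite plus_INR; field; lra).
    assert (F1 : kappa * (INR h * th - PI) <= kappa * A) by (apply Rmult_le_compat_l; lra).
    assert (F2 : kappa * A <= 0) by nra.
    assert (F3 : 0 <= INR a * th) by nra; assert (F4 : 0 <= INR b * th) by nra.
    assert (F5 : kappa * PI <= PI) by (generalize PI_RGT_0; nra).
    assert (F6 : kappa * (INR h * th) = INR a * th + INR b * th) by (rewrite <- Rmult_assoc, Ek; ring).
    apply sin_ge_0; lra.
Qed.

(** Moving [u] along a circle towards the bisecting ray moves the integral away
    from the positive real side of the line of argument [beta0]. *)
Lemma Im_rot_ray_int_nonpos (r th : R) : 0 < r -> 0 < INR h * th <= PI ->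
  Im (Cexpi (- beta0) * ray_int a b h (RtoC r * Cexpi th) 1)%C <= 0.
Proof.
  intros Hr Hth.
  assert (K := kappa_bounds (U := U)); assert (Hh := INR_h_gt0 (U := U)).
  assert (Hp := INR_pos_params (U := U)); destruct Hp as [A1 [B1 [P1 Q1]]].
  assert (Ek : kappa * INR h = INR a + INR b) by (unfold kappa; rewrite plus_INR; field; lra).
  assert (Em : INR h * mid_angle = PI) by (unfold mid_angle; field; lra).
  assert (HPI := PI_RGT_0).
  assert (Hle : th <= mid_angle) by (apply Rmult_le_reg_l with (INR h); lra).
  assert (E0 : Im (Cexpi (- beta0) * ray_int a b h (RtoC r * Cexpi mid_angle) 1)%C = 0).
  { assert (Hreg := regular_angle r mid_angle ltac:(lra) mid_angle_in).
    transitivity (Im (Cexpi (- beta0) * ray_int a b h (RtoC r * Cexpi mid_angle) 0)%C);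
      [|rewrite ray_int_0, Cmult_0_r; reflexivity].
    apply (is_derive_const_eq (fun x => Im (Cexpi (- beta0) * ray_int a b h (RtoC r * Cexpi mid_angle) x)%C) 0 1);
      [lra|].
    intros t Ht.
    assert (D := Pder_scal (Cexpi (- beta0)) _ _ _ (Pder_ray_int_unit _ t Hreg Ht)).
    apply is_derive_eq with (1 := proj2 D).
    unfold ray_integrand.
    replace (RtoC t * (RtoC r * Cexpi mid_angle))%C with (RtoC (t * r) * Cexpi mid_angle)%C by (rewrite RtoC_mult; ring).
    assert (Htr : 0 <= t * r) by (apply Rmult_le_pos; lra).
    rewrite <- Cmult_assoc, integrand_polar by (apply regular_angle; [exact Htr|exact (mid_angle_in (U := U))]).
    assert (B := Carg_one_minus ((t * r) ^ h) PI ltac:(apply pow_le; auto) ltac:(lra)).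
    rewrite polar_pow, Em.
    set (A := Carg _) in B; assert (EA : A = 0) by (clear - B; lra).
    fold A; rewrite EA.
    set (w := (t * r) ^ (a - 1) * _).
    rewrite Rmult_0_r, Rminus_0_r, beta0_a, Cexpi_opp.
    replace (/ Cexpi beta0 * (RtoC r * (RtoC w * Cexpi beta0)))%C with (RtoC (r * w))
      by (rewrite RtoC_mult; field; apply Cexpi_neq0).
    reflexivity. }
  rewrite <- E0.
  set (dI := fun y => (Ci * (RtoC r * Cexpi y) * integrand a b h (RtoC r * Cexpi y))%C).
  apply (is_derive_incr (fun y => Im (Cexpi (- beta0) * ray_int a b h (RtoC r * Cexpi y) 1)%C)
    (fun y => Im (Cexpi (- beta0) * dI y)%C)); auto.
  - intros y Hy.
    assert (Hi : in_angle y) by (unfold in_angle; nra).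
    apply (Pder_scal (Cexpi (- beta0)) _ _ _ (Pder_ray_int_angle r y (regular_angle r y ltac:(lra) Hi))).
  - intros y Hy; unfold dI.
    assert (Hth0 : 0 < th) by (apply Rmult_lt_reg_l with (INR h); lra).
    assert (Hi : in_angle y) by (unfold in_angle; nra).
    replace (Ci * (RtoC r * Cexpi y) * integrand a b h (RtoC r * Cexpi y))%C
      with (Ci * RtoC r * (Cexpi y * integrand a b h (RtoC r * Cexpi y)))%C by ring.
    rewrite integrand_polar by (apply regular_angle; auto; lra).
    set (A := Carg _).
    assert (HA : INR h * y - PI <= A <= 0).
    { unfold A; rewrite polar_pow; apply Carg_one_minus; [apply pow_le; lra|nra]. }
    set (w := r ^ (a - 1) * _).
    assert (Hw : 0 <= w) by (apply Rmult_le_pos; [apply pow_le; lra|left; apply exp_pos]).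
    replace (Cexpi (- beta0) * (Ci * RtoC r * (RtoC w * Cexpi (INR a * y - kappa * A))))%C
      with (Ci * RtoC r * RtoC w * (Cexpi (INR a * y - kappa * A) * Cexpi (- beta0)))%C by ring.
    rewrite <- Cexpi_plus.
    replace (Im _) with (r * w * cos (INR a * y - kappa * A + - beta0)) by (simpl; ring).
    apply Rmult_le_pos; [apply Rmult_le_pos; [lra|exact Hw]|].
    assert (Eb := beta0_a (U := U)); assert (Eg := gamma0_b (U := U)); assert (Ekk := kappa_angles (U := U)).
    assert (Bb := beta0_bounds (U := U)); assert (Bg := beta0_bounds (U := urn_swap a b h p q U)).
    assert (F1 : kappa * (INR h * y - PI) <= kappa * A) by (apply Rmult_le_compat_l; lra).
    assert (F2 : kappa * A <= 0) by nra.
    assert (F3 : 0 <= INR a * y) by nra; assert (F4 : 0 <= INR b * y) by nra.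
    assert (F6 : kappa * (INR h * y) = INR a * y + INR b * y) by (rewrite <- Rmult_assoc, Ek; ring).
    apply cos_ge_0; lra.
Qed.

End Shape2.

(** * Continuation along segments from the origin *)

Definition Copen (V : C -> Prop) : Prop := forall z, V z -> near z V.

Definition star (V : C -> Prop) : Prop :=
  forall z t, V z -> 0 <= t <= 1 -> V (RtoC t * z)%C.

Lemma near_imp (z : C) (P Q : C -> Prop) : (forall w, P w -> Q w) -> near z P -> near z Q.
Proof. intros H [eps [He K]]; exists eps; split; auto. Qed.

Lemma near_and (z : C) (P Q : C -> Prop) : near z P -> near z Q -> near z (fun w => P w /\ Q w).
Proof.
  intros [e1 [He1 K1]] [e2 [He2 K2]]; exists (Rmin e1 e2); split; [apply Rmin_pos; auto|].
  intros w Hw; split; [apply K1|apply K2]; apply Rlt_le_trans with (1 := Hw); [apply Rmin_l|apply Rmin_r].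
Qed.

Lemma near_self (z : C) (P : C -> Prop) : near z P -> P z.
Proof.
  intros [eps [He K]]; apply K; replace (z - z)%C with (RtoC 0) by ring; rewrite Cmod_0; auto.
Qed.

Lemma near_disc (c z : C) (r : R) : Cmod (z - c) < r -> near z (fun w => Cmod (w - c) < r).
Proof.
  intros H; exists (r - Cmod (z - c)); split; [lra|]; intros w Hw.
  replace (w - c)%C with ((w - z) + (z - c))%C by ring.
  apply Rle_lt_trans with (1 := Cmod_triangle _ _); lra.
Qed.

Lemma near_disc0 (z : C) (r : R) : Cmod z < r -> near z (fun w => Cmod w < r).
Proof.
  intros H; assert (K := near_disc (RtoC 0) z r).
  replace (z - RtoC 0)%C with z in K by ring; apply near_imp with (2 := K H).
  intros w Hw; replace w with (w - RtoC 0)%C by ring; auto.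
Qed.

Lemma Gder_ext_near (f g : C -> C) (z d : C) : near z (fun w => f w = g w) -> Gder f z d -> Gder g z d.
Proof.
  intros [eps [He K]] H v.
  assert (Hv := Cmod_ge_0 v).
  apply Pder_ext_loc with (3 := H v) (eps := eps / (1 + Cmod v)); [apply Rdiv_lt_0_compat; lra|].
  intros x Hx; rewrite Rminus_0_r in Hx; apply K.
  replace (z + RtoC x * v - z)%C with (RtoC x * v)%C by ring.
  rewrite Cmod_mult, Cmod_R.
  apply Rle_lt_trans with (Rabs x * (1 + Cmod v)); [generalize (Rabs_pos x); nra|].
  apply Rmult_lt_reg_r with (/ (1 + Cmod v)); [apply Rinv_0_lt_compat; lra|].
  rewrite Rmult_assoc, Rinv_r by lra; unfold Rdiv in Hx; lra.
Qed.

Lemma Gder_affine_comp (f : C -> C) (k c c0 z d : C) : Gder f (c0 + c * z) d ->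
  Gder (fun w => k * f (c0 + c * w))%C z (k * (c * d))%C.
Proof.
  intros H v; apply Pder_eq with (k * (c * v * d))%C; [|ring].
  apply Pder_scal; apply Pder_ext with (2 := H (c * v)%C).
  intros x; f_equal; ring.
Qed.

Lemma solves_ext_near (ca cb : R) (m n : nat) (f g f' g' : C -> C) (z : C) :
  near z (fun w => f w = f' w /\ g w = g' w) -> solves ca cb m n f g z -> solves ca cb m n f' g' z.
Proof.
  intros H [D1 D2].
  destruct (near_self z _ H) as [E1 E2]; rewrite E2 in D1; rewrite E1 in D2; split.
  - apply Gder_ext_near with (2 := D1); apply near_imp with (2 := H); intros w Hw; apply Hw.
  - apply Gder_ext_near with (2 := D2); apply near_imp with (2 := H); intros w Hw; apply Hw.
Qed.

Lemma analytic_at_ext_near (f g : C -> C) (z : C) : near z (fun w => f w = g w) ->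
  analytic_at f z -> analytic_at g z.
Proof.
  intros H [c Hc]; exists c.
  apply near_imp with (2 := near_and z _ _ H Hc); intros w [E K]; rewrite <- E; exact K.
Qed.

(** A solution issued from the initial data of [psi] on a domain that is
    star-shaped with respect to the origin. *)
Definition star_solution (a b p q : nat) (V : C -> Prop) (f g : C -> C) : Prop :=
  Copen V /\ star V /\ f (RtoC 0) = RtoC 0 /\ g (RtoC 0) = RtoC 1 /\
  forall z, V z -> solves (INR a) (INR b) (q - 1) (p - 1) f g z.

Definition reachable (a b p q : nat) (z : C) : Prop :=
  exists V f g, star_solution a b p q V f g /\ V z.

(** The continuation of the germ at 0 along segments; all star solutions agree,
    so that the choice of one of them is immaterial. *)
Definition continuation (a b p q : nat) (z : C) : C :=
  epsilon (inhabits (RtoC 0))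
    (fun v => exists V f g, star_solution a b p q V f g /\ V z /\ v = f z).

Lemma star_solution_unique (a b p q : nat) (V1 V2 : C -> Prop) (f1 g1 f2 g2 : C -> C) (z : C) :
  star_solution a b p q V1 f1 g1 -> star_solution a b p q V2 f2 g2 -> V1 z -> V2 z ->
  f1 z = f2 z /\ g1 z = g2 z.
Proof.
  intros [_ [S1 [A1 [B1 H1]]]] [_ [S2 [A2 [B2 H2]]]] Z1 Z2.
  assert (E : forall t, (RtoC 0 + RtoC t * (z - RtoC 0))%C = (RtoC t * z)%C) by (intros t; ring).
  apply (segment_unique (INR a) (INR b) (q - 1) (p - 1) f1 g1 f2 g2 (RtoC 0) z).
  - intros t Ht; rewrite E; apply H1, S1; auto.
  - intros t Ht; rewrite E; apply H2, S2; auto.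
  - rewrite A1, A2; auto.
  - rewrite B1, B2; auto.
Qed.

Lemma continuation_eq (a b p q : nat) (V : C -> Prop) (f g : C -> C) (z : C) :
  star_solution a b p q V f g -> V z -> continuation a b p q z = f z.
Proof.
  intros HS HV.
  destruct (epsilon_spec (inhabits (RtoC 0))
    (fun v => exists V f g, star_solution a b p q V f g /\ V z /\ v = f z)) as [V' [f' [g' [S' [HV' E]]]]].
  - exists (f z), V, f, g; auto.
  - unfold continuation; rewrite E.
    apply (star_solution_unique a b p q V' V f' g' f g z); auto.
Qed.

Section Reach.

Context {a b h p q : nat} {U : urn a b h p q}.

Let Ha : (0 < a)%nat. Proof. apply U. Qed.
Let Hb : (0 < b)%nat. Proof. apply U. Qed.
Let Hab : (a + b < h)%nat. Proof. apply U. Qed.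

Local Notation rhoh := (rhoh a b h).
Local Notation sys := (solves (INR a) (INR b) (q - 1) (p - 1)).
Local Notation reachable := (reachable a b p q).
Local Notation continuation := (continuation a b p q).
Local Notation star_solution := (star_solution a b p q).
Local Notation X0 := (X0 a b p q).
Local Notation Y0 := (Y0 a b p q).

Lemma continuation_analytic (z : C) : reachable z -> analytic_at continuation z.
Proof.
  intros [V [f [g [HS HV]]]].
  assert (N : near z V) by (apply HS; auto).
  apply analytic_at_ext_near with f.
  - apply near_imp with (2 := N); intros w Hw; symmetry; apply continuation_eq with V g; auto.
  - apply solves_analytic with g.
    apply near_imp with (2 := N); intros w Hw; apply HS; auto.
Qed.

(** The system is invariant under [(z, X, Y) -> (om z, om X, Y)] when [om^p = 1]. *)
Lemma star_solution_rot (V : C -> Prop) (f g : C -> C) (om : C) :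
  Cmod om = 1 -> (om ^ p)%C = RtoC 1 -> star_solution V f g ->
  star_solution (fun z => V (/ om * z)%C) (fun z => om * f (/ om * z))%C (fun z => g (/ om * z)%C).
Proof.
  intros Hm Hom [O1 [S1 [A1 [B1 H1]]]].
  assert (Hz : om <> RtoC 0) by (apply Cmod_gt_0; lra).
  assert (Hmi : Cmod (/ om) = 1) by (rewrite Cmod_inv, Hm by auto; field).
  refine (conj _ (conj _ (conj _ (conj _ _)))).
  - intros z Hz'; destruct (O1 _ Hz') as [eps [He K]]; exists eps; split; auto.
    intros w Hw; apply K; replace (/ om * w - / om * z)%C with (/ om * (w - z))%C by ring.
    rewrite Cmod_mult, Hmi, Rmult_1_l; auto.
  - intros z t Hz' Ht; replace (/ om * (RtoC t * z))%C with (RtoC t * (/ om * z))%C by ring.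
    apply S1; auto.
  - replace (/ om * RtoC 0)%C with (RtoC 0) by ring; rewrite A1; ring.
  - replace (/ om * RtoC 0)%C with (RtoC 0) by ring; auto.
  - intros z Hz'; destruct (H1 _ Hz') as [D1 D2]; split.
    + assert (D := Gder_affine_comp f om (/ om)%C (RtoC 0) z).
      intros v; apply Pder_eq with (v * (om * (/ om * (RtoC (INR a) * g (/ om * z) ^ (q - 1)))))%C;
        [|field; auto].
      apply Pder_ext with (fun t => om * f (RtoC 0 + / om * (z + RtoC t * v)))%C.
      * intros x; do 2 f_equal; ring.
      * apply D; replace (RtoC 0 + / om * z)%C with (/ om * z)%C by ring; auto.
    + assert (D := Gder_affine_comp g (RtoC 1) (/ om)%C (RtoC 0) z).
      intros v.
      apply Pder_eq with (v * (RtoC 1 * (/ om * (RtoC (INR b) * f (/ om * z) ^ (p - 1)))))%C.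
      * apply Pder_ext with (fun t => RtoC 1 * g (RtoC 0 + / om * (z + RtoC t * v)))%C.
        { intros x; rewrite Cmult_1_l; f_equal; ring. }
        apply D; replace (RtoC 0 + / om * z)%C with (/ om * z)%C by ring; auto.
      * rewrite Cpow_mult_l.
        assert (E : (om ^ (p - 1))%C = (/ om)%C).
        { assert (E1 : (om * om ^ (p - 1))%C = RtoC 1)
            by (rewrite Cpow_pred; [auto|generalize (p_ge_2 (U := U)); lia]).
          replace (om ^ (p - 1))%C with (/ om * (om * om ^ (p - 1)))%C by (field; auto).
          rewrite E1; ring. }
        rewrite E; ring.
Qed.

Lemma reachable_rot (z om : C) : Cmod om = 1 -> (om ^ p)%C = RtoC 1 -> reachable z ->
  reachable (om * z) /\ continuation (om * z)%C = (om * continuation z)%C.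
Proof.
  intros Hm Hom [V [f [g [HS HV]]]].
  assert (Hz : om <> RtoC 0) by (apply Cmod_gt_0; lra).
  assert (HS' := star_solution_rot V f g om Hm Hom HS).
  assert (E : (/ om * (om * z))%C = z) by (field; auto).
  split.
  - eexists _, _, _; split; [exact HS'|]; cbv beta; rewrite E; auto.
  - rewrite (continuation_eq _ _ _ _ _ _ _ _ HS') by (rewrite E; auto).
    rewrite E, (continuation_eq _ _ _ _ _ _ _ _ HS HV); reflexivity.
Qed.

Lemma disc_star_solution : star_solution (fun z => Cmod z < rhoh) X0 Y0.
Proof.
  refine (conj _ (conj _ (conj _ (conj _ _)))).
  - intros z Hz; apply near_disc0; auto.
  - intros z t Hz Ht; rewrite Cmod_mult, Cmod_RtoC_pos by lra; generalize (Cmod_ge_0 z); nra.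
  - apply X0_0.
  - apply Y0_0.
  - intros z Hz; apply Csolves_solves, basic_Csolves; auto.
Qed.

Lemma disc_reachable (z : C) : Cmod z < rhoh -> reachable z /\ continuation z = X0 z.
Proof.
  intros Hz; split.
  - eexists _, _, _; split; [exact disc_star_solution|auto].
  - apply (continuation_eq _ _ _ _ _ _ _ _ disc_star_solution Hz).
Qed.

Lemma solves_near_disc (z : C) : Cmod z < rhoh -> sys X0 Y0 z.
Proof. intros Hz; apply Csolves_solves, basic_Csolves; auto. Qed.

(** Continuation beyond the disc: the two solutions paste together because they agree
    on the overlap. *)
Lemma glue_star_solution (V : C -> Prop) (f g : C -> C) :
  Copen V -> star (fun z => Cmod z < rhoh \/ V z) ->
  (forall z, V z -> sys f g z) ->
  (forall z, V z -> Cmod z < rhoh -> f z = X0 z /\ g z = Y0 z) ->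
  forall z, V z -> reachable z /\ continuation z = f z.
Proof.
  intros HO Hst HS Hag.
  set (F := fun z => if Rlt_dec (Cmod z) rhoh then X0 z else f z).
  set (G := fun z => if Rlt_dec (Cmod z) rhoh then Y0 z else g z).
  assert (EV : forall z, V z -> F z = f z /\ G z = g z).
  { intros z Hz; unfold F, G; destruct (Rlt_dec (Cmod z) rhoh); auto.
    destruct (Hag z Hz); auto. }
  assert (ED : forall z, Cmod z < rhoh -> F z = X0 z /\ G z = Y0 z).
  { intros z Hz; unfold F, G; destruct (Rlt_dec (Cmod z) rhoh); [auto|lra]. }
  assert (H : star_solution (fun z => Cmod z < rhoh \/ V z) F G).
  { assert (R0 := rhoh_pos (U := U)).
    refine (conj _ (conj Hst (conj _ (conj _ _)))).
    - intros z [Hz|Hz].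
      + apply near_imp with (2 := near_disc0 z _ Hz); auto.
      + apply near_imp with (2 := HO z Hz); auto.
    - destruct (ED (RtoC 0)) as [E _]; [rewrite Cmod_0; auto|]; rewrite E; apply X0_0.
    - destruct (ED (RtoC 0)) as [_ E]; [rewrite Cmod_0; auto|]; rewrite E; apply Y0_0.
    - intros z [Hz|Hz].
      + apply solves_ext_near with X0 Y0; [|apply solves_near_disc; auto].
        apply near_imp with (2 := near_disc0 z _ Hz); intros w Hw.
        destruct (ED w Hw); auto.
      + apply solves_ext_near with f g; [|auto].
        apply near_imp with (2 := HO z Hz); intros w Hw; destruct (EV w Hw); auto. }
  intros z Hz; split.
  - eexists _, _, _; split; [exact H|right; exact Hz].
  - transitivity (F z); [apply (continuation_eq _ _ _ _ _ _ _ _ H); right; exact Hz|apply EV; auto].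
Qed.

End Reach.

(** * Continuation to the kite *)

Lemma near_gt (f : C -> R) (z : C) (M : R) : 0 < M ->
  (forall w, Rabs (f w - f z) <= M * Cmod (w - z)) -> 0 < f z -> near z (fun w => 0 < f w).
Proof.
  intros HM Hf Hz; exists (f z / M); split; [apply Rdiv_lt_0_compat; auto|].
  intros w Hw; specialize (Hf w); apply Rabs_le_between in Hf.
  assert (M * Cmod (w - z) < f z); [|lra].
  apply Rmult_lt_reg_l with (/ M); [apply Rinv_0_lt_compat; auto|].
  rewrite <- Rmult_assoc, Rinv_l by lra; unfold Rdiv in Hw; lra.
Qed.

Section Kite.

Context {a b h p q : nat} {U : urn a b h p q}.

Let Ha : (0 < a)%nat. Proof. apply U. Qed.
Let Hb : (0 < b)%nat. Proof. apply U. Qed.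
Let Hab : (a + b < h)%nat. Proof. apply U. Qed.

Local Notation kappa := (kappa a b h).
Local Notation apex := (apex a b h).
Local Notation be := (PI / INR p).
Local Notation ga := (PI / INR q).
Local Notation rho1 := (rhoh a b h).
Local Notation rho2 := (rhoh b a h).

(** In the triangle with vertices 0, [rho], [apex], the foot of the altitude from
    [rho] cuts [L] into [rho1 cos be] and [rho2 cos ga]. *)
Lemma triangle_relations (L : R) : apex = (RtoC L * Cexpi be)%C ->
  L = rho1 * cos be + rho2 * cos ga /\ rho1 * sin be = rho2 * sin ga.
Proof.
  intros E.
  assert (E2 : RtoC L = (RtoC rho1 * Cexpi (- be) + RtoC rho2 * Cexpi ga)%C).
  { transitivity (apex * Cexpi (- be))%C.
    - rewrite E, Cexpi_opp; field; apply Cexpi_neq0.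
    - rewrite apex_rho, kappa_angles, Cexpi_plus, Cexpi_opp; field; apply Cexpi_neq0. }
  split.
  - apply (f_equal Re) in E2; simpl in E2; rewrite cos_neg in E2; lra.
  - apply (f_equal Im) in E2; simpl in E2; rewrite sin_neg in E2; lra.
Qed.

Lemma trig_signs : 0 < sin be /\ 0 <= cos be /\ 0 < sin ga /\ 0 <= cos ga.
Proof.
  assert (B1 := beta0_bounds (U := U)); assert (B2 := beta0_bounds (U := urn_swap a b h p q U)).
  assert (HPI := PI_RGT_0).
  repeat split; try (apply sin_gt_0; lra); apply cos_ge_0; lra.
Qed.

(** The exchanged solution, moved to the disc around the apex. *)
Definition apex_f (z : C) : C :=
  (Cexpi be * Y0 b a q p (Cexpi (- (PI * kappa)) * apex + - Cexpi (- (PI * kappa)) * z))%C.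
Definition apex_g (z : C) : C :=
  (Cexpi ga * X0 b a q p (Cexpi (- (PI * kappa)) * apex + - Cexpi (- (PI * kappa)) * z))%C.

Lemma Cexpi_be_pow : (Cexpi be ^ (p - 1))%C = (- Cexpi (- be))%C.
Proof.
  assert (H := INR_pos_params (U := U)).
  rewrite Cexpi_pow, minus_INR by (generalize (p_ge_2 (U := U)); lia); simpl (INR 1).
  replace ((INR p - 1) * be) with (PI + - be) by (field; lra).
  rewrite Cexpi_plus, Cexpi_PI; ring.
Qed.

Lemma apex_arg (z : C) : Cmod (z - apex) =
  Cmod (Cexpi (- (PI * kappa)) * apex + - Cexpi (- (PI * kappa)) * z).
Proof.
  replace (Cexpi (- (PI * kappa)) * apex + - Cexpi (- (PI * kappa)) * z)%C
    with (Cexpi (- (PI * kappa)) * (apex - z))%C by ring.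
  rewrite Cmod_mult, Cmod_Cexpi, Rmult_1_l; apply Cmod_minus_sym.
Qed.

End Kite.

Section Kite2.

Context {a b h p q : nat} {U : urn a b h p q}.

Let Ha : (0 < a)%nat. Proof. apply U. Qed.
Let Hb : (0 < b)%nat. Proof. apply U. Qed.
Let Hab : (a + b < h)%nat. Proof. apply U. Qed.

Local Notation regular := (regular h).
Local Notation kappa := (kappa a b h).
Local Notation mid_angle := (mid_angle h).
Local Notation apex := (apex a b h).
Local Notation be := (PI / INR p).
Local Notation ga := (PI / INR q).
Local Notation rho1 := (rhoh a b h).
Local Notation rho2 := (rhoh b a h).
Local Notation sys := (solves (INR a) (INR b) (q - 1) (p - 1)).
Local Notation X0 := (X0 a b p q).
Local Notation Y0 := (Y0 a b p q).
Local Notation apex_f := (@apex_f a b h p q).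
Local Notation apex_g := (@apex_g a b h p q).

Lemma apex_solves (z : C) : Cmod (z - apex) < rho2 -> sys apex_f apex_g z.
Proof.
  intros Hz; rewrite apex_arg in Hz.
  destruct (solves_near_disc (U := urn_swap a b h p q U) _ Hz) as [D1 D2].
  assert (Ek : Cexpi (- (PI * kappa)) = (Cexpi (- be) * Cexpi (- ga))%C)
    by (rewrite <- Cexpi_plus, (kappa_angles (U := U)); f_equal; ring).
  split; intros v.
  - refine (Pder_eq _ _ _ _ (Gder_affine_comp _ _ _ _ z _ D2 v) _).
    unfold apex_g; rewrite Cpow_mult_l, (Cexpi_be_pow (U := urn_swap a b h p q U)), Ek.
    rewrite (Cexpi_opp be); field; apply Cexpi_neq0.
  - refine (Pder_eq _ _ _ _ (Gder_affine_comp _ _ _ _ z _ D1 v) _).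
    unfold apex_f; rewrite Cpow_mult_l, (Cexpi_be_pow (U := U)), Ek.
    rewrite (Cexpi_opp ga); field; apply Cexpi_neq0.
Qed.

Lemma mid_regular : regular (Cexpi mid_angle) /\ regular (Cexpi (- mid_angle)).
Proof.
  assert (M := mid_angle_in (U := U)).
  assert (R1 := regular_angle 1 _ Rle_0_1 M); assert (R2 := regular_angle_opp 1 _ Rle_0_1 M).
  rewrite Cmult_1_l in R1, R2; auto.
Qed.

(** Both solutions take the explicit values at the point of the bisecting ray
    where [|u| = 1]. *)
Lemma apex_agree_mid : exists z0, Cmod z0 < rho1 /\ Cmod (z0 - apex) < rho2 /\
  apex_f z0 = X0 z0 /\ apex_g z0 = Y0 z0.
Proof.
  destruct mid_regular as [R1 R2].
  destruct (ray_int_mid (U := U) 1) as [l1 K1]; [auto|].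
  destruct (ray_int_mid (U := urn_swap a b h p q U) (-1)) as [l2 K2]; [auto|].
  replace (1 * mid_angle) with mid_angle in K1 by ring.
  replace (-1 * mid_angle) with (- mid_angle) in K2 by ring.
  assert (D1 : forall x, 0 <= x <= 1 -> Cmod (ray_int a b h (Cexpi mid_angle) x) < rho1).
  { intros x Hx; destruct (K1 x Hx) as [E [B _]]; rewrite E, Cmod_polar; lra. }
  assert (D2 : forall x, 0 <= x <= 1 -> Cmod (ray_int b a h (Cexpi (- mid_angle)) x) < rho2).
  { intros x Hx; destruct (K2 x Hx) as [E [B _]]; rewrite E, Cmod_polar; lra. }
  destruct (basic_on_ray (U := U) _ R1 D1) as [X1 Y1].
  destruct (basic_on_ray (U := urn_swap a b h p q U) _ R2 D2) as [X2 Y2].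
  set (z0 := ray_int a b h (Cexpi mid_angle) 1) in *.
  assert (Ez : (Cexpi (- (PI * kappa)) * apex + - Cexpi (- (PI * kappa)) * z0)%C
     = ray_int b a h (Cexpi (- mid_angle)) 1).
  { unfold apex, apex_sum; rewrite Rinv_1, !Cmult_1_l; fold z0.
    rewrite Cexpi_opp; field; apply Cexpi_neq0. }
  assert (Dl := delta_inv (U := U) 1 mid_angle Rlt_0_1 (mid_angle_in (U := U))).
  rewrite Rinv_1, !Cmult_1_l in Dl.
  assert (Hd1 := delta_neq0 _ R1).
  assert (Ed : delta h (Cexpi (- mid_angle)) = delta h (Cexpi mid_angle)).
  { unfold mid_angle in *; apply (f_equal (fun w => / Cexpi (PI / INR h) * w)%C) in Dl.
    rewrite !Cmult_assoc, !Cinv_l, !Cmult_1_l in Dl by apply Cexpi_neq0; exact Dl. }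
  exists z0; refine (conj _ (conj _ (conj _ _))).
  - apply D1; lra.
  - rewrite apex_arg, Ez; apply D2; lra.
  - unfold apex_f; rewrite Ez, Y2, X1; unfold xi, eta.
    rewrite Ed, Cexpi_pow, (beta0_a (U := U)); reflexivity.
  - unfold apex_g; rewrite Ez, X2, Y1; unfold xi, eta.
    rewrite Ed, Cexpi_pow.
    replace (INR b * - mid_angle) with (- (INR b * mid_angle)) by ring.
    rewrite (gamma0_b (U := U)), Cexpi_opp.
    field; split; first [apply Cexpi_neq0|apply Cpow_nz; auto].
Qed.

Lemma apex_agree (z : C) : Cmod (z - apex) < rho2 -> Cmod z < rho1 ->
  apex_f z = X0 z /\ apex_g z = Y0 z.
Proof.
  intros H2 H1; destruct apex_agree_mid as [z0 [A1 [A2 [A3 A4]]]].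
  apply (segment_unique (INR a) (INR b) (q - 1) (p - 1) _ _ _ _ z0 z); auto.
  - intros t Ht; apply apex_solves, segment_in_disc; auto.
  - intros t Ht; apply solves_near_disc.
    replace (z0 + RtoC t * (z - z0))%C with (z0 + RtoC t * (z - z0) - RtoC 0)%C by ring.
    apply segment_in_disc; auto;
      [replace (z0 - RtoC 0)%C with z0 by ring|replace (z - RtoC 0)%C with z by ring]; auto.
Qed.

(** The second condition says that the angle between [z] and the apex, seen from 0, is
    less than [be]. *)
Definition apex_region (z : C) : Prop :=
  Cmod (z - apex) < rho2 /\ cos be * Cmod z < Re (Cexpi (- be) * z)%C.

Lemma Cmod_rot (z : C) (th : R) : Cmod (Cexpi th * z) = Cmod z.
Proof. rewrite Cmod_mult, Cmod_Cexpi; ring. Qed.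

Lemma Cmod_minus_apex (L : R) (z : C) : apex = (RtoC L * Cexpi be)%C ->
  Cmod (z - apex) ^ 2 = Cmod z ^ 2 - 2 * L * Re (Cexpi (- be) * z)%C + L ^ 2.
Proof.
  intros E.
  assert (E1 : Cmod (z - apex) = Cmod (Cexpi (- be) * z - RtoC L)).
  { rewrite <- (Cmod_rot (z - apex) (- be)); f_equal; rewrite E, Cexpi_opp.
    field; apply Cexpi_neq0. }
  rewrite E1, <- (Cmod_rot z (- be)), !Cmod_sqr; simpl; unfold Re, Im; ring.
Qed.

Lemma apex_region_open : Copen apex_region.
Proof.
  intros z [H1 H2]; apply near_and; [apply near_disc; auto|].
  assert (B := beta0_bounds (U := U)).
  assert (Hc : -1 <= cos be <= 1) by apply COS_bound.
  assert (N : near z (fun w => 0 < Re (Cexpi (- be) * w)%C - cos be * Cmod w)).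
  { apply near_gt with 2; [lra| |lra]; intros w.
    replace (Re (Cexpi (- be) * w)%C - cos be * Cmod w - (Re (Cexpi (- be) * z)%C - cos be * Cmod z))
      with (Re (Cexpi (- be) * (w - z))%C - cos be * (Cmod w - Cmod z)) by (simpl; unfold Re; simpl; ring).
    apply Rle_trans with (1 := Rabs_triang _ _); rewrite Rabs_Ropp, Rabs_mult.
    assert (A1 := re_le_Cmod (Cexpi (- be) * (w - z))%C); rewrite Cmod_rot in A1.
    assert (A2 : Rabs (Cmod w - Cmod z) <= Cmod (w - z)).
    { apply Rabs_le; generalize (Cmod_triangle_minus w z) (Cmod_triangle_minus z w).
      rewrite (Cmod_minus_sym z w); lra. }
    assert (A3 : Rabs (cos be) <= 1) by (apply Rabs_le; lra).
    generalize (Rabs_pos (Cmod w - Cmod z)) (Rabs_pos (cos be)); nra. }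
  apply near_imp with (2 := N); intros w Hw; lra.
Qed.

Lemma apex_region_star : star (fun z => Cmod z < rho1 \/ apex_region z).
Proof.
  destruct (apex_polar (U := U)) as [L [HL EL]].
  destruct (triangle_relations L EL) as [R1 R2].
  assert (P1 := rhoh_pos (U := U)); assert (P2 := rhoh_pos (U := urn_swap a b h p q U)).
  assert (T := trig_signs (U := U)); destruct T as [T1 [T2 [T3 T4]]].
  intros z t Hz Ht; destruct Hz as [Hz|[H1 H2]].
  { left; rewrite Cmod_mult, Cmod_RtoC_pos by lra; generalize (Cmod_ge_0 z); nra. }
  destruct (Rlt_le_dec (Cmod (RtoC t * z)) rho1) as [|L1]; [left; auto|right].
  assert (Em : Cmod (RtoC t * z) = t * Cmod z) by (rewrite Cmod_mult, Cmod_RtoC_pos; lra).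
  assert (Ex : Re (Cexpi (- be) * (RtoC t * z))%C = t * Re (Cexpi (- be) * z)%C)
    by (simpl; unfold Re; simpl; ring).
  rewrite Em in L1; assert (Ht0 : 0 < t) by (destruct (Req_dec t 0) as [E|]; [rewrite E in L1|]; lra).
  split; [|rewrite Em, Ex; nra].
  (* on the ray, |t z - apex|^2 is convex in t, and it is below rho2^2 both at z
     and where the ray leaves the disc of radius rho1 *)
  assert (S2 : sin be ^ 2 + cos be ^ 2 = 1) by (generalize (sin2_cos2 be); unfold Rsqr; lra).
  assert (S3 : sin ga ^ 2 + cos ga ^ 2 = 1) by (generalize (sin2_cos2 ga); unfold Rsqr; lra).
  assert (Q : rho2 ^ 2 = rho1 ^ 2 - 2 * L * (cos be * rho1) + L ^ 2).
  { transitivity ((rho2 * sin ga) ^ 2 + (rho2 * cos ga) ^ 2).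
    - replace ((rho2 * sin ga) ^ 2 + (rho2 * cos ga) ^ 2) with (rho2 ^ 2 * (sin ga ^ 2 + cos ga ^ 2)) by ring.
      rewrite S3; ring.
    - rewrite <- R2; replace (rho2 * cos ga) with (L - rho1 * cos be) by lra.
      replace ((rho1 * sin be) ^ 2) with (rho1 ^ 2 * (1 - cos be ^ 2)) by (rewrite <- S2; ring).
      ring. }
  assert (K1 : Cmod (z - apex) ^ 2 < rho2 ^ 2) by (generalize (Cmod_ge_0 (z - apex)); nra).
  assert (K2 : Cmod (RtoC t * z - apex) ^ 2 < rho2 ^ 2).
  { rewrite (Cmod_minus_apex L) in K1 |- * by auto.
    rewrite Em, Ex; rewrite Q in K1 |- *.
    set (r := Cmod z) in *; set (x := Re (Cexpi (- be) * z)%C) in *.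
    assert (Hr : rho1 <= r) by (unfold r in *; generalize (Cmod_ge_0 z); nra).
    assert (I1 : r ^ 2 - 2 * L * x < rho1 ^ 2 - 2 * L * (cos be * rho1)) by lra.
    assert (I2 : 0 < 2 * L * (x - cos be * r)) by (apply Rmult_lt_0_compat; lra).
    set (R0 := t * r) in *; set (B := rho1 ^ 2 - 2 * L * (cos be * rho1)) in *.
    assert (HR : rho1 <= R0 <= r)
      by (split; [exact L1|assert (0 <= (1 - t) * r) by (apply Rmult_le_pos; lra); unfold R0; lra]).
    apply Rmult_lt_reg_l with r; [lra|].
    replace (r * (R0 ^ 2 - 2 * L * (t * x) + L ^ 2)) with (R0 ^ 2 * r - 2 * L * R0 * x + r * L ^ 2)
      by (unfold R0; ring).
    set (e := B - (r ^ 2 - 2 * L * x)); set (I2' := 2 * L * (x - cos be * r)) in *.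
    destruct (Req_dec r rho1) as [E|E].
    - assert (R0 = r) by lra; rewrite H; assert (0 < r * e) by (apply Rmult_lt_0_compat; unfold e; lra).
      unfold e in H0; nra.
    - assert (J1 : 0 <= (r - R0) * (rho1 * I2')) by (apply Rmult_le_pos; [lra|apply Rmult_le_pos; lra]).
      assert (J2 : 0 <= (R0 - rho1) * (r * e)) by (apply Rmult_le_pos; [lra|apply Rmult_le_pos; unfold e; lra]).
      assert (J3 : 0 <= r * (r - rho1) * ((r - R0) * (R0 - rho1)))
        by (apply Rmult_le_pos; apply Rmult_le_pos; lra).
      assert (J4 : 0 < (r - R0) * (rho1 * I2') + (R0 - rho1) * (r * e)).
      { destruct (Rle_lt_dec r R0).
        - assert (0 < (R0 - rho1) * (r * e)) by (repeat apply Rmult_lt_0_compat; unfold e; lra); lra.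
        - assert (0 < (r - R0) * (rho1 * I2')) by (repeat apply Rmult_lt_0_compat; lra); lra. }
      apply Rmult_lt_reg_l with (r - rho1); [lra|].
      apply Rminus_gt_0_lt.
      replace ((r - rho1) * (r * (B + L ^ 2)) - (r - rho1) * (R0 ^ 2 * r - 2 * L * R0 * x + r * L ^ 2))
        with ((r - R0) * (rho1 * I2') + (R0 - rho1) * (r * e) + r * (r - rho1) * ((r - R0) * (R0 - rho1)))
        by (unfold I2', e, B; ring).
      lra. }
  apply Rnot_le_lt; intros N.
  assert (rho2 ^ 2 <= Cmod (RtoC t * z - apex) ^ 2) by (apply pow_incr; lra); lra.
Qed.

End Kite2.

(** * The fundamental polygon *)

Lemma filterlim_C (F : (R -> Prop) -> Prop) {FF : Filter F} (G : R -> C) (l : C) :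
  filterlim (fun x => Re (G x)) F (locally (Re l)) ->
  filterlim (fun x => Im (G x)) F (locally (Im l)) ->
  filterlim G F (locally (l : C_R_NormedModule)).
Proof.
  intros H1 H2; apply filterlim_locally; intros eps.
  generalize (filter_and _ _ (proj1 (filterlim_locally _ _) H1 eps)
    (proj1 (filterlim_locally _ _) H2 eps)); apply filter_imp.
  intros x [A B]; split; auto.
Qed.

Lemma closure_near_closed (K : C -> Prop) (f : C -> R) (M : R) : 0 < M ->
  (forall z w, Rabs (f w - f z) <= M * Cmod (w - z)) -> (forall z, K z -> f z <= 0) ->
  forall z, Cclosure K z -> f z <= 0.
Proof.
  intros HM Hf HK z Hz; apply Rnot_lt_le; intros N.
  destruct (Hz (f z / M)) as [w [Kw Hw]]; [apply Rdiv_lt_0_compat; auto|].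
  specialize (HK w Kw); specialize (Hf z w); apply Rabs_le_between in Hf.
  assert (M * Cmod (w - z) < f z); [|lra].
  apply Rmult_lt_reg_l with (/ M); [apply Rinv_0_lt_compat; auto|].
  rewrite <- Rmult_assoc, Rinv_l by lra; unfold Rdiv in Hw; lra.
Qed.

Lemma closure_finite_union (n : nat) (P : nat -> C -> Prop) (z : C) :
  Cclosure (fun w => exists j, (j < n)%nat /\ P j w) z ->
  exists j, (j < n)%nat /\ Cclosure (P j) z.
Proof.
  induction n as [|n IH]; intros Hz.
  - destruct (Hz 1 Rlt_0_1) as [w [[j [Hj _]] _]]; lia.
  - destruct (classic (Cclosure (P n) z)) as [|N]; [exists n; split; auto; lia|].
    destruct IH as [j [Hj Hc]]; [|exists j; split; auto; lia].
    intros eps He; apply not_all_ex_not in N; destruct N as [e0 N].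
    apply imply_to_and in N; destruct N as [He0 N].
    destruct (Hz (Rmin eps e0)) as [w [[j [Hj Pw]] Hw]]; [apply Rmin_pos; auto|].
    assert (W1 := Rlt_le_trans _ _ _ Hw (Rmin_l _ _)).
    assert (W2 := Rlt_le_trans _ _ _ Hw (Rmin_r _ _)).
    exists w; split; auto; exists j; split; auto.
    destruct (Nat.eq_dec j n) as [->|]; [|lia].
    exfalso; apply N; exists w; auto.
Qed.

Section Polygon.

Context {a b h p q : nat} {U : urn a b h p q}.

Let Ha : (0 < a)%nat. Proof. apply U. Qed.
Let Hb : (0 < b)%nat. Proof. apply U. Qed.
Let Hab : (a + b < h)%nat. Proof. apply U. Qed.

Local Notation regular := (regular h).
Local Notation rho1 := (rhoh a b h).

Definition improper_ray_int (u : C) : C :=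
  RInt_gen (V := C_R_CompleteNormedModule) (ray_integrand a b h u) (at_point 0) (at_left 1).

Lemma is_RInt_C (f : R -> C) (x y : R) : x <= y -> (forall t, x <= t <= y -> Ccont f t) ->
  is_RInt (V := C_R_NormedModule) f x y (CInt f x y).
Proof.
  intros Hxy Hc; apply (is_RInt_fct_extend_pair (U := R_NormedModule) (V := R_NormedModule));
    apply (RInt_correct (V := R_CompleteNormedModule)), ex_RInt_cont; auto; intros t Ht; apply (Hc t Ht).
Qed.

Lemma improper_ray_int_limit (u l : C) : (forall x, 0 <= x < 1 -> regular (RtoC x * u)) ->
  filterlim (fun x => Re (ray_int a b h u x)) (at_left 1) (locally (Re l)) ->
  filterlim (fun x => Im (ray_int a b h u x)) (at_left 1) (locally (Im l)) -> improper_ray_int u = l.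
Proof.
  intros Hr H1 H2.
  apply (is_RInt_gen_unique (V := C_R_CompleteNormedModule) (Fa := at_point 0) (Fb := at_left 1) _ l).
  apply (is_RInt_gen_at_left (V := C_R_NormedModule) (ray_integrand a b h u) (ray_int a b h u) 0 1 l Rlt_0_1).
  - intros x Hx; apply is_RInt_C; [lra|]; intros t Ht; apply ray_integrand_cont, Hr; lra.
  - apply filterlim_C; auto; apply at_left_proper_filter.
Qed.

Lemma improper_ray_int_regular (u : C) : regular u -> improper_ray_int u = ray_int a b h u 1.
Proof.
  intros Hr.
  assert (D := Pder_ray_int_unit u 1 Hr ltac:(lra)).
  apply improper_ray_int_limit.
  - intros x Hx; apply regular_ray; auto; lra.
  - intros P HP; destruct (Pder_continuous_Re _ _ _ D P HP) as [e He]; exists e; intros y Hy _; auto.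
  - intros P HP; destruct (Pder_continuous_Im _ _ _ D P HP) as [e He]; exists e; intros y Hy _; auto.
Qed.

Lemma improper_ray_int_one : improper_ray_int (RtoC 1) = RtoC rho1.
Proof.
  assert (E : forall x, 0 <= x < 1 -> ray_int a b h (RtoC 1) x = RtoC (Jr a b h x))
    by (intros x Hx; apply ray_int_real; auto).
  assert (N : at_left 1 (fun x => 0 <= x < 1)).
  { exists (mkposreal 1 Rlt_0_1); intros y Hy1 Hy2.
    assert (Hy : Rabs (y - 1) < 1) by exact Hy1; apply Rabs_def2 in Hy; lra. }
  apply improper_ray_int_limit.
  - intros x Hx; rewrite Cmult_1_r; apply regular_RtoC; lra.
  - apply filterlim_ext_loc with (Jr a b h).
    + apply filter_imp with (2 := N); intros x Hx; rewrite E; auto.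
    + apply rhoh_spec.
  - apply filterlim_ext_loc with (fun _ => 0).
    + apply filter_imp with (2 := N); intros x Hx; rewrite E; auto.
    + apply filterlim_const.
Qed.

(** ** Symmetries of the integral *)

Lemma ray_int_conj (c w : C) : (c ^ h)%C = RtoC 1 -> regular w ->
  regular (c * Cconj w) /\
  ray_int a b h (c * Cconj w) 1 = (c ^ a * Cconj (ray_int a b h w 1))%C.
Proof.
  intros Hc Hw.
  assert (E : forall t, (RtoC 1 - (c * Cconj t) ^ h)%C = Cconj (RtoC 1 - t ^ h)).
  { intros t; rewrite Cpow_mult_l, Hc, Cmult_1_l, <- Cpow_conj; apply C_eq; simpl; ring. }
  assert (R1 : forall t, regular t -> regular (c * Cconj t)).
  { intros t; unfold regular, slit; rewrite E, Cmod_conj; auto. }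
  assert (RI : forall x, 0 <= x <= 1 -> ray_integrand a b h (c * Cconj w) x
      = (c ^ a * Cconj (ray_integrand a b h w x))%C).
  { intros x Hx; unfold ray_integrand, integrand.
    assert (Ht := regular_ray w x Hw Hx).
    assert (Hd := delta_neq0 _ Ht).
    replace (RtoC x * (c * Cconj w))%C with (c * Cconj (RtoC x * w))%C
      by (apply C_eq; simpl; ring).
    set (t := (RtoC x * w)%C) in *.
    assert (Ed : delta h (c * Cconj t) = Cconj (delta h t))
      by (unfold delta; rewrite E, Cpowr_conj; auto).
    assert (Hd' : Cconj (delta h t) <> RtoC 0) by (apply Cmod_gt_0; rewrite Cmod_conj; apply Cmod_gt_0; auto).
    rewrite Ed, !Cmult_conj, Cpow_mult_l, <- (Cpow_pred c a) by auto.
    unfold Cdiv; rewrite Cmult_conj, Cinv_conj, !Cpow_conj by (apply Cpow_nz; auto); ring. }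
  split; auto.
  assert (K : (ray_int a b h (c * Cconj w) 1 - c ^ a * Cconj (ray_int a b h w 1))%C
            = (ray_int a b h (c * Cconj w) 0 - c ^ a * Cconj (ray_int a b h w 0))%C).
  { apply (Pder_const_eq (fun x => ray_int a b h (c * Cconj w) x - c ^ a * Cconj (ray_int a b h w x))%C 0 1); [lra|].
    intros x Hx.
    assert (D1 := Pder_ray_int_unit (c * Cconj w) x (R1 w Hw) Hx).
    assert (D2 := Pder_ray_int_unit w x Hw Hx).
    assert (D3 : Pder (fun x => Cconj (ray_int a b h w x)) x (Cconj (ray_integrand a b h w x))).
    { split; [apply D2|apply (is_derive_opp (fun x => Im (ray_int a b h w x))), D2]. }
    apply Pder_eq with (1 := Pder_minus _ _ _ _ _ D1 (Pder_scal (c ^ a)%C _ _ _ D3)).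
    rewrite RI by auto; ring. }
  rewrite !ray_int_0 in K.
  replace (Cconj (RtoC 0)) with (RtoC 0) in K by (apply C_eq; simpl; ring).
  replace (ray_int a b h (c * Cconj w) 1) with
    (ray_int a b h (c * Cconj w) 1 - c ^ a * Cconj (ray_int a b h w 1)
     + c ^ a * Cconj (ray_int a b h w 1))%C by ring.
  rewrite K; ring.
Qed.

End Polygon.

Section Polygon2.

Context {a b h p q : nat} {U : urn a b h p q}.

Let Ha : (0 < a)%nat. Proof. apply U. Qed.
Let Hb : (0 < b)%nat. Proof. apply U. Qed.
Let Hab : (a + b < h)%nat. Proof. apply U. Qed.

Local Notation in_angle := (in_angle h).
Local Notation apex := (apex a b h).
Local Notation be := (PI / INR p).
Local Notation ga := (PI / INR q).
Local Notation rho1 := (rhoh a b h).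
Local Notation rho2 := (rhoh b a h).

(** The quadrilateral with vertices 0, [rho], [apex] and the mirror image of
    [rho], in coordinates where the apex is real. *)
Definition kite_cone (z : C) : R :=
  Rabs (Im (Cexpi (- be) * z)%C) * cos be - Re (Cexpi (- be) * z)%C * sin be.
Definition kite_side (z : C) : R :=
  Re (Cexpi (- be) * z)%C * sin ga + Rabs (Im (Cexpi (- be) * z)%C) * cos ga
  - Cmod apex * sin ga.

(** Two sides come from the signs of the integral of this urn, and the one at the apex
    is the base of the kite of the exchanged urn. *)
Lemma kite_half (r th : R) : 0 < r -> 0 < INR h * th <= PI ->
  let z := ray_int a b h (RtoC r * Cexpi th) 1 in kite_cone z <= 0 /\ kite_side z <= 0.
Proof.
  intros Hr Hth z.
  assert (Hi : in_angle th) by (unfold in_angle; generalize PI_RGT_0; lra).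
  assert (I1 := Im_ray_int_nonneg r th Hr Hth); fold z in I1.
  assert (I2 := Im_rot_ray_int_nonpos r th Hr Hth); fold z in I2.
  assert (Hr' : 0 < / r) by (apply Rinv_0_lt_compat; auto).
  assert (I3 := Im_ray_int_nonneg (U := urn_swap a b h p q U) (/ r) th Hr' Hth).
  destruct (apex_polar (U := U)) as [L [HL EL]].
  assert (EmL : Cmod apex = L) by (rewrite EL, Cmod_polar; lra).
  assert (S := apex_sum_eq (U := U) r th Hr Hi).
  unfold apex_sum in S; fold z in S.
  set (v := ray_int b a h (RtoC (/ r) * Cexpi th) 1) in *.
  assert (Ev : ray_int b a h (RtoC (/ r) * Cexpi (- th)) 1 = Cconj v).
  { destruct (ray_int_conj (U := urn_swap a b h p q U) (RtoC 1) (RtoC (/ r) * Cexpi th)) as [_ E].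
    - apply Cpow_1_l.
    - apply regular_angle; auto; lra.
    - rewrite Cmult_1_l, Cmult_conj, Cexpi_conj, Cpow_1_l, Cmult_1_l in E.
      replace (Cconj (RtoC (/ r))) with (RtoC (/ r)) in E by (apply C_eq; simpl; ring); exact E. }
  unfold kite_cone, kite_side; rewrite EmL.
  set (x := Re (Cexpi (- be) * z)%C) in *; set (y := Im (Cexpi (- be) * z)%C) in *.
  rewrite (Rabs_left1 y) by auto.
  assert (Ez : z = (Cexpi be * (x, y))%C).
  { transitivity (Cexpi be * (Cexpi (- be) * z))%C; [rewrite Cexpi_opp; field; apply Cexpi_neq0|].
    f_equal; apply C_eq; reflexivity. }
  split.
  - assert (E1 : Im z = x * sin be + y * cos be) by (rewrite Ez; simpl; ring); lra.
  - assert (E3 : v = (Cexpi ga * ((L - x)%R, y))%C).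
    { rewrite Ev, EL, Ez, (kappa_angles (U := U)) in S.
      assert (S2 : Cconj v = (Cexpi (- ga) * ((L - x)%R, (- y)%R))%C).
      { assert (X : (Cexpi ga * Cconj v)%C = ((L - x)%R, (- y)%R)).
        { transitivity (Cexpi (- be) * (Cexpi be * (x, y) + Cexpi (be + ga) * Cconj v) - (x, y))%C.
          - rewrite Cexpi_plus, Cexpi_opp; field; apply Cexpi_neq0.
          - rewrite S, Cexpi_opp; replace (/ Cexpi be * (RtoC L * Cexpi be))%C with (RtoC L)
              by (field; apply Cexpi_neq0).
            apply C_eq; simpl; ring. }
        rewrite <- X, Cexpi_opp; field; apply Cexpi_neq0. }
      rewrite <- (Cconj_conj v), S2; apply C_eq; simpl; rewrite cos_neg, sin_neg; ring. }
    assert (E4 : Im v = (L - x) * sin ga + y * cos ga) by (rewrite E3; simpl; ring); lra.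
Qed.

(** The second half of the sector is the mirror image of the first one. *)
Lemma kite_image (r th : R) : 0 < r -> in_angle th ->
  let z := ray_int a b h (RtoC r * Cexpi th) 1 in kite_cone z <= 0 /\ kite_side z <= 0.
Proof.
  intros Hr Hth z.
  destruct (Rle_lt_dec (INR h * th) PI) as [L|L]; [apply kite_half; auto; unfold in_angle in Hth; lra|].
  assert (Hh := INR_h_gt0 (U := U)).
  set (th' := 2 * PI / INR h - th).
  assert (E' : INR h * th' = 2 * PI - INR h * th) by (unfold th'; field; lra).
  unfold in_angle in Hth.
  destruct (kite_half r th' Hr ltac:(lra)) as [K1 K2].
  assert (Hc : (Cexpi (2 * PI / INR h) ^ h)%C = RtoC 1).
  { rewrite Cexpi_pow; replace (INR h * (2 * PI / INR h)) with (2 * PI * INR 1) by (simpl; field; lra).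
    apply Cexpi_2PI_nat. }
  destruct (ray_int_conj (U := U) (Cexpi (2 * PI / INR h)) (RtoC r * Cexpi th') Hc) as [_ E].
  { apply regular_angle; [lra|unfold in_angle; lra]. }
  set (z' := ray_int a b h (RtoC r * Cexpi th') 1) in *.
  assert (Ez : z = (Cexpi (2 * be) * Cconj z')%C).
  { unfold z.
    replace (RtoC r * Cexpi th)%C with (Cexpi (2 * PI / INR h) * Cconj (RtoC r * Cexpi th'))%C.
    - rewrite E, Cexpi_pow; do 2 f_equal.
      rewrite <- (beta0_a (U := U)); unfold mid_angle; field; lra.
    - rewrite Cmult_conj, Cexpi_conj.
      replace (Cconj (RtoC r)) with (RtoC r) by (apply C_eq; simpl; ring).
      replace (Cexpi th) with (Cexpi (2 * PI / INR h) * Cexpi (- th'))%C; [ring|].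
      rewrite <- Cexpi_plus; f_equal; unfold th'; ring. }
  assert (Er : (Cexpi (- be) * z)%C = Cconj (Cexpi (- be) * z')).
  { rewrite Ez, Cmult_conj, Cexpi_conj, Ropp_involutive.
    replace (2 * be) with (be + be) by ring; rewrite Cexpi_plus, Cexpi_opp; field; apply Cexpi_neq0. }
  assert (Ex : Re (Cexpi (- be) * z)%C = Re (Cexpi (- be) * z')%C) by (rewrite Er; reflexivity).
  assert (Ey : Rabs (Im (Cexpi (- be) * z)%C) = Rabs (Im (Cexpi (- be) * z')%C))
    by (rewrite Er; apply Rabs_Ropp).
  unfold kite_cone, kite_side in *; rewrite Ex, Ey; auto.
Qed.

Lemma kite_form_Lipschitz (c1 c2 c3 : R) (z w : C) : Rabs c1 <= 1 -> Rabs c2 <= 1 ->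
  Rabs ((Re (Cexpi (- be) * w)%C * c1 + Rabs (Im (Cexpi (- be) * w)%C) * c2 - c3)
      - (Re (Cexpi (- be) * z)%C * c1 + Rabs (Im (Cexpi (- be) * z)%C) * c2 - c3))
   <= 2 * Cmod (w - z).
Proof.
  intros H1 H2.
  assert (A1 := re_le_Cmod (Cexpi (- be) * (w - z))%C); assert (A2 := im_le_Cmod (Cexpi (- be) * (w - z))%C).
  rewrite Cmod_rot in A1, A2.
  replace (Re (Cexpi (- be) * (w - z))%C) with (Re (Cexpi (- be) * w)%C - Re (Cexpi (- be) * z)%C) in A1
    by (simpl; unfold Re; simpl; ring).
  replace (Im (Cexpi (- be) * (w - z))%C) with (Im (Cexpi (- be) * w)%C - Im (Cexpi (- be) * z)%C) in A2
    by (simpl; unfold Im; simpl; ring).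
  set (x := Re (Cexpi (- be) * w)%C) in *; set (x' := Re (Cexpi (- be) * z)%C) in *.
  set (y := Im (Cexpi (- be) * w)%C) in *; set (y' := Im (Cexpi (- be) * z)%C) in *.
  replace (x * c1 + Rabs y * c2 - c3 - (x' * c1 + Rabs y' * c2 - c3))
    with ((x - x') * c1 + (Rabs y - Rabs y') * c2) by ring.
  apply Rle_trans with (1 := Rabs_triang _ _); rewrite !Rabs_mult.
  assert (A3 := Rabs_triang_inv2 y y').
  generalize (Rabs_pos (x - x')) (Rabs_pos (Rabs y - Rabs y')) (Rabs_pos c1) (Rabs_pos c2); nra.
Qed.

Lemma Rabs_trig_le (t : R) : Rabs (cos t) <= 1 /\ Rabs (sin t) <= 1.
Proof. split; apply Rabs_le; [apply COS_bound|apply SIN_bound]. Qed.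

Lemma kite_closed (K : C -> Prop) : (forall z, K z -> kite_cone z <= 0 /\ kite_side z <= 0) ->
  forall z, Cclosure K z -> kite_cone z <= 0 /\ kite_side z <= 0.
Proof.
  intros HK z Hz; split.
  - apply (closure_near_closed K kite_cone 2); auto; [lra| |intros w Hw; apply HK; auto].
    intros z1 z2; unfold kite_cone.
    replace (Rabs _ * cos be - Re (Cexpi (- be) * z2)%C * sin be
       - (Rabs (Im (Cexpi (- be) * z1)%C) * cos be - Re (Cexpi (- be) * z1)%C * sin be))
      with ((Re (Cexpi (- be) * z2)%C * - sin be + Rabs (Im (Cexpi (- be) * z2)%C) * cos be - 0)
       - (Re (Cexpi (- be) * z1)%C * - sin be + Rabs (Im (Cexpi (- be) * z1)%C) * cos be - 0)) by ring.
    apply kite_form_Lipschitz; rewrite ?Rabs_Ropp; apply Rabs_trig_le.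
  - apply (closure_near_closed K kite_side 2); auto; [lra| |intros w Hw; apply HK; auto].
    intros z1 z2; apply kite_form_Lipschitz; apply Rabs_trig_le.
Qed.

(** A kite is covered by the two discs, apart from the points on its outer
    sides; the altitude from [rho] separates the parts. *)
Lemma kite_covered (z : C) : kite_cone z <= 0 -> kite_side z < 0 ->
  Cmod z < rho1 \/ apex_region (a := a) (b := b) (h := h) (p := p) z.
Proof.
  intros K1 K2.
  destruct (apex_polar (U := U)) as [L [HL EL]].
  assert (EmL : Cmod apex = L) by (rewrite EL, Cmod_polar; lra).
  destruct (triangle_relations L EL) as [R1 R2].
  assert (P1 := rhoh_pos (U := U)); assert (P2 := rhoh_pos (U := urn_swap a b h p q U)).
  assert (T := trig_signs (U := U)); destruct T as [T1 [T2 [T3 T4]]].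
  assert (S2 : sin be ^ 2 + cos be ^ 2 = 1) by (generalize (sin2_cos2 be); unfold Rsqr; lra).
  assert (S3 : sin ga ^ 2 + cos ga ^ 2 = 1) by (generalize (sin2_cos2 ga); unfold Rsqr; lra).
  destruct (Rlt_le_dec (Cmod z) rho1) as [|Hr]; [left; auto|right].
  assert (D := Cmod_minus_apex L z EL); unfold apex_region.
  assert (Em : Cmod z ^ 2 = Re (Cexpi (- be) * z)%C ^ 2 + Rabs (Im (Cexpi (- be) * z)%C) ^ 2).
  { rewrite <- (Cmod_rot z (- be)), Cmod_sqr, <- !Rsqr_pow2, <- Rsqr_abs; auto. }
  unfold kite_cone, kite_side in *; rewrite EmL in K2.
  set (x := Re (Cexpi (- be) * z)%C) in *; set (y := Rabs (Im (Cexpi (- be) * z)%C)) in *.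
  assert (Hy : 0 <= y) by apply Rabs_pos.
  set (r := Cmod z) in *; set (d := Cmod (z - apex)) in *.
  assert (Hd : 0 <= d) by apply Cmod_ge_0.
  assert (Hx : 0 <= x).
  { assert (0 <= x * sin be) by nra; apply Rmult_le_reg_r with (sin be); lra. }
  assert (C1 : cos be * r <= x).
  { apply Rsqr_incr_0_var; auto; unfold Rsqr.
    assert ((y * cos be) * (y * cos be) <= (x * sin be) * (x * sin be))
      by (apply Rmult_le_compat; nra).
    replace (cos be * r * (cos be * r)) with (cos be ^ 2 * r ^ 2) by ring; rewrite Em.
    replace (x * x) with (x ^ 2 * (sin be ^ 2 + cos be ^ 2)) by (rewrite S2; ring); nra. }
  assert (C2 : cos be * r < x).
  { destruct C1 as [|E]; auto; exfalso.
    assert (Ey : y = r * sin be).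
    { assert (y ^ 2 = (r * sin be) ^ 2).
      { replace ((r * sin be) ^ 2) with (r ^ 2 * (1 - cos be ^ 2)) by (rewrite <- S2; ring).
        replace (y ^ 2) with (r ^ 2 - x ^ 2) by lra; rewrite <- E; ring. }
      assert (0 <= r * sin be) by (apply Rmult_le_pos; lra).
      apply Rsqr_inj; auto; unfold Rsqr; lra. }
    rewrite <- E, Ey in K2.
    assert (r * (cos be * sin ga + sin be * cos ga) < rho1 * (cos be * sin ga + sin be * cos ga)).
    { rewrite R1 in K2; replace (rho1 * (cos be * sin ga + sin be * cos ga))
        with (rho1 * cos be * sin ga + rho1 * sin be * cos ga) by ring.
      rewrite R2; lra. }
    assert (0 <= cos be * sin ga) by (apply Rmult_le_pos; lra).
    assert (0 <= sin be * cos ga) by (apply Rmult_le_pos; lra).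
    nra. }
  split; auto.
  apply Rnot_le_lt; intros N.
  assert (L1 : L - x < rho2 * cos ga) by nra.
  assert (L2 : y * cos ga < (L - x) * sin ga) by lra.
  assert (L3 : 0 < L - x).
  { assert (0 <= y * cos ga) by (apply Rmult_le_pos; lra).
    apply Rmult_lt_reg_r with (sin ga); lra. }
  assert (E4 : d ^ 2 = (L - x) ^ 2 + y ^ 2) by (rewrite D, Em; ring).
  assert (L4 : cos ga * d <= L - x).
  { apply Rsqr_incr_0_var; [|lra]; unfold Rsqr.
    assert ((y * cos ga) * (y * cos ga) <= ((L - x) * sin ga) * ((L - x) * sin ga))
      by (apply Rmult_le_compat; try lra; apply Rmult_le_pos; lra).
    replace (cos ga * d * (cos ga * d)) with (cos ga ^ 2 * d ^ 2) by ring; rewrite E4.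
    replace ((L - x) * (L - x)) with ((L - x) ^ 2 * (sin ga ^ 2 + cos ga ^ 2)) by (rewrite S3; ring); nra. }
  nra.
Qed.

Lemma apex_region_reachable (z : C) : apex_region (a := a) (b := b) (h := h) (p := p) z ->
  reachable a b p q z.
Proof.
  apply (glue_star_solution (U := U) _ (@apex_f a b h p q) (@apex_g a b h p q)).
  - apply (apex_region_open (U := U)).
  - apply (apex_region_star (U := U)).
  - intros w [Hw _]; apply (apex_solves (U := U)); auto.
  - intros w [Hw _] Hw2; apply (apex_agree (U := U)); auto.
Qed.

Lemma kite_covered_reachable (z : C) : kite_cone z <= 0 -> kite_side z < 0 -> reachable a b p q z.
Proof.
  intros K1 K2; destruct (kite_covered z K1 K2) as [H|H].
  - apply disc_reachable; auto.
  - apply apex_region_reachable; auto.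
Qed.

End Polygon2.

Section Points.

Context {a b h p q : nat} {U : urn a b h p q}.

Local Notation be := (PI / INR p).
Local Notation reachable := (reachable a b p q).
Local Notation continuation := (continuation a b p q).

(** ** Rotations *)

Lemma rot_pow (j : nat) : Cmod (Cexpi (2 * be) ^ j) = 1 /\ ((Cexpi (2 * be) ^ j) ^ p)%C = RtoC 1.
Proof.
  split; [rewrite Cmod_pow, Cmod_Cexpi; apply pow1|].
  rewrite !Cexpi_pow.
  replace (INR p * (INR j * (2 * be))) with (2 * PI * INR j)
    by (field; generalize (INR_pos_params (U := U)); lra).
  apply Cexpi_2PI_nat.
Qed.

Lemma reachable_rot_pow (z : C) (j : nat) : reachable z ->
  reachable (Cexpi (2 * be) ^ j * z) /\
  continuation (Cexpi (2 * be) ^ j * z)%C = (Cexpi (2 * be) ^ j * continuation z)%C.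
Proof. intros Hz; destruct (rot_pow j); apply (reachable_rot (U := U)); auto. Qed.

Lemma Cclosure_rot (K : C -> Prop) (om z : C) : Cmod om = 1 ->
  Cclosure (fun z => exists w, K w /\ z = (om * w)%C) z -> Cclosure K (/ om * z).
Proof.
  intros Hm Hz eps He.
  assert (H0 : om <> RtoC 0) by (apply Cmod_gt_0; lra).
  destruct (Hz eps He) as [w' [[w [Kw ->]] Hw]]; exists w; split; auto.
  replace (w - / om * z)%C with (/ om * (om * w - z))%C by (field; auto).
  rewrite Cmod_mult, Cmod_inv, Hm by auto; lra.
Qed.

(** ** Points of the circle of convergence *)

(** Up to a rotation the argument is between 0 and [2 be]; the law of cosines then
    puts the point in the disc around the apex. *)
Lemma circle_reachable (z : C) : Cmod z = rhoh a b h ->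
  (forall j : nat, (j < p)%nat -> z <> (RtoC (rhoh a b h) * Cexpi (2 * be) ^ j)%C) -> reachable z.
Proof.
  intros Hz Hj; set (rho := rhoh a b h) in *.
  assert (Hrho : 0 < rho) by (apply rhoh_pos).
  assert (HPI := PI_RGT_0).
  assert (Hp2 : 2 <= INR p) by apply (INR_pos_params (U := U)).
  assert (Hz0 : z <> RtoC 0) by (apply Cmod_gt_0; lra).
  assert (Hbe : 0 < 2 * be) by (apply Rmult_lt_0_compat; [lra|apply Rdiv_lt_0_compat; lra]).
  assert (T0 : exists t, 0 <= t < 2 * PI /\ z = (RtoC rho * Cexpi t)%C).
  { assert (B := Carg_bound z); assert (E := polar_form z Hz0); rewrite Hz in E.
    destruct (Rle_lt_dec 0 (Carg z)).
    - exists (Carg z); split; auto; lra.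
    - exists (Carg z + 2 * PI * INR 1); split; [simpl; split; [|lra]|].
      + destruct (Rle_lt_dec (- (2 * PI)) (Carg z)); lra.
      + rewrite Cexpi_plus, Cexpi_2PI_nat, Cmult_1_r; auto. }
  destruct T0 as [t [Ht Ez]].
  destruct (nfloor_ex (t / (2 * be))) as [j [J1 J2]]; [apply Rmult_le_pos; [lra|left; apply Rinv_0_lt_compat; auto]|].
  assert (K1 : INR j * (2 * be) <= t).
  { apply Rmult_le_compat_r with (r := 2 * be) in J1; [|lra].
    replace (t / (2 * be) * (2 * be)) with t in J1 by (field; lra); auto. }
  assert (K2 : t < INR j * (2 * be) + 2 * be).
  { apply Rmult_lt_compat_r with (r := 2 * be) in J2; [|lra].
    replace (t / (2 * be) * (2 * be)) with t in J2 by (field; lra); lra. }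
  assert (Hjp : (j < p)%nat).
  { apply INR_lt; apply Rmult_lt_reg_r with (2 * be); auto.
    replace (INR p * (2 * be)) with (2 * PI) by (field; lra); lra. }
  set (s0 := t - INR j * (2 * be)).
  assert (Ez2 : z = (Cexpi (2 * be) ^ j * (RtoC rho * Cexpi s0))%C).
  { rewrite Ez, Cexpi_pow; replace t with (INR j * (2 * be) + s0) at 1 by (unfold s0; ring).
    rewrite Cexpi_plus; ring. }
  assert (Hs0 : 0 < s0 < 2 * be).
  { split; [|unfold s0; lra].
    destruct (Req_dec s0 0) as [E|]; [|unfold s0 in *; lra].
    exfalso; apply (Hj j Hjp); rewrite Ez2, E, Cexpi_0; ring. }
  rewrite Ez2; apply reachable_rot_pow, (apex_region_reachable (U := U)).
  destruct (apex_polar (U := U)) as [L [HL EL]].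
  destruct (triangle_relations L EL) as [R1 R2].
  assert (Bb := beta0_bounds (U := U)).
  assert (Hcos : cos be < cos (s0 - be)).
  { destruct (Rle_lt_dec be s0).
    - apply cos_decreasing_1; lra.
    - rewrite <- (cos_neg (s0 - be)); apply cos_decreasing_1; lra. }
  assert (Ex : Re (Cexpi (- be) * (RtoC rho * Cexpi s0))%C = rho * cos (s0 - be)).
  { replace (Cexpi (- be) * (RtoC rho * Cexpi s0))%C with (RtoC rho * Cexpi (s0 - be))%C
      by (unfold Rminus; rewrite Cexpi_plus; ring).
    simpl; ring. }
  split.
  - apply Rnot_le_lt; intros N.
    assert (S2 : sin be ^ 2 + cos be ^ 2 = 1) by (generalize (sin2_cos2 be); unfold Rsqr; lra).
    set (rho2 := rhoh b a h) in *.
    assert (P2 : 0 < rho2) by (apply (rhoh_pos (U := urn_swap a b h p q U))).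
    assert (M : rho2 ^ 2 <= Cmod (RtoC rho * Cexpi s0 - apex a b h) ^ 2) by (apply pow_incr; lra).
    rewrite (Cmod_minus_apex L _ EL), Ex, Cmod_polar in M by lra.
    fold rho in R1, R2.
    set (ga := PI / INR q) in *.
    assert (S3 : sin ga ^ 2 + cos ga ^ 2 = 1) by (generalize (sin2_cos2 ga); unfold Rsqr; lra).
    assert (Q : rho2 ^ 2 = rho ^ 2 - 2 * L * (rho * cos be) + L ^ 2).
    { transitivity ((rho2 * sin ga) ^ 2 + (rho2 * cos ga) ^ 2).
      - replace ((rho2 * sin ga) ^ 2 + (rho2 * cos ga) ^ 2) with (rho2 ^ 2 * (sin ga ^ 2 + cos ga ^ 2)) by ring.
        rewrite S3; ring.
      - rewrite <- R2; replace (rho2 * cos ga) with (L - rho * cos be) by lra.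
        replace ((rho * sin be) ^ 2) with (rho ^ 2 * (1 - cos be ^ 2)) by (rewrite <- S2; ring).
        ring. }
    assert (0 < L * (rho * (cos (s0 - be) - cos be))) by (repeat apply Rmult_lt_0_compat; lra).
    lra.
  - rewrite Ex, Cmod_polar by lra; nra.
Qed.

End Points.

Section Interior.

Context {a b s p q : nat} {U : urn a b (a + b + s) p q}.

Local Notation h := (a + b + s)%nat.
Local Notation be := (PI / INR p).

Lemma omega_Cexpi : omega a b s = Cexpi (2 * be).
Proof.
  unfold omega; f_equal; rewrite (INR_h_p (U := U)) at 1.
  field; generalize (INR_pos_params (U := U)); lra.
Qed.

Lemma I_int_ray (u : C) : I_int a b s u = @improper_ray_int a b h u.
Proof. reflexivity. Qed.

Lemma kite_bounds (z : C) : kite a b s z ->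
  kite_cone (p := p) z <= 0 /\ kite_side (a := a) (b := b) (h := h) (p := p) (q := q) z <= 0.
Proof.
  apply kite_closed; intros w [u [[r [th [Hr [Hth ->]]]] ->]].
  assert (Hh := INR_h_gt0 (U := U)).
  assert (Hi : in_angle h th).
  { unfold in_angle; split; [apply Rmult_lt_0_compat; lra|].
    apply Rlt_le_trans with (INR h * (2 * PI / INR h)); [apply Rmult_lt_compat_l; lra|right; field; lra]. }
  rewrite I_int_ray, improper_ray_int_regular by (apply regular_angle; auto; lra).
  apply (kite_image (U := U)); auto.
Qed.

Lemma polygon_kite (z : C) : polygon a b s z -> exists j,
  let w := (/ (Cexpi (2 * be) ^ j) * z)%C in
  kite_cone (p := p) w <= 0 /\ kite_side (a := a) (b := b) (h := h) (p := p) (q := q) w <= 0.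
Proof.
  intros Hz.
  destruct (closure_finite_union (h / a)
    (fun j z => exists w, kite a b s w /\ z = (Cexpi (2 * be) ^ j * w)%C) z) as [j [_ Hc]].
  - intros eps He; destruct (Hz eps He) as [w [[j [w' [Hj [Kw ->]]]] Hw]].
    rewrite omega_Cexpi in Hw; exists (Cexpi (2 * be) ^ j * w')%C; split; auto.
    exists j; split; auto; exists w'; auto.
  - exists j; cbv zeta; apply Cclosure_rot in Hc; [|apply (rot_pow (U := U))].
    apply kite_closed with (2 := Hc); apply kite_bounds.
Qed.

(** A point [z] inside the polygon is in the kite strictly below the outer
    sides, because [(1 + e) z] is still in the polygon. *)
Lemma interior_reachable (z : C) : Cinterior (polygon a b s) z -> reachable a b p q z.
Proof.
  intros [eps [He HN]].
  destruct (Ceq_dec z (RtoC 0)) as [->|Hz].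
  { apply disc_reachable; rewrite Cmod_0; apply rhoh_pos. }
  assert (Hm := proj1 (Cmod_gt_0 z) Hz).
  set (e := eps / (2 * Cmod z)).
  assert (He0 : 0 < e) by (unfold e; apply Rdiv_lt_0_compat; lra).
  destruct (polygon_kite (RtoC (1 + e) * z)%C) as [j [K1 K2]].
  { apply HN; replace (RtoC (1 + e) * z - z)%C with (RtoC e * z)%C by (rewrite RtoC_plus; ring).
    rewrite Cmod_mult, Cmod_RtoC_pos by lra; unfold e.
    replace (eps / (2 * Cmod z) * Cmod z) with (eps / 2) by (field; lra); lra. }
  destruct (rot_pow (U := U) j) as [M1 M2]; set (om := (Cexpi (2 * be) ^ j)%C) in *.
  assert (H0 : om <> RtoC 0) by (apply Cmod_gt_0; lra).
  replace z with (om * (/ om * z))%C by (field; auto).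
  apply (reachable_rot (U := U)); auto.
  set (w := (/ om * z)%C).
  assert (Er : Re (Cexpi (- be) * (/ om * (RtoC (1 + e) * z)))%C = (1 + e) * Re (Cexpi (- be) * w)%C).
  { replace (Cexpi (- be) * (/ om * (RtoC (1 + e) * z)))%C with (RtoC (1 + e) * (Cexpi (- be) * w))%C
      by (unfold w; ring).
    unfold Re; simpl; ring. }
  assert (Ei : Rabs (Im (Cexpi (- be) * (/ om * (RtoC (1 + e) * z)))%C) = (1 + e) * Rabs (Im (Cexpi (- be) * w)%C)).
  { replace (Cexpi (- be) * (/ om * (RtoC (1 + e) * z)))%C with (RtoC (1 + e) * (Cexpi (- be) * w))%C
      by (unfold w; ring).
    rewrite <- (Rabs_pos_eq (1 + e)) at 2 by lra; rewrite <- Rabs_mult; f_equal.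
    unfold Im; simpl; ring. }
  destruct (apex_polar (U := U)) as [L [HL EL]].
  assert (EmL : Cmod (apex a b h) = L) by (rewrite EL, Cmod_polar; lra).
  assert (T := trig_signs (U := U)); destruct T as [T1 [T2 [T3 T4]]].
  apply (kite_covered_reachable (U := U)); unfold kite_cone, kite_side in *; rewrite Er, Ei in *; rewrite ?EmL in *.
  - set (x := Re _) in *; set (y := Rabs _) in *.
    apply Rmult_le_reg_l with (1 + e); lra.
  - set (x := Re _) in *; set (y := Rabs _) in *.
    assert (0 < L * sin (PI / INR q)) by (apply Rmult_lt_0_compat; lra).
    set (m := x * sin (PI / INR q) + y * cos (PI / INR q)) in *.
    assert ((1 + e) * m <= L * sin (PI / INR q)) by (unfold m; lra).
    destruct (Rle_lt_dec m 0); [unfold m in *; lra|].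
    assert (0 < e * m) by (apply Rmult_lt_0_compat; lra); unfold m in *; lra.
Qed.

End Interior.

(** * The series at the dominant singularity *)

Lemma Csum_plus (u v : nat -> C) (n : nat) : Csum (fun k => u k + v k)%C n = (Csum u n + Csum v n)%C.
Proof.
  induction n as [|n IH]; [apply C_eq; reflexivity|].
  rewrite !Csum_S, IH; ring.
Qed.

Lemma Csum_zero (f : nat -> C) (n : nat) : (forall i, (i <= n)%nat -> f i = RtoC 0) -> Csum f n = RtoC 0.
Proof.
  intros H; induction n as [|n IH].
  - rewrite <- (H 0%nat) by lia; apply C_eq; reflexivity.
  - rewrite Csum_S, IH, H by auto; ring.
Qed.

Lemma Csum_ends (f : nat -> C) (k : nat) : (1 <= k)%nat ->
  (forall i, (1 <= i < k)%nat -> f i = RtoC 0) -> Csum f k = (f 0%nat + f k)%C.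
Proof.
  intros Hk H; destruct k as [|k]; [lia|]; rewrite Csum_S; f_equal.
  assert (G : forall j, (j <= k)%nat -> Csum f j = f 0%nat).
  { induction j as [|j IH]; intros Hj; [apply C_eq; reflexivity|].
    rewrite Csum_S, (IH ltac:(lia)), (H (S j) ltac:(lia)); ring. }
  apply G; lia.
Qed.

Lemma conv_plus_r (u v w : nat -> C) (k : nat) :
  conv u (fun i => v i + w i)%C k = (conv u v k + conv u w k)%C.
Proof. unfold conv; rewrite <- Csum_plus; apply Csum_ext; intros; ring. Qed.

Lemma conv_plus_l (u v w : nat -> C) (k : nat) :
  conv (fun i => u i + v i)%C w k = (conv u w k + conv v w k)%C.
Proof. unfold conv; rewrite <- Csum_plus; apply Csum_ext; intros; ring. Qed.

Lemma conv_scal_r (c : C) (u v : nat -> C) (k : nat) : conv u (fun i => c * v i)%C k = (c * conv u v k)%C.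
Proof. unfold conv; rewrite <- Csum_scal; apply Csum_ext; intros; ring. Qed.

Definition unit_seq (k : nat) : C := match k with O => RtoC 1 | _ => RtoC 0 end.
Definition tailseq (u : nat -> C) (k : nat) : C := match k with O => RtoC 0 | _ => u k end.

Lemma conv_unit_r (u : nat -> C) (k : nat) : conv u unit_seq k = u k.
Proof.
  unfold conv; destruct k as [|k].
  - apply C_eq; simpl; unfold Re, Im; simpl; ring.
  - rewrite Csum_S, Nat.sub_diag, Csum_zero; [simpl; ring|].
    intros i Hi; replace (S k - i)%nat with (S (k - i)) by lia; simpl; ring.
Qed.

Lemma conv_unit_l (u : nat -> C) (k : nat) : conv unit_seq u k = u k.
Proof.
  unfold conv; destruct k as [|k].
  - apply C_eq; simpl; unfold Re, Im; simpl; ring.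
  - rewrite Csum_ends; [simpl; ring|lia|].
    intros [|i] Hi; [lia|simpl; ring].
Qed.

Lemma split_unit (u : nat -> C) (k : nat) : u 0%nat = RtoC 1 -> u k = (unit_seq k + tailseq u k)%C.
Proof. intros H; destruct k; simpl; [rewrite H|]; ring. Qed.

Lemma conv_pow_0 (u : nat -> C) (m : nat) : u 0%nat = RtoC 1 -> conv_pow u m 0 = RtoC 1.
Proof.
  intros H; induction m as [|m IH]; [reflexivity|].
  transitivity (u 0%nat * conv_pow u m 0)%C; [apply C_eq; reflexivity|].
  rewrite H, IH; ring.
Qed.

(** The top coefficient enters linearly, with a factor [m], because [y_0 = 1]. *)
Lemma conv_pow_top (y y' : nat -> C) (m k : nat) : (1 <= k)%nat -> y 0%nat = RtoC 1 ->
  (forall i, (i < k)%nat -> y' i = y i) -> y' k = RtoC 0 ->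
  conv_pow y m k = (RtoC (INR m) * y k + conv_pow y' m k)%C.
Proof.
  intros Hk Hy He Hz; induction m as [|m IH].
  - simpl; destruct k; [lia|]; ring.
  - assert (E : forall i, (i < k)%nat -> conv_pow y' m i = conv_pow y m i)
      by (intros i Hi; apply conv_pow_ext; intros j Hj; apply He; lia).
    assert (D : (conv y (conv_pow y m) k - conv y' (conv_pow y' m) k)%C
      = ((y 0%nat * conv_pow y m k - y' 0%nat * conv_pow y' m k)
         + (y k * conv_pow y m 0 - y' k * conv_pow y' m 0))%C).
    { transitivity (Csum (fun i => y i * conv_pow y m (k - i) - y' i * conv_pow y' m (k - i))%C k).
      - unfold conv.
        transitivity (Csum (fun i => y i * conv_pow y m (k - i))%C k
          + RtoC (-1) * Csum (fun i => y' i * conv_pow y' m (k - i))%C k)%C; [ring|].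
        rewrite <- Csum_scal, <- Csum_plus; apply Csum_ext; intros; ring.
      - rewrite Csum_ends; auto.
        + rewrite Nat.sub_0_r, Nat.sub_diag; reflexivity.
        + intros i Hi; rewrite He, E by lia; ring. }
    rewrite Hz, He, Hy, (conv_pow_0 y), IH in D by (auto; lia).
    simpl conv_pow; rewrite S_INR, RtoC_plus.
    replace (conv y (conv_pow y m) k) with (conv y (conv_pow y m) k - conv y' (conv_pow y' m) k
      + conv y' (conv_pow y' m) k)%C by ring.
    rewrite D; ring.
Qed.

Definition l1norm (N : nat) (u : nat -> C) : R := sum_f_R0 (fun k => Cmod (u k)) N.

Lemma l1norm_plus (N : nat) (u v w : nat -> C) : (forall k, (k <= N)%nat -> w k = u k + v k)%C ->
  l1norm N w <= l1norm N u + l1norm N v.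
Proof.
  intros H; unfold l1norm; rewrite <- sum_plus; apply sum_Rle; intros k Hk.
  rewrite H by auto; apply Cmod_triangle.
Qed.

Lemma l1norm_ge_0 (N : nat) (u : nat -> C) : 0 <= l1norm N u.
Proof. apply sum_Cmod_ge_0. Qed.

(** The coefficients of the linear part are solved for exactly in the recursion below,
    so that only this remainder has to be bounded. *)
Lemma conv_pow_quadratic (m : nat) : exists c, 0 <= c /\ forall (D : nat -> C) (N : nat),
  D 0%nat = RtoC 1 -> l1norm N (tailseq D) <= 1 ->
  l1norm N (fun k => conv_pow D m k - unit_seq k - RtoC (INR m) * tailseq D k)%C <= c * l1norm N (tailseq D) ^ 2.
Proof.
  induction m as [|m [c [Hc IH]]].
  - exists 0; split; [lra|]; intros D N HD Hv; rewrite Rmult_0_l; right.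
    unfold l1norm; rewrite <- (sum_eq (fun _ => 0)).
    + induction N as [|N IHN]; simpl; [reflexivity|rewrite IHN; [ring|]].
      apply Rle_trans with (2 := Hv); simpl; generalize (Cmod_ge_0 (tailseq D (S N))); unfold l1norm; simpl; lra.
    + intros k _; rewrite <- Cmod_0; f_equal; unfold unit_seq; destruct k; simpl; ring.
  - exists (2 * c + INR m); assert (Hm := pos_INR m); split; [lra|]; intros D N HD Hv.
    specialize (IH D N HD Hv).
    set (d := tailseq D) in *.
    set (Q := fun k => (conv_pow D m k - unit_seq k - RtoC (INR m) * d k)%C) in *.
    assert (E : forall k, (k <= N)%nat ->
      (conv_pow D (S m) k - unit_seq k - RtoC (INR (S m)) * d k = conv D Q k + RtoC (INR m) * conv d d k)%C).
    { intros k _; simpl conv_pow; rewrite S_INR, RtoC_plus.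
      rewrite (conv_ext D D (conv_pow D m) (fun i => Q i + (unit_seq i + RtoC (INR m) * d i))%C) by
        (auto; intros i _; unfold Q; ring).
      rewrite conv_plus_r, conv_plus_r, conv_unit_r, conv_scal_r.
      rewrite (conv_ext D (fun i => unit_seq i + d i)%C d d) by (auto; intros i _; apply split_unit; auto).
      rewrite conv_plus_l, conv_unit_l, (split_unit D k HD); fold d; ring. }
    eapply Rle_trans; [apply l1norm_plus with (1 := E)|].
    assert (A1 : l1norm N (conv D Q) <= l1norm N D * l1norm N Q) by apply sum_Cmod_conv_le.
    assert (A2 : l1norm N (conv d d) <= l1norm N d * l1norm N d) by apply sum_Cmod_conv_le.
    assert (A3 : l1norm N (fun k => RtoC (INR m) * conv d d k)%C = INR m * l1norm N (conv d d)).
    { unfold l1norm; rewrite scal_sum; apply sum_eq; intros k _.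
      rewrite Cmod_mult, Cmod_RtoC_pos by auto; ring. }
    assert (A4 : l1norm N D <= 1 + l1norm N d).
    { eapply Rle_trans; [apply (l1norm_plus N unit_seq d); intros k _; apply split_unit; auto|].
      apply Rplus_le_compat_r; clear; unfold l1norm; induction N as [|N IH]; simpl; rewrite ?Cmod_1, ?Cmod_0; simpl in *; lra. }
    assert (B1 := l1norm_ge_0 N Q); assert (B2 := l1norm_ge_0 N d); assert (B3 := l1norm_ge_0 N D).
    rewrite A3.
    assert (A5 : l1norm N D * l1norm N Q <= 2 * (c * l1norm N d ^ 2)) by (apply Rmult_le_compat; lra).
    assert (A6 : INR m * l1norm N (conv d d) <= INR m * (l1norm N d * l1norm N d)) by (apply Rmult_le_compat_l; auto).
    lra.
Qed.

Section Fuchs.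

Context {a b h p q : nat} {U : urn a b h p q}.

Let Ha : (0 < a)%nat. Proof. apply U. Qed.
Let Hb : (0 < b)%nat. Proof. apply U. Qed.
Let Hab : (a + b < h)%nat. Proof. apply U. Qed.

Variable K : R.

(** Determinant of the linear system for the two coefficients of rank [k]. It vanishes
    for [k = 1] only, which leaves one free parameter [K]. *)
Definition rec_det (k : nat) : R :=
  (INR h * INR k - INR a) * (INR h * INR k - INR b)
  - INR a * INR b * (INR (p - 1) * INR (q - 1)).

Definition coefX1 : R := - (K * INR (q - 1) / (INR q * INR (p - 1) + INR p * INR (q - 1))).
Definition coefY1 : R := K * INR (p - 1) / (INR q * INR (p - 1) + INR p * INR (q - 1)).

Definition next_coefX (k : nat) (x y : nat -> C) : C :=
  (RtoC (- ((INR h * INR k - INR b) * INR a) / rec_det k) * conv_pow y (q - 1) k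
   + RtoC (INR a * INR (q - 1) * INR b / rec_det k) * conv_pow x (p - 1) k)%C.
Definition next_coefY (k : nat) (x y : nat -> C) : C :=
  (RtoC (- ((INR h * INR k - INR a) * INR b) / rec_det k) * conv_pow x (p - 1) k
   + RtoC (INR b * INR (p - 1) * INR a / rec_det k) * conv_pow y (q - 1) k)%C.

(** The [N]-th approximation carries the coefficients up to index [N + 1] and
    vanishes beyond. *)
Fixpoint fuchs_approx (N : nat) : (nat -> C) * (nat -> C) :=
  match N with
  | O => (fun k => match k with O => RtoC 1 | S O => RtoC coefX1 | _ => RtoC 0 end,
          fun k => match k with O => RtoC 1 | S O => RtoC coefY1 | _ => RtoC 0 end)
  | S N' =>
      let x := fst (fuchs_approx N') in let y := snd (fuchs_approx N') in
      (fun k => if Nat.eq_dec k (S (S N')) then next_coefX k x y else x k,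
       fun k => if Nat.eq_dec k (S (S N')) then next_coefY k x y else y k)
  end.

Definition coefX (k : nat) : C := fst (fuchs_approx k) k.
Definition coefY (k : nat) : C := snd (fuchs_approx k) k.

Lemma fuchs_approx_beyond (N k : nat) : (S N < k)%nat -> fst (fuchs_approx N) k = RtoC 0 /\ snd (fuchs_approx N) k = RtoC 0.
Proof.
  revert k; induction N as [|N IH]; intros k Hk.
  - destruct k as [|[|k]]; [lia|lia|auto].
  - simpl; destruct (Nat.eq_dec k (S (S N))); [lia|apply IH; lia].
Qed.

Lemma fuchs_approx_stable (N k : nat) : (k <= S N)%nat -> fst (fuchs_approx N) k = coefX k /\ snd (fuchs_approx N) k = coefY k.
Proof.
  assert (Step : forall M, (k <= S M)%nat -> fst (fuchs_approx (S M)) k = fst (fuchs_approx M) k /\ snd (fuchs_approx (S M)) k = snd (fuchs_approx M) k).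
  { intros M HM; simpl; destruct (Nat.eq_dec k (S (S M))); [lia|auto]. }
  assert (G : forall M, (k <= S M)%nat -> forall j, fst (fuchs_approx (j + M)) k = fst (fuchs_approx M) k /\ snd (fuchs_approx (j + M)) k = snd (fuchs_approx M) k).
  { intros M HM j; induction j as [|j [I1 I2]]; [auto|].
    change (S j + M)%nat with (S (j + M)).
    destruct (Step (j + M)%nat ltac:(lia)) as [S1 S2]; rewrite S1, S2; auto. }
  intros HN; unfold coefX, coefY.
  destruct (Nat.le_gt_cases N k) as [L|L].
  - destruct (G N HN (k - N)%nat) as [G1 G2]; replace (k - N + N)%nat with k in * by lia; auto.
  - destruct (G k ltac:(lia) (N - k)%nat) as [G1 G2]; replace (N - k + k)%nat with N in * by lia; auto.
Qed.

Lemma coefX_0 : coefX 0 = RtoC 1. Proof. reflexivity. Qed.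
Lemma coefY_0 : coefY 0 = RtoC 1. Proof. reflexivity. Qed.
Lemma coefX_1 : coefX 1 = RtoC coefX1. Proof. reflexivity. Qed.
Lemma coefY_1 : coefY 1 = RtoC coefY1. Proof. reflexivity. Qed.

Lemma coef_SS (N : nat) : coefX (S (S N)) = next_coefX (S (S N)) (fst (fuchs_approx N)) (snd (fuchs_approx N))
  /\ coefY (S (S N)) = next_coefY (S (S N)) (fst (fuchs_approx N)) (snd (fuchs_approx N)).
Proof.
  destruct (fuchs_approx_stable (S N) (S (S N)) (Nat.le_refl _)) as [E1 E2].
  rewrite <- E1, <- E2; simpl; destruct (Nat.eq_dec N N); [auto|lia].
Qed.

Lemma INR_exponents : INR (p - 1) * INR a = INR h - INR a /\ INR (q - 1) * INR b = INR h - INR b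
  /\ 1 <= INR (p - 1) /\ 1 <= INR (q - 1).
Proof.
  assert (P2 := p_ge_2 (U := U)); assert (Q2 := q_ge_2 (U := U)).
  rewrite !minus_INR by lia; simpl (INR 1).
  assert (Ep := INR_h_p (U := U)); assert (Eq := INR_h_q (U := U)).
  assert (Hp := INR_pos_params (U := U)); repeat split; lra.
Qed.

Lemma rec_det_eq (k : nat) : rec_det k = INR h * (INR k - 1) * (INR h * INR k + (INR h - INR a - INR b)).
Proof.
  destruct INR_exponents as [E1 [E2 _]]; unfold rec_det.
  replace (INR a * INR b * (INR (p - 1) * INR (q - 1)))
    with ((INR (p - 1) * INR a) * (INR (q - 1) * INR b)) by ring.
  rewrite E1, E2; ring.
Qed.

Lemma sR_pos : 1 <= INR h - INR a - INR b.
Proof.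
  assert (INR (a + b + 1) <= INR h) by (apply le_INR; lia).
  rewrite !plus_INR in H; simpl (INR 1) in H; lra.
Qed.

Lemma rec_det_ge (k : nat) : (2 <= k)%nat -> INR h * INR k <= rec_det k /\ 1 <= rec_det k.
Proof.
  intros Hk; rewrite rec_det_eq.
  assert (2 <= INR k) by (apply (le_INR 2); auto).
  assert (1 <= INR h) by (apply (le_INR 1); lia).
  assert (S1 := sR_pos).
  assert (1 <= INR h * (INR k - 1)) by nra.
  assert (1 <= INR h * INR k) by nra.
  split; nra.
Qed.

(** At rank 1 the determinant vanishes, and [(coefX1, coefY1)] is in the kernel. *)
Lemma coef_rec (k : nat) :
  (RtoC (INR h * INR k) * coefX k = RtoC (INR a) * (coefX k - conv_pow coefY (q - 1) k))%C /\
  (RtoC (INR h * INR k) * coefY k = RtoC (INR b) * (coefY k - conv_pow coefX (p - 1) k))%C.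
Proof.
  destruct INR_exponents as [E1 [E2 [E3 E4]]].
  destruct k as [|[|N]].
  - rewrite !conv_pow_0, coefX_0, coefY_0 by reflexivity; simpl (INR 0); rewrite Rmult_0_r; split; ring.
  - rewrite (conv_pow_top coefY unit_seq), (conv_pow_top coefX unit_seq) by (auto; intros i Hi; replace i with 0%nat by lia; reflexivity).
    assert (Z : forall m, conv_pow unit_seq m 1 = RtoC 0).
    { intros m; induction m as [|m IH]; [reflexivity|].
      simpl conv_pow; rewrite conv_unit_l; auto. }
    rewrite !Z, coefX_1, coefY_1; simpl (INR 1); rewrite Rmult_1_r.
    set (d := INR q * INR (p - 1) + INR p * INR (q - 1)).
    assert (Hd : d <> 0).
    { unfold d; assert (Hp := INR_pos_params (U := U)); nra. }
    assert (X1 : INR h * coefX1 = INR a * (coefX1 - INR (q - 1) * coefY1)).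
    { unfold coefX1, coefY1; fold d; replace (INR h) with (INR (p - 1) * INR a + INR a) by lra; field; auto. }
    assert (X2 : INR h * coefY1 = INR b * (coefY1 - INR (p - 1) * coefX1)).
    { unfold coefX1, coefY1; fold d; replace (INR h) with (INR (q - 1) * INR b + INR b) by lra; field; auto. }
    split.
    + rewrite <- RtoC_mult, X1, RtoC_mult, RtoC_minus, RtoC_mult; ring.
    + rewrite <- RtoC_mult, X2, RtoC_mult, RtoC_minus, RtoC_mult; ring.
  - set (k := S (S N)).
    destruct (coef_SS N) as [A1 A2]; fold k in A1, A2.
    assert (Hdet : rec_det k <> 0) by (generalize (rec_det_ge k ltac:(lia)); lra).
    destruct (fuchs_approx_beyond N k ltac:(lia)) as [Z1 Z2].
    rewrite (conv_pow_top coefY (snd (fuchs_approx N)) (q - 1) k ltac:(lia) eq_refl (fun i Hi => proj2 (fuchs_approx_stable N i ltac:(lia))) Z2).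
    rewrite (conv_pow_top coefX (fst (fuchs_approx N)) (p - 1) k ltac:(lia) eq_refl (fun i Hi => proj1 (fuchs_approx_stable N i ltac:(lia))) Z1).
    set (R0 := conv_pow (snd (fuchs_approx N)) (q - 1) k) in *; set (S0 := conv_pow (fst (fuchs_approx N)) (p - 1) k) in *.
    unfold next_coefX, next_coefY in A1, A2; fold R0 S0 in A1, A2.
    assert (Hk : (RtoC (rec_det k) = (RtoC (INR h * INR k) - RtoC (INR a)) * (RtoC (INR h * INR k) - RtoC (INR b))
      - RtoC (INR a) * RtoC (INR b) * (RtoC (INR (p - 1)) * RtoC (INR (q - 1))))%C).
    { unfold rec_det; rewrite !RtoC_minus, !RtoC_mult, !RtoC_minus, !RtoC_mult; ring. }
    assert (Hdet' : RtoC (rec_det k) <> RtoC 0) by (apply RtoC_neq0; auto).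
    rewrite RtoC_div, RtoC_opp, RtoC_mult, RtoC_minus, RtoC_div, !RtoC_mult in A1 by auto.
    rewrite RtoC_div, RtoC_opp, RtoC_mult, RtoC_minus, RtoC_div, !RtoC_mult in A2 by auto.
    rewrite RtoC_mult in Hk |- *.
    set (H0 := RtoC (INR h)) in *; set (k0 := RtoC (INR k)) in *.
    set (ac := RtoC (INR a)) in *; set (bc := RtoC (INR b)) in *.
    set (mc := RtoC (INR (q - 1))) in *; set (nc := RtoC (INR (p - 1))) in *.
    set (dc := RtoC (rec_det k)) in *.
    assert (Q1 : (dc * coefX k = - (H0 * k0 - bc) * ac * R0 + ac * mc * bc * S0)%C) by (rewrite A1; field; auto).
    assert (Q2 : (dc * coefY k = - (H0 * k0 - ac) * bc * S0 + bc * nc * ac * R0)%C) by (rewrite A2; field; auto).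
    assert (cancel : forall u v : C, (dc * u = dc * v)%C -> u = v).
    { intros u v E; replace u with (/ dc * (dc * u))%C by (field; auto).
      rewrite E; field; auto. }
    split; apply cancel.
    + transitivity (H0 * k0 * (dc * coefX k))%C; [ring|].
      transitivity (ac * ((dc * coefX k) - (mc * (dc * coefY k) + dc * R0)))%C; [|ring].
      rewrite Q1, Q2, Hk; ring.
    + transitivity (H0 * k0 * (dc * coefY k))%C; [ring|].
      transitivity (bc * ((dc * coefY k) - (nc * (dc * coefX k) + dc * S0)))%C; [|ring].
      rewrite Q1, Q2, Hk; ring.
Qed.

Lemma next_coef_bound : exists C0, 0 < C0 /\ forall k x y, (2 <= k)%nat ->
  Cmod (next_coefX k x y) + Cmod (next_coefY k x y)
    <= C0 * (Cmod (conv_pow y (q - 1) k) + Cmod (conv_pow x (p - 1) k)).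
Proof.
  assert (Hp := INR_pos_params (U := U)); destruct Hp as [A1 [B1 _]].
  destruct INR_exponents as [E1 [E2 [E3 E4]]].
  set (c1 := INR a * INR (q - 1) * INR b); set (c2 := INR b * INR (p - 1) * INR a).
  assert (P1 : 0 <= c1) by (unfold c1; repeat apply Rmult_le_pos; lra).
  assert (P2 : 0 <= c2) by (unfold c2; repeat apply Rmult_le_pos; lra).
  exists (INR a + INR b + c1 + c2); split; [lra|].
  intros k x y Hk; destruct (rec_det_ge k Hk) as [D1 D2].
  assert (K2 : 2 <= INR k) by (apply (le_INR 2); auto).
  assert (Hh : INR a + INR b <= INR h) by (generalize sR_pos; lra).
  assert (T1 : forall u v, 0 <= u <= rec_det k -> 0 <= v -> Cmod (RtoC (- (u * v) / rec_det k)) <= v).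
  { intros u v Hu Hv; rewrite Cmod_R; unfold Rdiv.
    rewrite Rabs_mult, Rabs_Ropp, Rabs_mult, !Rabs_pos_eq; try lra; [|left; apply Rinv_0_lt_compat; lra].
    apply Rmult_le_reg_r with (rec_det k); [lra|]; rewrite Rmult_assoc, Rinv_l by lra; nra. }
  assert (T2 : forall v, 0 <= v -> Cmod (RtoC (v / rec_det k)) <= v).
  { intros v Hv; rewrite Cmod_RtoC_pos by (apply Rmult_le_pos; [lra|left; apply Rinv_0_lt_compat; lra]).
    apply Rmult_le_reg_r with (rec_det k); [lra|]; unfold Rdiv; rewrite Rmult_assoc, Rinv_l by lra; nra. }
  set (r := Cmod (conv_pow y (q - 1) k)); set (s := Cmod (conv_pow x (p - 1) k)).
  assert (Hr : 0 <= r) by apply Cmod_ge_0; assert (Hs : 0 <= s) by apply Cmod_ge_0.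
  assert (M1 : Cmod (next_coefX k x y) <= INR a * r + c1 * s).
  { unfold next_coefX; apply Rle_trans with (1 := Cmod_triangle _ _); rewrite !Cmod_mult; fold r s.
    apply Rplus_le_compat; apply Rmult_le_compat_r; auto; apply T1; try lra; nra. }
  assert (M2 : Cmod (next_coefY k x y) <= INR b * s + c2 * r).
  { unfold next_coefY; apply Rle_trans with (1 := Cmod_triangle _ _); rewrite !Cmod_mult; fold r s.
    apply Rplus_le_compat; apply Rmult_le_compat_r; auto; apply T1; try lra; nra. }
  assert (0 <= INR a * s) by (apply Rmult_le_pos; lra); assert (0 <= INR b * r) by (apply Rmult_le_pos; lra).
  assert (0 <= c1 * r) by (apply Rmult_le_pos; lra); assert (0 <= c2 * s) by (apply Rmult_le_pos; lra).
  lra.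
Qed.

Definition scaled (r : R) (u : nat -> C) (k : nat) : C := (u k * RtoC r ^ k)%C.

Lemma conv_pow_scaled (r : R) (u : nat -> C) (m k : nat) :
  conv_pow (scaled r u) m k = scaled r (conv_pow u m) k.
Proof.
  unfold scaled; revert k; induction m as [|m IH]; intros k; simpl conv_pow.
  - destruct k; simpl; ring.
  - rewrite <- conv_geom; apply conv_ext; auto.
Qed.

Lemma Cmod_scaled (r : R) (u : nat -> C) (k : nat) : 0 <= r -> Cmod (scaled r u k) = Cmod (u k) * r ^ k.
Proof. intros Hr; unfold scaled; rewrite Cmod_mult, Cmod_pow, Cmod_RtoC_pos; auto. Qed.

Lemma tailseq_scaled (r : R) (u : nat -> C) (k : nat) : tailseq (scaled r u) k = scaled r (tailseq u) k.
Proof. destruct k; unfold scaled; simpl; ring. Qed.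

Lemma sum_single (f : nat -> R) (M : nat) : 0 <= f 1%nat -> (forall k, k <> 1%nat -> f k = 0) ->
  sum_f_R0 f M <= f 1%nat.
Proof.
  intros H1 H; destruct M as [|M]; [simpl; rewrite (H 0%nat) by lia; auto|].
  right; induction M as [|M IH]; simpl; [rewrite (H 0%nat) by lia; ring|].
  simpl in IH; rewrite IH, (H (S (S M))) by lia; ring.
Qed.

(** The recursion bounds the new coefficients by quadratic remainders of the
    previous approximation, so that a small ball of l1 norms is preserved. *)
Lemma fuchs_approx_bound : exists r, 0 < r /\ forall N M,
  l1norm M (tailseq (scaled r (fst (fuchs_approx N)))) + l1norm M (tailseq (scaled r (snd (fuchs_approx N)))) <= 1.
Proof.
  destruct next_coef_bound as [C0 [HC0 B]].
  destruct (conv_pow_quadratic (q - 1)) as [c1 [Hc1 Q1]].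
  destruct (conv_pow_quadratic (p - 1)) as [c2 [Hc2 Q2]].
  set (e := Cmod (RtoC coefX1) + Cmod (RtoC coefY1)).
  assert (He : 0 <= e) by (unfold e; generalize (Cmod_ge_0 (RtoC coefX1)) (Cmod_ge_0 (RtoC coefY1)); lra).
  set (L := C0 * (c1 + c2)).
  assert (HL : 0 <= L) by (unfold L; apply Rmult_le_pos; lra).
  set (r := / (2 * (e + 1) * (2 * (L + 1)))).
  assert (Hd : 0 < 2 * (e + 1) * (2 * (L + 1))) by nra.
  assert (Hr : 0 < r) by (apply Rinv_0_lt_compat; auto).
  assert (Hr2 : r * (2 * (e + 1) * (2 * (L + 1))) = 1) by (unfold r; field; split; lra).
  exists r; split; auto.
  assert (S1 : 2 * (e * r) <= 1) by nra.
  assert (S2 : L * (2 * (e * r)) * 2 <= 1).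
  { assert (0 <= e * r) by (apply Rmult_le_pos; lra).
    assert (E2 : (e * r) * L * 4 + (e * r + r * (L + 1)) * 4 = 1) by (rewrite <- Hr2 at 2; ring).
    assert (0 <= r * (L + 1)) by (apply Rmult_le_pos; lra); lra. }
  enough (G : forall N M,
    l1norm M (tailseq (scaled r (fst (fuchs_approx N)))) + l1norm M (tailseq (scaled r (snd (fuchs_approx N)))) <= 2 * (e * r)).
  { intros N M; apply Rle_trans with (1 := G N M); auto. }
  set (E := fun k : nat => if Nat.eq_dec k 1 then e * r else 0).
  assert (HE : forall M, sum_f_R0 E M <= e * r).
  { intros M; apply (sum_single E M); unfold E; simpl; [apply Rmult_le_pos; lra|].
    intros k Hk; destruct (Nat.eq_dec k 1); [lia|auto]. }
  assert (Hk1 : forall N, Cmod (tailseq (scaled r (fst (fuchs_approx N))) 1) + Cmod (tailseq (scaled r (snd (fuchs_approx N))) 1) = e * r).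
  { intros N; rewrite !tailseq_scaled, !Cmod_scaled by lra; simpl tailseq.
    destruct (fuchs_approx_stable N 1 ltac:(lia)) as [E1 E2]; rewrite E1, E2, coefX_1, coefY_1; unfold e; ring. }
  induction N as [|N IH]; intros M.
  - unfold l1norm; rewrite <- plus_sum.
    apply Rle_trans with (sum_f_R0 E M); [|generalize (HE M); assert (0 <= e * r) by (apply Rmult_le_pos; lra); lra].
    apply sum_Rle; intros k _; unfold E; destruct (Nat.eq_dec k 1) as [->|Hk]; [right; apply (Hk1 0%nat)|].
    rewrite !tailseq_scaled, !Cmod_scaled by lra; destruct k as [|[|k]]; [|lia|]; simpl; rewrite Cmod_0; lra.
  - set (x := fst (fuchs_approx N)) in *; set (y := snd (fuchs_approx N)) in *.
    set (Ry := fun k => (conv_pow (scaled r y) (q - 1) k - unit_seq k - RtoC (INR (q - 1)) * tailseq (scaled r y) k)%C).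
    set (Rx := fun k => (conv_pow (scaled r x) (p - 1) k - unit_seq k - RtoC (INR (p - 1)) * tailseq (scaled r x) k)%C).
    assert (x0 : x 0%nat = RtoC 1) by (apply (fuchs_approx_stable N 0); lia).
    assert (y0 : y 0%nat = RtoC 1) by (apply (fuchs_approx_stable N 0); lia).
    assert (T : forall k, (k <= M)%nat ->
      Cmod (tailseq (scaled r (fst (fuchs_approx (S N)))) k) + Cmod (tailseq (scaled r (snd (fuchs_approx (S N)))) k)
      <= E k + C0 * (Cmod (Ry k) + Cmod (Rx k))).
    { intros k _; assert (P0 : 0 <= C0 * (Cmod (Ry k) + Cmod (Rx k)))
        by (apply Rmult_le_pos; [lra|]; generalize (Cmod_ge_0 (Ry k)) (Cmod_ge_0 (Rx k)); lra).
      unfold E; destruct (Nat.eq_dec k 1) as [->|Hk]; [rewrite (Hk1 (S N)); lra|].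
      rewrite !tailseq_scaled, !Cmod_scaled by lra.
      destruct k as [|[|j]]; [simpl; rewrite Cmod_0; lra|lia|]; set (k := S (S j)) in *.
      change (tailseq (fst (fuchs_approx (S N))) k) with (fst (fuchs_approx (S N)) k).
      change (tailseq (snd (fuchs_approx (S N))) k) with (snd (fuchs_approx (S N)) k).
      destruct (Nat.le_gt_cases k (S (S N))) as [Lk|Lk].
      2:{ destruct (fuchs_approx_beyond (S N) k ltac:(lia)) as [Z1 Z2]; rewrite Z1, Z2, Cmod_0; lra. }
      destruct (fuchs_approx_stable (S N) k ltac:(lia)) as [E1 E2]; rewrite E1, E2.
      destruct (coef_SS j) as [A1 A2]; fold k in A1, A2; rewrite A1, A2.
      destruct (fuchs_approx_beyond j k ltac:(lia)) as [Z1 Z2].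
      assert (Bk := B k (fst (fuchs_approx j)) (snd (fuchs_approx j)) ltac:(lia)).
      assert (F1 : forall i, (i < k)%nat -> snd (fuchs_approx j) i = y i).
      { intros i Hi; rewrite (proj2 (fuchs_approx_stable j i ltac:(lia))); symmetry; apply (fuchs_approx_stable N i); lia. }
      assert (F2 : forall i, (i < k)%nat -> fst (fuchs_approx j) i = x i).
      { intros i Hi; rewrite (proj1 (fuchs_approx_stable j i ltac:(lia))); symmetry; apply (fuchs_approx_stable N i); lia. }
      assert (Ey : Ry k = scaled r (conv_pow (snd (fuchs_approx j)) (q - 1)) k).
      { unfold Ry; rewrite conv_pow_scaled, tailseq_scaled; unfold scaled.
        rewrite (conv_pow_top y (snd (fuchs_approx j)) (q - 1) k ltac:(lia) y0 F1 Z2); simpl; ring. }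
      assert (Ex : Rx k = scaled r (conv_pow (fst (fuchs_approx j)) (p - 1)) k).
      { unfold Rx; rewrite conv_pow_scaled, tailseq_scaled; unfold scaled.
        rewrite (conv_pow_top x (fst (fuchs_approx j)) (p - 1) k ltac:(lia) x0 F2 Z1); simpl; ring. }
      rewrite Ey, Ex, !Cmod_scaled by lra.
      assert (0 <= r ^ k) by (apply pow_le; lra); nra. }
    assert (V := IH M); unfold l1norm in V |- *.
    rewrite <- plus_sum; apply Rle_trans with (1 := sum_Rle _ _ M T).
    rewrite plus_sum.
    replace (sum_f_R0 (fun k => C0 * (Cmod (Ry k) + Cmod (Rx k))) M) with (C0 * (l1norm M Ry + l1norm M Rx))
      by (unfold l1norm; rewrite <- plus_sum, scal_sum; apply sum_eq; intros; ring).
    fold (l1norm M (tailseq (scaled r x))) in V; fold (l1norm M (tailseq (scaled r y))) in V.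
    set (u := l1norm M (tailseq (scaled r x))) in *; set (v := l1norm M (tailseq (scaled r y))) in *.
    assert (U0 : 0 <= u) by apply l1norm_ge_0; assert (V0 : 0 <= v) by apply l1norm_ge_0.
    assert (G1 : l1norm M Ry <= c1 * v ^ 2).
    { apply Q1; [unfold scaled; rewrite y0; simpl; ring|fold v; lra]. }
    assert (G2 : l1norm M Rx <= c2 * u ^ 2).
    { apply Q2; [unfold scaled; rewrite x0; simpl; ring|fold u; lra]. }
    assert (W : v ^ 2 <= (2 * (e * r)) ^ 2 /\ u ^ 2 <= (2 * (e * r)) ^ 2) by (split; apply pow_incr; lra).
    assert (G3 : C0 * (l1norm M Ry + l1norm M Rx) <= L * (2 * (e * r)) ^ 2).
    { unfold L; rewrite Rmult_assoc; apply Rmult_le_compat_l; [lra|].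
      assert (c1 * v ^ 2 <= c1 * (2 * (e * r)) ^ 2) by (apply Rmult_le_compat_l; tauto).
      assert (c2 * u ^ 2 <= c2 * (2 * (e * r)) ^ 2) by (apply Rmult_le_compat_l; tauto).
      lra. }
    assert (G4 : L * (2 * (e * r)) ^ 2 <= e * r).
    { replace (L * (2 * (e * r)) ^ 2) with ((L * (2 * (e * r)) * 2) * (e * r)) by ring.
      assert (0 <= e * r) by (apply Rmult_le_pos; lra); nra. }
    generalize (HE M); lra.
Qed.

Lemma coef_CVin : exists r, 0 < r /\ CVin coefX r /\ CVin coefY r.
Proof.
  destruct fuchs_approx_bound as [r [Hr B]]; exists r; split; auto.
  assert (G : forall u : nat -> C, u 0%nat = RtoC 1 -> (forall N, l1norm N (tailseq (scaled r u)) <= 1) -> CVin u r).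
  { intros u u0 Hu r1 Hr1; apply ex_series_bounded with 2.
    - intros k; apply Rmult_le_pos; [apply Cmod_ge_0|apply pow_le; lra].
    - intros N; apply Rle_trans with (l1norm N unit_seq + l1norm N (tailseq (scaled r u))).
      + unfold l1norm; rewrite <- plus_sum; apply sum_Rle; intros k _.
        rewrite tailseq_scaled, Cmod_scaled by lra; destruct k as [|k]; simpl tailseq; simpl unit_seq.
        * rewrite u0, Cmod_0; simpl; lra.
        * rewrite Cmod_0, Rplus_0_l; apply Rmult_le_compat_l; [apply Cmod_ge_0|apply pow_incr; lra].
      + assert (l1norm N unit_seq <= 1); [|generalize (Hu N); lra].
        clear; unfold l1norm; induction N as [|N IH]; simpl; rewrite ?Cmod_1, ?Cmod_0; lra. }
  assert (P : forall u N, 0 <= l1norm N u) by (intros; apply l1norm_ge_0).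
  split; apply G; auto; intros N; assert (BN := B N N);
    [assert (Q := P (tailseq (scaled r (snd (fuchs_approx N)))) N)|assert (Q := P (tailseq (scaled r (fst (fuchs_approx N)))) N)].
  - replace (l1norm N (tailseq (scaled r coefX))) with (l1norm N (tailseq (scaled r (fst (fuchs_approx N))))); [lra|].
    apply sum_eq; intros k Hk; rewrite !tailseq_scaled; unfold scaled; do 2 f_equal.
    destruct k; simpl tailseq; auto; apply (fuchs_approx_stable N); lia.
  - replace (l1norm N (tailseq (scaled r coefY))) with (l1norm N (tailseq (scaled r (snd (fuchs_approx N))))); [lra|].
    apply sum_eq; intros k Hk; rewrite !tailseq_scaled; unfold scaled; do 2 f_equal.
    destruct k; simpl tailseq; auto; apply (fuchs_approx_stable N); lia.
Qed.

Lemma PS_index (c : nat -> C) (r : R) (w : C) : CVin c r -> Cmod w < r ->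
  PS (fun k => RtoC (INR k) * c k)%C w = (w * PS (dseq c) w)%C.
Proof.
  intros Hc Hw; apply Cis_series_unique.
  replace (w * PS (dseq c) w)%C with (RtoC (INR 0) * c 0%nat * w ^ 0 + w * PS (dseq c) w)%C by (simpl; ring).
  apply (Cis_series_incr_1 (fun k => RtoC (INR k) * c k * w ^ k)%C).
  apply Cis_series_ext with (2 := Cis_series_scal w _ _ (PS_correct (dseq c) r w (CVin_dseq c r Hc) Hw)).
  intros k; unfold dseq; simpl Cpow; ring.
Qed.

Lemma fuchs_system (r : R) (w : C) : CVin coefX r -> CVin coefY r -> Cmod w < r ->
  (RtoC (INR h) * (w * PS (dseq coefX) w) = RtoC (INR a) * (PS coefX w - PS coefY w ^ (q - 1)))%C /\
  (RtoC (INR h) * (w * PS (dseq coefY) w) = RtoC (INR b) * (PS coefY w - PS coefX w ^ (p - 1)))%C.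
Proof.
  intros Hal Hde Hw.
  assert (G : forall (u v : nat -> C) (c : R) (m : nat), CVin u r -> CVin v r ->
    (forall k, (RtoC (INR h * INR k) * u k = RtoC c * (u k - conv_pow v m k))%C) ->
    (RtoC (INR h) * (w * PS (dseq u) w) = RtoC c * (PS u w - PS v w ^ m))%C).
  { intros u v c m Hu Hv E.
    rewrite <- (PS_index u r w Hu Hw).
    rewrite <- (PS_conv_pow v r m w Hv Hw).
    rewrite <- (PS_scal _ _ r w (CVin_index u r Hu) Hw).
    apply Cis_series_unique.
    apply Cis_series_ext with (fun k => RtoC c * (u k * w ^ k - conv_pow v m k * w ^ k))%C.
    - intros k; transitivity (RtoC (INR h * INR k) * u k * w ^ k)%C; [rewrite E|rewrite RtoC_mult]; ring.
    - apply Cis_series_scal, Cis_series_minus; apply PS_correct with r; auto; apply CVin_conv_pow; auto. }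
  split; apply G; auto; intros k; apply (coef_rec k).
Qed.

End Fuchs.

(** * The expansion at the dominant singularity *)

(** The singular form with its exponent as a parameter: [c = a] gives [X], and [c = b]
    its companion [Y]. *)
Definition branch (h s c : nat) (A : C -> C) (zeta : C) : C :=
  (Cpowr (RtoC (INR s)) (- (INR c / INR s)) * Cpowr zeta (- (INR c / INR s))
   * A (Cpowr zeta (INR h / INR s)))%C.

(** The powers of [zeta] turn the regular singular system for the series into
    the autonomous system: the exponents match because [d m = c + s]. *)
Lemma Pder_branch (h s c d m : nat) (A D : C -> C) (A1 : C) (g : R -> C) (t : R) (e : C) :
  (0 < s)%nat -> (d * m = c + s)%nat -> Pder g t e -> slit (g t) ->
  let W := Cpowr (g t) (INR h / INR s) in
  Cder A W A1 -> (RtoC (INR h) * (W * A1) = RtoC (INR c) * (A W - D W ^ m))%C ->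
  Pder (fun x => branch h s c A (g x)) t (- e * (RtoC (INR c) * branch h s d D (g t) ^ m))%C.
Proof.
  intros Hs Hd Hg Hsl W HA E.
  assert (Hs0 : 0 < INR s) by (apply lt_0_INR; auto).
  assert (Hg0 := slit_neq0 _ Hsl).
  assert (Hsc : RtoC (INR s) <> RtoC 0) by (apply RtoC_neq0; lra).
  set (S := Cpowr (RtoC (INR s)) (- (INR c / INR s))).
  set (P := Cpowr (g t) (- (INR c / INR s))).
  assert (Q : forall u : C, u <> RtoC 0 ->
    (Cpowr u (- (INR d / INR s)) ^ m = Cpowr u (- (INR c / INR s)) / u)%C).
  { intros u Hu; rewrite Cpowr_pow by auto.
    replace (INR m * - (INR d / INR s)) with (- (INR c / INR s) + - 1).
    - rewrite Cpowr_plus by auto; unfold Cdiv; f_equal.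
      replace (-1) with (- (1)) by ring; rewrite Cpowr_opp, Cpowr_1; auto.
    - assert (Ed : INR d * INR m = INR c + INR s) by (rewrite <- mult_INR, <- plus_INR, Hd; auto).
      field_simplify_eq; [lra|lra]. }
  eapply Pder_eq.
  - unfold branch; apply Pder_mult.
    + apply (Pder_scal S), (Pder_Cpowr g t e); auto.
    + apply (Cder_Pder A (fun x => Cpowr (g x) (INR h / INR s)) t A1); [apply Pder_Cpowr; eauto|exact HA].
  - unfold branch; fold W S P; rewrite !Cpow_mult_l, !Q by auto; fold S P.
    replace (RtoC (INR h / INR s)) with (RtoC (INR h) / RtoC (INR s))%C by (rewrite RtoC_div by lra; auto).
    replace (RtoC (- (INR c / INR s))) with (- (RtoC (INR c) / RtoC (INR s)))%C
      by (rewrite RtoC_opp, RtoC_div by lra; auto).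
    transitivity (S * P * e / (RtoC (INR s) * g t) * (RtoC (INR h) * (W * A1) - RtoC (INR c) * A W))%C;
      [field; auto|rewrite E; field; auto].
Qed.

Section Sector.

Context {a b h p q : nat} {U : urn a b h p q}.

Let Ha : (0 < a)%nat. Proof. apply U. Qed.
Let Hb : (0 < b)%nat. Proof. apply U. Qed.
Let Hab : (a + b < h)%nat. Proof. apply U. Qed.
Let Hp : h = (a * p)%nat. Proof. apply U. Qed.
Let Hq : h = (b * q)%nat. Proof. apply U. Qed.

Variable s : nat.
Hypothesis Hs : h = (a + b + s)%nat.

Let Hs1 : (0 < s)%nat. Proof. lia. Qed.
Let Hs0 : 0 < INR s. Proof. apply lt_0_INR; lia. Qed.

(** The value of the first integral that makes the branch satisfy [Y^q - X^p = 1]. *)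
Definition pole_scale : R := Rpower (INR s) (INR h / INR s).

Local Notation coefX := (coefX (a := a) (b := b) (h := h) (p := p) (q := q) pole_scale).
Local Notation coefY := (coefY (a := a) (b := b) (h := h) (p := p) (q := q) pole_scale).
Local Notation sys := (solves (INR a) (INR b) (q - 1) (p - 1)).
Local Notation rhoh := (rhoh a b h).
Local Notation Jr := (Jr a b h).
Local Notation Xr := (Xr a h).
Local Notation Yr := (Yr b h).
Local Notation X0 := (X0 a b p q).
Local Notation Y0 := (Y0 a b p q).

Lemma RtoC_inj_eq (x y : R) : RtoC x = RtoC y -> x = y.
Proof. intros H; injection H; auto. Qed.

(** Along the positive axis [F = D^q - A^p] satisfies [w F' = F], so it is linear. *)
Lemma fuchs_first_integral (r t : R) : CVin coefX r -> CVin coefY r -> 0 < t < r ->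
  (PS coefY (RtoC t) ^ q - PS coefX (RtoC t) ^ p = RtoC (pole_scale * t))%C.
Proof.
  intros Hal Hde Ht.
  assert (P2 := p_ge_2 (U := U)); assert (Q2 := q_ge_2 (U := U)).
  set (F := fun x : R => (PS coefY (RtoC x) ^ q - PS coefX (RtoC x) ^ p)%C).
  set (F1 := fun x : R => (RtoC (INR q) * PS coefY (RtoC x) ^ (q - 1) * PS (dseq coefY) (RtoC x)
     - RtoC (INR p) * PS coefX (RtoC x) ^ (p - 1) * PS (dseq coefX) (RtoC x))%C).
  assert (M : forall x, 0 <= x < r -> Cmod (RtoC x) < r) by (intros; rewrite Cmod_RtoC_pos; lra).
  assert (D : forall x, 0 <= x < r -> Pder F x (F1 x)).
  { intros x Hx; unfold F, F1; eapply Pder_eq.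
    - apply Pder_minus; apply Pder_pow.
      + apply (Cder_Pder (PS coefY) RtoC x (PS (dseq coefY) (RtoC x)) (RtoC 1)); [apply Pder_id|apply PS_Cder with r; auto].
      + apply (Cder_Pder (PS coefX) RtoC x (PS (dseq coefX) (RtoC x)) (RtoC 1)); [apply Pder_id|apply PS_Cder with r; auto].
    - cbv beta; ring. }
  assert (F0 : F 0 = RtoC 0) by (unfold F; rewrite !PS_0, coefX_0, coefY_0, !Cpow_1_l; ring).
  assert (F10 : F1 0 = RtoC pole_scale).
  { unfold F1; rewrite !PS_0, coefX_0, coefY_0, !Cpow_1_l.
    unfold dseq; rewrite coefX_1, coefY_1, <- !RtoC_mult, <- RtoC_minus; f_equal.
    simpl (INR 1); destruct (INR_exponents (U := U)) as [_ [_ [E3 E4]]].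
    destruct (INR_pos_params (U := U)) as [_ [_ Pp]].
    unfold coefX1, coefY1; field.
    assert (0 < INR p) by (apply lt_0_INR; lia); assert (0 < INR q) by (apply lt_0_INR; lia); nra. }
  assert (Eu : forall x, 0 <= x < r -> (RtoC x * F1 x = F x)%C).
  { intros x Hx; destruct (fuchs_system pole_scale r (RtoC x) Hal Hde (M x Hx)) as [S1 S2].
    assert (Ep := INR_h_p (U := U)); assert (Eq := INR_h_q (U := U)).
    destruct (INR_pos_params (U := U)) as [Pa [Pb _]].
    assert (Hh : RtoC (INR h) <> RtoC 0) by (apply RtoC_neq0; apply not_0_INR; lia).
    assert (Ra : RtoC (INR a) <> RtoC 0) by (apply RtoC_neq0; lra).
    assert (Rb : RtoC (INR b) <> RtoC 0) by (apply RtoC_neq0; lra).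
    assert (Hh1 : RtoC (INR h) = (RtoC (INR a) * RtoC (INR p))%C) by (rewrite <- RtoC_mult, Ep; auto).
    assert (Hh2 : RtoC (INR h) = (RtoC (INR b) * RtoC (INR q))%C) by (rewrite <- RtoC_mult, Eq; auto).
    assert (T1 : (RtoC (INR q) * (RtoC x * PS (dseq coefY) (RtoC x))
       = PS coefY (RtoC x) - PS coefX (RtoC x) ^ (p - 1))%C).
    { transitivity (/ RtoC (INR b) * (RtoC (INR h) * (RtoC x * PS (dseq coefY) (RtoC x))))%C;
        [rewrite Hh2; field; auto|rewrite S2; field; auto]. }
    assert (T2 : (RtoC (INR p) * (RtoC x * PS (dseq coefX) (RtoC x))
       = PS coefX (RtoC x) - PS coefY (RtoC x) ^ (q - 1))%C).
    { transitivity (/ RtoC (INR a) * (RtoC (INR h) * (RtoC x * PS (dseq coefX) (RtoC x))))%C;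
        [rewrite Hh1; field; auto|rewrite S1; field; auto]. }
    unfold F1, F; rewrite <- (Cpow_pred (PS coefY (RtoC x)) q), <- (Cpow_pred (PS coefX (RtoC x)) p) by lia.
    transitivity (PS coefY (RtoC x) ^ (q - 1) * (RtoC (INR q) * (RtoC x * PS (dseq coefY) (RtoC x)))
      - PS coefX (RtoC x) ^ (p - 1) * (RtoC (INR p) * (RtoC x * PS (dseq coefX) (RtoC x))))%C; [ring|].
    rewrite T1, T2; ring. }
  assert (Cst : forall x, 0 < x <= t -> (RtoC (/ t) * F t = RtoC (/ x) * F x)%C).
  { intros x Hx.
    apply (Pder_const_eq (fun v => RtoC (/ v) * F v)%C x t); [lra|].
    intros v Hv; eapply Pder_eq.
    - apply Pder_mult; [apply Pder_RtoC; auto_derive; [lra|reflexivity]|apply D; lra].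
    - rewrite <- Eu by lra.
      replace (RtoC (/ v)) with (/ RtoC v)%C by (rewrite RtoC_inv by lra; auto).
      replace (RtoC (- (1) * / (v * v))) with (- (/ RtoC v * / RtoC v))%C
        by (rewrite <- !RtoC_inv by lra; rewrite <- RtoC_mult, <- RtoC_opp; f_equal; field; lra).
      field; apply RtoC_neq0; lra. }
  assert (Ek : (RtoC (/ t) * F t = RtoC pole_scale)%C).
  { apply Ceq_minus, Cmod_eq_0, Rle_antisym; [|apply Cmod_ge_0].
    apply le_epsilon; intros eps He.
    destruct (proj1 (Pder_expand F 0 (F1 0)) (D 0 ltac:(lra)) eps He) as [del [Hdel B]].
    set (x := Rmin t (del / 2)).
    assert (Hx : 0 < x <= t /\ x < del).
    { unfold x; split; [split; [apply Rmin_glb_lt; lra|apply Rmin_l]|].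
      apply Rle_lt_trans with (1 := Rmin_r _ _); lra. }
    rewrite (Cst x) by tauto.
    specialize (B x ltac:(rewrite Rabs_pos_eq; lra)).
    rewrite Rplus_0_l, F0, F10, Rabs_pos_eq in B by lra.
    replace (RtoC (/ x) * F x - RtoC pole_scale)%C with (RtoC (/ x) * (F x - RtoC 0 - RtoC x * RtoC pole_scale))%C.
    - rewrite Cmod_mult, Cmod_RtoC_pos by (left; apply Rinv_0_lt_compat; lra).
      apply Rmult_le_reg_l with x; [lra|]; rewrite <- Rmult_assoc, Rinv_r by lra; lra.
    - replace (RtoC (/ x)) with (/ RtoC x)%C by (rewrite RtoC_inv by lra; auto).
      field; apply RtoC_neq0; lra. }
  change (F t = RtoC (pole_scale * t)); rewrite Rmult_comm, RtoC_mult, <- Ek, Cmult_assoc, <- RtoC_mult, Rinv_r by lra.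
  ring.
Qed.

Lemma conv_real (u v : nat -> C) (k : nat) : (forall i, Im (u i) = 0) -> (forall i, Im (v i) = 0) ->
  Im (conv u v k) = 0.
Proof.
  intros Hu Hv; unfold conv, Csum; simpl.
  rewrite (sum_eq _ (fun _ => 0)); [induction k; simpl; [auto|rewrite IHk; ring]|].
  intros i _; assert (A := Hu i); assert (B := Hv (k - i)%nat); unfold Im, Re in *; simpl; rewrite A, B; ring.
Qed.

Lemma conv_pow_real (u : nat -> C) (m k : nat) : (forall i, Im (u i) = 0) -> Im (conv_pow u m k) = 0.
Proof.
  intros Hu; revert k; induction m as [|m IH]; intros k; [destruct k; reflexivity|apply conv_real; auto].
Qed.

Lemma coef_real (k : nat) : Im (coefX k) = 0 /\ Im (coefY k) = 0.
Proof.
  enough (G : forall N k, Im (fst (fuchs_approx (a := a) (b := b) (h := h) (p := p) (q := q) pole_scale N) k) = 0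
    /\ Im (snd (fuchs_approx (a := a) (b := b) (h := h) (p := p) (q := q) pole_scale N) k) = 0)
    by (split; unfold coefX, coefY; apply G).
  clear k; induction N as [|N IH]; intros k.
  - destruct k as [|[|k]]; split; reflexivity.
  - assert (I1 := fun k => proj1 (IH k)); assert (I2 := fun k => proj2 (IH k)).
    simpl; destruct (Nat.eq_dec k (S (S N))); [|auto].
    unfold next_coefX, next_coefY; rewrite !im_plus, !im_scal_l; rewrite !conv_pow_real by auto; split; ring.
Qed.

Lemma PS_real (c : nat -> C) (t : R) : (forall k, Im (c k) = 0) -> PS c (RtoC t) = RtoC (Re (PS c (RtoC t))).
Proof.
  intros H; apply C_eq; [reflexivity|].
  transitivity (Series (fun _ : nat => 0)); [|apply is_series_unique, is_series_zero].
  unfold PS, CSeries, Im at 1; cbn [snd]; apply Series_ext; intros k.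
  rewrite <- RtoC_pow, Cmult_comm, im_scal_l, H; ring.
Qed.

Lemma PS_near_1 (c : nat -> C) (r : R) : 0 < r -> CVin c r -> c 0%nat = RtoC 1 ->
  exists del, 0 < del /\ forall w, Cmod w < del -> Cmod (PS c w - RtoC 1) <= 1 / 2.
Proof.
  intros Hr Hc H0.
  destruct (PS_Cder c r (RtoC 0) Hc ltac:(rewrite Cmod_0; auto) 1 ltac:(lra)) as [del [Hdel B]].
  set (L := Cmod (PS (dseq c) (RtoC 0))) in *.
  assert (HL : 0 <= L) by apply Cmod_ge_0.
  exists (Rmin del (/ (2 * (1 + L)))); split.
  - apply Rmin_glb_lt; auto; apply Rinv_0_lt_compat; lra.
  - intros w Hw.
    assert (W1 := Rlt_le_trans _ _ _ Hw (Rmin_l _ _)); assert (W2 := Rlt_le_trans _ _ _ Hw (Rmin_r _ _)).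
    specialize (B w W1); rewrite Cplus_0_l, PS_0, H0 in B.
    apply Rle_trans with (1 * Cmod w + Cmod w * L).
    + replace (PS c w - RtoC 1)%C with ((PS c w - RtoC 1 - w * PS (dseq c) (RtoC 0)) + w * PS (dseq c) (RtoC 0))%C by ring.
      apply Rle_trans with (1 := Cmod_triangle _ _); rewrite Cmod_mult; fold L; lra.
    + assert (Cmod w * (2 * (1 + L)) <= 1).
      { apply Rle_trans with (/ (2 * (1 + L)) * (2 * (1 + L))); [apply Rmult_le_compat_r; lra|].
        right; field; lra. }
      lra.
Qed.

Local Notation fx := (branch h s a (PS coefX)).
Local Notation fy := (branch h s b (PS coefY)).

Lemma branch_radius : exists r del, 0 < r /\ CVin coefX r /\ CVin coefY r /\ 0 < del /\
  (forall x, 0 < x < del -> Rpower x (INR h / INR s) < r) /\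
  (forall w, Cmod w < r -> Cmod (PS coefX w - RtoC 1) <= 1 / 2 /\ Cmod (PS coefY w - RtoC 1) <= 1 / 2).
Proof.
  destruct (coef_CVin pole_scale) as [r0 [Hr0 [Hal Hde]]].
  destruct (PS_near_1 coefX r0 Hr0 Hal (coefX_0 pole_scale)) as [d1 [Hd1 B1]].
  destruct (PS_near_1 coefY r0 Hr0 Hde (coefY_0 pole_scale)) as [d2 [Hd2 B2]].
  set (r := Rmin r0 (Rmin d1 d2)).
  assert (Hr : 0 < r) by (repeat apply Rmin_glb_lt; auto).
  assert (L1 : r <= r0) by apply Rmin_l.
  assert (L2 : r <= d1) by (apply Rle_trans with (1 := Rmin_r _ _), Rmin_l).
  assert (L3 : r <= d2) by (apply Rle_trans with (1 := Rmin_r _ _), Rmin_r).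
  assert (Hh : 0 < INR h) by (apply lt_0_INR; lia).
  exists r, (Rpower r (INR s / INR h)); repeat split; auto.
  - apply CVin_le with r0; auto.
  - apply CVin_le with r0; auto.
  - apply exp_pos.
  - intros x Hx; apply Rlt_le_trans with (Rpower (Rpower r (INR s / INR h)) (INR h / INR s)).
    + apply Rlt_Rpower_l; [apply Rdiv_lt_0_compat; auto|auto].
    + right; rewrite Rpower_mult; replace (INR s / INR h * (INR h / INR s)) with 1 by (field; lra).
      apply Rpower_1; auto.
  - apply B1; lra.
  - apply B2; lra.
Qed.

Variables r del : R.
Hypothesis Hr : 0 < r.
Hypothesis Hal : CVin coefX r.
Hypothesis Hde : CVin coefY r.
Hypothesis Hdel : 0 < del.
Hypothesis Hpow : forall x, 0 < x < del -> Rpower x (INR h / INR s) < r.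
Hypothesis Hhalf : forall w, Cmod w < r -> Cmod (PS coefX w - RtoC 1) <= 1 / 2 /\ Cmod (PS coefY w - RtoC 1) <= 1 / 2.

Lemma exponents_nat : (b * (q - 1) = a + s)%nat /\ (a * (p - 1) = b + s)%nat.
Proof. rewrite !Nat.mul_sub_distr_l, <- Hp, <- Hq; lia. Qed.

Lemma branch_solves (P z : C) : slit (P - z) -> Cmod (P - z) < del ->
  sys (fun w => fx (P - w)%C) (fun w => fy (P - w)%C) z.
Proof.
  intros Hsl Hm; destruct exponents_nat as [X1 X2].
  set (W := Cpowr (P - z)%C (INR h / INR s)).
  assert (HW : Cmod W < r).
  { unfold W; rewrite Cmod_Cpowr by (apply slit_neq0; auto); apply Hpow; split; auto.
    apply Cmod_gt_0, slit_neq0; auto. }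
  destruct (fuchs_system pole_scale r W Hal Hde HW) as [S1 S2].
  assert (Hg : forall v : C, Pder (fun t => P - (z + RtoC t * v))%C 0 (- v)%C).
  { intros v; eapply Pder_eq; [apply Pder_minus; [apply Pder_const|apply Pder_affine]|ring]. }
  assert (E0 : forall v : C, (P - (z + RtoC 0 * v) = P - z)%C) by (intros; ring).
  split; intros v.
  - eapply Pder_eq.
    + apply (Pder_branch h s a b (q - 1) (PS coefX) (PS coefY) (PS (dseq coefX) W) _ 0 (- v)%C Hs1 X1 (Hg v));
        rewrite E0; fold W; auto; apply PS_Cder with r; auto.
    + cbv beta; rewrite E0; ring.
  - eapply Pder_eq.
    + apply (Pder_branch h s b a (p - 1) (PS coefY) (PS coefX) (PS (dseq coefY) W) _ 0 (- v)%C Hs1 X2 (Hg v));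
        rewrite E0; fold W; auto; apply PS_Cder with r; auto.
    + cbv beta; rewrite E0; ring.
Qed.

Lemma branch_real_form (c : nat) (u : nat -> C) (x : R) : (forall k, Im (u k) = 0) -> 0 < x < del ->
  (forall w, Cmod w < r -> Cmod (PS u w - RtoC 1) <= 1 / 2) ->
  exists v, 1 / 2 <= v /\ PS u (RtoC (Rpower x (INR h / INR s))) = RtoC v /\
    branch h s c (PS u) (RtoC x) = RtoC (Rpower (INR s * x) (- (INR c / INR s)) * v).
Proof.
  intros Hu Hx Hn; set (w := RtoC (Rpower x (INR h / INR s))).
  assert (Hw : Cmod w < r) by (unfold w; rewrite Cmod_RtoC_pos; [auto|left; apply exp_pos]).
  assert (E := PS_real u (Rpower x (INR h / INR s)) Hu); fold w in E.
  exists (Re (PS u w)); split; [|split; [exact E|]].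
  - assert (B := Hn w Hw); assert (C1 := re_le_Cmod (PS u w - RtoC 1)%C).
    change (Re (PS u w - RtoC 1)%C) with (Re (PS u w) + - 1) in C1.
    apply Rabs_le_between in C1; lra.
  - unfold branch; rewrite !Cpowr_RtoC by lra; fold w; rewrite E, <- !RtoC_mult; do 2 f_equal.
    apply Rpower_mult_distr; lra.
Qed.

Lemma fx_unbounded (M eta : R) : 0 < eta -> exists x, 0 < x < eta /\ x < del /\ M <= Cmod (fx (RtoC x)).
Proof.
  intros He; assert (Pa := proj1 (INR_pos_params (U := U))).
  set (B := 2 * (Rabs M + 1)).
  assert (HB : 0 < B) by (unfold B; generalize (Rabs_pos M); lra).
  set (y := Rpower B (- (INR s / INR a)) / INR s).
  assert (Hy : 0 < y) by (apply Rdiv_lt_0_compat; [apply exp_pos|auto]).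
  set (x := Rmin y (Rmin (eta / 2) (del / 2))).
  assert (Hx : 0 < x) by (repeat apply Rmin_glb_lt; lra).
  assert (X1 : x <= y) by apply Rmin_l.
  assert (X2 : x <= eta / 2) by (apply Rle_trans with (1 := Rmin_r _ _), Rmin_l).
  assert (X3 : x <= del / 2) by (apply Rle_trans with (1 := Rmin_r _ _), Rmin_r).
  exists x; repeat split; try lra.
  destruct (branch_real_form a coefX x (fun k => proj1 (coef_real k)) ltac:(lra) (fun w Hw => proj1 (Hhalf w Hw)))
    as [v [Hv [_ E]]].
  assert (G : B <= Rpower (INR s * x) (- (INR a / INR s))).
  { replace B with (Rpower (INR s * y) (- (INR a / INR s))).
    - rewrite !Rpower_Ropp; apply Rinv_le_contravar; [apply exp_pos|].
      apply Rle_Rpower_l; [left; apply Rdiv_lt_0_compat; lra|].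
      split; [apply Rmult_lt_0_compat; auto|apply Rmult_le_compat_l; lra].
    - unfold y; replace (INR s * (Rpower B (- (INR s / INR a)) / INR s)) with (Rpower B (- (INR s / INR a))) by (field; lra).
      rewrite Rpower_mult; replace (- (INR s / INR a) * - (INR a / INR s)) with 1 by (field; lra).
      apply Rpower_1; auto. }
  rewrite E, Cmod_RtoC_pos by (apply Rmult_le_pos; [left; apply exp_pos|lra]).
  assert (M <= Rabs M) by apply Rle_abs.
  apply Rle_trans with (B * (1 / 2)); [unfold B; lra|apply Rmult_le_compat; lra].
Qed.

Lemma pow_base_lt (x y : R) (k : nat) : 0 < x < y -> (0 < k)%nat -> x ^ k < y ^ k.
Proof.
  intros H Hk; rewrite <- !Rpower_pow by lra.
  apply Rlt_Rpower_l; [apply lt_0_INR; auto|lra].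
Qed.

(** The first integral and the signs determine the point of the real curve. *)
Lemma branch_on_real_curve (x : R) : 0 < x < del -> exists t, 0 < t < 1 /\
  fx (RtoC x) = RtoC (Xr t) /\ fy (RtoC x) = RtoC (Yr t).
Proof.
  intros Hx.
  assert (P2 := p_ge_2 (U := U)); assert (Q2 := q_ge_2 (U := U)).
  destruct (INR_pos_params (U := U)) as [Pa [Pb _]].
  assert (Ep := INR_h_p (U := U)); assert (Eq := INR_h_q (U := U)).
  destruct (branch_real_form a coefX x (fun k => proj1 (coef_real k)) Hx (fun w Hw => proj1 (Hhalf w Hw)))
    as [v [Hv [Ev Efx]]].
  destruct (branch_real_form b coefY x (fun k => proj2 (coef_real k)) Hx (fun w Hw => proj2 (Hhalf w Hw)))
    as [u [Hu [Eu Efy]]].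
  set (X := Rpower (INR s * x) (- (INR a / INR s)) * v) in *.
  set (Y := Rpower (INR s * x) (- (INR b / INR s)) * u) in *.
  assert (HX : 0 < X) by (apply Rmult_lt_0_compat; [apply exp_pos|lra]).
  assert (HY : 0 < Y) by (apply Rmult_lt_0_compat; [apply exp_pos|lra]).
  assert (I : Y ^ q = 1 + X ^ p).
  { assert (F := fuchs_first_integral r (Rpower x (INR h / INR s)) Hal Hde
      (conj (exp_pos _) (Hpow x Hx))).
    rewrite Ev, Eu, <- !RtoC_pow, <- RtoC_minus in F; apply RtoC_inj_eq in F.
    assert (F' : u ^ q = v ^ p + pole_scale * Rpower x (INR h / INR s)) by lra.
    unfold X, Y; rewrite !Rpow_mult_distr, !Rpower_nat_pow.
    replace (INR q * - (INR b / INR s)) with (- (INR h / INR s)) by (rewrite Eq; field; lra).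
    replace (INR p * - (INR a / INR s)) with (- (INR h / INR s)) by (rewrite Ep; field; lra).
    rewrite F', Rmult_plus_distr_l; unfold pole_scale; rewrite Rpower_mult_distr by lra.
    rewrite <- Rpower_plus, Rplus_opp_l, Rpower_O by (apply Rmult_lt_0_compat; lra); ring. }
  assert (Y1 : 1 < Y).
  { apply Rnot_le_lt; intros HY1.
    assert (Y ^ q <= 1) by (rewrite <- (pow1 q); apply pow_incr; lra).
    assert (0 < X ^ p) by (apply pow_lt; auto); lra. }
  set (d := Rpower Y (- (1 / INR b))).
  assert (Hd : 0 < d < 1).
  { split; [apply exp_pos|]; apply Rlt_le_trans with (Rpower Y 0); [|right; apply Rpower_O; auto].
    apply Rpower_lt; auto; assert (0 < 1 / INR b) by (apply Rdiv_lt_0_compat; lra); lra. }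
  destruct (dr_tpar (U := U) d Hd) as [T1 T2]; set (t := tpar h d) in *.
  assert (EY : Yr t = Y).
  { unfold Yr; rewrite T2; unfold d; rewrite Rpower_nat_pow.
    replace (INR b * - (1 / INR b)) with (- (1)) by (field; lra).
    rewrite Rpower_Ropp, Rpower_1, Rinv_inv by auto; reflexivity. }
  assert (EX : Xr t = X).
  { assert (Xp : Xr t ^ p = X ^ p) by (generalize (Yr_pow_q (U := U) t ltac:(lra)); rewrite EY; lra).
    assert (X0' : 0 < Xr t).
    { unfold Xr; rewrite T2; apply Rdiv_lt_0_compat; apply pow_lt; lra. }
    apply Rle_antisym; apply Rnot_lt_le; intros L.
    - assert (X ^ p < Xr t ^ p) by (apply pow_base_lt; [lra|lia]); lra.
    - assert (Xr t ^ p < X ^ p) by (apply pow_base_lt; [lra|lia]); lra. }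
  exists t; split; [auto|]; rewrite EX, EY; auto.
Qed.

(** Both sides solve the system on a convex domain, and they have the same value at
    [Jr t]. *)
Lemma branch_agree (x t : R) (z : C) : 0 < x < del -> 0 < t < 1 ->
  fx (RtoC x) = RtoC (Xr t) -> fy (RtoC x) = RtoC (Yr t) ->
  let P := RtoC (Jr t + x) in
  Cmod z < rhoh -> Cmod (P - z) < del -> Re z < Jr t + x ->
  fx (P - z)%C = X0 z /\ fy (P - z)%C = Y0 z.
Proof.
  intros Hx Ht Efx Efy P Hz1 Hz2 Hz3.
  destruct (basic_real (U := U) t ltac:(lra)) as [B1 B2].
  assert (J0 : 0 <= Jr t) by (rewrite <- (Jr_0 (a := a) (b := b) (h := h)); apply (Jr_incr (U := U)); lra).
  assert (JR : Jr t < rhoh) by (apply (Jr_lt_rhoh (U := U)); lra).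
  assert (EP : (P - RtoC (Jr t) = RtoC x)%C) by (unfold P; rewrite <- RtoC_minus; f_equal; ring).
  apply (segment_unique (INR a) (INR b) (q - 1) (p - 1) (fun w => fx (P - w)%C) (fun w => fy (P - w)%C) X0 Y0
    (RtoC (Jr t)) z).
  - intros v Hv; apply branch_solves.
    + apply Re_pos_slit; unfold P, Re in *; simpl.
      match goal with |- 0 < ?e => replace e with ((1 - v) * x + v * (Jr t + x - fst z)) by ring end.
      destruct (Req_dec v 1) as [->|]; [lra|].
      assert (0 < (1 - v) * x) by (apply Rmult_lt_0_compat; lra).
      assert (0 <= v * (Jr t + x - fst z)) by (apply Rmult_le_pos; lra); lra.
    + rewrite Cmod_minus_sym; apply segment_in_disc; auto; rewrite Cmod_minus_sym; [|auto].
      rewrite EP, Cmod_RtoC_pos; lra.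
  - intros v Hv; apply (solves_near_disc (U := U)).
    replace (RtoC (Jr t) + RtoC v * (z - RtoC (Jr t)))%C
      with (RtoC (Jr t) + RtoC v * (z - RtoC (Jr t)) - RtoC 0)%C by ring.
    apply segment_in_disc; auto; unfold Cminus; rewrite Copp_0, Cplus_0_r; auto.
    rewrite Cmod_RtoC_pos; lra.
  - rewrite EP, Efx; auto.
  - rewrite EP, Efy; auto.
Qed.

Lemma solves_bounded (f g : C -> C) (c0 c1 : R) : c0 <= c1 ->
  (forall x, c0 <= x <= c1 -> sys f g (RtoC x)) ->
  exists M, forall x, c0 <= x <= c1 -> Cmod (f (RtoC x)) <= M.
Proof.
  intros Hc Hs2.
  apply (path_bounded (fun x => f (RtoC x)) (fun x => RtoC (INR a) * g (RtoC x) ^ (q - 1))%C); auto.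
  intros x Hx; destruct (Hs2 x Hx) as [G _].
  eapply Pder_eq; [apply Pder_ext with (f := fun y : R => f (RtoC 0 + RtoC y * RtoC 1)%C)|].
  - intros y; f_equal; ring.
  - apply Gder_affine; replace (RtoC 0 + RtoC x * RtoC 1)%C with (RtoC x) by ring; exact G.
  - ring.
Qed.

(** The solution through a point of the real curve blows up both at [rho] and at
    the pole of the branch, so the two points coincide. *)
Lemma branch_pole (x : R) : 0 < x < del -> exists t, 0 < t < 1 /\ rhoh = Jr t + x /\
  fx (RtoC x) = RtoC (Xr t) /\ fy (RtoC x) = RtoC (Yr t).
Proof.
  intros Hx; destruct (branch_on_real_curve x Hx) as [t [Ht [E1 E2]]].
  exists t; split; [auto|split; [|auto]].
  assert (Ag := fun z => branch_agree x t z Hx Ht E1 E2); cbv zeta in Ag.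
  assert (J0 : 0 <= Jr t) by (rewrite <- (Jr_0 (a := a) (b := b) (h := h)); apply (Jr_incr (U := U)); lra).
  assert (JR : Jr t < rhoh) by (apply (Jr_lt_rhoh (U := U)); lra).
  apply Rle_antisym; apply Rnot_lt_le; intros L.
  - destruct (solves_bounded X0 Y0 0 (Jr t + x) ltac:(lra)) as [M HM].
    { intros v Hv; apply (solves_near_disc (U := U)); rewrite Cmod_RtoC_pos; lra. }
    destruct (fx_unbounded (M + 1) x ltac:(lra)) as [y [Hy1 [Hy2 Hy3]]].
    assert (Ey : (RtoC (Jr t + x) - RtoC (Jr t + x - y))%C = RtoC y) by (rewrite <- RtoC_minus; f_equal; ring).
    destruct (Ag (RtoC (Jr t + x - y))) as [A _].
    + rewrite Cmod_RtoC_pos; lra.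
    + rewrite Ey, Cmod_RtoC_pos; lra.
    + simpl; lra.
    + rewrite Ey in A; rewrite A in Hy3.
      generalize (HM (Jr t + x - y) ltac:(lra)); lra.
  - destruct (solves_bounded X0 Y0 0 (Jr t) J0) as [M1 HM1].
    { intros v Hv; apply (solves_near_disc (U := U)); rewrite Cmod_RtoC_pos; lra. }
    assert (Es : forall v, (RtoC (Jr t + x) - RtoC v)%C = RtoC (Jr t + x - v)) by (intros; rewrite <- RtoC_minus; auto).
    destruct (solves_bounded (fun w => fx (RtoC (Jr t + x) - w)%C) (fun w => fy (RtoC (Jr t + x) - w)%C)
      (Jr t) rhoh ltac:(lra)) as [M2 HM2].
    { intros v Hv; apply branch_solves; rewrite Es.
      - apply Re_pos_slit; simpl; lra.
      - rewrite Cmod_RtoC_pos; lra. }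
    destruct (real_curve_unbounded (U := U) (Rmax M1 M2 + 1)) as [t1 [Ht1 [X1 _]]].
    assert (R1 := Rmax_l M1 M2); assert (R2 := Rmax_r M1 M2).
    destruct (basic_real (U := U) t1 Ht1) as [B1 _].
    assert (J1 : 0 <= Jr t1) by (rewrite <- (Jr_0 (a := a) (b := b) (h := h)); apply (Jr_incr (U := U)); lra).
    assert (JR1 : Jr t1 < rhoh) by (apply (Jr_lt_rhoh (U := U)); lra).
    assert (Big : Xr t1 <= Cmod (X0 (RtoC (Jr t1)))) by (rewrite B1, Cmod_R; apply Rle_abs).
    destruct (Rle_lt_dec (Jr t1) (Jr t)) as [D|D].
    + generalize (HM1 (Jr t1) ltac:(lra)); lra.
    + destruct (Ag (RtoC (Jr t1))) as [A _].
      * rewrite Cmod_RtoC_pos; lra.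
      * rewrite Es, Cmod_RtoC_pos; lra.
      * simpl; lra.
      * generalize (HM2 (Jr t1) ltac:(lra)); rewrite A; lra.
Qed.

(** This contains the sector of opening [3 PI / 2] and is star-shaped together with the
    disc. *)
Definition sector_region (z : C) : Prop :=
  Cmod (RtoC rhoh - z) < del /\ 0 < Re (RtoC rhoh - z)%C + Rabs (Im (RtoC rhoh - z)%C).

Lemma sector_region_open : Copen sector_region.
Proof.
  intros z [H1 H2]; set (e := Re (RtoC rhoh - z)%C + Rabs (Im (RtoC rhoh - z)%C)) in *.
  exists (Rmin (e / 2) (del - Cmod (RtoC rhoh - z))); split; [apply Rmin_glb_lt; lra|].
  intros w Hw.
  assert (W1 := Rlt_le_trans _ _ _ Hw (Rmin_l _ _)); assert (W2 := Rlt_le_trans _ _ _ Hw (Rmin_r _ _)).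
  assert (C1 := re_le_Cmod (w - z)%C); assert (C2 := im_le_Cmod (w - z)%C).
  split.
  - replace (RtoC rhoh - w)%C with ((RtoC rhoh - z) + (z - w))%C by ring.
    apply Rle_lt_trans with (1 := Cmod_triangle _ _); rewrite (Cmod_minus_sym z w); lra.
  - unfold e in *; unfold Re, Im in *; simpl in *.
    assert (T := Rabs_triang_inv (0 + - snd z) (snd w + - snd z)).
    replace (0 + - snd z - (snd w + - snd z)) with (0 + - snd w) in T by ring.
    apply Rabs_le_between in C1; lra.
Qed.

(** Shrinking towards the origin a point outside the disc brings it closer to
    [rho] as long as it stays outside. *)
Lemma sector_region_star : star (fun z => Cmod z < rhoh \/ sector_region z).
Proof.
  assert (R0 := rhoh_pos (U := U)).
  intros z t Hz Ht; destruct (Rlt_le_dec (Cmod (RtoC t * z)) rhoh) as [L|L]; [left; auto|].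
  rewrite Cmod_mult, Cmod_RtoC_pos in L by lra.
  assert (Z0 := Cmod_ge_0 z).
  destruct Hz as [Hz|[H1 H2]]; [nra|right].
  assert (Hz : rhoh <= Cmod z) by nra.
  assert (Q : Cmod z ^ 2 = Re z ^ 2 + Im z ^ 2) by apply Cmod_sqr.
  assert (C1 := re_le_Cmod z); apply Rabs_le_between in C1.
  split.
  - apply Rle_lt_trans with (2 := H1).
    apply Rsqr_incr_0_var; [|apply Cmod_ge_0]; rewrite !Rsqr_pow2, !Cmod_sqr.
    assert (Q2 : Cmod z ^ 2 = fst z * fst z + snd z * snd z) by (rewrite Q; unfold Re, Im; ring); clear Q.
    unfold Re, Im in *; cbn [fst snd Cminus Cplus Copp Cmult RtoC] in *.
    assert (G : 0 <= (1 - t) * ((1 + t) * Cmod z ^ 2 - 2 * rhoh * fst z)).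
    { apply Rmult_le_pos; [lra|].
      assert (rhoh * Cmod z <= t * Cmod z * Cmod z) by (apply Rmult_le_compat_r; lra).
      assert (rhoh * Cmod z <= Cmod z * Cmod z) by (apply Rmult_le_compat_r; lra).
      assert (rhoh * fst z <= rhoh * Cmod z) by (apply Rmult_le_compat_l; lra).
      lra. }
    rewrite Q2 in G; nra.
  - unfold Re, Im in *; simpl in *.
    replace (0 + - (t * snd z + 0 * fst z)) with (t * (0 + - snd z)) by ring.
    rewrite Rabs_mult, (Rabs_pos_eq t) by lra.
    replace (rhoh + - (t * fst z - 0 * snd z) + t * Rabs (0 + - snd z))
      with ((1 - t) * rhoh + t * (rhoh + - fst z + Rabs (0 + - snd z))) by ring.
    destruct (Req_dec t 1) as [->|]; [lra|].
    assert (0 < (1 - t) * rhoh) by (apply Rmult_lt_0_compat; lra).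
    assert (0 <= t * (rhoh + - fst z + Rabs (0 + - snd z))) by (apply Rmult_le_pos; lra); lra.
Qed.

Lemma sector_slit (z : C) : 0 < Re z + Rabs (Im z) -> slit z.
Proof.
  intros H; apply slit_iff; intros [I J]; rewrite I, Rabs_R0 in H; lra.
Qed.

Lemma sector_region_reachable (z : C) : sector_region z ->
  reachable a b p q z /\ continuation a b p q z = fx (RtoC rhoh - z)%C.
Proof.
  destruct (branch_pole (del / 2) ltac:(lra)) as [t [Ht [E [E1 E2]]]].
  apply (glue_star_solution (U := U) sector_region (fun z => fx (RtoC rhoh - z)%C) (fun z => fy (RtoC rhoh - z)%C)).
  - apply sector_region_open.
  - apply sector_region_star.
  - intros w [W1 W2]; apply branch_solves; auto; apply sector_slit; auto.
  - intros w [W1 W2] Hw; rewrite E in *.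
    apply (branch_agree (del / 2) t w ltac:(lra) Ht E1 E2); auto; [lra|].
    assert (C1 := re_le_Cmod w); apply Rabs_le_between in C1; lra.
Qed.

End Sector.

(** * The Beta and Gamma values of the radius *)

Lemma sup_scal_le (E : R -> R) (P : R -> Prop) (L c k : R) : 0 <= c ->
  (forall v, v < L -> exists u, P u /\ v < E u) -> (forall u, P u -> c * E u <= k) -> c * L <= k.
Proof.
  intros Hc HL Hk; apply Rnot_lt_le; intros C.
  destruct Hc as [Hc|<-].
  - destruct (HL (k / c)) as [u [Pu Hu]]; [apply Rmult_lt_reg_r with c; auto; field_simplify; lra|].
    assert (k < c * E u); [|generalize (Hk u Pu); lra].
    apply Rmult_lt_reg_l with (/ c); [apply Rinv_0_lt_compat; auto|].
    rewrite <- Rmult_assoc, Rinv_l by lra; unfold Rdiv in Hu; lra.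
  - destruct (HL (L - 1)) as [u [Pu Hu]]; [lra|]; generalize (Hk u Pu); lra.
Qed.

(** The substitution [t = v^h] turns the Gamma integral at [k/h] into [h] times
    this smooth one. *)
Definition Egam (h k : nat) (u : R) : R := RInt (fun v => v ^ (k - 1) * exp (- v ^ h)) 0 u.

Section Egam.

Context {h k : nat}.
Hypothesis Hk : (1 <= k)%nat.
Hypothesis Hkh : (k <= h)%nat.

Local Notation E := (Egam h k).

Lemma Egam_integrand_continuous (v : R) : continuous (fun v => v ^ (k - 1) * exp (- v ^ h)) v.
Proof. apply (ex_derive_continuous (V := R_NormedModule)); auto_derive; auto. Qed.

Lemma is_derive_Egam (u : R) : is_derive E u (u ^ (k - 1) * exp (- u ^ h)).
Proof.
  apply (is_derive_RInt_open (fun v => v ^ (k - 1) * exp (- v ^ h)) 0 (- Rabs u - 1) (Rabs u + 1)).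
  - generalize (Rabs_pos u); lra.
  - generalize (Rle_abs u) (Rle_abs (- u)); rewrite Rabs_Ropp; lra.
  - intros; apply Egam_integrand_continuous.
Qed.

Lemma Egam_0 : E 0 = 0.
Proof. apply (RInt_point (V := R_CompleteNormedModule)). Qed.

Lemma Egam_incr (u v : R) : 0 <= u <= v -> E u <= E v.
Proof.
  intros H; apply is_derive_incr with (fun v => v ^ (k - 1) * exp (- v ^ h)); [lra|intros; apply is_derive_Egam|].
  intros t Ht; apply Rmult_le_pos; [apply pow_le; lra|left; apply exp_pos].
Qed.

Lemma Egam_nonneg (u : R) : 0 <= u -> 0 <= E u.
Proof. intros; rewrite <- Egam_0; apply Egam_incr; lra. Qed.

Lemma Egam_pos : 0 < E 1.
Proof.
  rewrite <- Egam_0.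
  apply is_derive_incr_strict with (fun v => v ^ (k - 1) * exp (- v ^ h)); [lra|intros; apply is_derive_Egam| |].
  - intros t Ht; apply Rmult_le_pos; [apply pow_le; lra|left; apply exp_pos].
  - intros t Ht; apply Rmult_lt_0_compat; [apply pow_lt; lra|apply exp_pos].
Qed.

Lemma Egam_integrand_le_1 (v : R) : 0 <= v -> v ^ (k - 1) * exp (- v ^ h) <= 1.
Proof.
  intros Hv; rewrite exp_Ropp; assert (P := exp_pos (v ^ h)).
  apply Rmult_le_reg_r with (exp (v ^ h)); auto; rewrite Rmult_assoc, Rinv_l, Rmult_1_r, Rmult_1_l by lra.
  assert (X := exp_ineq1_le (v ^ h)).
  assert (V0 : 0 <= v ^ h) by (apply pow_le; auto).
  destruct (Rle_lt_dec v 1) as [L|L].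
  - assert (v ^ (k - 1) <= 1) by (rewrite <- (pow1 (k - 1)); apply pow_incr; lra); lra.
  - assert (v ^ (k - 1) <= v ^ h) by (apply Rle_pow; [lra|lia]); lra.
Qed.

Lemma Egam_le_id (u : R) : 0 <= u -> E u <= u.
Proof.
  intros Hu.
  assert (G : 0 - E 0 <= u - E u); [|rewrite Egam_0 in G; lra].
  apply (is_derive_incr (fun v => v - E v) (fun v => 1 - v ^ (k - 1) * exp (- v ^ h))); auto.
  - intros t Ht; apply is_derive_Rminus; [apply (is_derive_id (K := R_AbsRing))|apply is_derive_Egam].
  - intros t Ht; generalize (Egam_integrand_le_1 t); lra.
Qed.

Lemma Egam_bounded (u : R) : 0 <= u -> E u <= 2.
Proof.
  assert (E1 : E 1 <= 1) by (apply Egam_le_id; lra).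
  intros Hu; destruct (Rle_lt_dec u 1) as [L|L]; [generalize (Egam_incr u 1); lra|].
  assert (Hh : 1 <= INR h) by (apply (le_INR 1); lia).
  set (f := fun v => - (/ INR h * exp (- v ^ h)) - E v).
  assert (G : f 1 <= f u).
  { apply is_derive_incr with (fun v => v ^ (h - 1) * exp (- v ^ h) - v ^ (k - 1) * exp (- v ^ h)); [lra| |].
    - intros t Ht; apply is_derive_Rminus; [|apply is_derive_Egam].
      auto_derive; auto; replace (h - 1)%nat with (pred h) by lia; field; lra.
    - intros t Ht; rewrite <- Rmult_minus_distr_r; apply Rmult_le_pos; [|left; apply exp_pos].
      assert (t ^ (k - 1) <= t ^ (h - 1)) by (apply Rle_pow; [lra|lia]); lra. }
  unfold f in G; rewrite pow1 in G.
  assert (I1 : 0 < / INR h) by (apply Rinv_0_lt_compat; lra).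
  assert (I2 : / INR h <= 1) by (rewrite <- Rinv_1; apply Rinv_le_contravar; lra).
  assert (0 < exp (- u ^ h)) by apply exp_pos.
  assert (X1 : exp (- (1)) < exp 0) by (apply exp_increasing; lra); rewrite exp_0 in X1.
  assert (0 < exp (- (1))) by apply exp_pos.
  assert (0 < / INR h * exp (- u ^ h)) by (apply Rmult_lt_0_compat; auto).
  assert (/ INR h * exp (- (1)) <= 1) by nra.
  lra.
Qed.

Lemma Egam_limit : exists L, 0 < L /\ (forall u, 0 <= u -> E u <= L) /\
  (forall v, v < L -> exists u, 0 < u /\ v < E u).
Proof.
  destruct (completeness (fun y => exists u, 0 <= u /\ y = E u)) as [L [H1 H2]].
  - exists 2; intros y [u [Hu ->]]; apply Egam_bounded; auto.
  - exists (E 0), 0; split; [lra|auto].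
  - assert (HL : 0 < L).
    { apply Rlt_le_trans with (1 := Egam_pos); apply H1; exists 1; split; [lra|auto]. }
    exists L; split; [auto|split].
    + intros u Hu; apply H1; exists u; auto.
    + intros v Hv; apply NNPP; intros N.
      assert (L <= v); [|lra]; apply H2; intros y [u [Hu ->]].
      apply Rnot_lt_le; intros C; apply N.
      exists (u + 1); split; [lra|]; apply Rlt_le_trans with (1 := C), Egam_incr; lra.
Qed.

End Egam.

Section Beta.

Context {a b h p q : nat} {U : urn a b h p q}.

Let Ha : (0 < a)%nat. Proof. apply U. Qed.
Let Hb : (0 < b)%nat. Proof. apply U. Qed.
Let Hab : (a + b < h)%nat. Proof. apply U. Qed.

Variable s : nat.
Hypothesis Hs : h = (a + b + s)%nat.

Let Hs1 : (1 <= s)%nat. Proof. lia. Qed.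

Local Notation rhoh := (rhoh a b h).
Local Notation Jr := (Jr a b h).
Local Notation Ea := (Egam h a).
Local Notation Es := (Egam h s).
Local Notation Eas := (Egam h (a + s)).

(** The coordinate [m / (m^h + n^h)^(1/h)], which is constant on the ray [n = d m]. *)
Definition tau (d : R) : R := Rpower (1 + d ^ h) (- (1 / INR h)).
Definition phi_tau (d : R) : R := tau d ^ (a + s) * d ^ (s - 1).

Let Hh : 1 <= INR h. Proof. apply (le_INR 1); lia. Qed.

Lemma one_plus_pow_pos (d : R) : 0 <= d -> 0 < 1 + d ^ h.
Proof. intros Hd; assert (0 <= d ^ h) by (apply pow_le; auto); lra. Qed.

Lemma tau_pos (d : R) : 0 < tau d.
Proof. apply exp_pos. Qed.

Lemma tau_pow (d : R) : 0 <= d -> tau d ^ h = / (1 + d ^ h).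
Proof.
  intros Hd; unfold tau; rewrite Rpower_nat_pow.
  replace (INR h * - (1 / INR h)) with (- (1)) by (field; lra).
  rewrite Rpower_Ropp, Rpower_1; auto; apply one_plus_pow_pos; auto.
Qed.

Lemma tau_lt_1 (d : R) : 0 < d -> tau d < 1.
Proof.
  intros Hd; unfold tau; rewrite Rpower_Ropp; apply Rlt_le_trans with (/ 1); [apply Rinv_lt_contravar|rewrite Rinv_1; lra].
  - rewrite Rmult_1_l; apply exp_pos.
  - apply Rle_lt_trans with (Rpower 1 (1 / INR h)); [right; symmetry; unfold Rpower; rewrite ln_1, Rmult_0_r; apply exp_0|].
    assert (0 < d ^ h) by (apply pow_lt; auto).
    apply Rlt_Rpower_l; [apply Rdiv_lt_0_compat; lra|lra].
Qed.

Lemma tau_le_1 (d : R) : 0 <= d -> tau d <= 1.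
Proof.
  intros [Hd|<-]; [left; apply tau_lt_1; auto|].
  right; unfold tau; rewrite pow_i by lia; rewrite Rplus_0_r; unfold Rpower; rewrite ln_1, Rmult_0_r; apply exp_0.
Qed.

Lemma tau_onto (t : R) : 0 < t < 1 -> exists d, 0 < d /\ tau d = t /\
  (forall d', 0 < d' -> t < tau d' -> d' < d).
Proof.
  intros Ht.
  assert (P : 0 < t ^ h) by (apply pow_lt; lra).
  assert (P1 : t ^ h < 1).
  { rewrite <- (pow1 h); apply pow_base_lt; [lra|lia]. }
  assert (P2 : 1 < / t ^ h) by (rewrite <- Rinv_1; apply Rinv_lt_contravar; lra).
  set (d := Rpower (/ t ^ h - 1) (1 / INR h)).
  assert (Hd : 0 < d) by apply exp_pos.
  assert (Ed : d ^ h = / t ^ h - 1) by (apply (Rpower_root_pow (U := U)); lra).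
  exists d; split; [auto|split].
  - unfold tau; rewrite Ed; replace (1 + (/ t ^ h - 1)) with (/ t ^ h) by ring.
    transitivity (Rpower (t ^ h) (1 / INR h)); [|apply (Rpower_pow_root (U := U)); lra].
    unfold Rpower; rewrite ln_Rinv by auto; f_equal; ring.
  - intros d' Hd' Ht'; apply Rnot_le_lt; intros L.
    assert (t ^ h < tau d' ^ h) by (apply pow_base_lt; [lra|lia]).
    rewrite tau_pow in H by lra.
    assert (d ^ h <= d' ^ h) by (apply pow_incr; lra).
    assert (/ (1 + d' ^ h) <= t ^ h); [|lra].
    rewrite <- (Rinv_inv (t ^ h)); apply Rinv_le_contravar; lra.
Qed.

Lemma is_derive_tau (d : R) : 0 < d -> is_derive tau d (- (tau d * d ^ (h - 1) * tau d ^ h)).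
Proof.
  intros Hd; assert (P := one_plus_pow_pos d (Rlt_le _ _ Hd)).
  rewrite tau_pow by lra; unfold tau at 1, Rpower at 1; auto_derive; [auto|].
  change (exp (- (1 / INR h) * ln (1 + d ^ h))) with (tau d).
  replace (h - 1)%nat with (pred h) by lia; field; split; lra.
Qed.

Lemma is_derive_Jr_tau (d : R) : 0 < d -> is_derive (fun d => - Jr (tau d)) d (phi_tau d).
Proof.
  intros Hd; assert (T0 := tau_pos d); assert (T1 := tau_lt_1 d Hd).
  apply is_derive_eq with (- (Fr a b h (tau d) * - (tau d * d ^ (h - 1) * tau d ^ h))).
  - apply (is_derive_opp (K := R_AbsRing) (V := R_NormedModule) (fun d => Jr (tau d))).
    apply is_derive_Rcomp; [apply (is_derive_Jr (U := U)); lra|apply is_derive_tau; auto].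
  - assert (Ed : dr h (tau d) = d * tau d).
    { unfold dr; rewrite tau_pow by lra; assert (P := one_plus_pow_pos d (Rlt_le _ _ Hd)).
      replace (1 - / (1 + d ^ h)) with (d ^ h * tau d ^ h) by (rewrite tau_pow by lra; field; lra).
      rewrite <- Rpow_mult_distr; apply (Rpower_pow_root (U := U)), Rmult_lt_0_compat; auto. }
    unfold Fr, phi_tau; rewrite Ed, Rpow_mult_distr.
    replace h with ((a + b) + s)%nat at 2 by lia.
    replace (h - 1)%nat with ((a + b) + (s - 1))%nat by lia.
    replace (a + s)%nat with ((a - 1) + 1 + s)%nat by lia.
    rewrite !pow_add, pow_1; field.
    repeat split; apply Rgt_not_eq; try apply pow_lt; auto.
Qed.

(** The double integral of [m^(a-1) exp(-m^h) n^(s-1) exp(-n^h)] over the triangle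
    [n <= d m], [m <= M]. *)
Definition triangle_int (M d : R) : R := RInt (fun m => m ^ (a - 1) * exp (- m ^ h) * Es (d * m)) 0 M.

Lemma is_derive_Es_comp (d m : R) : is_derive (fun x => Es (d * x)) m (d * ((d * m) ^ (s - 1) * exp (- (d * m) ^ h))).
Proof.
  apply is_derive_eq with ((d * m) ^ (s - 1) * exp (- (d * m) ^ h) * d); [|ring].
  apply (is_derive_Rcomp Es (fun x => d * x)); [apply is_derive_Egam|auto_derive; auto; ring].
Qed.

Lemma triangle_integrand_continuous (d m : R) : continuous (fun m => m ^ (a - 1) * exp (- m ^ h) * Es (d * m)) m.
Proof.
  apply (ex_derive_continuous (V := R_NormedModule)); eexists.
  apply (is_derive_Rmult (fun m => m ^ (a - 1) * exp (- m ^ h)) (fun m => Es (d * m)) m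
    (Derive (fun m => m ^ (a - 1) * exp (- m ^ h)) m)); [apply Derive_correct; auto_derive; auto|apply is_derive_Es_comp].
Qed.

Lemma is_derive_triangle_int_bound (d M : R) : is_derive (fun M => triangle_int M d) M (M ^ (a - 1) * exp (- M ^ h) * Es (d * M)).
Proof.
  apply (is_derive_RInt_open (fun m => m ^ (a - 1) * exp (- m ^ h) * Es (d * m)) 0 (- Rabs M - 1) (Rabs M + 1)).
  - generalize (Rabs_pos M); lra.
  - generalize (Rle_abs M) (Rle_abs (- M)); rewrite Rabs_Ropp; lra.
  - intros; apply triangle_integrand_continuous.
Qed.

Lemma triangle_int_0 (d : R) : triangle_int 0 d = 0.
Proof. apply (RInt_point (V := R_CompleteNormedModule)). Qed.

Lemma triangle_int_bounds (M m0 d : R) : 0 < d -> 0 <= m0 <= M ->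
  (Ea M - Ea m0) * Es (d * m0) <= triangle_int M d <= Ea M * Es (d * M).
Proof.
  intros Hd Hm.
  assert (W : forall m, 0 <= m -> 0 <= m ^ (a - 1) * exp (- m ^ h))
    by (intros; apply Rmult_le_pos; [apply pow_le; auto|left; apply exp_pos]).
  assert (Mono : forall u v, 0 <= u <= v -> 0 <= Es (d * u) <= Es (d * v)).
  { intros u v Huv; split; [apply Egam_nonneg; apply Rmult_le_pos; lra|apply Egam_incr].
    split; [apply Rmult_le_pos; lra|apply Rmult_le_compat_l; lra]. }
  split.
  - assert (P0 : 0 <= triangle_int m0 d).
    { rewrite <- (triangle_int_0 d); apply (is_derive_incr (fun M => triangle_int M d)
        (fun m => m ^ (a - 1) * exp (- m ^ h) * Es (d * m))); [lra|intros; apply is_derive_triangle_int_bound|].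
      intros t Ht; apply Rmult_le_pos; [apply W; lra|apply (Mono t t); lra]. }
    assert (G : triangle_int m0 d - Ea m0 * Es (d * m0) <= triangle_int M d - Ea M * Es (d * m0)); [|lra].
    apply (is_derive_incr (fun m => triangle_int m d - Ea m * Es (d * m0))
      (fun m => m ^ (a - 1) * exp (- m ^ h) * Es (d * m) - m ^ (a - 1) * exp (- m ^ h) * Es (d * m0))); [lra| |].
    + intros t Ht; apply is_derive_Rminus; [apply is_derive_triangle_int_bound|].
      eapply is_derive_eq; [apply is_derive_Rmult; [apply is_derive_Egam|apply is_derive_cst]|cbv beta; ring].
    + intros t Ht; rewrite <- Rmult_minus_distr_l; apply Rmult_le_pos; [apply W; lra|].
      generalize (Mono m0 t); lra.
  - assert (G : Ea 0 * Es (d * M) - triangle_int 0 d <= Ea M * Es (d * M) - triangle_int M d).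
    { apply (is_derive_incr (fun m => Ea m * Es (d * M) - triangle_int m d)
        (fun m => m ^ (a - 1) * exp (- m ^ h) * Es (d * M) - m ^ (a - 1) * exp (- m ^ h) * Es (d * m))); [lra| |].
      + intros t Ht; apply is_derive_Rminus; [|apply is_derive_triangle_int_bound].
        eapply is_derive_eq; [apply is_derive_Rmult; [apply is_derive_Egam|apply is_derive_cst]|cbv beta; ring].
      + intros t Ht; rewrite <- Rmult_minus_distr_l; apply Rmult_le_pos; [apply W; lra|].
        generalize (Mono t M); lra. }
    rewrite Egam_0, triangle_int_0 in G; lra.
Qed.

Lemma continuity_2d_snd (f : R -> R) (x y : R) : continuity_pt f y -> continuity_2d_pt (fun _ v => f v) x y.
Proof. intros H; apply (continuity_1d_2d_pt_comp f (fun _ v => v)); [auto|apply continuity_2d_pt_id2]. Qed.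

(** On the ray [n = d m] one has [m^h + n^h = (m / tau d)^h], so that the derivative is
    again an incomplete Gamma integral. *)
Lemma is_derive_triangle_int (M d : R) : 0 <= M -> 0 < d ->
  is_derive (triangle_int M) d (phi_tau d * Eas (M / tau d)).
Proof.
  intros HM Hd.
  set (W := fun m => m ^ (a - 1) * exp (- m ^ h)).
  set (dg := fun d m => W m * (m * ((d * m) ^ (s - 1) * exp (- (d * m) ^ h)))).
  assert (Dd : forall d m, is_derive (fun d => W m * Es (d * m)) d (dg d m)).
  { intros d' m; eapply is_derive_eq.
    - apply is_derive_Rmult; [apply is_derive_cst|].
      apply is_derive_ext with (fun x => Es (m * x)); [intros; f_equal; ring|apply is_derive_Es_comp].
    - unfold dg; rewrite (Rmult_comm m d'); ring. }
  apply is_derive_eq with (RInt (fun m => Derive (fun u => W m * Es (u * m)) d) 0 M).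
  - apply (is_derive_RInt_param (fun d m => W m * Es (d * m))).
    + apply filter_forall; intros y t _; eexists; apply Dd.
    + intros t _; apply continuity_2d_pt_ext with dg.
      { intros u v; symmetry; apply is_derive_unique, Dd. }
      assert (CW : forall v, continuity_pt (fun m => W m * m) v).
      { intros v; apply continuity_pt_filterlim, (ex_derive_continuous (V := R_NormedModule) (fun m => W m * m)); unfold W; auto_derive; auto. }
      assert (CE : forall v, continuity_pt (fun x => x ^ (s - 1) * exp (- x ^ h)) v).
      { intros v; apply continuity_pt_filterlim, (ex_derive_continuous (V := R_NormedModule) (fun x => x ^ (s - 1) * exp (- x ^ h))); auto_derive; auto. }
      apply continuity_2d_pt_ext with (fun u v => (W v * v) * ((fun x => x ^ (s - 1) * exp (- x ^ h)) (u * v))).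
      { intros u v; unfold dg; ring. }
      apply (continuity_2d_pt_mult (fun _ v => W v * v) (fun u v => (fun x => x ^ (s - 1) * exp (- x ^ h)) (u * v)));
        [apply (continuity_2d_snd (fun m => W m * m)); auto|].
      apply (continuity_1d_2d_pt_comp (fun x => x ^ (s - 1) * exp (- x ^ h)) (fun u v => u * v)); [auto|].
      apply continuity_2d_pt_mult; [apply continuity_2d_pt_id1|apply continuity_2d_pt_id2].
    + apply filter_forall; intros y; apply ex_RInt_cont; [auto|intros; apply triangle_integrand_continuous].
  - rewrite (RInt_ext _ (dg d)) by (intros; apply is_derive_unique, Dd).
    assert (T0 := tau_pos d).
    assert (P := one_plus_pow_pos d (Rlt_le _ _ Hd)).
    replace (phi_tau d * Eas (M / tau d)) with (phi_tau d * Eas (M / tau d) - phi_tau d * Eas (0 / tau d))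
      by (unfold Rdiv at 2; rewrite Rmult_0_l, Egam_0; ring).
    apply is_RInt_unique, (is_RInt_derive (fun m => phi_tau d * Eas (m / tau d)) (dg d)).
    + intros m _; eapply is_derive_eq.
      * apply is_derive_Rmult; [apply is_derive_cst|].
        apply (is_derive_Rcomp Eas (fun m => m / tau d)); [apply is_derive_Egam|auto_derive; [auto|reflexivity]].
      * unfold dg, W, phi_tau.
        replace (- (m / tau d) ^ h) with (- m ^ h + - (d * m) ^ h).
        -- rewrite exp_plus, (Rpow_mult_distr d m (s - 1)), (pow_div m).
           replace (a + s - 1)%nat with ((a - 1) + 1 + (s - 1))%nat by lia.
           replace (a + s)%nat with ((a - 1) + 1 + (s - 1) + 1)%nat by lia.
           rewrite !pow_add, !pow_1; cbv beta; field.
           repeat split; apply Rgt_not_eq; try apply pow_lt; auto.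
        -- rewrite pow_div, tau_pow, Rpow_mult_distr by lra; field; lra.
    + intros m _; apply (ex_derive_continuous (V := R_NormedModule)); unfold dg, W; auto_derive; auto.
Qed.

Lemma triangle_int_increment (M d0 d L : R) : 0 <= M -> 0 < d0 <= d -> (forall u, 0 <= u -> Eas u <= L) ->
  Eas M * (Jr (tau d0) - Jr (tau d)) <= triangle_int M d - triangle_int M d0 <= L * (Jr (tau d0) - Jr (tau d)).
Proof.
  intros HM Hd HL.
  assert (Pp : forall x, 0 < x -> 0 <= phi_tau x)
    by (intros x Hx; apply Rmult_le_pos; apply pow_le; [left; apply tau_pos|lra]).
  assert (B : forall x, 0 < x -> Eas M <= Eas (M / tau x) <= L).
  { intros x Hx; assert (T0 := tau_pos x); assert (T1 := tau_le_1 x (Rlt_le _ _ Hx)).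
    assert (M <= M / tau x).
    { apply Rmult_le_reg_r with (tau x); auto; unfold Rdiv; rewrite Rmult_assoc, Rinv_l by lra; nra. }
    split; [apply Egam_incr; lra|apply HL; lra]. }
  split.
  - assert (G : triangle_int M d0 - Eas M * - Jr (tau d0) <= triangle_int M d - Eas M * - Jr (tau d)); [|lra].
    apply (is_derive_incr (fun x => triangle_int M x - Eas M * - Jr (tau x))
      (fun x => phi_tau x * Eas (M / tau x) - Eas M * phi_tau x)); [lra| |].
    + intros t Ht; apply is_derive_Rminus; [apply is_derive_triangle_int; lra|].
      eapply is_derive_eq; [apply is_derive_Rmult; [apply is_derive_cst|apply is_derive_Jr_tau; lra]|cbv beta; ring].
    + intros t Ht; generalize (B t ltac:(lra)) (Pp t ltac:(lra)); intros; nra.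
  - assert (G : L * - Jr (tau d0) - triangle_int M d0 <= L * - Jr (tau d) - triangle_int M d); [|lra].
    apply (is_derive_incr (fun x => L * - Jr (tau x) - triangle_int M x)
      (fun x => L * phi_tau x - phi_tau x * Eas (M / tau x))); [lra| |].
    + intros t Ht; apply is_derive_Rminus; [|apply is_derive_triangle_int; lra].
      eapply is_derive_eq; [apply is_derive_Rmult; [apply is_derive_cst|apply is_derive_Jr_tau; lra]|cbv beta; ring].
    + intros t Ht; generalize (B t ltac:(lra)) (Pp t ltac:(lra)); intros; nra.
Qed.

Lemma Jr_small (eps : R) : 0 < eps -> exists t, 0 < t < 1 /\ Jr t < eps.
Proof.
  intros He.
  assert (C : continuity_pt Jr 0) by (apply is_derive_continuity_pt with (Fr a b h 0), (is_derive_Jr (U := U)); lra).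
  destruct (C eps He) as [del [Hdel H]]; exists (Rmin (del / 2) (1 / 2)).
  assert (Ht : 0 < Rmin (del / 2) (1 / 2)) by (apply Rmin_glb_lt; lra).
  assert (H1 := Rmin_l (del / 2) (1 / 2)); assert (H2 := Rmin_r (del / 2) (1 / 2)).
  split; [lra|].
  specialize (H (Rmin (del / 2) (1 / 2))); simpl in H; unfold R_dist, Rdist in H.
  rewrite (Jr_0 (a := a) (b := b) (h := h)), Rminus_0_r, Rminus_0_r in H.
  apply Rle_lt_trans with (1 := Rle_abs _), H; split; [split; [exact I|lra]|].
  rewrite Rabs_pos_eq; lra.
Qed.

(** When [M] tends to infinity and [d] runs over the positive reals, the triangle fills
    the quadrant while [Jr (tau d)] sweeps the interval from [rho] to 0. *)
Lemma Egam_product (La Ls Las : R) :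
  (forall u, 0 <= u -> Ea u <= La) -> (forall v, v < La -> exists u, 0 < u /\ v < Ea u) ->
  (forall u, 0 <= u -> Es u <= Ls) -> (forall v, v < Ls -> exists u, 0 < u /\ v < Es u) ->
  (forall u, 0 <= u -> Eas u <= Las) -> (forall v, v < Las -> exists u, 0 < u /\ v < Eas u) ->
  rhoh * Las = La * Ls.
Proof.
  intros A1 A2 S1 S2 T1 T2.
  destruct (rhoh_spec (U := U)) as [_ [_ R3]].
  assert (R0 := rhoh_pos (U := U)).
  assert (La0 : 0 <= La) by (apply Rle_trans with (2 := A1 0 ltac:(lra)), Egam_nonneg; lra).
  assert (Ls0 : 0 <= Ls) by (apply Rle_trans with (2 := S1 0 ltac:(lra)), Egam_nonneg; lra).
  assert (Las0 : 0 <= Las) by (apply Rle_trans with (2 := T1 0 ltac:(lra)), Egam_nonneg; lra).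
  apply Rle_antisym.
  - apply sup_scal_le with (E := Eas) (P := fun u => 0 < u); auto; [lra|].
    intros M HM; rewrite Rmult_comm.
    assert (E0 : 0 <= Eas M) by (apply Egam_nonneg; lra).
    apply sup_scal_le with (E := Jr) (P := fun t => 0 < t < 1); auto.
    { intros v Hv; destruct (R3 (Rmax v 0) ltac:(apply Rmax_lub_lt; auto)) as [t [Ht1 Ht2]].
      exists t; assert (v <= Rmax v 0) by apply Rmax_l; split; [|lra].
      destruct Ht1 as [[Ht|<-] Ht1]; [lra|].
      rewrite (Jr_0 (a := a) (b := b) (h := h)) in Ht2; generalize (Rmax_r v 0); lra. }
    intros t Ht; apply le_epsilon; intros eps He.
    destruct (tau_onto t Ht) as [d0 [Hd0 [Et _]]].
    destruct (Jr_small (eps / (Eas M + 1))) as [t1 [Ht1 Hj]]; [apply Rdiv_lt_0_compat; lra|].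
    assert (Jt : Eas M * Jr t1 <= eps).
    { assert (J1 : 0 <= Jr t1) by (rewrite <- (Jr_0 (a := a) (b := b) (h := h)); apply (Jr_incr (U := U)); lra).
      assert (Jr t1 * (Eas M + 1) <= eps / (Eas M + 1) * (Eas M + 1)) by (apply Rmult_le_compat_r; lra).
      replace (eps / (Eas M + 1) * (Eas M + 1)) with eps in H by (field; lra); lra. }
    assert (Fin : forall d, 0 < d -> 0 <= triangle_int M d <= La * Ls).
    { intros d Hd; destruct (triangle_int_bounds M 0 d Hd ltac:(lra)) as [B1 B2].
      rewrite Rmult_0_r, !Egam_0, Rmult_0_r in B1.
      split; [auto|apply Rle_trans with (1 := B2), Rmult_le_compat].
      - apply Egam_nonneg; lra.
      - apply Egam_nonneg, Rmult_le_pos; lra.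
      - apply A1; lra.
      - apply S1, Rmult_le_pos; lra. }
    destruct (Rle_lt_dec t t1) as [Lt|Lt].
    + assert (Jr t <= Jr t1) by (apply (Jr_incr (U := U)); lra).
      assert (0 <= La * Ls) by (apply Rmult_le_pos; auto).
      assert (Eas M * Jr t <= Eas M * Jr t1) by (apply Rmult_le_compat_l; auto); lra.
    + destruct (tau_onto t1 Ht1) as [d [Hd [Et1 Hlt]]].
      assert (d0 < d) by (apply Hlt; auto; rewrite Et; auto).
      destruct (triangle_int_increment M d0 d Las ltac:(lra) ltac:(lra) T1) as [I1 _].
      rewrite Et, Et1 in I1; generalize (Fin d Hd) (Fin d0 Hd0); lra.
  - rewrite Rmult_comm.
    apply sup_scal_le with (E := Ea) (P := fun u => 0 < u); auto.
    intros M HM; apply le_epsilon; intros eps He.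
    set (m0 := Rmin M (eps / (Ls + 1))).
    assert (Hm0 : 0 < m0) by (apply Rmin_glb_lt; [lra|apply Rdiv_lt_0_compat; lra]).
    assert (Hm1 : m0 <= M) by apply Rmin_l.
    assert (Em : Ls * Ea m0 <= eps).
    { assert (Ea m0 <= m0) by (apply Egam_le_id; [lia|lia|lra]).
      assert (m0 <= eps / (Ls + 1)) by apply Rmin_r.
      assert (0 <= Ea m0) by (apply Egam_nonneg; lra).
      assert (Ea m0 * (Ls + 1) <= eps / (Ls + 1) * (Ls + 1)) by (apply Rmult_le_compat_r; lra).
      replace (eps / (Ls + 1) * (Ls + 1)) with eps in H2 by (field; lra); nra. }
    assert (D0 : 0 <= Ea M - Ea m0) by (assert (Ea m0 <= Ea M) by (apply Egam_incr; lra); lra).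
    enough (G : (Ea M - Ea m0) * Ls <= rhoh * Las) by lra.
    apply sup_scal_le with (E := Es) (P := fun u => 0 < u); auto.
    intros u Hu; apply le_epsilon; intros e2 He2.
    set (d := u / m0); assert (Hd : 0 < d) by (apply Rdiv_lt_0_compat; auto).
    assert (Eu : d * m0 = u) by (unfold d; field; lra).
    set (d0 := Rmin d (e2 / ((La + 1) * M))).
    assert (Pm : 0 < (La + 1) * M) by (apply Rmult_lt_0_compat; lra).
    assert (Hd0 : 0 < d0) by (apply Rmin_glb_lt; [auto|apply Rdiv_lt_0_compat; lra]).
    assert (Hd1 : d0 <= d) by apply Rmin_l.
    destruct (triangle_int_bounds M m0 d Hd ltac:(lra)) as [B1 _].
    destruct (triangle_int_bounds M m0 d0 Hd0 ltac:(lra)) as [_ B2].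
    destruct (triangle_int_increment M d0 d Las ltac:(lra) ltac:(lra) T1) as [_ I2].
    rewrite Eu in B1.
    assert (X1 : Ea M * Es (d0 * M) <= e2).
    { assert (0 <= d0 * M) by (apply Rmult_le_pos; lra).
      assert (Es (d0 * M) <= d0 * M) by (apply Egam_le_id; [lia|lia|auto]).
      assert (0 <= Es (d0 * M)) by (apply Egam_nonneg; auto).
      assert (d0 * ((La + 1) * M) <= e2).
      { apply Rle_trans with (e2 / ((La + 1) * M) * ((La + 1) * M)); [apply Rmult_le_compat_r; [lra|apply Rmin_r]|].
        right; field; split; lra. }
      apply Rle_trans with (La * (d0 * M)); [apply Rmult_le_compat; auto; [apply Egam_nonneg; lra|apply A1; lra]|lra]. }
    assert (X2 : Las * (Jr (tau d0) - Jr (tau d)) <= Las * rhoh).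
    { apply Rmult_le_compat_l; auto.
      assert (Jr (tau d0) < rhoh) by (apply (Jr_lt_rhoh (U := U)); split; [left; apply tau_pos|apply tau_lt_1; auto]).
      assert (0 <= Jr (tau d)).
      { rewrite <- (Jr_0 (a := a) (b := b) (h := h)); apply (Jr_incr (U := U));
          [lra|left; apply tau_pos|apply tau_lt_1; auto]. }
      lra. }
    lra.
Qed.

Lemma is_derive_root (t : R) : 0 < t -> is_derive (fun t => Rpower t (1 / INR h)) t (Rpower t (1 / INR h) / (INR h * t)).
Proof.
  intros Ht; unfold Rpower; auto_derive; [auto|]; field; lra.
Qed.

Lemma Rpower_split (t : R) (k : nat) : 0 < t -> (1 <= k)%nat ->
  Rpower t (INR k / INR h - 1) = Rpower t (1 / INR h) ^ k / t.
Proof.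
  intros Ht Hk; rewrite Rpower_nat_pow; replace (INR k * (1 / INR h)) with (INR k / INR h) by (field; lra).
  unfold Rminus; rewrite Rpower_plus, Rpower_Ropp, Rpower_1 by auto; reflexivity.
Qed.

Lemma root_lt (t c : R) : 0 < t -> 0 < c -> t < c ^ h -> Rpower t (1 / INR h) < c.
Proof.
  intros Ht Hc H; rewrite <- (Rpower_pow_root (U := U) c Hc).
  apply Rlt_Rpower_l; [apply Rdiv_lt_0_compat|]; lra.
Qed.

Lemma lt_root (t c : R) : 0 < c -> c ^ h < t -> c < Rpower t (1 / INR h).
Proof.
  intros Hc H; rewrite <- (Rpower_pow_root (U := U) c Hc) at 1.
  apply Rlt_Rpower_l; [apply Rdiv_lt_0_compat; lra|split; [apply pow_lt; auto|auto]].
Qed.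

Lemma filterlim_difference (G : R -> R) (Fa Fb : (R -> Prop) -> Prop) {FFa : Filter Fa} {FFb : Filter Fb}
  (l l0 : R) : filterlim G Fb (locally l) -> filterlim G Fa (locally l0) ->
  filterlim (fun ab : R * R => minus (G (snd ab)) (G (fst ab))) (filter_prod Fa Fb) (locally (minus l l0)).
Proof.
  intros H1 H2; apply (filterlim_comp_2 (G := locally l) (H := locally (opp l0))
    (fun ab : R * R => G (snd ab)) (fun ab : R * R => opp (G (fst ab))) plus).
  - apply (filterlim_comp _ _ _ snd G _ Fb); [apply filterlim_snd|auto].
  - apply (filterlim_comp _ _ _ (fun ab : R * R => G (fst ab)) opp _ (locally l0)).
    + apply (filterlim_comp _ _ _ fst G _ Fa); [apply filterlim_fst|auto].
    + apply (filterlim_opp (V := R_NormedModule)).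
  - apply (filterlim_plus (V := R_NormedModule)).
Qed.

Lemma Gamma_Egam (k : nat) (L : R) : (1 <= k <= h)%nat -> (forall u, 0 <= u -> Egam h k u <= L) ->
  (forall v, v < L -> exists u, 0 < u /\ v < Egam h k u) -> Gamma (INR k / INR h) = INR h * L.
Proof.
  intros Hk L1 L2; unfold Gamma; apply is_RInt_gen_unique.
  set (G := fun t => INR h * Egam h k (Rpower t (1 / INR h))).
  assert (DG : forall t, 0 < t -> is_derive G t (Rpower t (INR k / INR h - 1) * exp (- t))).
  { intros t Ht; eapply is_derive_eq.
    - unfold G; apply is_derive_Rmult; [apply is_derive_cst|].
      apply (is_derive_Rcomp (Egam h k) (fun t => Rpower t (1 / INR h))); [apply is_derive_Egam|apply is_derive_root; auto].
    - cbv beta; rewrite (Rpower_root_pow (U := U)), Rpower_split by (auto; lia).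
      replace k with (S (k - 1)) at 3 by lia; simpl pow; field; lra. }
  apply (is_RInt_gen_filterlim (V := R_NormedModule) (at_right 0) (Rbar_locally p_infty) _
    (fun ab => minus (G (snd ab)) (G (fst ab)))).
  - apply Filter_prod with (fun x => 0 < x) (fun y => 1 < y).
    + exists (mkposreal 1 Rlt_0_1); intros y _ Hy; auto.
    + exists 1; auto.
    + intros x y Hx Hy; simpl; apply (is_RInt_derive G).
      * intros t Ht; apply DG; apply Rlt_le_trans with (2 := proj1 Ht); apply Rmin_glb_lt; lra.
      * intros t Ht; assert (Ht0 : 0 < t) by (apply Rlt_le_trans with (2 := proj1 Ht); apply Rmin_glb_lt; lra).
        apply (ex_derive_continuous (V := R_NormedModule)); unfold Rpower; auto_derive; auto.
  - replace (INR h * L) with (minus (INR h * L) 0) by exact (Rminus_0_r _).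
    apply (filterlim_difference G (at_right 0) (Rbar_locally p_infty)).
    + apply filterlim_locally; intros eps.
      destruct (L2 (L - eps / INR h)) as [u [Hu1 Hu2]].
      { assert (0 < eps / INR h) by (apply Rdiv_lt_0_compat; [apply cond_pos|lra]); lra. }
      exists (u ^ h); intros t Ht.
      assert (U1 : u < Rpower t (1 / INR h)) by (apply lt_root; auto).
      assert (U2 : Egam h k u <= Egam h k (Rpower t (1 / INR h))) by (apply Egam_incr; lra).
      assert (U3 := L1 (Rpower t (1 / INR h)) ltac:(lra)).
      unfold ball; simpl; unfold AbsRing_ball, abs, minus, plus, opp; simpl; unfold G.
      replace (INR h * Egam h k (Rpower t (1 / INR h)) + - (INR h * L))
        with (- (INR h * (L - Egam h k (Rpower t (1 / INR h))))) by ring.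
      rewrite Rabs_Ropp, Rabs_pos_eq by (apply Rmult_le_pos; lra).
      assert (X : INR h * (L - Egam h k (Rpower t (1 / INR h))) < INR h * (eps / INR h)) by (apply Rmult_lt_compat_l; lra).
      replace (INR h * (eps / INR h)) with (pos eps) in X by (field; lra); auto.
    + apply filterlim_locally; intros eps.
      assert (He : 0 < eps / INR h) by (apply Rdiv_lt_0_compat; [apply cond_pos|lra]).
      exists (mkposreal _ (pow_lt _ h He)); intros t Bt Ht.
      unfold ball in *; simpl in *; unfold AbsRing_ball, abs, minus, plus, opp in *; simpl in *.
      rewrite Ropp_0, Rplus_0_r in *; rewrite Rabs_pos_eq in Bt by lra.
      assert (U1 := root_lt t _ Ht He Bt).
      assert (U0 : 0 < Rpower t (1 / INR h)) by apply exp_pos.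
      assert (U2 : 0 <= Egam h k (Rpower t (1 / INR h)) <= Rpower t (1 / INR h)).
      { split; [apply Egam_nonneg|apply Egam_le_id; try lia]; lra. }
      unfold G; rewrite Rabs_pos_eq by (apply Rmult_le_pos; lra).
      assert (X : INR h * Egam h k (Rpower t (1 / INR h)) < INR h * (eps / INR h)) by (apply Rmult_lt_compat_l; lra).
      replace (INR h * (eps / INR h)) with (pos eps) in X by (field; lra); auto.
Qed.

Lemma Beta_rhoh : Beta (INR a / INR h) (INR s / INR h) = INR h * rhoh.
Proof.
  unfold Beta; apply is_RInt_gen_unique.
  destruct (rhoh_spec (U := U)) as [_ [_ R3]].
  set (G := fun t => INR h * Jr (Rpower t (1 / INR h))).
  assert (root1 : forall t, 0 < t < 1 -> 0 < Rpower t (1 / INR h) < 1).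
  { intros t Ht; split; [apply exp_pos|apply root_lt; try lra; rewrite pow1; lra]. }
  assert (DG : forall t, 0 < t < 1 -> is_derive G t (Rpower t (INR a / INR h - 1) * Rpower (1 - t) (INR s / INR h - 1))).
  { intros t Ht; assert (R1 := root1 t Ht); eapply is_derive_eq.
    - unfold G; apply is_derive_Rmult; [apply is_derive_cst|].
      apply (is_derive_Rcomp Jr (fun t => Rpower t (1 / INR h))); [apply (is_derive_Jr (U := U)); lra|apply is_derive_root; lra].
    - cbv beta; unfold Fr; rewrite (dr_pow_ab (U := U)), (Rpower_root_pow (U := U)), Rpower_split by (try lra; lia).
      replace (INR s / INR h - 1) with (- kappa a b h).
      + rewrite Rpower_Ropp; replace (Rpower t (1 / INR h) ^ a) with (Rpower t (1 / INR h) * Rpower t (1 / INR h) ^ (a - 1)) by (replace a with (S (a - 1)) at 2 by lia; reflexivity); field.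
        repeat split; try lra; apply Rgt_not_eq, exp_pos.
      + unfold kappa; replace (INR s) with (INR h - INR (a + b)) by (rewrite Hs, (plus_INR (a + b)); ring); field; lra. }
  apply (is_RInt_gen_filterlim (V := R_NormedModule) (at_right 0) (at_left 1) _
    (fun ab => minus (G (snd ab)) (G (fst ab)))).
  - apply Filter_prod with (fun x => 0 < x < 1) (fun y => 0 < y < 1).
    + exists (mkposreal 1 Rlt_0_1); intros y By Hy; unfold ball in By; simpl in By; unfold AbsRing_ball, abs, minus, plus, opp in By; simpl in By.
      rewrite Ropp_0, Rplus_0_r in By; apply Rabs_lt_between in By; lra.
    + exists (mkposreal 1 Rlt_0_1); intros y By Hy; unfold ball in By; simpl in By; unfold AbsRing_ball, abs, minus, plus, opp in By; simpl in By.
      apply Rabs_lt_between in By; lra.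
    + intros x y Hx Hy; simpl; apply (is_RInt_derive G).
      * intros t Ht; apply DG; split; [apply Rlt_le_trans with (2 := proj1 Ht); apply Rmin_glb_lt; lra|].
        apply Rle_lt_trans with (1 := proj2 Ht); apply Rmax_lub_lt; lra.
      * intros t Ht; assert (Ht0 : 0 < t < 1).
        { split; [apply Rlt_le_trans with (2 := proj1 Ht); apply Rmin_glb_lt; lra|].
          apply Rle_lt_trans with (1 := proj2 Ht); apply Rmax_lub_lt; lra. }
        apply (ex_derive_continuous (V := R_NormedModule)); unfold Rpower; auto_derive; repeat split; lra.
  - replace (INR h * rhoh) with (minus (INR h * rhoh) 0) by exact (Rminus_0_r _).
    apply (filterlim_difference G (at_right 0) (at_left 1)).
    + apply filterlim_locally; intros eps.
      destruct (R3 (rhoh - eps / INR h)) as [u [Hu1 Hu2]].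
      { assert (0 < eps / INR h) by (apply Rdiv_lt_0_compat; [apply cond_pos|lra]); lra. }
      set (u1 := (u + 1) / 2); assert (Hu : 0 < u1 < 1 /\ u <= u1) by (unfold u1; lra).
      assert (Pu : 0 < 1 - u1 ^ h) by (assert (u1 ^ h < 1 ^ h) by (apply pow_base_lt; [lra|lia]); rewrite pow1 in H; lra).
      exists (mkposreal _ Pu); intros t Bt Ht.
      unfold ball in *; simpl in *; unfold AbsRing_ball, abs, minus, plus, opp in *; simpl in *.
      apply Rabs_lt_between in Bt.
      assert (Pu2 : 0 < u1 ^ h) by (apply pow_lt; lra).
      assert (U1 : u1 < Rpower t (1 / INR h)) by (apply lt_root; lra).
      assert (R1 := root1 t ltac:(lra)).
      assert (U2 : Jr u <= Jr (Rpower t (1 / INR h))) by (apply (Jr_incr (U := U)); lra).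
      assert (U3 : Jr (Rpower t (1 / INR h)) < rhoh) by (apply (Jr_lt_rhoh (U := U)); lra).
      unfold G; replace (INR h * Jr (Rpower t (1 / INR h)) + - (INR h * rhoh))
        with (- (INR h * (rhoh - Jr (Rpower t (1 / INR h))))) by ring.
      rewrite Rabs_Ropp, Rabs_pos_eq by (apply Rmult_le_pos; lra).
      assert (X : INR h * (rhoh - Jr (Rpower t (1 / INR h))) < INR h * (eps / INR h)) by (apply Rmult_lt_compat_l; lra).
      replace (INR h * (eps / INR h)) with (pos eps) in X by (field; lra); auto.
    + apply filterlim_locally; intros eps.
      assert (He : 0 < eps / INR h) by (apply Rdiv_lt_0_compat; [apply cond_pos|lra]).
      destruct (Jr_small _ He) as [u [Hu1 Hu2]].
      assert (Pu : 0 < u ^ h) by (apply pow_lt; lra).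
      assert (Pu1 : u ^ h < 1) by (rewrite <- (pow1 h); apply pow_base_lt; [lra|lia]).
      exists (mkposreal _ Pu); intros t Bt Ht.
      unfold ball in *; simpl in *; unfold AbsRing_ball, abs, minus, plus, opp in *; simpl in *.
      rewrite Ropp_0, Rplus_0_r in *; rewrite Rabs_pos_eq in Bt by lra.
      assert (U1 : Rpower t (1 / INR h) < u) by (apply root_lt; lra).
      assert (R1 := root1 t ltac:(lra)).
      assert (U2 : 0 <= Jr (Rpower t (1 / INR h)) <= Jr u).
      { split; [rewrite <- (Jr_0 (a := a) (b := b) (h := h))|]; apply (Jr_incr (U := U)); lra. }
      unfold G; rewrite Rabs_pos_eq by (apply Rmult_le_pos; lra).
      assert (X : INR h * Jr (Rpower t (1 / INR h)) < INR h * (eps / INR h)) by (apply Rmult_lt_compat_l; lra).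
      replace (INR h * (eps / INR h)) with (pos eps) in X by (field; lra); auto.
Qed.

Lemma rhoh_Beta_Gamma : rhoh = 1 / INR h * Beta (INR a / INR h) (INR s / INR h) /\
  rhoh = 1 / INR h * (Gamma (INR a / INR h) * Gamma (INR s / INR h) / Gamma (INR (a + s) / INR h)).
Proof.
  split; [rewrite Beta_rhoh; field; lra|].
  destruct (@Egam_limit h a ltac:(lia) ltac:(lia)) as [La [_ [A1 A2]]].
  destruct (@Egam_limit h s ltac:(lia) ltac:(lia)) as [Ls [_ [S1 S2]]].
  destruct (@Egam_limit h (a + s) ltac:(lia) ltac:(lia)) as [Las [T0 [T1 T2]]].
  rewrite (Gamma_Egam a La), (Gamma_Egam s Ls), (Gamma_Egam (a + s) Las) by (auto; lia).
  assert (E := Egam_product La Ls Las A1 A2 S1 S2 T1 T2).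
  replace (INR h * La * (INR h * Ls)) with (INR h * INR h * (La * Ls)) by ring.
  rewrite <- E; field; lra.
Qed.

End Beta.

(** * The local inversion and the theorem *)

Lemma Cder_is_derive (f : C -> C) (z d : C) : Cder f z d ->
  is_derive (K := C_AbsRing) (V := C_NormedModule) f z d.
Proof.
  intros H; split; [apply is_linear_scal_l|].
  intros x Hx; rewrite <- (is_filter_lim_locally_unique (K := C_AbsRing) (V := AbsRing_NormedModule C_AbsRing) z x Hx); clear x Hx.
  intros eps; destruct (H eps (cond_pos eps)) as [del [Hdel B]].
  exists (mkposreal del Hdel); intros y Hy.
  change (Cmod (y - z)%C < del) in Hy; specialize (B (y - z)%C Hy).
  replace (z + (y - z))%C with (y : C) in B by (apply C_eq; unfold Re, Im; simpl; ring).
  exact B.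
Qed.

Lemma Cder_continuous (f : C -> C) (z d : C) : Cder f z d -> forall eps, 0 < eps ->
  exists del, 0 < del /\ forall w, Cmod w < del -> Cmod (f (z + w) - f z)%C < eps.
Proof.
  intros H eps He; destruct (H 1 Rlt_0_1) as [del [Hdel B]].
  assert (HL := Cmod_ge_0 d).
  exists (Rmin del (eps / (2 + Cmod d))); split; [apply Rmin_glb_lt; auto; apply Rdiv_lt_0_compat; lra|].
  intros w Hw.
  assert (W1 := Rlt_le_trans _ _ _ Hw (Rmin_l _ _)); assert (W2 := Rlt_le_trans _ _ _ Hw (Rmin_r _ _)).
  specialize (B w W1).
  replace (f (z + w) - f z)%C with ((f (z + w) - f z - w * d) + w * d)%C by ring.
  apply Rle_lt_trans with (1 := Cmod_triangle _ _); rewrite Cmod_mult.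
  assert (Cmod w * (2 + Cmod d) < eps).
  { apply Rlt_le_trans with (eps / (2 + Cmod d) * (2 + Cmod d)); [apply Rmult_lt_compat_r; lra|right; field; lra]. }
  generalize (Cmod_ge_0 w); nra.
Qed.

Lemma Rabs_atan_le (x : R) : Rabs (atan x) <= Rabs x.
Proof.
  assert (G : forall x, 0 <= x -> 0 <= atan x <= x).
  { intros y Hy; split.
    - rewrite <- atan_0; destruct Hy as [Hy|<-]; [left; apply atan_increasing; auto|lra].
    - assert (0 - atan 0 <= y - atan y); [|rewrite atan_0 in *; lra].
      apply (is_derive_incr (fun t => t - atan t) (fun t => 1 - / (1 + t ^ 2))); auto.
      + intros t _; apply is_derive_Rminus; [apply (is_derive_id (K := R_AbsRing))|].
        apply is_derive_Reals, derivable_pt_lim_atan.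
      + intros t _; assert (0 <= t ^ 2) by apply pow2_ge_0.
        assert (/ (1 + t ^ 2) <= / 1) by (apply Rinv_le_contravar; lra); rewrite Rinv_1 in *; lra. }
  destruct (Rle_lt_dec 0 x) as [L|L].
  - rewrite !Rabs_pos_eq; auto; apply G; auto.
  - rewrite <- (Rabs_Ropp (atan x)), <- (Rabs_Ropp x), <- atan_opp.
    rewrite !Rabs_pos_eq; try apply G; lra.
Qed.

Lemma Carg_near_1 (y : C) : Cmod (y - RtoC 1) <= 1 / 2 ->
  slit y /\ Rabs (Carg y) <= 2 * Cmod (y - RtoC 1).
Proof.
  intros H; assert (C1 := re_le_Cmod (y - RtoC 1)%C); assert (C2 := im_le_Cmod (y - RtoC 1)%C).
  change (Re (y - RtoC 1)%C) with (Re y + - 1) in C1; change (Im (y - RtoC 1)%C) with (Im y + - 0) in C2.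
  replace (Im y + - 0) with (Im y) in C2 by ring; apply Rabs_le_between in C1.
  assert (Hsl : slit y) by (apply Re_pos_slit; lra).
  split; auto; rewrite Carg_atan, Rabs_mult, (Rabs_pos_eq 2) by (auto; lra).
  apply Rmult_le_compat_l; [lra|]; apply Rle_trans with (1 := Rabs_atan_le _).
  assert (C3 := re_le_Cmod y); apply Rabs_le_between in C3.
  unfold Rdiv; rewrite Rabs_mult, Rabs_inv, (Rabs_pos_eq (Cmod y + Re y)) by lra.
  apply Rle_trans with (2 := C2); rewrite <- (Rmult_1_r (Rabs (Im y))) at 2.
  apply Rmult_le_compat_l; [apply Rabs_pos|].
  assert (/ (Cmod y + Re y) <= / 1) by (apply Rinv_le_contravar; lra); rewrite Rinv_1 in *; lra.
Qed.

Lemma Croot_exists (v : C) (k : nat) : (0 < k)%nat -> exists u, (u ^ k)%C = v.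
Proof.
  intros Hk; destruct (Ceq_dec v (RtoC 0)) as [->|N].
  - exists (RtoC 0); destruct k; [lia|]; simpl; ring.
  - exists (Cpowr v (1 / INR k)); apply Cpowr_root_pow; auto.
Qed.

Section Local.

Context {a b h p q : nat} {U : urn a b h p q}.

Let Ha : (0 < a)%nat. Proof. apply U. Qed.
Let Hb : (0 < b)%nat. Proof. apply U. Qed.
Let Hab : (a + b < h)%nat. Proof. apply U. Qed.
Let Hp : h = (a * p)%nat. Proof. apply U. Qed.
Let Hq : h = (b * q)%nat. Proof. apply U. Qed.

Local Notation rhoh := (rhoh a b h).
Local Notation Jr := (Jr a b h).
Local Notation Xr := (Xr a h).
Local Notation X0 := (X0 a b p q).
Local Notation Y0 := (Y0 a b p q).

(** [q Y^(q-1) Y' = p X^(p-1) X'], because [q b = h = p a]. *)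
Lemma basic_first_integral (z : C) : Cmod z < rhoh -> (Y0 z ^ q = RtoC 1 + X0 z ^ p)%C.
Proof.
  intros Hz; assert (P2 := p_ge_2 (U := U)); assert (Q2 := q_ge_2 (U := U)).
  set (F := fun t : R => (Y0 (RtoC 0 + RtoC t * z) ^ q - X0 (RtoC 0 + RtoC t * z) ^ p)%C).
  assert (E : F 1 = F 0).
  { apply (Pder_const_eq F 0 1); [lra|]; intros t Ht.
    assert (Hs : Cmod (RtoC 0 + RtoC t * z) < rhoh).
    { rewrite Cplus_0_l, Cmod_mult, Cmod_RtoC_pos by lra.
      apply Rle_lt_trans with (2 := Hz); generalize (Cmod_ge_0 z); nra. }
    destruct (solves_near_disc (U := U) _ Hs) as [S1 S2].
    eapply Pder_eq.
    - unfold F; apply Pder_minus; apply Pder_pow; [apply (Gder_affine Y0 _ _ _ _ S2)|apply (Gder_affine X0 _ _ _ _ S1)].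
    - cbv beta; assert (E1 : (RtoC (INR q) * RtoC (INR b) = RtoC (INR p) * RtoC (INR a))%C).
      { rewrite <- !RtoC_mult, <- !mult_INR; do 2 f_equal; lia. }
      set (x := X0 (RtoC 0 + RtoC t * z)%C); set (y := Y0 (RtoC 0 + RtoC t * z)%C).
      transitivity (z * y ^ (q - 1) * x ^ (p - 1) * (RtoC (INR q) * RtoC (INR b) - RtoC (INR p) * RtoC (INR a)))%C;
        [ring|rewrite E1; ring]. }
  unfold F in E.
  replace (RtoC 0 + RtoC 1 * z)%C with z in E by ring; replace (RtoC 0 + RtoC 0 * z)%C with (RtoC 0) in E by ring.
  rewrite X0_0, Y0_0, Cpow_1_l in E.
  assert (Z : (RtoC 0 ^ p = RtoC 0)%C) by (destruct p; [lia|simpl; ring]).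
  rewrite Z in E.
  transitivity ((Y0 z ^ q - X0 z ^ p) + X0 z ^ p)%C; [ring|rewrite E; ring].
Qed.

(** Explicit inversion of [xi] and [eta] near [y = 1]: [u^a = x y^(-a/b)] gives
    [1 - u^h = y^(-q)], whose principal root is [y^(-1/b)]. *)
Lemma xi_inverse (x y : C) (eps : R) : Cmod (y - RtoC 1) <= 1 / 2 -> Cmod (y - RtoC 1) <= / INR q ->
  (y ^ q = RtoC 1 + x ^ p)%C -> 0 < eps -> Cmod x * Rpower 2 (INR a / INR b) < eps ^ a ->
  exists u, Cmod u < eps /\ xi a h u = x.
Proof.
  intros H1 H2 Hxy He Hx.
  assert (P2 := p_ge_2 (U := U)); assert (Q2 := q_ge_2 (U := U)).
  destruct (INR_pos_params (U := U)) as [Pa [Pb [_ Pq]]].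
  assert (Eq := INR_h_q (U := U)); assert (Ep := INR_h_p (U := U)).
  destruct (Carg_near_1 y H1) as [Hsl Harg].
  assert (Hy := slit_neq0 y Hsl); assert (Cy := proj1 (Cmod_gt_0 y) Hy).
  assert (HhR : 0 < INR h) by (apply lt_0_INR; lia).
  destruct (Croot_exists (x * Cpowr y (- (INR a / INR b)))%C a Ha) as [u Eu].
  exists u; split.
  - apply Rnot_le_lt; intros L.
    assert (C1 : eps ^ a <= Cmod u ^ a) by (apply pow_incr; lra).
    rewrite <- Cmod_pow, Eu, Cmod_mult, Cmod_Cpowr in C1 by auto.
    assert (Rpower (Cmod y) (- (INR a / INR b)) <= Rpower 2 (INR a / INR b)); [|generalize (Cmod_ge_0 x); nra].
    assert (Cl : 1 / 2 <= Cmod y).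
    { assert (T := Cmod_triangle (y - (y - RtoC 1))%C (y - RtoC 1)%C).
      assert (T2 := Cmod_triangle_minus (RtoC 1) (RtoC 1 - y)%C).
      rewrite Cmod_1, (Cmod_minus_sym (RtoC 1) y) in T2; replace (RtoC 1 - (RtoC 1 - y))%C with y in T2 by ring; lra. }
    replace (Rpower 2 (INR a / INR b)) with (Rpower (1 / 2) (- (INR a / INR b))).
    + rewrite !Rpower_Ropp; apply Rinv_le_contravar; [apply exp_pos|].
      apply Rle_Rpower_l; [left; apply Rdiv_lt_0_compat; lra|lra].
    + unfold Rpower; f_equal; rewrite ln_div, ln_1 by lra; ring.
  - assert (Euh : (u ^ h = x ^ p / y ^ q)%C).
    { rewrite Hp, Cpow_mult_r, Eu, Cpow_mult_l, Cpowr_pow by auto; unfold Cdiv; f_equal.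
      replace (INR p * - (INR a / INR b)) with (- INR q) by (apply Rmult_eq_reg_r with (INR b); [|lra]; field_simplify; lra).
      rewrite Cpowr_opp by auto; f_equal.
      rewrite <- (Cpowr_1 y Hy) at 2; rewrite Cpowr_pow by auto; f_equal; ring. }
    assert (Yq : (y ^ q)%C <> RtoC 0) by (apply Cpow_nz; auto).
    assert (Ed : delta h u = Cpowr y (- (1 / INR b))).
    { unfold delta; rewrite Euh.
      replace (RtoC 1 - x ^ p / y ^ q)%C with (RtoC (Rpower (Cmod y) (- INR q)) * Cexpi (- INR q * Carg y))%C.
      - rewrite Cpowr_polar.
        + rewrite Cpowr_nz, Rpower_mult by auto; rewrite Eq; f_equal; [do 2 f_equal|f_equal]; field; lra.
        + apply exp_pos.
        + assert (Rabs (INR q * Carg y) <= 2).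
          { rewrite Rabs_mult, Rabs_pos_eq by lra.
            apply Rle_trans with (INR q * (2 * / INR q)); [apply Rmult_le_compat_l; lra|right; field; lra]. }
          assert (P3 := PI_4); assert (P4 := PI2_1); apply Rabs_le_between in H; lra.
      - rewrite <- Cpowr_nz, Cpowr_opp by auto.
        replace (Cpowr y (INR q)) with (y ^ q)%C.
        + replace (x ^ p)%C with (y ^ q - RtoC 1)%C by (rewrite Hxy; ring); field; auto.
        + rewrite <- (Cpowr_1 y Hy) at 1; rewrite Cpowr_pow by auto; f_equal; ring. }
    unfold xi; rewrite Ed, Eu, Cpowr_pow by auto.
    replace (INR a * - (1 / INR b)) with (- (INR a / INR b)) by (field; lra).
    field; apply Cpowr_neq0; auto.
Qed.

Lemma ray_int_small (eta : R) : 0 < eta -> exists r, 0 < r < 1 /\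
  forall u, Cmod u < r -> Cmod (ray_int a b h u 1) < eta.
Proof.
  intros He; destruct (Jr_small (U := U) eta He) as [t [Ht Hj]].
  exists t; split; auto; intros u Hu.
  assert (Hu0 := Cmod_ge_0 u).
  assert (B : Cmod (ray_int a b h u 1 - ray_int a b h u 0) <= Jr (1 * Cmod u) - Jr (0 * Cmod u)).
  { apply (ray_int_le (U := U)); try lra.
    intros v Hv; apply regular_unit; rewrite Cmod_mult, Cmod_RtoC_pos by lra; nra. }
  rewrite ray_int_0, Rmult_0_l, Rmult_1_l, (Jr_0 (a := a) (b := b) (h := h)) in B.
  replace (ray_int a b h u 1 - RtoC 0)%C with (ray_int a b h u 1) in B by ring.
  assert (Jr (Cmod u) <= Jr t) by (apply (Jr_incr (U := U)); lra); lra.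
Qed.

(** The derivative of [X0] at 0 is [a], hence not 0. *)
Lemma X0_locally_injective : exists r, 0 < r <= rhoh /\ forall z w, Cmod z < r -> Cmod w < r ->
  X0 z = X0 w -> z = w.
Proof.
  assert (R0 := rhoh_pos (U := U)).
  destruct (INR_pos_params (U := U)) as [Pa _].
  destruct (basic_Csolves (U := U) (RtoC 0) ltac:(rewrite Cmod_0; auto)) as [_ S2].
  assert (N : forall eps, 0 < eps -> exists c, 0 < c <= 1 /\ forall y, Cmod (y - RtoC 1) < c -> Cmod (y ^ (q - 1) - RtoC 1) < eps).
  { intros eps He.
    set (Q := INR (q - 1) * 2 ^ (q - 1) + 1).
    assert (HQ : 1 <= Q).
    { unfold Q; assert (0 <= INR (q - 1)) by apply pos_INR; assert (0 < 2 ^ (q - 1)) by (apply pow_lt; lra); nra. }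
    exists (Rmin 1 (eps / Q)); split.
    - split; [apply Rmin_glb_lt; [lra|apply Rdiv_lt_0_compat; lra]|apply Rmin_l].
    - intros y Hy.
      assert (W1 := Rlt_le_trans _ _ _ Hy (Rmin_l _ _)); assert (W2 := Rlt_le_trans _ _ _ Hy (Rmin_r _ _)).
      assert (B := Cmod_pow_minus_le y (RtoC 1) (q - 1) 2 ltac:(lra)).
      rewrite Cpow_1_l, Cmod_1 in B.
      assert (Cy : Cmod y <= 2).
      { replace y with ((y - RtoC 1) + RtoC 1)%C by ring.
        apply Rle_trans with (1 := Cmod_triangle _ _); rewrite Cmod_1; lra. }
      specialize (B Cy ltac:(lra)).
      assert (C0 := Cmod_ge_0 (y - RtoC 1)%C).
      assert (Cmod (y - RtoC 1) * Q < eps).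
      { apply Rlt_le_trans with (eps / Q * Q); [apply Rmult_lt_compat_r; lra|right; field; lra]. }
      unfold Q in H; lra. }
  destruct (N (1 / 2) ltac:(lra)) as [c [Hc Bc]].
  destruct (Cder_continuous Y0 _ _ S2 c ltac:(lra)) as [del [Hdel Bd]].
  exists (Rmin rhoh del); split; [split; [apply Rmin_glb_lt; auto|apply Rmin_l]|].
  intros z w Hz Hw E.
  assert (Z1 := Rlt_le_trans _ _ _ Hz (Rmin_l _ _)); assert (Z2 := Rlt_le_trans _ _ _ Hz (Rmin_r _ _)).
  assert (W1 := Rlt_le_trans _ _ _ Hw (Rmin_l _ _)); assert (W2 := Rlt_le_trans _ _ _ Hw (Rmin_r _ _)).
  assert (Seg : forall t r, 0 <= t <= 1 -> Cmod z < r -> Cmod w < r -> Cmod (z + RtoC t * (w - z)) < r).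
  { intros t r Ht A1 A2; replace (z + RtoC t * (w - z))%C with (z + RtoC t * (w - z) - RtoC 0)%C by ring.
    apply segment_in_disc; auto; unfold Cminus; rewrite Copp_0, Cplus_0_r; auto. }
  (* [X0 (z) - a z] varies along the segment at less than half the speed of [a z]. *)
  assert (M : Cmod ((X0 (z + RtoC 1 * (w - z)) - RtoC (INR a) * (z + RtoC 1 * (w - z)))
     - (X0 (z + RtoC 0 * (w - z)) - RtoC (INR a) * (z + RtoC 0 * (w - z)))) <= (INR a * Cmod (w - z) * (1 / 2)) * (1 - 0)).
  { apply (path_mean_value (fun t => X0 (z + RtoC t * (w - z)) - RtoC (INR a) * (z + RtoC t * (w - z)))%C
      (fun t => RtoC (INR a) * (w - z) * (Y0 (z + RtoC t * (w - z)) ^ (q - 1) - RtoC 1))%C); [lra| |].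
    - intros t Ht; destruct (solves_near_disc (U := U) _ (Seg t rhoh Ht Z1 W1)) as [S1 _].
      eapply Pder_eq.
      + apply Pder_minus; [apply (Gder_affine X0 _ _ _ _ S1)|apply Pder_scal, Pder_affine].
      + ring.
    - intros t Ht; rewrite !Cmod_mult, (Cmod_RtoC_pos (INR a)) by lra.
      apply Rmult_le_compat_l; [apply Rmult_le_pos; [lra|apply Cmod_ge_0]|left].
      apply Bc; specialize (Bd _ (Seg t del Ht Z2 W2)).
      rewrite Cplus_0_l, Y0_0 in Bd; auto. }
  replace (z + RtoC 1 * (w - z))%C with w in M by ring; replace (z + RtoC 0 * (w - z))%C with z in M by ring.
  rewrite E in M; replace (X0 w - RtoC (INR a) * w - (X0 w - RtoC (INR a) * z))%C with (RtoC (- INR a) * (w - z))%C in M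
    by (rewrite RtoC_opp; ring).
  rewrite Cmod_mult, Cmod_R, Rabs_Ropp, Rabs_pos_eq in M by lra.
  assert (Z : Cmod (w - z) = 0) by (apply Rle_antisym; [nra|apply Cmod_ge_0]).
  apply Cmod_eq_0 in Z; replace z with (z + RtoC 0)%C by ring; rewrite <- Z; ring.
Qed.

(** The preimage of [z] is the [u] with [xi u = X0 z], because [X0] is injective near 0. *)
Lemma ray_int_onto (eps : R) : 0 < eps -> exists r, 0 < r <= rhoh /\
  forall z, Cmod z < r -> exists u, Cmod u < eps /\ Cmod u < 1 /\ ray_int a b h u 1 = z.
Proof.
  intros He; assert (R0 := rhoh_pos (U := U)).
  destruct (INR_pos_params (U := U)) as [Pa [Pb [_ Pq]]].
  destruct X0_locally_injective as [r1 [Hr1 Inj]].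
  destruct (ray_int_small r1 ltac:(lra)) as [r2 [Hr2 Sm]].
  set (e := Rmin eps r2); assert (Hep : 0 < e) by (apply Rmin_glb_lt; lra).
  assert (E1 : e <= eps) by apply Rmin_l; assert (E2 : e <= r2) by apply Rmin_r.
  destruct (basic_Csolves (U := U) (RtoC 0) ltac:(rewrite Cmod_0; auto)) as [S1 S2].
  assert (Pw := exp_pos (INR a / INR b * ln 2)); fold (Rpower 2 (INR a / INR b)) in Pw.
  assert (Pe : 0 < e ^ a) by (apply pow_lt; auto).
  destruct (Cder_continuous X0 _ _ S1 (e ^ a / Rpower 2 (INR a / INR b)) (Rdiv_lt_0_compat _ _ Pe Pw)) as [d1 [D1 B1]].
  assert (Pq' : 0 < / INR q) by (apply Rinv_0_lt_compat; lra).
  destruct (Cder_continuous Y0 _ _ S2 (Rmin (1 / 2) (/ INR q)) ltac:(apply Rmin_glb_lt; lra)) as [d2 [D2 B2]].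
  exists (Rmin r1 (Rmin d1 d2)); split; [split; [repeat apply Rmin_glb_lt; lra|apply Rle_trans with (1 := Rmin_l _ _); lra]|].
  intros z Hz.
  assert (Z1 := Rlt_le_trans _ _ _ Hz (Rmin_l _ _)); assert (Z2 := Rlt_le_trans _ _ _ Hz (Rmin_r _ _)).
  assert (Z3 := Rlt_le_trans _ _ _ Z2 (Rmin_l _ _)); assert (Z4 := Rlt_le_trans _ _ _ Z2 (Rmin_r _ _)).
  specialize (B1 z Z3); specialize (B2 z Z4); rewrite Cplus_0_l, X0_0 in B1; rewrite Cplus_0_l, Y0_0 in B2.
  replace (X0 z - RtoC 0)%C with (X0 z) in B1 by ring.
  destruct (xi_inverse (X0 z) (Y0 z) e) as [u [Hu Eu]]; auto.
  - left; apply Rlt_le_trans with (1 := B2), Rmin_l.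
  - left; apply Rlt_le_trans with (1 := B2), Rmin_r.
  - apply basic_first_integral; lra.
  - apply Rlt_le_trans with (e ^ a / Rpower 2 (INR a / INR b) * Rpower 2 (INR a / INR b));
      [apply Rmult_lt_compat_r; auto|right; field; lra].
  - exists u; split; [lra|split; [lra|]].
    destruct (basic_in_unit_disc (U := U) u ltac:(lra)) as [_ [EX _]].
    apply Inj; [apply Sm; lra|auto|rewrite EX; auto].
Qed.

(** [f] is unbounded on the radius of direction [c]. *)
Lemma rhoh_singular (c : C) (D : C -> Prop) (f : C -> C) : Cmod c = 1 ->
  (forall x, 0 <= x < rhoh -> D (c * RtoC x)%C /\ f (c * RtoC x)%C = (c * X0 (RtoC x))%C) ->
  singular_at f D (c * RtoC rhoh)%C.
Proof.
  intros Hc Hf [g [Hg [eps [He Hn]]]].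
  destruct (analytic_at_bounded g _ Hg) as [M [e1 [He1 HM]]].
  assert (R0 := rhoh_pos (U := U)).
  set (e := Rmin (rhoh / 2) (Rmin (eps / 2) (e1 / 2))).
  assert (Hep : 0 < e) by (repeat apply Rmin_glb_lt; lra).
  assert (E0 : e <= rhoh / 2) by apply Rmin_l.
  assert (E1 : e <= eps / 2) by (apply Rle_trans with (1 := Rmin_r _ _), Rmin_l).
  assert (E2 : e <= e1 / 2) by (apply Rle_trans with (1 := Rmin_r _ _), Rmin_r).
  destruct (solves_bounded (a := a) (b := b) (p := p) (q := q) X0 Y0 0 (rhoh - e) ltac:(lra)) as [M1 HM1].
  { intros x Hx; apply (solves_near_disc (U := U)); rewrite Cmod_RtoC_pos; lra. }
  destruct (real_curve_unbounded (U := U) (Rmax M M1 + 1)) as [t [Ht [X1 _]]].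
  assert (L1 := Rmax_l M M1); assert (L2 := Rmax_r M M1).
  assert (J0 : 0 <= Jr t) by (rewrite <- (Jr_0 (a := a) (b := b) (h := h)); apply (Jr_incr (U := U)); lra).
  assert (J1 : Jr t < rhoh) by (apply (Jr_lt_rhoh (U := U)); lra).
  destruct (basic_real (U := U) t Ht) as [BX _].
  assert (Big : Xr t <= Cmod (X0 (RtoC (Jr t)))) by (rewrite BX, Cmod_R; apply Rle_abs).
  destruct (Rle_lt_dec (Jr t) (rhoh - e)) as [L|L]; [generalize (HM1 (Jr t) ltac:(lra)); lra|].
  assert (Dist : Cmod (c * RtoC (Jr t) - c * RtoC rhoh) < 2 * e).
  { replace (c * RtoC (Jr t) - c * RtoC rhoh)%C with (c * RtoC (Jr t - rhoh))%C by (rewrite RtoC_minus; ring).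
    rewrite Cmod_mult, Hc, Cmod_R, Rabs_left by lra; lra. }
  destruct (Hf (Jr t) ltac:(lra)) as [F1 F2].
  assert (G1 : Cmod (g (c * RtoC (Jr t))%C) <= M) by (apply HM; lra).
  assert (Dist2 : Cmod (c * RtoC (Jr t) - c * RtoC rhoh) < eps) by lra.
  rewrite (Hn _ Dist2 F1), F2, Cmod_mult, Hc in G1; lra.
Qed.

End Local.

(** [cos t + |sin t|] is positive for [|t| < 3 PI / 4]. *)
Lemma sector_cond (p r : R) (z : C) : sector p r (3 * PI / 2) z ->
  0 < Re (RtoC p - z)%C + Rabs (Im (RtoC p - z)%C).
Proof.
  intros [[H0 _] H]; set (w := (RtoC p - z)%C) in *.
  assert (Hw : w <> RtoC 0) by (apply Cmod_gt_0; unfold w; rewrite Cmod_minus_sym; auto).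
  assert (Pw := proj1 (Cmod_gt_0 w) Hw).
  set (u := Rabs (Carg w)) in *.
  assert (U0 : 0 <= u) by apply Rabs_pos.
  assert (P := PI_RGT_0).
  assert (Es : Rabs (Im w) = Cmod w * sin u).
  { assert (S : Im w = Cmod w * sin (Carg w)) by (rewrite sin_Carg by auto; field; lra).
    rewrite S, Rabs_mult, (Rabs_pos_eq (Cmod w)) by lra; f_equal; unfold u.
    destruct (Rle_lt_dec 0 (Carg w)) as [L|L].
    - rewrite (Rabs_pos_eq (Carg w)) by auto; apply Rabs_pos_eq, sin_ge_0; auto; apply Carg_bound.
    - rewrite (Rabs_left (Carg w)), sin_neg by auto; rewrite <- Rabs_Ropp, <- sin_neg; apply Rabs_pos_eq, sin_ge_0; try lra.
      generalize (Carg_bound w); lra. }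
  assert (Ec : Re w = Cmod w * cos u).
  { assert (S : Re w = Cmod w * cos (Carg w)) by (rewrite cos_Carg by auto; field; lra).
    rewrite S; f_equal; unfold u, Rabs; destruct (Rcase_abs (Carg w)); [rewrite cos_neg|]; auto. }
  rewrite Es, Ec, <- Rmult_plus_distr_l; apply Rmult_lt_0_compat; auto.
  assert (S : 0 < sin (u + PI / 4)) by (apply sin_gt_0; lra).
  rewrite sin_plus, <- sin_cos_PI4 in S.
  assert (0 < sin (PI / 4)) by (apply sin_gt_0; lra); nra.
Qed.

Theorem theorem2 :
  forall a b s : nat,
  (0 < a)%nat -> (0 < b)%nat -> (0 < s)%nat ->
  let h := (a + b + s)%nat in
  let a0 := a in
  let b0 := 0%nat in
  let t0 := (a0 + b0)%nat in
  let rho := rho a b s in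
  let omega := omega a b s in
  tenable a b s a0 b0 ->
  (exists psi : C -> C, implicit_psi a b s a0 t0 psi) /\
  forall psi : C -> C, implicit_psi a b s a0 t0 psi ->
  exists Psi : C -> C,
    near (RtoC 0) (fun z => Psi z = psi z) /\
    (* (i) *)
    analytic_on Psi (Cinterior (polygon a b s)) /\
    (* (ii) *)
    (analytic_on Psi (Cdisc rho) /\
     RtoC rho = I_int a b s (RtoC 1) /\
     rho = 1 / INR h * Beta (INR a / INR h) (INR s / INR h) /\
     rho = 1 / INR h * (Gamma (INR a / INR h) * Gamma (INR s / INR h)
                        / Gamma (INR (a + s) / INR h))) /\
    (* (iii) *)
    ((omega ^ (h / a))%C = RtoC 1 /\
     singular_at Psi (Cdisc rho) (RtoC rho) /\
     (forall j : nat, (j < h / a)%nat ->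
        singular_at Psi (Cdisc rho) (RtoC rho * omega ^ j)%C) /\
     (forall z : C, Cmod z = rho ->
        (forall j : nat, (j < h / a)%nat -> z <> (RtoC rho * omega ^ j)%C) ->
        regular_at Psi (Cdisc rho) z)) /\
    exists (A : C -> C) (r phi : R),
      0 < r /\ PI < phi < 2 * PI /\
      (* (iv) *)
      (analytic_at A (RtoC 0) /\ A (RtoC 0) = RtoC 1 /\
       (exists d : C,
          is_derive (K := C_AbsRing) (V := C_NormedModule) A (RtoC 0) d /\
          d <> RtoC 0) /\
       analytic_on Psi (sector rho r phi) /\
       (forall z : C, sector rho r phi z ->
          Psi z = singular_form h s t0 rho A z)) /\
      (* (v) *)
      ((forall z : C, z <> RtoC 0 ->
          Cinterior (polygon a b s) z \/ Cdisc rho z \/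
          (exists j : nat, (j < h / a)%nat /\
             rotated (omega ^ j)%C (sector rho r phi) z) ->
          (Psi (omega * z) / (omega * z) ^ (a0 / a))%C
          = (Psi z / z ^ (a0 / a))%C) /\
       (forall j : nat, (j < h / a)%nat ->
          analytic_on Psi (rotated (omega ^ j)%C (sector rho r phi)) /\
          forall z : C, rotated (omega ^ j)%C (sector rho r phi) z ->
            Psi z = ((omega ^ j) ^ (a0 / a)
                     * singular_form h s t0 rho A (z / omega ^ j))%C)).
Proof.
  intros a b s Ha Hb Hs h a0 b0 t0 rho1 om [[k Hk] [[l Hl] _]]; subst a0 b0.
  set (p := (1 + k)%nat); set (q := (1 + l)%nat).
  assert (Hhp : h = (a * p)%nat) by (unfold h, p; lia).
  assert (Hhq : h = (b * q)%nat) by (unfold h, q; lia).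
  assert (U : urn a b h p q) by (constructor; auto; unfold h; lia).
  assert (Et : t0 = a) by apply Nat.add_0_r.
  assert (Ed : (a / a)%nat = 1%nat) by (apply Nat.div_same; lia).
  assert (Er : rho1 = rhoh a b h) by reflexivity.
  assert (Eh : (h / a)%nat = p) by (rewrite Hhp, Nat.mul_comm; apply Nat.div_mul; lia).
  assert (Eo : om = Cexpi (2 * (PI / INR p))) by apply (omega_Cexpi (U := U)).
  rewrite Eh, Ed, Er, Et, Eo in *; clear Eh Ed Er Et Eo t0 rho1 om.
  set (om := Cexpi (2 * (PI / INR p))).
  assert (P2 : (2 <= p)%nat) by apply (p_ge_2 (U := U)).
  assert (R0 : 0 < rhoh a b h) by apply (rhoh_pos (U := U)).
  assert (EI : forall u, Cmod u < 1 -> I_int a b s u = ray_int a b h u 1).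
  { intros u Hu; rewrite I_int_ray; apply (improper_ray_int_regular (U := U)), (regular_unit (U := U)); auto. }
  split.
  { exists (X0 a b p q), 1; split; [lra|]; intros u Hu.
    replace (u - RtoC 0)%C with u in Hu by ring.
    rewrite EI by auto; destruct (basic_in_unit_disc (U := U) u Hu) as [_ [E _]]; exact E. }
  intros psi [eps [He Hpsi]].
  set (Psi := continuation a b p q).
  assert (Hdisc : forall z, Cdisc (rhoh a b h) z -> reachable a b p q z /\ Psi z = X0 a b p q z)
    by apply (disc_reachable (U := U)).
  assert (Hinter : forall z, Cinterior (polygon a b s) z -> reachable a b p q z)
    by apply (interior_reachable (U := U)).
  assert (Hrot : forall z j, reachable a b p q z -> reachable a b p q (om ^ j * z) /\ Psi (om ^ j * z)%C = (om ^ j * Psi z)%C)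
    by (intros z j; apply (reachable_rot_pow (U := U))).
  assert (Om : forall j, Cmod (om ^ j) = 1 /\ ((om ^ j) ^ p)%C = RtoC 1) by (intros j; apply (rot_pow (U := U))).
  assert (Om0 : forall j, (om ^ j)%C <> RtoC 0) by (intros j; apply Cmod_gt_0; rewrite (proj1 (Om j)); lra).
  assert (Ana : forall z, reachable a b p q z -> analytic_at Psi z) by apply (continuation_analytic (U := U)).
  destruct (branch_radius (U := U) s eq_refl) as [r [del [Hr [Hal [Hde [Hdel [Hpow Hhalf]]]]]]].
  set (A := PS (coefX (a := a) (b := b) (h := h) (p := p) (q := q) (pole_scale (h := h) s))).
  assert (Hsec : forall z, sector (rhoh a b h) del (3 * PI / 2) z ->
    reachable a b p q z /\ Psi z = singular_form h s a (rhoh a b h) A z).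
  { intros z Hz; apply (sector_region_reachable (U := U) s eq_refl r del); auto.
    split; [rewrite Cmod_minus_sym; apply Hz|apply sector_cond with del; auto]. }
  assert (Hrsec : forall j z, rotated (om ^ j)%C (sector (rhoh a b h) del (3 * PI / 2)) z ->
    reachable a b p q z /\ Psi z = (om ^ j * singular_form h s a (rhoh a b h) A (z / om ^ j))%C).
  { intros j z [w [Hw ->]]; destruct (Hsec w Hw) as [W1 W2]; destruct (Hrot w j W1) as [W3 W4].
    split; [auto|]; rewrite W4, W2; do 2 f_equal; field; auto. }
  assert (Hsing : forall j, singular_at Psi (Cdisc (rhoh a b h)) (RtoC (rhoh a b h) * om ^ j)%C).
  { intros j; rewrite Cmult_comm; apply (rhoh_singular (U := U)); [apply Om|].
    intros x Hx.
    assert (Dx : Cdisc (rhoh a b h) (RtoC x)) by (unfold Cdisc; rewrite Cmod_RtoC_pos; lra).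
    split; [unfold Cdisc in *; rewrite Cmod_mult, (proj1 (Om j)), Rmult_1_l; auto|].
    destruct (Hdisc _ Dx) as [D1 D2]; rewrite <- D2; apply Hrot; auto. }
  exists Psi; split; [|split; [|split; [|split]]].
  - destruct (ray_int_onto (U := U) eps He) as [e [He1 H]]; exists e; split; [lra|].
    intros z Hz; replace (z - RtoC 0)%C with z in Hz by ring.
    destruct (H z Hz) as [u [Hu1 [Hu2 <-]]].
    destruct (Hdisc (ray_int a b h u 1)) as [_ E]; [apply Rlt_le_trans with (1 := Hz); lra|].
    rewrite E; destruct (basic_in_unit_disc (U := U) u Hu2) as [_ [E2 _]]; rewrite E2.
    rewrite <- (EI u Hu2); symmetry; apply Hpsi; replace (u - RtoC 0)%C with u by ring; auto.
  - intros z Hz; auto.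
  - split; [intros z Hz; apply Ana, Hdisc; auto|split].
    + rewrite I_int_ray; symmetry; apply (improper_ray_int_one (U := U)).
    + apply (rhoh_Beta_Gamma (U := U) s eq_refl).
  - split; [|split; [|split]].
    + generalize (proj2 (Om 1%nat)); rewrite Cpow_1_r; auto.
    + generalize (Hsing 0%nat); simpl Cpow; rewrite Cmult_1_r; auto.
    + intros j _; apply Hsing.
    + intros z Hz Hj; exists Psi; split; [apply Ana, (circle_reachable (U := U)); auto|].
      exists 1; split; [lra|auto].
  - exists A, del, (3 * PI / 2); assert (P := PI_RGT_0).
    split; [auto|split; [lra|split; [split; [|split; [|split; [|split]]]|split]]].
    + apply (analytic_at_PS A (RtoC 0) _ r Hr Hal); intros w _; unfold A; f_equal; ring.
    + unfold A; rewrite PS_0; reflexivity.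
    + exists (dseq (coefX (a := a) (b := b) (h := h) (p := p) (q := q) (pole_scale (h := h) s)) 0).
      split; [apply Cder_is_derive; rewrite <- PS_0; apply PS_Cder with r; auto; rewrite Cmod_0; auto|].
      unfold dseq; rewrite coefX_1, <- RtoC_mult; apply RtoC_neq0.
      destruct (INR_exponents (U := U)) as [_ [_ [E3 E4]]].
      destruct (INR_pos_params (U := U)) as [_ [_ [Pp Pq]]].
      assert (0 < pole_scale (h := h) s) by apply exp_pos.
      simpl (INR 1); rewrite Rmult_1_l; unfold coefX1; apply Ropp_neq_0_compat, Rgt_not_eq, Rdiv_lt_0_compat; nra.
    + intros z Hz; apply Ana, Hsec; auto.
    + intros z Hz; apply Hsec; auto.
    + intros z Hz Hd; assert (Hz2 : reachable a b p q z).
      { destruct Hd as [Hd|[Hd|[j [_ Hd]]]]; [auto|apply Hdisc; auto|apply (Hrsec j); auto]. }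
      assert (E := proj2 (Hrot z 1%nat Hz2)); rewrite Cpow_1_r in E; rewrite E, !Cpow_1_r.
      field; split; auto; rewrite <- (Cpow_1_r om); auto.
    + intros j _; split; [intros z Hz; apply Ana, (Hrsec j); auto|].
      intros z Hz; rewrite Cpow_1_r; apply (Hrsec j); auto.
Qed.
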